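(* Let $U\subset\mathbb R^n$ be an open neighborhood of the origin and let $f:U\to\mathbb R$ be a $C^\infty$ function with $f(0)=0$, $\nabla f(0)=0$, $\Gamma_+(f)\neq\emptyset$, which belongs to $\hat{\mathcal E}(U)$ and is nondegenerate over $\mathbb R$ with respect to $\Gamma_+(f)$. Suppose at least one of the following holds: (a) $d(f)>1$; (b) $f\ge0$ on $U$ or $f\le0$ on $U$; (c) $1/d(f)$ is not an odd integer and $f_{\tau_*}$ does not vanish on $U\cap(\mathbb R\setminus\{0\})^n$. Then $\beta(f)=-1/d(f)$ and $\eta(f)=m(f)$.
   Context: Notation: $H(a,l)=\{x:\langle a,x\rangle=l\}$, $H^+(a,l)=\{x:\langle a,x\rangle\ge l\}$. A polyhedron is a finite intersection of sets $H^+(a,l)$ with $(a,l)\in\mathbb Z^n\times\mathbb Z$; a pair is valid for $P$ if $P\subset H^+(a,l)$; faces are $P\cap H(a,l)$ for valid $(a,l)$, and $(a,l)$ defines $\gamma$ if $P\cap H(a,l)=\gamma$. Newton polyhedron: for $f$ with Taylor series $\sum c_\alpha x^\alpha$ at $0$, $\Gamma_+(f)$ is the convex hull of $\bigcup\{\alpha+\mathbb R_+^n:c_\alpha\neq0\}$. The Newton distance $d(f)$: $(d(f),\dots,d(f))$ is the point where the diagonal $\alpha_1=\dots=\alpha_n$ meets the boundary of $\Gamma_+(f)$. The principal face $\tau_*$ is the face whose relative interior contains this point; $m(f)=n-\dim\tau_*$. $\gamma$-part and classes: let $P\subset\mathbb R_+^n$ be a polyhedron with $P+\mathbb R_+^n\subset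 P$, $f\in C^\infty(U)$ with $\Gamma_+(f)\subset P$, $\gamma$ a face of $P$. $f$ admits the $\gamma$-part on $U$ if for every $x\in U$ the limit $\lim_{t\to0^+}f(t^{a_1}x_1,\dots,t^{a_n}x_n)/t^l$ exists for all valid pairs $(a,l)\in\mathbb Z_+^n\times\mathbb Z_+$ defining $\gamma$; its value is $f_\gamma(x)$. $\hat{\mathcal E}[P](U)$: $f\in C^\infty(U)$ with $\Gamma_+(f)\subset P$ admitting the $\gamma$-part on $U$ for every face $\gamma$ of $P$; $\hat{\mathcal E}(U)=\{f: f\in\hat{\mathcal E}[\Gamma_+(f)](U)\}$. In (c), $f_{\tau_*}$ is the $\tau_*$-part of $f$ with $P=\Gamma_+(f)$. Nondegeneracy: for every compact face $\gamma$ of $\Gamma_+(f)$, $f_\gamma=\sum_{\alpha\in\gamma}c_\alpha x^\alpha$ satisfies $\nabla f_\gamma\ne0$ on $U\cap(\mathbb R\setminus\{0\})^n$. Oscillation index: for $\varphi$ supported in a small neighborhood of $0$, $I(t;\varphi)=\int e^{itf}\varphi\,dx$ has an asymptotic expansion $\sum_\alpha\sum_{k=1}^nC_{\alpha k}(\varphi)t^\alpha(\log t)^{k-1}$ as $t\to+\infty$. $S(f)$ is the set of $(\alpha,k)$ such that for every neighborhood of $0$ there is a $C^\infty$ $\varphi$ supported in it with $C_{\alpha k}(\varphi)\ne0$; $(\beta(f),\eta(f))$ is the lexicographic maximum of $S(f)$. *)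

(* Defs.v *)
From HB Require Import structures.
From mathcomp Require Import all_boot all_order all_algebra.
From mathcomp Require Import all_classical all_reals all_analysis.
From Stdlib Require Import ClassicalEpsilon.
Set Implicit Arguments. Unset Strict Implicit. Unset Printing Implicit Defensive.
Import Order.TTheory GRing.Theory Num.Theory.
Import numFieldNormedType.Exports.
Local Open Scope classical_set_scope.
Local Open Scope ring_scope.

Section Defs.
Variables (R : realType) (n : nat).
Notation V := 'rV[R]_n.

Definition coord (x : V) (i : 'I_n) : R := x ord0 i.
Definition evec (i : 'I_n) : V := delta_mx ord0 i.
Definition diag (t : R) : V := const_mx t.

Definition partial (i : 'I_n) (g : V -> R) : V -> R := fun x => 'D_(evec i) g x.

Definition iter_partial (s : seq 'I_n) (g : V -> R) : V -> R := foldr partial g s.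

Definition smooth_on (U : set V) (g : V -> R) : Prop :=
  forall (s : seq 'I_n) (x : V), U x ->
    {for x, continuous (iter_partial s g)} /\
    forall i : 'I_n, derivable (iter_partial s g) x (evec i).

Definition mindex := {ffun 'I_n -> nat}.
Definition mpoint (a : mindex) : V := \row_i (a i)%:R.

Definition dpart (a : mindex) (g : V -> R) : V -> R :=
  foldr (fun i h => iter (a i) (partial i) h) g (enum 'I_n).

Definition taylor_coef (g : V -> R) (a : mindex) : R :=
  dpart a g 0 / (\prod_i ((a i)`!)%:R).

Definition monomial (a : mindex) (x : V) : R := \prod_i (coord x i) ^+ (a i).

Definition conv_hull (A : set V) : set V :=
  [set x | exists (k : nat) (p : 'I_k -> V) (w : 'I_k -> R),
      (forall j, A (p j)) /\ (forall j, 0 <= w j) /\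
      \sum_j w j = 1 /\ x = \sum_j w j *: p j].

Definition aff_hull (A : set V) : set V :=
  [set x | exists (k : nat) (p : 'I_k -> V) (w : 'I_k -> R),
      (forall j, A (p j)) /\ \sum_j w j = 1 /\ x = \sum_j w j *: p j].

Definition orthant : set V := [set v | forall i, 0 <= coord v i].

Definition newton_poly (g : V -> R) : set V :=
  conv_hull [set x | exists a : mindex, taylor_coef g a != 0 /\
                       exists v, orthant v /\ x = mpoint a + v].

(* Newton distance: the diagonal meets the boundary of Gamma_+(g) at (d,...,d) *)
Definition newton_dist (g : V -> R) : R := inf [set t : R | newton_poly g (diag t)].

Definition ipair (a : 'I_n -> int) (x : V) : R := \sum_i (a i)%:~R * coord x i.
Definition Hplane (a : 'I_n -> int) (l : int) : set V := [set x | ipair a x = l%:~R].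
Definition Hhalf (a : 'I_n -> int) (l : int) : set V := [set x | l%:~R <= ipair a x].

Definition valid_pair (P : set V) (a : 'I_n -> int) (l : int) : Prop := P `<=` Hhalf a l.
Definition defines_face (P : set V) (a : 'I_n -> int) (l : int) (g : set V) : Prop :=
  valid_pair P a l /\ P `&` Hplane a l = g.
Definition is_face (P : set V) (g : set V) : Prop :=
  exists (a : 'I_n -> int) (l : int), defines_face P a l g.

Definition aff_indep (S : set V) (k : nat) : Prop :=
  exists (p0 : V) (p : 'I_k -> V), S p0 /\ (forall j, S (p j)) /\
    row_free (\matrix_(j < k) (p j - p0)).
Definition dim_set (S : set V) : nat := \max_(k < n.+1 | `[< aff_indep S k >]) k.

Definition relint (S : set V) : set V :=
  [set x | S x /\ exists2 e : R, 0 < e &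
     forall y, aff_hull S y -> `|y - x| < e -> S y].

Definition principal_face (g : V -> R) : set V :=
  epsilon (inhabits set0)
    (fun tau => is_face (newton_poly g) tau /\ relint tau (diag (newton_dist g))).
Definition mult_m (g : V -> R) : nat := (n - dim_set (principal_face g))%N.

Definition tscale (a : 'I_n -> nat) (t : R) (x : V) : V := \row_i (t ^+ a i * coord x i).
Definition natv (a : 'I_n -> nat) : 'I_n -> int := fun i => (a i)%:Z.

Definition admits_part (P : set V) (U : set V) (g : V -> R) (gam : set V) : Prop :=
  forall x, U x -> forall (a : 'I_n -> nat) (l : nat),
    defines_face P (natv a) l%:Z gam ->
    exists L : R, (fun t => g (tscale a t x) / t ^+ l) @ 0^'+ --> L.

Definition in_Ehat (U : set V) (g : V -> R) : Prop :=
  newton_poly g `<=` newton_poly g /\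
  forall gam, is_face (newton_poly g) gam -> admits_part (newton_poly g) U g gam.

(* f_gamma = sum_{alpha in gamma} c_alpha x^alpha for compact faces *)
Definition face_poly (g : V -> R) (gam : set V) : V -> R :=
  fun x => \sum_(a \in [set a : mindex | gam (mpoint a)]) taylor_coef g a * monomial a x.

Definition torus_part (U : set V) : set V := [set x | U x /\ forall i, coord x i != 0].

Definition newton_nondegenerate (U : set V) (g : V -> R) : Prop :=
  forall gam, is_face (newton_poly g) gam -> gam !=set0 -> compact gam ->
    forall x, torus_part U x -> exists i, partial i (face_poly g gam) x != 0.

Definition upd (x : V) (i : 'I_n) (s : R) : V :=
  \row_j (if j == i then s else coord x j).

Definition int_coord (i : 'I_n) (h : V -> R) : V -> R :=
  fun x => fine (\int[@lebesgue_measure R]_(s in setT) (h (upd x i s))%:E)%E.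

Definition int_Rn (h : V -> R) : R := foldr int_coord h (enum 'I_n) 0.

(* Re and Im parts of I(t; phi) = int e^{i t f} phi dx *)
Definition osc_re (g phi : V -> R) (t : R) : R := int_Rn (fun x => cos (t * g x) * phi x).
Definition osc_im (g phi : V -> R) (t : R) : R := int_Rn (fun x => sin (t * g x) * phi x).

Definition exps (C : R -> nat -> R) (N : nat) : set R :=
  [set al | - (N%:R) <= al /\ exists k, (1 <= k <= n)%N /\ C al k != 0].

(* I(t) ~ sum_alpha sum_{k=1}^n C alpha k t^alpha (log t)^(k-1) as t -> +oo *)
Definition has_expansion (I : R -> R) (C : R -> nat -> R) : Prop :=
  forall N : nat, finite_set (exps C N) /\
    forall eps : R, 0 < eps -> \forall t \near +oo%R,
      `| I t - \sum_(al \in exps C N)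
                 \sum_(1 <= k < n.+1) C al k * (powR t al * (ln t) ^+ (k.-1)) |
      <= eps * powR t (- (N%:R)).

Definition supp (phi : V -> R) : set V := closure [set x | phi x != 0].

Definition in_S (g : V -> R) (al : R) (k : nat) : Prop :=
  (1 <= k <= n)%N /\
  forall W : set V, nbhs (0 : V) W ->
    exists phi : V -> R, smooth_on setT phi /\ compact (supp phi) /\ supp phi `<=` W /\
      exists Cre Cim : R -> nat -> R,
        has_expansion (osc_re g phi) Cre /\ has_expansion (osc_im g phi) Cim /\
        (Cre al k != 0 \/ Cim al k != 0).

Definition is_osc_index (g : V -> R) (beta : R) (eta : nat) : Prop :=
  in_S g beta eta /\
  forall al k, in_S g al k -> al < beta \/ (al = beta /\ (k <= eta)%N).

Definition open_set (U : set V) : Prop := open U.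

End Defs.

(* Main.v *)
(** Near the origin [f] is replaced by a finite sum of [x^al * F_al(x)] with smooth [F_al] and exponents [al] in
 the Newton polyhedron; the limits defining the face parts are what makes such a Hadamard decomposition possible.
 With [m(x)] the sum of the [|x^v|] over generating exponents [v], nondegeneracy on the compact faces gives
 [sum_i (x_i d_i f)^2 >= c m(x)^2] near [0], by extracting limits along an ultrafilter. Integrating by parts with the
 Euler fields then bounds the oscillatory integral [I] by the integral of [(1 + t m)^-M], and counting dyadic boxes
 bounds the latter by [t^(-1/d) (log t)^(m(f)-1)].
 For a facet [(a, l)], the Euler identity shows that [l t d/dt + k] applied to [I] gains decay in the direction [a];
 solving these first order equations one after the other in [L = log t] yields the asymptotic expansion.
 If the leading coefficient vanished for a plateau [phi], then averaging [I] over [t] against [y^N e^-y] would show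
 that the integral of [phi] against the kernels [N! (1 - i t f)^-(N+1)] is negligible. The equations
 [(t d/dt + j) G = G'], harmless unless [j = 1/d], lead from these kernels to the positive kernel
 [(1 + (t f)^2)^-(J+1)] (times [t f] when [f] has a sign), whose integral is bounded below by
 [t^(-1/d) (log t)^(m(f)-1)]; the hypotheses (a), (b), (c) serve to avoid [j = 1/d] and to control the zeros of
 [f] in that last step. *)
Require Import Defs.
From HB Require Import structures.
From Stdlib Require ClassicalEpsilon.
From mathcomp Require Import all_boot all_order all_algebra.
From mathcomp Require Import all_classical all_reals all_analysis.
From mathcomp Require Import ring lra zify.
Import Order.TTheory GRing.Theory Num.Theory.
Import numFieldNormedType.Exports.
Set Implicit Arguments. Unset Strict Implicit. Unset Printing Implicit Defensive.
Local Open Scope classical_set_scope.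
Local Open Scope ring_scope.
Import Defs.

(** The functions are only smooth, so neither resolution of singularities nor curve selection is at
    hand: toric geometry is replaced by counting boxes |x_j| ~ e^(-k_j) with integral k, where
    monomials are exponentials of linear forms in k. Lipschitz functions supported in a box are
    stable under integration in one variable, and quadratic error bounds give derivatives of
    integrals, so iterated one-variable integrals suffice. With L = log t, t d/dt becomes d/dL. An
    equation G' + j G = G1 passes smallness relative to t^(-1/d) (log t)^(m-1) from G1 to G unless j
    = 1/d, where integration costs a logarithm. The rates j are odd for the even kernel and positive
    even for the odd one: this is the origin of the parity condition in (c), and when f has a sign
    one of the two kernels always avoids 1/d. If d > 1, the kernel 1 / (1 + (t f)^2) is reached
    without any equation. In (c) nothing is known of the zeros of face parts off the principal face;
    a factor (1 + t^2 M)^-J, with M the sum of squared monomials off that face, restores the decay,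
    and the errors it causes are negligible. *)

Lemma eqW (R : numDomainType) (x y : R) : x = y -> x <= y.
Proof. by move=> ->. Qed.

#[export] Hint Extern 0 (is_true (0 <= expR _)) => exact: expR_ge0 : core.
#[export] Hint Extern 0 (is_true (0 < expR _)) => exact: expR_gt0 : core.
#[export] Hint Extern 0 (is_true (0 <= _ ^+ 2)) => exact: sqr_ge0 : core.

Ltac pos :=
 solve [ done
 | match goal with
  | H : is_true (0 < ?x) |- is_true (0 <= ?x) => exact: (ltW H)
  | H : is_true (0 < ?x) |- is_true (?x != 0) => exact: lt0r_neq0 H
  | |- is_true (0 < _ / _) => apply: divr_gt0; pos
  | |- is_true (0 <= _ / _) => apply: divr_ge0; pos
  | |- is_true (0 < _ * _) => apply: mulr_gt0; pos
  | |- is_true (0 <= _ * _) => apply: mulr_ge0; pos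
  | |- is_true (0 < _^-1) => rewrite invr_gt0; pos
  | |- is_true (0 <= _^-1) => rewrite invr_ge0; pos
  | |- is_true (0 < _ ^+ _) => apply: exprn_gt0; pos
  | |- is_true (0 <= _ ^+ _) => apply: exprn_ge0; pos
  | |- is_true (0 < _ + _) =>
    first [apply: addr_gt0; pos | apply: ltr_wpDl; pos | apply: ltr_wpDr; pos]
  | |- is_true (0 <= _ + _) => apply: addr_ge0; pos
  | |- is_true (0 <= \sum_(i <- _ | _) _) => apply: sumr_ge0 => ? _; pos
  | |- is_true (0 < Num.min _ _) => rewrite lt_min; apply/andP; split; pos
  | |- is_true (0 < _%:R) => rewrite ltr0n; done
  | |- is_true (_ != 0) => apply: lt0r_neq0; pos
  end ].

Ltac deriv h := apply: (is_derive_eq h _); rewrite /GRing.scale /=.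

(** * Smooth functions of several variables and their partial derivatives *)

Section Calculus.
Variables (R : realType) (n : nat).
Local Notation V := 'rV[R]_n.
Implicit Types (x y : V) (g h : V -> R) (i j : 'I_n) (O : set V).

Lemma coord_upd x i s j : coord (upd x i s) j = if j == i then s else coord x j.
Proof. by rewrite /coord mxE. Qed.

Lemma coordP x y : (forall i, coord x i = coord y i) -> x = y.
Proof. by move=> e; apply/rowP => i; exact: e. Qed.

Lemma upd_id x i : upd x i (coord x i) = x.
Proof. by apply: coordP => j; rewrite coord_upd; case: eqP => // ->. Qed.

Lemma upd_upd x i s s' : upd (upd x i s) i s' = upd x i s'.
Proof. by apply: coordP => j; rewrite !coord_upd; case: eqP. Qed.

Lemma updC x i j s s' : i != j -> upd (upd x i s) j s' = upd (upd x j s') i s.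
Proof.
move=> ij; apply: coordP => k; rewrite !coord_upd; case: (eqVneq k j) => // ->.
by rewrite eq_sym (negbTE ij).
Qed.

Lemma upd_shift x i (t : R) : t *: evec R i + x = upd x i (t + coord x i).
Proof.
apply: coordP => j; rewrite coord_upd /coord /evec !mxE eqxx /=.
by case: eqP => [->|]; rewrite ?mulr1 // mulr0 add0r.
Qed.

(** [upd x i] parametrizes a line parallel to an axis; through this equivalence the chain rule and
    the mean value theorem of one variable serve for partial derivatives. *)
Lemma is_derive_upd x i g d :
 is_derive x (evec R i) g d <-> is_derive (coord x i) 1 (fun s => g (upd x i s)) d.
Proof.
have e : (fun t : R => t^-1 *: (g (t *: evec R i + x) - g x)) =
 (fun t : R => t^-1 *: (g (upd x i (t *: 1 + coord x i)) - g (upd x i (coord x i)))).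
 by apply/funext => t; rewrite upd_shift upd_id [t *: 1]mulr1.
split=> -[h1 h2]; constructor; move: h1 h2.
- by rewrite /derivable e.
- by rewrite /derive e.
- by rewrite /derivable e.
- by rewrite /derive e.
Qed.

Lemma upd_continuous1 x i : continuous (fun s => upd x i s).
Proof.
move=> s; apply/cvgrPdist_lt => e e0; near=> p.
rewrite /Num.Def.normr/= mx_normrE; apply/bigmax_ltP; split => // -[k j] _ /=.
rewrite !mxE; case: eqP => _; last by rewrite subrr normr0.
by [].
Unshelve. all: end_near.
Qed.

Lemma coord_continuous i : continuous (fun x => coord x i).
Proof. exact: coord_continuous. Qed.

Record csm (p : R -> R) : Prop := Csm { csmE : forall k (r : R), derivable (derive1n k p) r 1 }.
Arguments csmE [p] _ k r.

Lemma csm_derive1 p : csm p -> csm (derive1 p).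
Proof. by move=> cp; constructor=> k x; rewrite -derive1Sn; exact: csmE. Qed.

Lemma csm_derivable p (x : R) : csm p -> is_derive x 1 p (derive1 p x).
Proof. by move=> /csmE/(_ 0%N x) pd; rewrite derive1E; by []. Qed.

Lemma csm_continuous p : csm p -> continuous p.
Proof.
move=> cp x; have := csmE cp 0%N x; move=> /derivable1_diffP; exact: differentiable_continuous.
Qed.

(** [alg_ext] is there because a derivative computed inside the algebra agrees with the function
    [partial i g] only on [O]. *)
Inductive alg O : (V -> R) -> Prop :=
| alg_sm g : smooth_on O g -> alg O g
| alg_cst c : alg O (fun=> c)
| alg_coord i : alg O (fun x => coord x i)
| alg_add g h : alg O g -> alg O h -> alg O (fun x => g x + h x)
| alg_mul g h : alg O g -> alg O h -> alg O (fun x => g x * h x)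
| alg_inv g : alg O g -> (forall x, O x -> g x != 0) -> alg O (fun x => (g x)^-1)
| alg_comp p g : csm p -> alg O g -> alg O (fun x => p (g x))
| alg_ext g h : (forall x, O x -> g x = h x) -> alg O g -> alg O h.

Lemma pd_is_derive O g i x : smooth_on O g -> O x -> is_derive x (evec R i) g (partial i g x).
Proof. by move=> sg Ox; apply: derivableP; have [_] := sg [::] x Ox; exact. Qed.

Lemma iter_partial_rcons s i g : iter_partial (rcons s i) g = iter_partial s (partial i g).
Proof. by rewrite /iter_partial -cats1 foldr_cat. Qed.

Lemma smooth_on_partial O g i : smooth_on O g -> smooth_on O (partial i g).
Proof. by move=> sg s x Ox; rewrite -iter_partial_rcons; exact: sg. Qed.

Lemma near_open O x (P : set V) : open O -> O x -> (forall y, O y -> P y) -> \near x, P x.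
Proof. by move=> oO Ox h; near=> y; apply: h; near: y; exact: open_nbhs_nbhs. Unshelve. all: end_near. Qed.

(* The algebra generated by smooth functions is stable under partial derivatives,
  which makes all its elements smooth. *)
Lemma alg_spec O g : open O -> alg O g -> forall x, O x -> {for x, continuous g} /\
 forall i, exists dg, alg O dg /\ forall x, O x -> is_derive x (evec R i) g (dg x).
Proof.
move=> oO; elim=> {g} [g sg|c|j|g h _ ihg _ ihh|g h ag ihg ah ihh|g ag ihg g0|p g cp ag ihg|g h gh _ ihg] x Ox.
- split=> [|i]; first by have [] := sg [::] x Ox.
 exists (partial i g); split; first exact/alg_sm/smooth_on_partial.
 by move=> y Oy; exact: pd_is_derive Oy.
- split=> [|i]; first exact: cst_continuous.
 by exists (fun=> 0); split=> [|y Oy]; [exact: alg_cst|exact: is_derive_cst].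
- split=> [|i]; first exact: coord_continuous.
 exists (fun=> (j == i)%:R); split=> [|y Oy]; first exact: alg_cst.
 apply/is_derive_upd; case: (eqVneq j i) => [->|ji].
  rewrite (_ : (fun s => _) = id); first exact: is_derive_id.
  by apply/funext => s; rewrite coord_upd eqxx.
 rewrite (_ : (fun s => _) = cst (coord y j)); first exact: is_derive_cst.
 by apply/funext => s; rewrite coord_upd (negbTE ji).
- have [cg dg] := ihg x Ox; have [ch dh] := ihh x Ox.
 split=> [|i]; first exact: continuousD.
 have [g' [ag' hg']] := dg i; have [h' [ah' hh']] := dh i.
 exists (fun y => g' y + h' y); split=> [|y Oy]; first exact: alg_add.
 by apply: is_deriveD; auto.
- have [cg dg] := ihg x Ox; have [ch dh] := ihh x Ox.
 split=> [|i]; first exact: continuousM.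
 have [g' [ag' hg']] := dg i; have [h' [ah' hh']] := dh i.
 exists (fun y => g y * h' y + h y * g' y); split=> [|y Oy].
  by apply: alg_add; apply: alg_mul.
 by apply: is_deriveM; auto.
- have [cg dg] := ihg x Ox; split=> [|i]; first by apply: continuousV => //; exact: g0.
 have [g' [ag' hg']] := dg i.
 exists (fun y => (-1) * (((g y)^-1 * (g y)^-1) * g' y)); split=> [|y Oy].
  by apply: alg_mul; [exact: alg_cst|apply: alg_mul => //; apply: alg_mul; apply: alg_inv].
 have [d1 d2] := hg' y Oy; constructor; first exact: derivableV (g0 _ Oy) d1.
 by rewrite deriveV ?g0 // d2 /GRing.scale /= expr2 invfM mulN1r mulNr.
- have [cg dg] := ihg x Ox; split=> [|i].
  by apply: (@continuous_comp _ _ _ g p) => //; exact: csm_continuous.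
 have [g' [ag' hg']] := dg i.
 exists (fun y => derive1 p (g y) * g' y); split=> [|y Oy].
  by apply: alg_mul => //; apply: alg_comp => //; exact: csm_derive1.
 apply/is_derive_upd; apply: (@is_derive1_comp _ p (fun s => g (upd y i s))).
  by rewrite upd_id; exact: csm_derivable.
 exact/is_derive_upd/hg'.
- have [cg dg] := ihg x Ox.
 have ng y : O y -> \near y, g y = h y by move=> Oy; exact: near_open Oy _.
 split=> [|i].
  suff : h y @[y --> x] --> h x by [].
  rewrite -(gh _ Ox); apply: cvg_trans cg.
  by apply: (@near_eq_cvg _ _ (nbhs x)); exact: ng.
 have [g' [ag' hg']] := dg i.
 exists g'; split=> // y Oy; apply: near_eq_is_derive (hg' _ Oy); exact: ng.
Qed.

Lemma alg_smooth O g : open O -> alg O g -> smooth_on O g.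
Proof.
move=> oO ag s.
have : alg O (iter_partial s g).
 elim: s => //= i s ih; have [-> |/set0P[x Ox]] := eqVneq O set0.
  by apply: alg_sm => s' x [].
 have [_ /(_ i)[g' [ag' hg']]] := alg_spec oO ih Ox.
 apply: alg_ext ag' => y Oy; rewrite /partial; have [_ ->] := hg' _ Oy; by [].
move=> {}ag x Ox; have [cg dg] := alg_spec oO ag Ox; split=> // i.
by have [g' [_ /(_ _ Ox)[]]] := dg i.
Qed.

Record sm g : Prop := Sm { smE : smooth_on setT g }.

Lemma smP g : sm g <-> alg setT g.
Proof. by split=> [[]|/(alg_smooth openT)]; [exact: alg_sm|constructor]. Qed.

Lemma sm_cst c : sm (fun=> c). Proof. exact/smP/alg_cst. Qed.
Lemma sm_coord i : sm (fun x => coord x i). Proof. exact/smP/alg_coord. Qed.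
Lemma sm_add g h : sm g -> sm h -> sm (fun x => g x + h x).
Proof. by move=> /smP ? /smP ?; exact/smP/alg_add. Qed.
Lemma sm_mul g h : sm g -> sm h -> sm (fun x => g x * h x).
Proof. by move=> /smP ? /smP ?; exact/smP/alg_mul. Qed.
Lemma sm_inv g : sm g -> (forall x, g x != 0) -> sm (fun x => (g x)^-1).
Proof. by move=> /smP ? ?; exact/smP/alg_inv. Qed.
Lemma sm_comp p g : csm p -> sm g -> sm (fun x => p (g x)).
Proof. by move=> ? /smP ?; exact/smP/alg_comp. Qed.
Lemma sm_partial i g : sm g -> sm (partial i g).
Proof. by case=> sg; constructor; exact: smooth_on_partial. Qed.
Lemma sm_continuous g : sm g -> continuous g.
Proof. by case=> /(_ [::]) sg x; have [] := sg x I. Qed.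
Lemma sm_is_derive g i x : sm g -> is_derive x (evec R i) g (partial i g x).
Proof. by case=> sg; exact: pd_is_derive sg _. Qed.
Lemma sm_is_derive1 g i x (s : R) : sm g ->
 is_derive s 1 (fun s => g (upd x i s)) (partial i g (upd x i s)).
Proof.
move=> sg; have /is_derive_upd := sm_is_derive i (upd x i s) sg.
rewrite coord_upd eqxx; rewrite (_ : (fun s0 => _) = (fun s0 => g (upd x i s0))) //.
by apply/funext => u; rewrite upd_upd.
Qed.

Lemma sm_scale c g : sm g -> sm (fun x => c * g x).
Proof. by move=> sg; apply: sm_mul => //; exact: sm_cst. Qed.
Lemma sm_opp g : sm g -> sm (fun x => - g x).
Proof.
move=> sg; rewrite (_ : (fun x => _) = (fun x => -1 * g x)); first exact: sm_scale.
by apply/funext => x; lra.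
Qed.
Lemma sm_sub g h : sm g -> sm h -> sm (fun x => g x - h x).
Proof. by move=> sg sh; apply: sm_add => //; exact: sm_opp. Qed.
Lemma sm_sum (I : Type) (r : seq I) (P : pred I) (G : I -> V -> R) :
 (forall k, P k -> sm (G k)) -> sm (fun x => \sum_(k <- r | P k) G k x).
Proof.
move=> sG; elim: r => [|k r ih].
 by rewrite (_ : (fun x => _) = (fun=> 0)); [exact: sm_cst|apply/funext => x; rewrite big_nil].
case Pk : (P k).
 rewrite (_ : (fun x => _) = (fun x => G k x + \sum_(k <- r | P k) G k x)).
  by apply: sm_add => //; exact: sG.
 by apply/funext => x; rewrite big_cons Pk.
rewrite (_ : (fun x => _) = (fun x => \sum_(k <- r | P k) G k x)) //.
by apply/funext => x; rewrite big_cons Pk.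
Qed.
Lemma sm_prod (I : Type) (r : seq I) (G : I -> V -> R) :
 (forall k, sm (G k)) -> sm (fun x => \prod_(k <- r) G k x).
Proof.
move=> sG; elim: r => [|k r ih].
 by rewrite (_ : (fun x => _) = (fun=> 1)); [exact: sm_cst|apply/funext => x; rewrite big_nil].
rewrite (_ : (fun x => _) = (fun x => G k x * \prod_(k <- r) G k x)); first exact: sm_mul.
by apply/funext => x; rewrite big_cons.
Qed.
Lemma sm_exp g k : sm g -> sm (fun x => g x ^+ k).
Proof.
move=> sg; elim: k => [|k ih]; first by rewrite (_ : (fun x => _) = (fun=> 1)) //; exact: sm_cst.
rewrite (_ : (fun x => _) = (fun x => g x * g x ^+ k)); first exact: sm_mul.
by apply/funext => x; rewrite exprS.
Qed.
Lemma sm_monomial a : sm (@monomial R n a).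
Proof. by apply: sm_prod => i; apply: sm_exp; exact: sm_coord. Qed.

Lemma pd_val g i x d : is_derive x (evec R i) g d -> partial i g x = d.
Proof. by case. Qed.
Lemma pd_cst i c x : partial i (fun=> c) x = 0.
Proof. by apply: pd_val; by []. Qed.
Lemma pd_coord i j x : partial i (fun x => coord x j) x = (j == i)%:R.
Proof.
apply: pd_val; apply/is_derive_upd; case: (eqVneq j i) => [->|ji].
 rewrite (_ : (fun s => _) = id); first exact: is_derive_id.
 by apply/funext => s; rewrite coord_upd eqxx.
rewrite (_ : (fun s => _) = cst (coord x j)); first exact: is_derive_cst.
by apply/funext => s; rewrite coord_upd (negbTE ji).
Qed.
Lemma pd_add i g h x : sm g -> sm h ->
 partial i (fun x => g x + h x) x = partial i g x + partial i h x.
Proof. by move=> sg sh; apply: pd_val; apply: is_deriveD; exact: sm_is_derive. Qed.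
Lemma pd_mul i g h x : sm g -> sm h ->
 partial i (fun x => g x * h x) x = g x * partial i h x + h x * partial i g x.
Proof. by move=> sg sh; apply: pd_val; apply: is_deriveM; exact: sm_is_derive. Qed.
Lemma pd_scale i c g x : sm g -> partial i (fun x => c * g x) x = c * partial i g x.
Proof. by move=> sg; rewrite pd_mul ?pd_cst ?mulr0 ?addr0 //; exact: sm_cst. Qed.
Lemma pd_inv i g x : sm g -> g x != 0 ->
 partial i (fun x => (g x)^-1) x = - ((g x)^-1 ^+ 2 * partial i g x).
Proof.
move=> sg g0; have [d _] := sm_is_derive i x sg.
by rewrite /partial deriveV // /GRing.scale /= exprVn mulNr.
Qed.
Lemma pd_comp i p g x d : is_derive (g x) 1 p d -> sm g ->
 partial i (fun x => p (g x)) x = d * partial i g x.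
Proof.
move=> dp sg; apply/pd_val/is_derive_upd; apply: (@is_derive1_comp _ p (fun s => g (upd x i s))).
 by rewrite upd_id.
exact/is_derive_upd/sm_is_derive.
Qed.
Lemma pd_sum i (I : Type) (r : seq I) (P : pred I) (G : I -> V -> R) x :
 (forall k, P k -> sm (G k)) ->
 partial i (fun x => \sum_(k <- r | P k) G k x) x = \sum_(k <- r | P k) partial i (G k) x.
Proof.
move=> sG; elim: r => [|k r ih].
 rewrite big_nil (_ : (fun x => _) = (fun=> 0)) ?pd_cst //.
 by apply/funext => y; rewrite big_nil.
rewrite big_cons; case Pk : (P k).
 rewrite (_ : (fun x => _) = (fun x => G k x + \sum_(k <- r | P k) G k x)).
  by rewrite pd_add ?ih //; [exact: sG|exact: sm_sum].
 by apply/funext => y; rewrite big_cons Pk.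
rewrite (_ : (fun x => _) = (fun x => \sum_(k <- r | P k) G k x)) //.
by apply/funext => y; rewrite big_cons Pk.
Qed.
Lemma pd_exp i g k x : sm g ->
 partial i (fun x => g x ^+ k) x = k%:R * g x ^+ k.-1 * partial i g x.
Proof.
move=> sg; rewrite (_ : (fun x => _) = g ^+ k); last by apply/funext => y; rewrite exprfctE.
by apply: pd_val; apply: is_deriveX; exact: sm_is_derive.
Qed.

(** Stated for x_i d_i rather than d_i: the Euler field is diagonal on monomials and no exponent has
    to be lowered. *)
Lemma pd_monomial i a x : coord x i * partial i (@monomial R n a) x = (a i)%:R * monomial a x.
Proof.
pose P (y : V) := \prod_(j | j != i) coord y j ^+ a j.
have e : @monomial R n a = (fun x => coord x i ^+ a i * P x).
 by apply/funext => y; rewrite /monomial (bigD1 i).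
have sp : sm P.
 rewrite (_ : P = (fun x => \prod_j (if j != i then coord x j ^+ a j else 1))).
  by apply: sm_prod => j; case: (j != i); [exact/sm_exp/sm_coord|exact: sm_cst].
 by apply/funext => y; rewrite /P big_mkcond.
have P0 : partial i P x = 0.
 apply: pd_val; apply/is_derive_upd.
 rewrite (_ : (fun s => _) = cst (P x)); first exact: is_derive_cst.
 by apply/funext => s; apply: eq_bigr => j ji; rewrite coord_upd (negbTE ji).
have scx := sm_exp (a i) (sm_coord i).
rewrite e (pd_mul i x scx sp) pd_exp ?pd_coord ?eqxx ?mulr1 ?P0; last exact: sm_coord.
by rewrite mulr0 add0r; case: (a i) => [|k] /=; rewrite ?mul0r ?mulr0 // exprS; ring.
Qed.

End Calculus.

#[export] Hint Resolve sm_cst sm_coord sm_add sm_mul sm_partial sm_opp sm_sub sm_exp sm_monomial : smooth.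
Ltac smooth := solve [auto 12 with smooth].

(** * Integrals of compactly supported continuous functions of one variable *)

Section OneDim.
Variable R : realType.
Local Notation mu := (@lebesgue_measure R).
Implicit Types (F G : R -> R) (K C : R).

Lemma mvt F F' : (forall u : R, is_derive u 1 F (F' u)) -> forall a b,
 exists2 c, `|c - a| <= `|b - a| & F b - F a = F' c * (b - a).
Proof.
move=> dF.
have cF : continuous F.
 by move=> u; apply/differentiable_continuous/derivable1_diffP; auto.
have key a b : a <= b -> exists2 c, c \in `[a, b] & F b - F a = F' c * (b - a).
 by move=> ab; apply: (MVT_segment ab); exact: continuous_subspaceT.
move=> a b; case: (leP a b) => ab.
 have [c] := key a b ab; rewrite in_itv /= => /andP[ac cb] e; exists c => //.
 by rewrite !ger0_norm ?subr_ge0 // lerB.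
have [c] := key b a (ltW ab); rewrite in_itv /= => /andP[bc ca] e; exists c.
 by rewrite !ler0_norm ?subr_le0 ?(ltW ab) // lerN2 lerB.
lra.
Qed.

(** A quadratic remainder with a constant free of parameters can be integrated, so derivatives of
    integrals are established in this form. *)
Lemma quad_is_derive F (u d C : R) :
 (\forall h \near (0 : R), `|F (u + h) - F u - h * d| <= C * h ^+ 2) -> is_derive u 1 F d.
Proof.
move=> q; suff H : (fun h : R => h^-1 *: ((F \o shift u) (h *: 1) - F u)) @ 0^' --> d.
 by constructor; [apply/cvg_ex; exists d|exact: cvg_lim H].
apply/cvgrPdist_le => e e0; near=> h.
have h0 : h != 0 by near: h; exact: nbhs_dnbhs_neq.
have qh : `|F (u + h) - F u - h * d| <= C * h ^+ 2.
 by near: h; apply: nbhs_dnbhs; exact: q.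
have hC : `|h| * `|C| <= e.
 near: h; apply: nbhs_dnbhs; exists (e / (`|C| + 1)) => /=; first pos.
 move=> y /=; rewrite sub0r normrN => /ltW ye; rewrite (le_trans (ler_wpM2r _ ye)) //.
 by rewrite -mulrA ler_piMr ?(ltW e0) // mulrC ler_pdivrMr // mul1r lerDl.
rewrite /= [h *: 1]mulr1 (addrC h) -mulrN1 /GRing.scale /=.
rewrite (_ : d + _ = - (h^-1 * (F (u + h) - F u - h * d))).
 rewrite normrN normrM normfV mulrC ler_pdivrMr ?normr_gt0 //.
 rewrite (le_trans qh) // (le_trans (ler_norm _)) // normrM normrX expr2.
 rewrite mulrA (mulrC `|C|) ler_wpM2r //.
by field.
Unshelve. all: end_near. Qed.

Definition int1 F := \int[mu]_(s in setT) F s.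
Definition ccs K F := continuous F /\ forall s, K < `|s| -> F s = 0.

Lemma ccs_restrict K F : ccs K F -> F = (F \_ `[- K, K]%classic).
Proof.
case=> cF sF; apply/funext => s; rewrite patchE; case: ifPn => //.
by rewrite mem_setE in_itv /= -ler_norml -ltNge => /sF.
Qed.

Lemma ccs_integrable_itv K F : ccs K F -> mu.-integrable `[- K, K] (EFin \o F).
Proof.
case=> cF _; apply: continuous_compact_integrable; first exact: segment_compact.
exact: continuous_subspaceT.
Qed.

Lemma ccs_integrable K F : ccs K F -> mu.-integrable setT (EFin \o F).
Proof.
move=> cF; rewrite (ccs_restrict cF).
rewrite (_ : EFin \o _ = (EFin \o F) \_ `[- K, K]%classic).
 by apply: (proj1 (@integrable_mkcond _ _ _ mu `[- K, K]%classic (EFin \o F) (measurable_itv _))); exact: ccs_integrable_itv.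
by apply/funext => s /=; rewrite !patchE; case: ifP.
Qed.

Lemma int1E K F : ccs K F -> int1 F = \int[mu]_(s in `[- K, K]) F s.
Proof. by move=> cF; rewrite /int1 [RHS]Rintegral_mkcond -(ccs_restrict cF). Qed.

Lemma ccsZ K F c : ccs K F -> ccs K (fun s => c * F s).
Proof.
move=> [c1 c2]; split=> [u|u Ku]; last by rewrite c2 // mulr0.
by apply: (@cvgM _ _ (nbhs u)); [exact: cvg_cst|exact: c1].
Qed.

Lemma ccsD K F G : ccs K F -> ccs K G -> ccs K (fun s => F s + G s).
Proof.
move=> [c1 c2] [c3 c4]; split=> [u|u Ku]; last by rewrite c2 // c4 // addr0.
by apply: (@cvgD _ _ _ (nbhs u)); [exact: c1|exact: c3].
Qed.

Lemma int1D K F G : ccs K F -> ccs K G -> int1 (fun s => F s + G s) = int1 F + int1 G.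
Proof. by move=> cF cG; rewrite /int1 RintegralD //; [exact: ccs_integrable cF|exact: ccs_integrable cG]. Qed.

Lemma int1Z K F c : ccs K F -> int1 (fun s => c * F s) = c * int1 F.
Proof. by move=> cF; rewrite /int1 RintegralZl //; exact: ccs_integrable cF. Qed.

Lemma int1_le K F G : ccs K F -> ccs K G -> (forall s, F s <= G s) -> int1 F <= int1 G.
Proof. by move=> cF cG FG; apply: le_Rintegral => //; [exact: ccs_integrable cF|exact: ccs_integrable cG]. Qed.

Lemma int1_ge0 F : (forall s, 0 <= F s) -> 0 <= int1 F.
Proof. by move=> F0; apply: Rintegral_ge0. Qed.

Lemma int1_0 : int1 (fun=> 0) = 0.
Proof. by rewrite /int1 Rintegral_cst // mul0r. Qed.

Lemma int1_bound K F C : 0 <= K -> ccs K F -> (forall s, `|F s| <= C) -> `|int1 F| <= C * (2 * K).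
Proof.
move=> K0 cF FC; rewrite (int1E cF).
apply: le_trans (le_normr_Rintegral _ (ccs_integrable_itv cF)) _ => //.
have iC : mu.-integrable `[- K, K] (EFin \o cst C).
 by apply: continuous_compact_integrable; [exact: segment_compact|apply: continuous_subspaceT => ?; exact: cst_continuous].
have := @le_Rintegral _ _ _ mu `[- K, K]%classic (fun s => `|F s|) (cst C).
rewrite Rintegral_cst //= lebesgue_measure_itv /= lte_fin.
have iF : mu.-integrable `[- K, K] (EFin \o (fun s => `|F s|)).
 by have := integrable_abse (ccs_integrable_itv cF).
move=> /(_ _ iF iC (fun s _ => FC s)) H; apply: le_trans (H _) _ => //.
have C0 : 0 <= C by apply: le_trans (FC 0).
case: ifPn => _; last by rewrite /= mulr0 mulr_ge0 // mulr_ge0.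
by rewrite -EFinB /= opprK mulr2n mulrDl mul1r.
Qed.

Lemma int1_deriv K F F' : ccs K F -> continuous F' -> (forall u : R, is_derive u 1 F (F' u)) ->
 (forall s, K < `|s| -> F' s = 0) -> 0 <= K -> int1 F' = 0.
Proof.
move=> [cF sF] cF' dF sF' K0.
(* Vanishing is only stated for |s| > K; enlarging the interval makes the boundary terms zero at
   once. *)
have cF'1 : ccs (K + 1) F' by split=> // s Ks; apply: sF'; apply: lt_trans Ks; rewrite ltrDl.
rewrite (int1E cF'1) /Rintegral.
have K1 : - (K + 1) < K + 1 by rewrite gtrN // ltr_wpDl.
rewrite (@continuous_FTC2 _ F' F) //.
- rewrite !sF ?sube0 //= ?normrN ger0_norm ?ltrDl // addr_ge0 //.
- exact: continuous_subspaceT.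
- split.
 + by [].
 + by apply: cvg_at_right_filter; exact: cF.
 + by apply: cvg_at_left_filter; exact: cF.
- by move=> u _; rewrite derive1E; case: (dF u).
Qed.

End OneDim.

(** * Iterated integrals over the whole space *)

Section Multi.
Variables (R : realType) (n : nat).
Local Notation V := 'rV[R]_n.
Implicit Types (x y : V) (g h : V -> R) (i j : 'I_n) (K C : R) (s : seq 'I_n).

Definition d1 x y := \sum_i `|coord x i - coord y i|.

Lemma d1_upd x y i u : d1 (upd x i u) (upd y i u) <= d1 x y.
Proof.
apply: ler_sum => j _; rewrite !coord_upd; case: eqP => _ //.
by rewrite subrr normr0.
Qed.

Lemma d1_updr x i u v : d1 (upd x i u) (upd x i v) = `|u - v|.
Proof.
rewrite /d1 (bigD1 i) //= !coord_upd eqxx big1 ?addr0 // => j /negbTE ji.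
by rewrite !coord_upd ji subrr normr0.
Qed.

(** [s] lists the coordinates already integrated out, in which no support condition can be asked any
    more. The Lipschitz bound, in the l^1 distance, is the regularity that survives each
    integration. *)
Record LC K s g : Prop := MkLC {
 LC_lip : exists L, forall x y, `|g x - g y| <= L * d1 x y;
 LC_supp : forall i x, i \notin s -> K < `|coord x i| -> g x = 0 }.

Lemma lip_continuous (F : R -> R) L : (forall u v, `|F u - F v| <= L * `|u - v|) -> continuous F.
Proof.
move=> lF u; apply/cvgrPdist_le => e e0; near=> v.
apply: le_trans (lF _ _) _; apply: (@le_trans _ _ (`|L| * `|u - v|)).
 by rewrite ler_wpM2r // ler_norm.
have : `|u - v| <= e / (`|L| + 1).
 by near: v; apply: cvgr_dist_le; pos.
rewrite ler_pdivlMr // => h; apply: le_trans h.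
by rewrite mulrC ler_wpM2l // lerDl.
Unshelve. all: end_near. Qed.

Lemma LC_1d K s g i x : LC K s g -> i \notin s -> ccs K (fun u => g (upd x i u)).
Proof.
case=> -[L lg] sg si; split=> [|u Ku]; last by apply: (sg i) => //; rewrite coord_upd eqxx.
by apply: (@lip_continuous _ L) => u v; apply: le_trans (lg _ _) _; rewrite d1_updr.
Qed.

Lemma int_coordE i g x : int_coord i g x = int1 (fun u => g (upd x i u)).
Proof. by []. Qed.

Lemma LC_lin K s g h a b : LC K s g -> LC K s h -> LC K s (fun x => a * g x + b * h x).
Proof.
case=> -[L lg] sg [[M lh] sh]; split.
 exists (`|a| * L + `|b| * M) => x y.
 rewrite (_ : _ - _ = a * (g x - g y) + b * (h x - h y)); last by ring.
 apply: le_trans (ler_normD _ _) _; rewrite !normrM mulrDl -!mulrA.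
 by apply: lerD; apply: ler_wpM2l.
by move=> i x si Ki; rewrite (sg i) // (sh i) // !mulr0 addr0.
Qed.

Lemma LC_widen K K' s g : K <= K' -> LC K s g -> LC K' s g.
Proof. by move=> KK [lg sg]; split=> // i x si /(le_lt_trans KK); exact: sg. Qed.

(** The difference of two integrals is the integral of the difference over an interval of length 2
    K, which multiplies the Lipschitz constant by 2 K. *)
Lemma int_coord_LC K s g i : 0 <= K -> i \notin s -> LC K s g -> LC K (i :: s) (int_coord i g).
Proof.
move=> K0 si gLC; have [[L lg] sg] := gLC; split.
 exists (L * (2 * K)) => x y; rewrite !int_coordE.
 rewrite -mulN1r -(int1Z _ (LC_1d y gLC si)).
 have cy : ccs K (fun u => -1 * g (upd y i u)).
  exact: (ccsZ _ (LC_1d y gLC si)).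
 rewrite -(int1D (LC_1d x gLC si) cy) -mulrA (mulrC (2 * K)) mulrA.
 apply: int1_bound => //; first exact: (ccsD (LC_1d x gLC si) cy).
 move=> u; rewrite mulN1r; apply: le_trans (lg _ _) _.
 (* No sign is imposed on [L]: if it is negative, the Lipschitz bounds force both distances to
    vanish. *)
 case: (lerP 0 L) => L0; first by rewrite ler_wpM2l // d1_upd.
 have := le_trans (normr_ge0 _) (lg (upd x i u) (upd y i u)).
 have := le_trans (normr_ge0 _) (lg x y).
 rewrite !nmulr_rge0 // => h1 h2.
 have d0 z w : 0 <= d1 z w by apply: sumr_ge0.
 have -> : d1 x y = 0 by apply/eqP; rewrite eq_le h1 d0.
 by have -> : d1 (upd x i u) (upd y i u) = 0 by apply/eqP; rewrite eq_le h2 d0.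
move=> j x; rewrite inE negb_or => /andP[ji sj] Kj; rewrite int_coordE.
rewrite (_ : (fun u => _) = (fun=> 0)) ?int1_0 //.
by apply/funext => u; apply: (sg j) => //; rewrite coord_upd (negbTE ji).
Qed.

Definition Ifold s g : V -> R := foldr (@int_coord R n) g s.

Section Fold.
Variables (K : R) (K0 : 0 <= K).

Lemma Ifold_LC s g : uniq s -> LC K [::] g -> LC K s (Ifold s g).
Proof. by move=> + gLC; elim: s => //= i s ih /andP[si us]; apply: int_coord_LC => //; exact: ih. Qed.

Lemma Ifold_lin s g h a b : uniq s -> LC K [::] g -> LC K [::] h ->
 Ifold s (fun x => a * g x + b * h x) = (fun x => a * Ifold s g x + b * Ifold s h x).
Proof.
move=> + lg lh; elim: s => //= i s ih /andP[si us]; rewrite ih //.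
have cg := LC_1d _ (Ifold_LC us lg) si; have ch := LC_1d _ (Ifold_LC us lh) si.
have cz c (F : V -> R) x : ccs K (fun u => F (upd x i u)) -> ccs K (fun u => c * F (upd x i u)).
 exact: ccsZ.
apply/funext => x; rewrite !int_coordE.
by rewrite (int1D (cz a _ x (cg x)) (cz b _ x (ch x))) (int1Z _ (cg x)) (int1Z _ (ch x)).
Qed.

Lemma Ifold_le s g h : uniq s -> LC K [::] g -> LC K [::] h -> (forall x, g x <= h x) ->
 forall x, Ifold s g x <= Ifold s h x.
Proof.
move=> + lg lh gh; elim: s => //= i s ih /andP[si us] x; rewrite !int_coordE.
apply: int1_le (LC_1d _ (Ifold_LC us lg) si) (LC_1d _ (Ifold_LC us lh) si) _ => u.
exact: ih.
Qed.

Lemma Ifold_bound s g C : uniq s -> LC K [::] g -> (forall x, `|g x| <= C) ->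
 forall x, `|Ifold s g x| <= C * (2 * K) ^+ size s.
Proof.
move=> + lg gC; elim: s => [|i s ih] /=; first by move=> _ x; rewrite mulr1.
move=> /andP[si us] x; rewrite int_coordE exprSr mulrA.
by apply: int1_bound (LC_1d _ (Ifold_LC us lg) si) _ => // u; exact: ih.
Qed.

(** Differentiability in x_i with a quadratic error uniform in x, a form of the derivative that
    commutes with integration in another variable. *)
Definition Der i g g' := exists C, forall x t,
 `|g (upd x i (coord x i + t)) - g x - t * g' x| <= C * t ^+ 2.

Lemma Ifold_Der s g g' i : uniq s -> i \notin s -> LC K [::] g -> LC K [::] g' ->
 Der i g g' -> Der i (Ifold s g) (Ifold s g').
Proof.
move=> + + lg lg' D; elim: s => //= j s ih /andP[sj us].
rewrite inE negb_or => /andP[ij si]; have [C DC] := ih us si.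
exists (C * (2 * K)) => x t; rewrite !int_coordE.
have cg := LC_1d _ (Ifold_LC us lg) sj; have cg' := LC_1d _ (Ifold_LC us lg') sj.
have cz c (F : V -> R) y : ccs K (fun u => F (upd y j u)) -> ccs K (fun u => c * F (upd y j u)).
 exact: ccsZ.
have cd (F G : R -> R) : ccs K F -> ccs K G -> ccs K (fun u => F u + G u).
 exact: ccsD.
rewrite -(mulN1r (int1 _)) -(int1Z _ (cg x)) -mulNr -(int1Z _ (cg' x)).
rewrite -(int1D (cg _) (cz _ _ _ (cg x))).
rewrite -(int1D (cd _ _ (cg _) (cz _ _ _ (cg x))) (cz _ _ _ (cg' x))).
rewrite -mulrA (mulrC (2 * K)) mulrA.
apply: int1_bound => //; auto.
move=> u; have := DC (upd x j u) t; rewrite coord_upd (negbTE ij).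
by rewrite updC 1?eq_sym // mulN1r mulNr.
Qed.

Lemma int_coord_Der s g g' i x : i \notin s -> LC K s g -> LC K s g' -> Der i g g' ->
 int_coord i g' x = 0.
Proof.
move=> si lg lg' [C D]; rewrite int_coordE.
have [cg' sg'] := LC_1d x lg' si.
apply: (@int1_deriv _ K (fun u => g (upd x i u))) => //; first exact: LC_1d lg si.
move=> u; apply: (@quad_is_derive _ _ _ _ C); near=> t.
by have := D (upd x i u) t; rewrite coord_upd eqxx upd_upd.
Unshelve. all: end_near. Qed.

Lemma int_RnE g : int_Rn g = Ifold (enum 'I_n) g 0. Proof. by []. Qed.

Lemma Ifold0 s : Ifold s (fun=> 0) = (fun=> 0).
Proof. by elim: s => //= j s ->; apply/funext => x; rewrite int_coordE int1_0. Qed.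

(** The fold is cut at coordinate i: the inner integrations keep [Der], the integral in x_i of a
    derivative is 0, and the outer integrals of 0 are 0. No exchange of integrations occurs. *)
Lemma int_Rn_Der g g' i : LC K [::] g -> LC K [::] g' -> Der i g g' -> int_Rn g' = 0.
Proof.
move=> lg lg' D; rewrite int_RnE.
have : i \in enum 'I_n by rewrite mem_enum.
have := enum_uniq 'I_n; move: (enum 'I_n) => e + ie; case/splitPr: ie => s1 s2.
rewrite cat_uniq /= => /and3P[us1 _ /andP[is2 us2]].
rewrite /Ifold foldr_cat /=.
rewrite (_ : int_coord i _ = (fun=> 0)).
 by rewrite -/(Ifold s1 (fun=> 0)) Ifold0.
apply/funext => x; apply: (int_coord_Der (s := s2)) => //.
- exact: Ifold_LC us2 lg.
- exact: Ifold_LC.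
- exact: Ifold_Der.
Qed.

Lemma int_Rn_lin g h a b : LC K [::] g -> LC K [::] h ->
 int_Rn (fun x => a * g x + b * h x) = a * int_Rn g + b * int_Rn h.
Proof. by move=> lg lh; rewrite !int_RnE Ifold_lin // enum_uniq. Qed.

Lemma int_Rn_le g h : LC K [::] g -> LC K [::] h -> (forall x, g x <= h x) ->
 int_Rn g <= int_Rn h.
Proof. by move=> lg lh gh; rewrite !int_RnE; apply: Ifold_le => //; exact: enum_uniq. Qed.

Lemma int_Rn_bound g C : LC K [::] g -> (forall x, `|g x| <= C) -> `|int_Rn g| <= C * (2 * K) ^+ n.
Proof.
move=> lg gC; have := Ifold_bound (enum_uniq 'I_n) lg gC 0.
by rewrite -cardE card_ord.
Qed.

Lemma int_Rn_abs g h : LC K [::] g -> LC K [::] h -> (forall x, `|g x| <= h x) ->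
 `|int_Rn g| <= int_Rn h.
Proof.
move=> lg lh gh; rewrite ler_norml; apply/andP; split; last first.
 by apply: int_Rn_le => // x; exact: le_trans (ler_norm _) (gh x).
rewrite -mulN1r -[_ * _]addr0 -(mul0r (int_Rn h)) -int_Rn_lin //.
apply: int_Rn_le => //; first exact: LC_lin.
by move=> x; rewrite mul0r addr0 mulN1r lerNl; apply: le_trans (gh x); rewrite -normrN ler_norm.
Qed.

Lemma int_Rn_param (G : R -> V -> R) k t C : (forall u, LC K [::] (G u)) -> LC K [::] k ->
 (\forall d \near (0 : R), forall x, `|G (t + d) x - G t x - d * k x| <= C * d ^+ 2) ->
 is_derive t 1 (fun u => int_Rn (G u)) (int_Rn k).
Proof.
move=> lG lk H; apply: (@quad_is_derive _ _ _ _ (C * (2 * K) ^+ n)); near=> d.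
rewrite (_ : _ - _ = int_Rn (fun x => 1 * (1 * G (t + d) x + (-1) * G t x) + (- d) * k x)).
 rewrite mulrAC; apply: int_Rn_bound; first by apply: LC_lin => //; exact: LC_lin.
 by move=> x; rewrite !mul1r mulN1r mulNr; move: x; near: d; exact: H.
rewrite int_Rn_lin ?int_Rn_lin //; last exact: LC_lin.
by rewrite !mul1r mulN1r mulNr.
Unshelve. all: end_near. Qed.

End Fold.

Section Prod.
Variables (K : R) (K0 : 0 <= K) (b : 'I_n -> R -> R) (L : R).
Hypotheses (b1 : forall j u, `|b j u| <= 1)
 (bL : forall j u v, `|b j u - b j v| <= L * `|u - v|)
 (bs : forall j u, K < `|u| -> b j u = 0).

Lemma prod_norm_le1 (r : seq 'I_n) x : `|\prod_(j <- r) b j (coord x j)| <= 1.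
Proof.
elim: r => [|j r ih]; first by rewrite big_nil normr1.
by rewrite big_cons normrM mulr_ile1.
Qed.

Lemma prod_LC : LC K [::] (fun x => \prod_j b j (coord x j)).
Proof.
split; last by move=> i x _ Ki; rewrite (bigD1 i) //= bs // mul0r.
exists L => x y; rewrite mulr_sumr.
elim: (index_enum _) => [|j r ih]; first by rewrite !big_nil subrr normr0.
rewrite !big_cons (_ : _ - _ = b j (coord x j) * (\prod_(j <- r) b j (coord x j) - \prod_(j <- r) b j (coord y j))
  + (b j (coord x j) - b j (coord y j)) * \prod_(j <- r) b j (coord y j)); last by ring.
apply: le_trans (ler_normD _ _) _; rewrite addrC !normrM; apply: lerD.
 by apply: le_trans (bL j (coord x j) (coord y j)); rewrite ler_piMr // prod_norm_le1.
by apply: le_trans ih; rewrite ler_piMl.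
Qed.

Lemma Ifold_prod s x : uniq s ->
 Ifold s (fun x => \prod_j b j (coord x j)) x =
 \prod_j (if j \in s then int1 (b j) else b j (coord x j)).
Proof.
elim: s x => [|i s ih] x /=; auto.
move=> /andP[si us]; rewrite int_coordE.
rewrite (_ : (fun u => _) = (fun u => (\prod_(j | j != i)
  (if j \in i :: s then int1 (b j) else b j (coord x j))) * b i u)).
 have cb : ccs K (b i) by split=> [|u /bs //]; exact: (@lip_continuous (b i) L).
 by rewrite (int1Z _ cb) [RHS](bigD1 i) //= mem_head mulrC.
apply/funext => u; rewrite ih // (bigD1 i) //= (negbTE si) coord_upd eqxx mulrC; congr (_ * _).
by apply: eq_bigr => j ji; rewrite inE (negbTE ji) /= coord_upd (negbTE ji).
Qed.

Lemma int_Rn_prod : int_Rn (fun x => \prod_j b j (coord x j)) = \prod_j int1 (b j).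
Proof.
by rewrite int_RnE Ifold_prod ?enum_uniq //; apply: eq_bigr => j _; rewrite mem_enum.
Qed.

End Prod.

Lemma bounded_box g K : continuous g ->
 exists2 B : R, 0 <= B & forall x, (forall i, `|coord x i| <= K) -> `|g x| <= B.
Proof.
move=> cg; pose A := [set x : V | forall i, `[- K, K]%classic (x ord0 i)].
have cA : compact A by apply: (@rV_compact _ _ (fun=> `[- K, K]%classic)) => i; exact: segment_compact.
have /compact_bounded[B [_ hB]] : compact (g @` A).
 by apply: continuous_compact => //; exact: continuous_subspaceT.
exists (`|B| + 1) => // x xK; apply: (hB (`|B| + 1)).
 by rewrite (le_lt_trans (ler_norm _)) // ltrDl.
exists x => //; rewrite /A /= => i; rewrite in_itv /= -ler_norml; exact: xK.
Qed.

Definition supB K g := forall i x, K < `|coord x i| -> g x = 0.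

Lemma supB_partial K g i : supB K g -> supB K (partial i g).
Proof.
move=> sg j x Kx; rewrite /partial.
rewrite (@near_eq_derive _ _ _ g (fun=> 0)) ?derive_cst //.
have : open [set y : V | K < `|coord y j|].
 apply: (open_comp (f := fun y : V => `|coord y j|) (D := [set r | K < r])); auto.
 move=> y _; apply: (@continuous_comp _ _ _ (fun y => coord y j) (fun r : R => `|r|)).
  exact: coord_continuous.
 exact: norm_continuous.
by move=> /near_open; apply => // y; exact: sg.
Qed.

Lemma box_or_zero K g x : supB K g -> (forall i, `|coord x i| <= K) \/ g x = 0.
Proof.
move=> sK; have [/forallP xK|] := boolP [forall i, `|coord x i| <= K]; auto.
by rewrite negb_forall => /existsP[i]; rewrite -ltNge => /sK ->; right.
Qed.

Lemma sm_bounded K g : sm g -> supB K g -> exists2 B : R, 0 <= B & forall x, `|g x| <= B.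
Proof.
move=> sg sK; have [B B0 gB] := bounded_box K (sm_continuous sg).
exists B => // x; have [xK|->] := box_or_zero x sK; auto.
by rewrite normr0.
Qed.

(** One coordinate is changed at a time; [Z] confines the coordinates so that the intermediate
    points stay where the one-variable bound holds. *)
Lemma coordwise_lip (Z : R -> Prop) g (B : R) x y :
 (forall z i u v, (forall j, Z (coord z j)) -> Z u -> Z v -> `|g (upd z i u) - g (upd z i v)| <= B * `|u - v|) ->
 (forall j, Z (coord x j)) -> (forall j, Z (coord y j)) -> `|g x - g y| <= B * d1 x y.
Proof.
move=> step xZ yZ.
pose mix (s : seq 'I_n) : V := \row_i (if i \in s then coord x i else coord y i).
have mixZ s j : Z (coord (mix s) j) by rewrite /coord mxE; case: ifP.
have H s : uniq s -> `|g (mix s) - g y| <= B * \sum_(i <- s) `|coord x i - coord y i|.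
 elim: s => [_|i s ih /= /andP[si us]].
  by rewrite big_nil mulr0 (_ : mix [::] = y) ?subrr ?normr0 //; apply: coordP => i; rewrite /coord mxE.
 rewrite big_cons mulrDr (_ : _ - _ = (g (mix (i :: s)) - g (mix s)) + (g (mix s) - g y)); last by ring.
 apply: le_trans (ler_normD _ _) _; apply: lerD; auto.
 have -> : mix s = upd (mix s) i (coord y i).
  by apply: coordP => j; rewrite coord_upd /coord mxE; case: eqP => [->|//]; rewrite (negbTE si).
 have -> : mix (i :: s) = upd (mix s) i (coord x i); last auto.
 by apply: coordP => j; rewrite coord_upd /coord !mxE inE; case: eqP => [->|//].
have := H (enum 'I_n) (enum_uniq _).
rewrite (_ : mix _ = x); last by apply: coordP => i; rewrite /coord mxE mem_enum.
by rewrite /d1 big_enum.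
Qed.

(** Two uses of the mean value theorem in place of Taylor's formula, at the price of a factor 2 in
    the constant. *)
Lemma mvt2 g i x (t : R) : sm g -> exists2 c : R, `|c - coord x i| <= `|t| &
 `|g (upd x i (coord x i + t)) - g x - t * partial i g x| <= `|partial i (partial i g) (upd x i c)| * t ^+ 2.
Proof.
move=> sg; have [c cx e] := mvt (fun s : R => sm_is_derive1 i x s sg) (coord x i) (coord x i + t).
have [c' cx' e'] := mvt (fun s : R => sm_is_derive1 i x s (sm_partial i sg)) (coord x i) c.
rewrite upd_id in e; rewrite upd_id in e'; move: cx; rewrite addrAC subrr add0r => cx.
exists c'; first exact: le_trans cx' cx.
rewrite e addrAC subrr add0r (_ : _ - _ = (partial i g (upd x i c) - partial i g x) * t); last by ring.
by rewrite e' -(real_normK (num_real t)) expr2 !normrM mulrA ler_wpM2r // ler_wpM2l.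
Qed.

Lemma sm_LC K g : sm g -> supB K g -> LC K [::] g.
Proof.
move=> sg sK; split; last by move=> i x _; exact: sK.
have bi i : exists2 B : R, 0 <= B & forall x, `|partial i g x| <= B.
 by apply: (@sm_bounded K); [exact: sm_partial|exact: supB_partial].
have [B B0 gB] : exists2 B : R, 0 <= B & forall i x, `|partial i g x| <= B.
 have /choice[b hb] i : exists r : R, 0 <= r /\ forall x, `|partial i g x| <= r.
  by have [r ? ?] := bi i; exists r.
 exists (\sum_i b i); first by apply: sumr_ge0 => i _; case: (hb i).
 move=> i x; have [_ /(_ x) h] := hb i; apply: le_trans h _.
 by rewrite (bigD1 i) //= lerDl sumr_ge0 // => j _; case: (hb j).
exists B => x y.
have step z i u v : `|g (upd z i u) - g (upd z i v)| <= B * `|u - v|.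
 have [c _ ->] := mvt (fun s : R => sm_is_derive1 i z s sg) v u.
 by rewrite normrM ler_wpM2r.
by apply: (@coordwise_lip xpredT) => // z i u v _ _ _; pos.
Qed.

Lemma sm_Der K g i : sm g -> supB K g -> Der i g (partial i g).
Proof.
move=> sg sK.
have [B B0 gB] : exists2 B : R, 0 <= B & forall x, `|partial i (partial i g) x| <= B.
 by apply: (@sm_bounded K); [exact/sm_partial/sm_partial|exact/supB_partial/supB_partial].
exists B => x t.
have [c _ h] := mvt2 i x t sg; apply: le_trans h _.
by rewrite ler_wpM2r.
Qed.

Lemma int_Rn_partial K g i : 0 <= K -> sm g -> supB K g -> int_Rn (partial i g) = 0.
Proof.
move=> K0 sg sK; apply: (int_Rn_Der K0 (g := g)); [exact: sm_LC| |exact: sm_Der sK].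
by apply: sm_LC; [exact: sm_partial|exact: supB_partial].
Qed.

End Multi.

(** * Finitely generated cones with integral generators *)

Section FourierMotzkin.
Variables (R : realType) (I : finType).
Implicit Types (g h : {ffun I -> int}) (G H : seq {ffun I -> int}) (y : I -> R).

Definition zz h g : int := \sum_i h i * g i.
Definition zp h y : R := \sum_i (h i)%:~R * y i.

(** Membership is peeled off generator by generator, to match the elimination. Generators and
    inequalities stay integral because face parts are only given for integral pairs. *)
Fixpoint incone G y : Prop :=
 if G is g :: G' then exists2 c : R, 0 <= c & incone G' (fun i => y i - c * (g i)%:~R)
 else forall i, y i = 0.

Lemma zp_sub h y g c : zp h (fun i => y i - c * (g i)%:~R) = zp h y - c * (zz h g)%:~R.
Proof.
rewrite /zp /zz raddf_sum /= mulr_sumr -sumrB; apply: eq_bigr => i _.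
lra.
Qed.

Lemma incone_ge0 G h y : (forall g, g \in G -> 0 <= zz h g) -> incone G y -> 0 <= zp h y.
Proof.
elim: G y => [|g G ih] y hG /=.
 by move=> y0; rewrite /zp big1 // => i _; rewrite y0 mulr0.
move=> [c c0] /ih; rewrite zp_sub => H.
have /H : forall g, g \in G -> 0 <= zz h g by move=> g' gG; apply: hG; rewrite inE gG orbT.
rewrite subr_ge0; apply: le_trans; rewrite mulr_ge0 // ler0z; apply: hG; exact: mem_head.
Qed.

(** The maximum of 0 and the list; knowing where it is attained tells which inequality is binding in
    the elimination. *)
Lemma seq_ub (s : seq R) : exists c, [/\ 0 <= c, forall r, r \in s -> r <= c & c = 0 \/ c \in s].
Proof.
elim: s => [|r s [c [c0 cs cin]]]; first by exists 0; split => //; left.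
case: (leP r c) => rc.
 exists c; split=> // [r'|]; first by rewrite inE => /orP[/eqP -> //|]; exact: cs.
 by case: cin => [|cin]; [left|right; rewrite inE cin orbT].
exists r; split=> [|r'|]; [exact: le_trans (ltW rc)| |by right; rewrite mem_head].
by rewrite inE => /orP[/eqP -> //|/cs r'c]; lra.
Qed.

(* Fourier--Motzkin elimination, one generator at a time. *)
Lemma cone_inequalities G : exists H, (forall h g, h \in H -> g \in G -> 0 <= zz h g) /\
 forall y, (forall h, h \in H -> 0 <= zp h y) -> incone G y.
Proof.
elim: G => [|g G [H [HG HP]]].
 exists ([seq [ffun j => (j == i)%:Z] | i : I] ++ [seq [ffun j => - (j == i)%:Z] | i : I]).
 split=> // y yH i; apply/eqP; rewrite eq_le; apply/andP; split.
  have := yH [ffun j => - (j == i)%:Z]; rewrite mem_cat map_f ?orbT ?mem_enum // => /(_ isT).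
  rewrite /zp (bigD1 i) //= ffunE eqxx big1 ?addr0 ?mulN1r ?oppr_ge0 //.
  by move=> j /negbTE ji; rewrite ffunE ji mul0r.
 have := yH [ffun j => (j == i)%:Z]; rewrite mem_cat map_f ?mem_enum // => /(_ isT).
 rewrite /zp (bigD1 i) //= ffunE eqxx big1 ?addr0 ?mul1r //.
 by move=> j /negbTE ji; rewrite ffunE ji mul0r.
(* This combination vanishes on [g], and for [h1] positive and [h2] negative on [g] its coefficients
   are nonnegative: it says that the two opposite bounds on the coefficient of [g] are
   compatible. *)
pose cmb h1 h2 : {ffun I -> int} := [ffun i => zz h1 g * h2 i - zz h2 g * h1 i].
have cmbz h1 h2 g' : zz (cmb h1 h2) g' = zz h1 g * zz h2 g' - zz h2 g * zz h1 g'.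
 rewrite {1}/zz 2!mulr_sumr -sumrB; apply: eq_bigr => i _; rewrite ffunE; ring.
have cmbp h1 h2 y : zp (cmb h1 h2) y = (zz h1 g)%:~R * zp h2 y - (zz h2 g)%:~R * zp h1 y.
 rewrite {1}/zp 2!mulr_sumr -sumrB; apply: eq_bigr => i _; rewrite ffunE rmorphB !rmorphM /=; ring.
exists ([seq h <- H | 0 <= zz h g] ++
 [seq cmb h1 h2 | h1 <- [seq h <- H | 0 < zz h g], h2 <- [seq h <- H | zz h g < 0]]).
split=> [h g'|y yH].
 rewrite mem_cat => /orP[|/allpairsP[[h1 h2] /=[]]].
  by rewrite mem_filter inE => /andP[hg hH] /orP[/eqP -> //|]; exact: HG.
 rewrite !mem_filter => /andP[h1g h1H] /andP[h2g h2H] -> ; rewrite cmbz inE => /orP[/eqP ->|g'G].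
  lra.
 rewrite subr_ge0; apply: (@le_trans _ _ 0); first by rewrite mulr_le0_ge0 ?HG // ltW.
 by apply: mulr_ge0; auto.
(* Inequalities negative on [g] bound its coefficient from below, those positive on [g] from above;
   [c] is the largest lower bound. *)
have [c [c0 cs cin]] := seq_ub [seq zp h y / (zz h g)%:~R | h <- H & zz h g < 0].
exists c => //; apply: HP => h hH; rewrite zp_sub subr_ge0.
case: (ltgtP (zz h g) 0) => hg; last by rewrite hg mulr0; apply: yH; rewrite mem_cat mem_filter hg hH.
 rewrite -ler_ndivrMr ?ltrz0 //; apply: cs; apply/mapP; exists h => //.
 by rewrite mem_filter hg.
have hy : 0 <= zp h y by apply: yH; rewrite mem_cat mem_filter hH (ltW hg).
rewrite -ler_pdivlMr ?ltr0z //; case: cin => [->|/mapP[h2]].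
 by rewrite divr_ge0 // ler0z ltW.
rewrite mem_filter => /andP[h2g h2H] ->.
rewrite ler_ndivrMr ?ltrz0 // mulrAC ler_pdivrMr ?ltr0z //.
have := yH (cmb h h2); rewrite mem_cat; have -> : cmb h h2 \in
 [seq cmb h1 h2 | h1 <- [seq h <- H | 0 < zz h g], h2 <- [seq h <- H | zz h g < 0]].
 by apply: allpairs_f; rewrite mem_filter ?hg ?h2g.
rewrite orbT => /(_ isT); rewrite cmbp subr_ge0.
lra.
Qed.

End FourierMotzkin.

(** * Dickson's lemma *)

Section Dickson.
Variable n : nat.
Implicit Types (P : mindex n -> Prop) (s : seq 'I_n).

(** Induction on the coordinates. The list [L'] dominates in the coordinates of [s]; it also
    dominates at i every a with a_i >= M, and each of the finitely many values a_i < M defines a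
    smaller set to which the induction hypothesis applies. *)
Lemma dickson_seq s P : exists L : seq (mindex n), (forall v, v \in L -> P v) /\
 forall a, P a -> exists2 v, v \in L & forall i, i \in s -> (v i <= a i)%N.
Proof.
elim: s P => [|i s ih] P.
 have [[a Pa]|nP] := pselect (exists a, P a).
  by exists [:: a]; split=> [v|a' _]; [rewrite inE => /eqP ->|exists a; rewrite ?mem_head].
 by exists [::]; split=> // a Pa; case: nP; exists a.
have [L' [L'P hL']] := ih P.
pose M := \max_(v <- L') v i.
have [Lc hLc] := choice (fun c : nat => ih (fun a => P a /\ a i = c)).
exists (L' ++ flatten [seq Lc c | c <- iota 0 M]); split=> [v|a Pa].
 rewrite mem_cat => /orP[/L'P //|/flatten_mapP[c _]].
 by have [h _] := hLc c => /h[].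
case: (leqP M (a i)) => Ma.
 have [v vL va] := hL' a Pa; exists v; first by rewrite mem_cat vL.
 move=> j; rewrite inE => /orP[/eqP ->|]; auto.
 by apply: leq_trans Ma; rewrite /M (big_rem v) //= leq_maxl.
have [h1 h2] := hLc (a i); have [v vL va] := h2 a (conj Pa erefl).
exists v.
 rewrite mem_cat; apply/orP; right; apply/flatten_mapP; exists (a i) => //.
 by rewrite mem_iota.
move=> j; rewrite inE => /orP[/eqP ->|]; auto.
by have [_ ->] := h1 v vL.
Qed.

Lemma dickson P : exists L : seq (mindex n), [/\ uniq L, forall v, v \in L -> P v &
 forall a, P a -> exists2 v, v \in L & forall i, (v i <= a i)%N].
Proof.
have [L [LP hL]] := dickson_seq (enum 'I_n) P; exists (undup L).
split=> [|v|a /hL[v vL va]]; first exact: undup_uniq.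
 by rewrite mem_undup; exact: LP.
by exists v; rewrite ?mem_undup // => i; apply: va; rewrite mem_enum.
Qed.

End Dickson.

(** * Generators and half-spaces of the Newton polyhedron *)

Section Newton.
Variables (R : realType) (n : nat) (f : 'rV[R]_n -> R).
Local Notation V := 'rV[R]_n.
Implicit Types (x : V) (a : mindex n) (i : 'I_n).

Definition npair (a b : mindex n) : nat := (\sum_i a i * b i)%N.
Definition rpair (c : 'I_n -> R) x : R := \sum_i c i * coord x i.
Definition nr (a : mindex n) : 'I_n -> R := fun i => (a i)%:R.

Lemma rpair_mpoint c b : rpair c (mpoint R b) = \sum_i c i * (b i)%:R.
Proof. by apply: eq_bigr => i _; rewrite /coord mxE. Qed.

Lemma rpair_nr a b : rpair (nr a) (mpoint R b) = (npair a b)%:R.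
Proof. by rewrite rpair_mpoint natr_sum; apply: eq_bigr => i _; lra. Qed.

Lemma rpair_diag c t : rpair c (diag n t) = (\sum_i c i) * t.
Proof. by rewrite mulr_suml; apply: eq_bigr => i _; rewrite /coord mxE. Qed.

Lemma rpair_lin c (k : nat) (p : 'I_k -> V) (w : 'I_k -> R) :
 rpair c (\sum_j w j *: p j) = \sum_j w j * rpair c (p j).
Proof.
rewrite /rpair; under [RHS]eq_bigr do rewrite mulr_sumr.
rewrite exchange_big /=; apply: eq_bigr => i _; rewrite /coord summxE mulr_sumr.
by apply: eq_bigr => j _; rewrite mxE; ring.
Qed.

Lemma rpairD c x y : rpair c (x + y) = rpair c x + rpair c y.
Proof. by rewrite -big_split; apply: eq_bigr => i _; rewrite /coord mxE mulrDr. Qed.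

Lemma rpairZ c t x : rpair c (t *: x) = t * rpair c x.
Proof. by rewrite mulr_sumr; apply: eq_bigr => i _; rewrite /coord mxE; ring. Qed.

Lemma rpair_evec c i : rpair c (evec R i) = c i.
Proof.
rewrite /rpair (bigD1 i) //= /coord /evec mxE !eqxx mulr1 big1 ?addr0 // => j /negbTE ji.
by rewrite mxE ji andbF mulr0.
Qed.

Variable A : seq (mindex n).
Hypotheses (uA : uniq A) (AE : forall v, v \in A -> taylor_coef f v != 0)
 (AD : forall a, taylor_coef f a != 0 -> exists2 v, v \in A & forall i, (v i <= a i)%N).

Lemma newton_valid c (l : R) : (forall i, 0 <= c i) ->
 (forall v, v \in A -> l <= rpair c (mpoint R v)) -> forall x, newton_poly f x -> l <= rpair c x.
Proof.
move=> c0 cA x [k [p [w [pP [w0 [w1 ->]]]]]]; rewrite rpair_lin -[l]mul1r -w1 mulr_suml.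
apply: ler_sum => j _; apply: ler_wpM2l => //.
have [a [/AD[v vA va] [u [u0 ->]]]] := pP j.
rewrite rpairD; apply: le_trans (cA v vA) _; rewrite -[leLHS]addr0; apply: lerD.
 by rewrite !rpair_mpoint; apply: ler_sum => i _; rewrite ler_wpM2l // ler_nat.
by apply: sumr_ge0 => i _; pos.
Qed.

Lemma newton_up x y : newton_poly f x -> (forall i, coord x i <= coord y i) -> newton_poly f y.
Proof.
move=> [k [p [w [pP [w0 [w1 e]]]]]] xy.
exists k, (fun j => p j + (y - x)), w; split; last split=> //; last split=> //.
 move=> j; have [a [ca [u [u0 ->]]]] := pP j; exists a; split=> //.
 exists (u + (y - x)); split; last by rewrite -!addrA.
 by move=> i; rewrite /coord !mxE addr_ge0 ?subr_ge0 //; [exact: u0|exact: xy].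
under eq_bigr do rewrite scalerDr.
by rewrite big_split /= -e -scaler_suml w1 scale1r addrC subrK.
Qed.

Lemma newton_mem v : v \in A -> newton_poly f (mpoint R v).
Proof.
move=> vA; exists 1%N, (fun=> mpoint R v), (fun=> 1); split; last first.
 by split=> //; rewrite !big_ord1 scale1r.
move=> _; exists v; split; auto.
by exists 0; split=> [i|]; rewrite ?addr0 // /coord mxE.
Qed.

Lemma newton_conv (w : mindex n -> R) x : (forall v, v \in A -> 0 <= w v) ->
 \sum_(v <- A) w v = 1 -> (forall i, \sum_(v <- A) w v * (v i)%:R <= coord x i) ->
 newton_poly f x.
Proof.
move=> w0 w1 wx.
pose y : V := \sum_(v <- A) w v *: mpoint R v.
have yx i : coord y i <= coord x i.
 rewrite (_ : coord y i = \sum_(v <- A) w v * (v i)%:R) //.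
 by rewrite /coord summxE; apply: eq_bigr => v _; rewrite !mxE.
apply: newton_up yx.
case: A w0 w1 AE @y => [|v0 A'] w0 w1 AE' y; first by move: w1; rewrite big_nil => /eqP; rewrite eq_sym oner_eq0.
pose B := v0 :: A'.
exists (size B), (fun j => mpoint R (nth v0 B j)), (fun j => w (nth v0 B j)); split.
 move=> j; exists (nth v0 B j); split; first by apply: AE'; rewrite mem_nth.
 by exists 0; split=> [i|]; rewrite ?addr0 // /coord mxE.
split; first by move=> j; apply: w0; rewrite mem_nth.
by split; [rewrite -w1 (big_nth v0) big_mkord|rewrite /y (big_nth v0) big_mkord].
Qed.

(** Homogenization: x lies in the polyhedron as soon as (x, 1) lies in the cone generated by the (v,
    1) and the (e_i, 0), and elimination finds the inequalities of that cone. *)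
Lemma newton_inequalities : exists G : seq (mindex n * nat),
 (forall p v, p \in G -> v \in A -> (p.2 <= npair p.1 v)%N) /\
 forall x, (forall p, p \in G -> p.2%:R <= rpair (nr p.1) x) -> newton_poly f x.
Proof.
pose I := ('I_n + unit)%type.
pose ga (v : mindex n) : {ffun I -> int} := [ffun k => if k is inl i then (v i)%:Z else 1].
pose ge (i : 'I_n) : {ffun I -> int} := [ffun k => if k is inl j then (j == i)%:Z else 0].
have [H [HG HP]] := cone_inequalities R ([seq ga v | v <- A] ++ [seq ge i | i : 'I_n]).
(* An inequality <a, x> + c >= 0 has level -c. For c >= 0 the level is replaced by 0, which still
   holds on [A] because a >= 0, and which implies the original one. *)
pose nn (h : {ffun I -> int}) : mindex n * nat :=
 ([ffun i => `|h (inl i)|%N], if 0 <= h (inr tt) then 0%N else `|h (inr tt)|%N).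
have zge h i : zz h (ge i) = h (inl i).
 rewrite /zz big_sumType /= (bigD1 i) //= ffunE eqxx mulr1 !big1 ?addr0 // => [k _|j ji].
  by rewrite ffunE mulr0.
 by rewrite ffunE (negbTE ji) mulr0.
have hge h i : h \in H -> 0 <= h (inl i).
 by move=> hH; rewrite -zge; apply: HG => //; rewrite mem_cat map_f ?orbT // mem_enum.
have un (F : unit -> int) : \sum_k F k = F tt.
 by rewrite (bigD1 tt) //= big1 ?addr0 // => -[].
have unR (F : unit -> R) : \sum_k F k = F tt.
 by rewrite (bigD1 tt) //= big1 ?addr0 // => -[].
exists [seq nn h | h <- H]; split=> [p v /mapP[h hH ->] vA|x xG].
 rewrite /=; case: ifPn => // /=; rewrite -ltNge => hlt.
 have := HG h (ga v) hH; rewrite mem_cat map_f // => /(_ isT).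
 rewrite /zz big_sumType /= un ffunE mulr1 => H0.
 have e : Posz (npair [ffun i => `|h (inl i)|%N] v) = \sum_i h (inl i) * (v i)%:Z.
  rewrite /npair -[Posz _]natz natr_sum; apply: eq_bigr => i _.
  by rewrite natrM !natz ffunE gez0_abs // hge.
 rewrite -lez_nat e (ltz0_abs hlt) -subr_ge0 opprK.
 by apply: le_trans H0 _; rewrite lerD2r ler_sum // => i _; rewrite ffunE.
have : incone ([seq ga v | v <- A] ++ [seq ge i | i : 'I_n])
 (fun k => if k is inl i then coord x i else 1).
 apply: HP => h hH; rewrite /zp big_sumType /= unR mulr1.
 have := xG (nn h); rewrite map_f // => /(_ isT).
 have -> : rpair (nr (nn h).1) x = \sum_i (h (inl i))%:~R * coord x i.
  apply: eq_bigr => i _; rewrite /nr /= ffunE; congr (_ * _).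
  by rewrite -[in RHS](gez0_abs (hge h i hH)) pmulrn.
 rewrite /=; case: ifPn => h0 /=; first by move=> /addr_ge0; apply; rewrite ler0z.
 by rewrite -ltNge in h0; rewrite pmulrn (ltz0_abs h0) intrN -subr_ge0 opprK.
(* Membership in the cone is unfolded over sublists [B], each step yielding the weight of one
   exponent. *)
suff key (B : seq (mindex n)) (y : I -> R) : uniq B ->
  incone ([seq ga v | v <- B] ++ [seq ge i | i : 'I_n]) y ->
  exists w : mindex n -> R, [/\ forall v, v \in B -> 0 <= w v,
   \sum_(v <- B) w v = y (inr tt) & forall i, \sum_(v <- B) w v * (v i)%:R <= y (inl i)].
 by move=> /(key A _ uA)[w [w0 w1 wx]]; exact: newton_conv wx.
elim: B y => [|v B ih] y.
 move=> _ /= yc; exists (fun=> 0); split=> // [|i]; rewrite big_nil.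
  apply/eqP; rewrite eq_le; apply/andP; split.
   pose h : {ffun I -> int} := [ffun k => if k is inl i then 0 else 1].
   have := incone_ge0 (h := h) _ yc; rewrite /zp big_sumType /= unR ffunE mul1r.
   rewrite big1 ?add0r; last by move=> i _; rewrite ffunE mul0r.
   by apply=> g /mapP[i _ ->]; rewrite zge ffunE.
  pose h : {ffun I -> int} := [ffun k => if k is inl i then 0 else -1].
  have := incone_ge0 (h := h) _ yc; rewrite /zp big_sumType /= unR ffunE mulN1r.
  rewrite big1 ?add0r ?oppr_ge0; last by move=> i _; rewrite ffunE mul0r.
  by apply=> g /mapP[i _ ->]; rewrite zge ffunE.
 pose h : {ffun I -> int} := [ffun k => if k is inl j then (j == i)%:Z else 0].
 have := incone_ge0 (h := h) _ yc; rewrite /zp big_sumType /= unR ffunE mul0r addr0.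
 rewrite (bigD1 i) //= ffunE eqxx mul1r big1 ?addr0; last first.
  by move=> j /negbTE ji; rewrite ffunE ji mul0r.
 by apply=> g /mapP[k _ ->]; rewrite zge ffunE; case: eqP.
move=> /= /andP[vB uB] [c c0] /(ih _ uB)[w [w0 w1 wx]].
pose w' u := if u == v then c else w u.
have w'B (F : mindex n -> R) : \sum_(u <- B) w' u * F u = \sum_(u <- B) w u * F u.
 rewrite !big_seq; apply: eq_bigr => u uB'; rewrite /w'; case: eqP => // uv.
 by rewrite uv (negbTE vB) in uB'.
exists w'; split=> [u|| i].
- by rewrite inE /w'; case: eqP => [//|_ /= /w0].
- rewrite big_cons {1}/w' eqxx; under eq_bigr do rewrite -[w' _]mulr1.
 rewrite (w'B (fun=> 1)); under eq_bigr do rewrite mulr1.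
 by rewrite w1 ffunE mulr1 addrC subrK.
rewrite big_cons {1}/w' eqxx (w'B (fun u => (u i)%:R)) addrC -lerBrDr.
by have := wx i; rewrite ffunE.
Qed.

End Newton.

Lemma seq_lb (R : realType) (s : seq R) : (forall r, r \in s -> 0 < r) ->
 exists2 e : R, 0 < e & forall r, r \in s -> e <= r.
Proof.
elim: s => [|r s ih] h; first by exists 1.
have [r' r's|e e0 es] := ih; first by apply: h; rewrite inE r's orbT.
exists (Num.min e r); first by rewrite lt_min e0 h ?mem_head.
move=> r'; rewrite inE => /orP[/eqP ->|/es er]; first by rewrite ge_min lexx orbT.
by rewrite ge_min er.
Qed.

(** Two finite descriptions of one polyhedron: functionals are tested on the generators [A], points
    on the half-spaces [G]. [gen_pos] is the form in which f(0) = 0 is remembered. *)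
Record newton_gen (R : realType) (n : nat) (f : 'rV[R]_n -> R) (A : seq (mindex n))
  (G : seq (mindex n * nat)) : Prop := NewtonGen {
 gen_coef : forall v, v \in A -> taylor_coef f v != 0;
 gen_dom : forall a, taylor_coef f a != 0 -> exists2 v, v \in A & forall i, (v i <= a i)%N;
 gen_nil : A != [::];
 gen_pos : forall v, v \in A -> (0 < \sum_i v i)%N;
 gen_G : forall p v, p \in G -> v \in A -> (p.2 <= npair p.1 v)%N;
 gen_ineq : forall x, (forall p, p \in G -> p.2%:R <= rpair (nr R p.1) x) -> newton_poly f x }.

(** * Newton distance and principal face *)

Section PrincipalFace.
Variables (R : realType) (n : nat) (f : 'rV[R]_n -> R).
Local Notation V := 'rV[R]_n.
Implicit Types (x y q : V) (i : 'I_n).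
Variables (A : seq (mindex n)) (G : seq (mindex n * nat)).
Hypothesis NG : newton_gen f A G.

Local Notation P := (newton_poly f).
Local Notation d := (newton_dist f).
Local Notation tau := (principal_face f).

Lemma exA : exists v, v \in A.
Proof. by case: A (gen_nil NG) => // v A' _; exists v; rewrite mem_head. Qed.

Lemma newton_G p x : p \in G -> P x -> p.2%:R <= rpair (nr R p.1) x.
Proof.
move=> pG; apply: (newton_valid (gen_dom NG)) => [i|v vA]; auto.
by rewrite rpair_nr ler_nat (gen_G NG).
Qed.

Lemma n_gt0 : (0 < n)%N.
Proof.
have [v vA] := exA; case: (posnP n) => // n0.
have := gen_pos NG vA; rewrite big1 // => i _.
by have h := leq_ltn_trans (leq0n i) (ltn_ord i); rewrite n0 in h.
Qed.

(** The sum of the coordinates is at least 1 on every generator; hence the infimum that defines the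
    distance is positive. *)
Lemma diag_lb t : P (diag n t) -> n%:R^-1 <= t.
Proof.
move=> Pt; rewrite -[_^-1]mul1r ler_pdivrMr ?ltr0n ?n_gt0 //.
have : 1 <= rpair (fun=> 1) (diag n t).
 apply: (newton_valid (gen_dom NG)) Pt => [i|v vA]; auto.
 rewrite rpair_mpoint; under eq_bigr do rewrite mul1r.
 by rewrite -natr_sum ler1n (gen_pos NG).
by rewrite rpair_diag sumr_const card_ord mulrC.
Qed.

Lemma diag_ex : [set t : R | P (diag n t)] !=set0.
Proof.
have [v vA] := exA; exists (\sum_i v i)%:R => /=.
apply: newton_up (newton_mem (gen_coef NG) vA) _ => i; rewrite /coord !mxE ler_nat.
by rewrite (bigD1 i) //= leq_addr.
Qed.

Lemma dist_gt0 : 0 < d.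
Proof.
apply: (@lt_le_trans _ _ n%:R^-1); first by rewrite invr_gt0 ltr0n n_gt0.
by apply: lb_le_inf; [exact: diag_ex|move=> t; exact: diag_lb].
Qed.

Lemma dist_min t : P (diag n t) -> d <= t.
Proof. by move=> Pt; apply: ge_inf => //; exists n%:R^-1 => r; exact: diag_lb. Qed.

(** The infimum is attained because membership of a diagonal point is a finite set of non-strict
    linear inequalities in t. *)
Lemma dist_mem : P (diag n d).
Proof.
apply: (gen_ineq NG) => p pG; rewrite rpair_diag.
(* A zero normal gives no bound on t, but then its level is 0. *)
have [S0|S0] := posnP (\sum_i p.1 i).
 have [v vA] := exA; suff -> : p.2 = 0%N.
  by rewrite mulr_ge0 ?(ltW dist_gt0) // sumr_ge0 // => i _; auto.
 apply/eqP; rewrite -leqn0; apply: leq_trans (gen_G NG pG vA) _; rewrite leqn0 sum_nat_eq0.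
 move/eqP: S0; rewrite sum_nat_eq0 => /forallP S0; apply/forallP => i.
 by move: (S0 i) => /= /eqP ->.
have S1 : 0 < \sum_i nr R p.1 i by rewrite -natr_sum ltr0n.
rewrite mulrC -ler_pdivrMr //; apply: lb_le_inf; first exact: diag_ex.
move=> t /= Pt; rewrite ler_pdivrMr //.
by have := newton_G pG Pt; rewrite rpair_diag mulrC.
Qed.

Lemma coord_norm x i : `|coord x i| <= `|x|.
Proof.
rewrite {2}/Num.Def.normr/= mx_normrE; apply: le_trans (le_bigmax _ _ (ord0, i)) => //=.
Qed.

Lemma ipair_natv (a : mindex n) x : ipair (natv a) x = rpair (nr R a) x.
Proof. by []. Qed.

Lemma aff_hull_sub S y q q' c : aff_hull S y -> S q -> S q' -> aff_hull S (y + c *: (q - q')).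
Proof.
move=> [k [p [w [pS [w1 ->]]]]] Sq Sq'.
exists (k + 2)%N, (fun j => match fintype.split j with inl j' => p j' | inr b => if b == 0 then q else q' end),
 (fun j => match fintype.split j with inl j' => w j' | inr b => if b == 0 then c else - c end).
split; first by move=> j; case: fintype.split => // b; case: eqP.
have sl (j : 'I_k) : fintype.split (lshift 2 j) = inl j.
 by case: splitP => [j' /= e|j' /= e]; [congr inl; exact: val_inj|have := ltn_ord j; rewrite e ltnNge leq_addr].
have sr (j : 'I_2) : fintype.split (rshift k j) = inr j.
 case: splitP => [j' /= e|j' /= /addnI e]; last by congr inr; exact: val_inj.
 by have := ltn_ord j'; rewrite -e ltnNge leq_addr.
split.
 rewrite big_split_ord /=; under eq_bigr do rewrite sl; under [X in _ + X]eq_bigr do rewrite sr.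
 by rewrite w1 !big_ord_recl big_ord0 /= addr0 subrr addr0.
rewrite big_split_ord /=; under [X in _ = X + _]eq_bigr do rewrite sl.
under [X in _ = _ + X]eq_bigr do rewrite sr.
by rewrite !big_ord_recl big_ord0 /= addr0 scaleNr scalerBr.
Qed.

Lemma aff_hull_in S y : S y -> aff_hull S y.
Proof.
by move=> Sy; exists 1%N, (fun=> y), (fun=> 1); split=> //; split; rewrite big_ord1 ?scale1r.
Qed.

Lemma rpair_bound c x : `|rpair c x| <= (\sum_i `|c i|) * `|x|.
Proof.
rewrite mulr_suml; apply: le_trans (ler_norm_sum _ _ _) _; apply: ler_sum => i _.
by rewrite normrM ler_wpM2l // coord_norm.
Qed.

(* The normal vectors tight at the diagonal point add up to one that defines the principal face. *)
Lemma principal_face_spec : is_face P tau /\ relint tau (diag n d).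
Proof.
apply: (ClassicalEpsilon.epsilon_spec (inhabits set0) (fun t => is_face P t /\ relint t (diag n d))).
pose tight (p : mindex n * nat) := p.2%:R == rpair (nr R p.1) (diag n d).
pose a i : int := \sum_(p <- G | tight p) (p.1 i)%:Z.
pose l : int := \sum_(p <- G | tight p) p.2%:Z.
have aE x : ipair a x = \sum_(p <- G | tight p) rpair (nr R p.1) x.
 rewrite /ipair /rpair exchange_big /=; apply: eq_bigr => i _.
 by rewrite raddf_sum /= mulr_suml; by [].
have lE : l%:~R = \sum_(p <- G | tight p) p.2%:R :> R by rewrite raddf_sum.
have va : valid_pair P a l.
 move=> x Px; rewrite /Hhalf /= aE lE big_seq_cond [leRHS]big_seq_cond.
 by apply: ler_sum => p /andP[pG _]; exact: newton_G.
exists (P `&` Hplane a l); split; first by exists a, l.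
have Sd : (P `&` Hplane a l) (diag n d).
 split; first exact: dist_mem.
 by rewrite /Hplane /= aE lE; apply: eq_bigr => p /eqP ->.
split=> //.
have tp x p : (P `&` Hplane a l) x -> p \in G -> tight p -> rpair (nr R p.1) x = p.2%:R.
 move=> [Px]; rewrite /Hplane /= aE lE => /eqP; rewrite -subr_eq0 -sumrB.
 rewrite big_seq_cond psumr_eq0; last first.
  by move=> q /andP[qG _]; rewrite subr_ge0; exact: newton_G.
 by move=> /allP h pG ptt; have := h p pG; rewrite pG ptt /= subr_eq0 => /eqP.
pose gap (p : mindex n * nat) : R := (rpair (nr R p.1) (diag n d) - p.2%:R) / ((\sum_i `|nr R p.1 i|) + 1).
have S1 (p : mindex n * nat) : 0 < (\sum_i `|nr R p.1 i|) + 1 by rewrite ltr_wpDl // sumr_ge0.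
have [r /mapP[p]|e e0 eG] := @seq_lb R [seq gap p | p <- G & ~~ tight p].
 rewrite mem_filter => /andP[npt pG] ->; rewrite divr_gt0 // subr_gt0 lt_neqAle npt /=.
 by apply: newton_G => //; exact: dist_mem.
exists e => // y yaff ye.
have yt p : p \in G -> tight p -> rpair (nr R p.1) y = p.2%:R.
 move=> pG ptt; have [k [q [w [qS [w1 ->]]]]] := yaff; rewrite rpair_lin.
 by under eq_bigr do rewrite (tp _ _ (qS _) pG ptt); rewrite -mulr_suml w1 mul1r.
split; last first.
 rewrite /Hplane /= aE lE big_seq_cond [RHS]big_seq_cond.
 by apply: eq_bigr => p /andP[pG]; exact: yt.
apply: (gen_ineq NG) => p pG; have [ptt|npt] := boolP (tight p); first by rewrite yt.
have h := eG (gap p) (map_f _ _); rewrite mem_filter npt pG in h; have {}h := h isT.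
have : `|rpair (nr R p.1) (y - diag n d)| <= rpair (nr R p.1) (diag n d) - p.2%:R.
 apply: le_trans (rpair_bound _ _) _.
 move: h; rewrite ler_pdivlMr // => h; apply: le_trans h.
 by rewrite mulrC; apply: ler_pM => //; [exact: sumr_ge0|exact: ltW|rewrite lerDl].
have -> : rpair (nr R p.1) y = rpair (nr R p.1) (diag n d) + rpair (nr R p.1) (y - diag n d).
 by rewrite -rpairD addrC subrK.
by rewrite ler_norml => /andP[h1 _]; lra.
Qed.

Lemma tau_diag : tau (diag n d). Proof. by have [_ []] := principal_face_spec. Qed.

(** A negative a_i is refuted at the diagonal point moved along e_i, which stays in the polyhedron;
    the level is then a sum of nonnegative terms. *)
Lemma principal_normal : exists a : mindex n, exists l : nat, defines_face P (natv a) l%:Z tau.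
Proof.
have [[a [l [va ta]]] _] := principal_face_spec.
have dt : ipair a (diag n d) = l%:~R by have := tau_diag; rewrite -ta => -[].
have aD x y : ipair a (x + y) = ipair a x + ipair a y := rpairD _ x y.
have a0 i : 0 <= a i.
 rewrite -(ler0z R) leNgt; apply/negP => ai.
 have : P (diag n d + evec R i).
  apply: newton_up dist_mem _ => j; rewrite /coord !mxE lerDl.
  by [].
 move=> /va; rewrite /Hhalf /= aD dt (_ : ipair a (evec R i) = (a i)%:~R); last exact: (rpair_evec (fun i => (a i)%:~R)).
 lra.
have l0 : 0 <= l.
 rewrite -(ler0z R) -dt; apply: sumr_ge0 => i _.
 by rewrite /coord mxE mulr_ge0 ?ler0z // ltW // dist_gt0.
exists [ffun i => `|a i|%N], `|l|%N.
have -> : natv [ffun i => `|a i|%N] = a.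
 by apply/funext => i; rewrite /natv ffunE gez0_abs.
by rewrite gez0_abs //; split.
Qed.

Lemma aff_dim : exists p0 (p : 'I_(dim_set tau) -> V), [/\ tau p0, forall j, tau (p j),
 row_free (\matrix_(j < dim_set tau) (p j - p0)) &
 forall q, tau q -> (q - p0 <= \matrix_(j < dim_set tau) (p j - p0))%MS].
Proof.
have a0 : aff_indep tau 0.
 exists (diag n d), (fun=> 0); split; first exact: tau_diag.
 by split=> [[]//|]; rewrite /row_free flatmx0 mxrank0.
have mx k : (k < n.+1)%N -> aff_indep tau k -> (k <= dim_set tau)%N.
 move=> kn ak; rewrite /dim_set (bigD1 (Ordinal kn)) /=; last exact/asboolP.
 exact: leq_maxl.
have [k kP ke] : exists2 k : 'I_n.+1, `[< aff_indep tau k >] & dim_set tau = k.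
 have c0 : (0 < #|(fun k : 'I_n.+1 => `[< aff_indep tau k >])|)%N.
  by apply/card_gt0P; exists ord0; apply/asboolP.
 by have [k kP ke] := eq_bigmax_cond (fun k : 'I_n.+1 => k : nat) c0; exists k.
have {kP} : aff_indep tau (dim_set tau) by rewrite ke; exact/asboolP.
move=> [p0 [p [tp0 [tp pf]]]]; exists p0, p; split=> // q tq.
apply: contrapT => nq.
set D := dim_set tau in p pf tp nq *.
pose p' (j : 'I_D.+1) := if insub (val j) is Some j' then p j' else q.
have p'w j : p' (widen_ord (leqnSn D) j) = p j.
 by rewrite /p'; case: insubP => [j' _ e|]; [congr p; exact: val_inj|rewrite /= ltn_ord].
have p'm : p' ord_max = q by rewrite /p' insubF //= ltnn.
have rf : row_free (\matrix_(j < D.+1) (p' j - p0)).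
 apply: inj_row_free => v; rewrite mulmx_sum_row big_ord_recr /=.
 rewrite rowK p'm; under eq_bigr do rewrite rowK p'w.
 have e : \sum_(j < D) v ord0 (widen_ord (leqnSn D) j) *: (p j - p0) =
   (\row_j v ord0 (widen_ord (leqnSn D) j)) *m (\matrix_(j < D) (p j - p0)).
  by rewrite mulmx_sum_row; apply: eq_bigr => j _; rewrite rowK mxE.
 rewrite e; case: (eqVneq (v ord0 ord_max) 0) => [v0|v0].
  rewrite v0 scale0r addr0 => /eqP; rewrite mulmx_free_eq0 // => /eqP/rowP h.
  apply/rowP => j; rewrite [RHS]mxE; case: (unliftP ord_max j) => [j' ->|->] //.
  by have := h j'; rewrite !mxE => <-; congr (v _ _); apply: val_inj; rewrite /= /bump leqNgt ltn_ord.
 move=> /eqP; rewrite addrC addr_eq0 => /eqP h; case: nq.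
 rewrite -[q - p0](scalerK v0) scalemx_sub //.
 by rewrite h -mulNmx submxMl.
have Dn : (D.+1 < n.+1)%N by move: rf; rewrite /row_free => /eqP <-; rewrite ltnS rank_leq_col.
have : (D.+1 <= D)%N by apply: mx => //; exists p0, p'; split=> //; split=> // j; rewrite /p'; case: insubP.
by rewrite ltnn.
Qed.

(** This is how the relative interior enters: valid inequalities can be tested on both sides of the
    diagonal point, as in [gap_u]. *)
Lemma aff_move (k : nat) (q q' : 'I_k -> V) (c : 'I_k -> R) :
 (forall j, tau (q j)) -> (forall j, tau (q' j)) ->
 exists2 e : R, 0 < e & forall t, `|t| <= e -> P (diag n d + t *: \sum_j c j *: (q j - q' j)).
Proof.
move=> tq tq'; have [[a [l [va ta]]] [td [r r0 hr]]] := principal_face_spec.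
set S := \sum_j _.
exists (r / (`|S| + 1) / 2); first pos.
move=> t te; have : tau (diag n d + t *: S).
 apply: hr.
  rewrite /S scaler_sumr.
  elim: (index_enum _) => [|j s ih]; first by rewrite big_nil addr0; exact: aff_hull_in.
  by rewrite big_cons addrCA addrC scalerA; apply: aff_hull_sub.
 rewrite addrC addKr normrZ; apply: le_lt_trans (ler_wpM2r _ te) _ => //.
 rewrite mulrAC ltr_pdivrMr // mulrAC ltr_pdivrMr ?ltr_wpDl //.
 by have := normr_ge0 S; nra.
by rewrite -ta => -[].
Qed.

(** The rows of [u] span the directions of the principal face, [pd_free] adds that the diagonal is
    transversal to it, and [e] is a step that can be taken both ways from the diagonal point. *)
Record pdata (u : 'M[R]_(dim_set tau, n)) (a : mindex n) (l : nat) (e : R) : Prop := PData {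
 pd_face : defines_face P (natv a) l%:Z tau;
 pd_egt0 : 0 < e;
 pd_move : forall r, P (diag n d + e *: row r u) /\ P (diag n d - e *: row r u);
 pd_free : row_free (col_mx u (const_mx 1 : 'rV_n));
 pd_span : forall q, tau q -> (q - diag n d <= u)%MS }.

Lemma principal_data : exists u a l e, pdata u a l e.
Proof.
have [p0 [p [tp0 tp pf ps]]] := aff_dim; have [a [l al]] := principal_normal.
pose u := \matrix_(j < dim_set tau) (p j - p0).
have mv r : exists e : R, 0 < e /\ forall t, `|t| <= e -> P (diag n d + t *: row r u).
 have [e e0 he] := aff_move (q := fun j : 'I_1 => p r) (q' := fun=> p0) (fun=> 1) (fun=> tp r) (fun=> tp0).
 by exists e; split=> // t te; have := he t te; rewrite big_ord1 scale1r rowK.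
have /choice[E hE] := mv.
have [r /mapP[j _ ->]|e e0 eE] := @seq_lb R [seq E j | j : 'I_(dim_set tau)]; first by case: (hE j).
exists u, a, l, e; split=> // [r||q tq].
- have er : e <= E r by apply: eE; apply: map_f; rewrite mem_enum.
 have [_ h] := hE r; rewrite -scaleNr; split; apply: h.
  by rewrite gtr0_norm.
 by rewrite normrN gtr0_norm.
- apply: inj_row_free => v; rewrite -[v]hsubmxK mul_row_col.
 set v1 := lsubmx v; set v2 := rsubmx v; rewrite [v2]mx11_scalar mul_scalar_mx.
 case: (eqVneq (v2 0 0) 0) => [->|c0].
  rewrite scale0r addr0 => /eqP; rewrite mulmx_free_eq0 // => /eqP ->.
  by rewrite raddf0 row_mx0.
 (* Were (1, ..., 1) a direction of the face, one could move down the diagonal inside the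
    polyhedron, against the minimality of d. *)
 move=> h; have [e' e'0 he'] := aff_move (fun j => - (v2 0 0)^-1 * v1 0 j) tp (fun=> tp0).
 have := he' (- e'); rewrite normrN gtr0_norm // lexx => /(_ isT).
 rewrite (_ : \sum_j _ = const_mx 1).
  rewrite (_ : _ + _ = diag n (d - e')) => [/dist_min|].
   by rewrite lerDl oppr_ge0 leNgt e'0.
  by apply: coordP => i; rewrite /coord !mxE mulr1.
 have {}h : (const_mx 1 : 'rV_n) = - (v2 0 0)^-1 *: (v1 *m u).
  move/eqP: h; rewrite addrC addr_eq0 => /eqP h.
  by rewrite scaleNr -scalerN -h scalerA mulVf // scale1r.
 rewrite h mulmx_sum_row scaler_sumr; apply: eq_bigr => j _.
 by rewrite scalerA rowK.
- rewrite (_ : _ - _ = (q - p0) - (diag n d - p0)); last by rewrite opprB addrA subrK.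
 by rewrite addmx_sub ?eqmx_opp ?ps //; exact: tau_diag.
Qed.

Section Consequences.
Variables (u : 'M[R]_(dim_set tau, n)) (a : mindex n) (l : nat) (e : R).
Hypothesis pdu : pdata u a l e.

Lemma dim_lt : (dim_set tau < n)%N.
Proof.
have := pd_free pdu; rewrite /row_free => /eqP h.
by have := rank_leq_col (col_mx u (const_mx 1 : 'rV_n)); rewrite h addn1.
Qed.

(** Testing the functional at the diagonal point moved by e u_r and by -e u_r bounds its value on
    u_r by its slack at the diagonal point. *)
Lemma gap_u (c : 'I_n -> R) L r : (forall i, 0 <= c i) ->
 (forall v, v \in A -> L <= rpair c (mpoint R v)) ->
 e * `|rpair c (row r u)| <= (\sum_i c i) * d - L.
Proof.
move=> c0 cA; have [h1 h2] := pd_move pdu r; have e0 := pd_egt0 pdu.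
have := newton_valid (gen_dom NG) c0 cA h1; rewrite rpairD rpairZ rpair_diag => h3.
have := newton_valid (gen_dom NG) c0 cA h2; rewrite -scaleNr rpairD rpairZ rpair_diag => h4.
rewrite -(gtr0_norm e0) -normrM ler_norml; lra.
Qed.

Lemma normal_A v : v \in A -> (l <= npair a v)%N.
Proof.
move=> vA; have [va _] := pd_face pdu; have := va _ (newton_mem (gen_coef NG) vA).
by rewrite /Hhalf /= ipair_natv rpair_nr ler_nat.
Qed.

Lemma normal_d : (\sum_i nr R a i) * d = l%:R.
Proof.
have [_ ta] := pd_face pdu; have := tau_diag; rewrite -ta => -[_].
by rewrite /Hplane /= ipair_natv rpair_diag.
Qed.

Lemma normal_span v : v \in A -> npair a v = l -> (mpoint R v - diag n d <= u)%MS.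
Proof.
move=> vA vl; apply: (pd_span pdu); have [_ <-] := pd_face pdu.
by split; [exact: (newton_mem (gen_coef NG) vA)|rewrite /Hplane /= ipair_natv rpair_nr vl].
Qed.

(** The polyhedron is stable under adding e_i, and a functional with a_i = 0 does not see the move,
    so the moved diagonal point is still on the face. *)
Lemma normal_evec i : a i = 0%N -> (evec R i <= u)%MS.
Proof.
move=> ai; rewrite -[evec R i](addrK (diag n d)) [evec R i + _]addrC; apply: (pd_span pdu).
have [_ <-] := pd_face pdu; split.
 apply: newton_up dist_mem _ => j; rewrite /coord !mxE lerDl.
 by [].
rewrite /Hplane /= ipair_natv rpairD rpair_diag normal_d rpair_evec /nr ai addr0.
by [].
Qed.

Lemma normal_u r : rpair (nr R a) (row r u) = 0.
Proof.
have e0 := pd_egt0 pdu.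
have h := gap_u (c := nr R a) (L := l%:R) r _ _; rewrite normal_d subrr in h.
have : e * `|rpair (nr R a) (row r u)| <= 0.
 by apply: h => [i|v vA]; rewrite /nr ?ler0n // rpair_nr ler_nat normal_A.
by rewrite pmulr_rle0 // normr_le0 => /eqP.
Qed.

(** If a = 0, every e_i is a direction of the face, hence so is (1, ..., 1), against [pd_free]. *)
Lemma normal_gt0 : (0 < \sum_i a i)%N.
Proof.
case: (posnP (\sum_i a i)) => // /eqP; rewrite sum_nat_eq0 => /forallP a0.
have h1 : ((const_mx 1 : 'rV_n) <= u)%MS.
 rewrite (_ : const_mx 1 = \sum_i evec R i).
  by apply: summx_sub => i _; apply: normal_evec; exact/eqP/(a0 i).
 apply: coordP => j; rewrite /coord summxE mxE (bigD1 j) //= mxE !eqxx big1 ?addr0 // => i.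
 by rewrite mxE eq_sym => /negbTE ->; by [].
have := pd_free pdu; rewrite /row_free -addsmxE.
rewrite (addsmx_idPl h1) => /eqP h2.
by have := rank_leq_row u; rewrite h2 addn1 ltnn.
Qed.

Local Notation W := (col_mx u (const_mx 1 : 'rV_n))^T.
(** A basis of the vectors orthogonal to the face directions and to (1, ..., 1). Adding them to the
    normal [a] changes neither its values on the face nor the sum of its entries; there are m(f) - 1
    of them, the source of the logarithms in the lower bound. *)
Definition cmx := row_base (kermx W).

Lemma cmx_free : row_free cmx. Proof. exact: row_base_free. Qed.

Lemma cmx_rank : \rank (kermx W) = (n - (dim_set tau).+1)%N.
Proof. by rewrite mxrank_ker mxrank_tr (eqP (pd_free pdu : _ == _)) addn1. Qed.

Lemma mul_perp k (c : 'M[R]_(k, n)) : c *m W = 0 -> c *m u^T = 0 /\ c *m (const_mx 1 : 'rV_n)^T = 0.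
Proof. by rewrite tr_col_mx mul_mx_row -[RHS]row_mx0 => /eq_row_mx. Qed.

Lemma cmx_perp r q : (q <= u)%MS -> rpair (fun i => cmx r i) q = 0.
Proof.
move=> /submxP[w ->].
have : cmx *m W = 0 by apply/sub_kermxP; rewrite eq_row_base.
move=> /mul_perp[h _].
have : (cmx *m (w *m u)^T) r 0 = 0 by rewrite trmx_mul mulmxA h mul0mx mxE.
rewrite mxE => h'; rewrite -[RHS]h'; apply: eq_bigr => i _.
by congr (_ * _); rewrite [RHS]mxE.
Qed.

Lemma cmx_sum r : \sum_i cmx r i = 0.
Proof.
have : cmx *m W = 0 by apply/sub_kermxP; rewrite eq_row_base.
move=> /mul_perp[_ h].
have : (cmx *m (const_mx 1 : 'rV[R]_n)^T) r 0 = 0 by rewrite h mxE.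
by rewrite mxE => h'; rewrite -[RHS]h'; apply: eq_bigr => i _; rewrite !mxE mulr1.
Qed.

Lemma normal_perturb : exists2 eta : R, 0 < eta & forall s : 'I_(\rank (kermx W)) -> R,
 (forall r, `|s r| <= eta) ->
 (forall i, 0 <= (a i)%:R + \sum_r s r * cmx r i) /\
 forall v, v \in A -> l%:R <= rpair (fun i => (a i)%:R + \sum_r s r * cmx r i) (mpoint R v).
Proof.
pose C := 1 + \sum_r (\sum_i `|cmx r i| + \sum_(v <- A) `|rpair (fun i => cmx r i) (mpoint R v - diag n d)|).
have C0 : 0 < C by rewrite /C ltr_wpDr // sumr_ge0 // => r _; rewrite addr_ge0 // sumr_ge0.
have bnd (F : 'I_(\rank (kermx W)) -> R) s : (forall r, `|s r| <= C^-1) ->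
  \sum_r `|F r| <= C -> - 1 <= \sum_r s r * F r.
 move=> hs hF; have : `|\sum_r s r * F r| <= 1; last by rewrite ler_norml => /andP[].
 apply: le_trans (ler_norm_sum _ _ _) _; apply: (@le_trans _ _ (\sum_r C^-1 * `|F r|)).
  by apply: ler_sum => r _; rewrite normrM ler_wpM2r.
 by rewrite -mulr_sumr mulrC ler_pdivrMr // mul1r.
exists C^-1; first pos.
move=> s hs; split=> [i|v vA].
 have [ai|ai] := posnP (a i).
  rewrite ai add0r big1 // => r _; have := cmx_perp r (normal_evec ai).
  by rewrite rpair_evec => ->; lra.
 apply: (@le_trans _ _ (1 - 1)); first by [].
 apply: lerD; first by rewrite ler1n.
 apply: bnd => //.
 rewrite /C -[leLHS]add0r lerD // ler_sum // => r _.
 by rewrite (bigD1 i) //= -addrA lerDl addr_ge0 // ?sumr_ge0.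
have lin (q : V) : rpair (fun i => (a i)%:R + \sum_r s r * cmx r i) q =
  rpair (nr R a) q + \sum_r s r * rpair (fun i => cmx r i) q.
 rewrite /rpair; under [X in _ + X]eq_bigr do rewrite mulr_sumr.
 rewrite exchange_big /= -big_split /=; apply: eq_bigr => i _.
 rewrite mulrDl; congr (_ + _); rewrite mulr_suml; apply: eq_bigr => r _; ring.
have eqv : rpair (fun i => (a i)%:R + \sum_r s r * cmx r i) (mpoint R v) =
  (npair a v)%:R + \sum_r s r * rpair (fun i => cmx r i) (mpoint R v - diag n d).
 rewrite lin rpair_nr; congr (_ + _); apply: eq_bigr => r _; congr (_ * _).
 by rewrite rpairD -scaleN1r rpairZ rpair_diag cmx_sum mul0r mulr0 addr0.
rewrite eqv; case: (ltngtP l (npair a v)) (normal_A vA) => // [lv _|lv _].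
 apply: (@le_trans _ _ (l.+1%:R - 1)); first lra.
 apply: lerD; first by rewrite ler_nat.
 apply: bnd => //.
 rewrite /C -[leLHS]add0r lerD // ler_sum // => r _.
 by rewrite -[leLHS]add0r lerD ?sumr_ge0 // (big_rem v) //= lerDl sumr_ge0.
rewrite -lv big1 ?addr0 // => r _; rewrite cmx_perp ?mulr0 //.
exact: normal_span.
Qed.

End Consequences.
End PrincipalFace.

(** * Exponential sums over lattice boxes *)

Section Sums.
Variables (R : realType) (n : nat).

(* Telescoping against the logistic function. *)
Lemma exp_dist_sum (c : R) : 0 < c -> exists2 C : R, 0 < C &
 forall N (w : R), \sum_(k < N) expR (- c * `|k%:R - w|) <= C.
Proof.
move=> c0; pose q := expR (- c).
have q0 : 0 < q by exact: expR_gt0.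
have q1 : 0 < 1 - q by rewrite subr_gt0 /q -[ltRHS]expR0 ltr_expR oppr_lt0.
pose s (x : R) := (1 + expR (- c * x))^-1.
have s0 x : 0 < s x by rewrite invr_gt0 addr_gt0 //.
have s1 x : s x <= 1 by rewrite invf_le1 ?addr_gt0 // lerDl expR_ge0.
have key x : expR (- c * `|x|) <= 4 / (1 - q) * (s (x + 1) - s x).
 set y := expR (- c * x); have y0 : 0 < y by exact: expR_gt0.
 have ey : expR (- c * (x + 1)) = q * y by rewrite mulrDr mulr1 expRD mulrC.
 have -> : s (x + 1) - s x = y * (1 - q) / ((1 + y) * (1 + q * y)).
  by rewrite /s ey -/y; field; nra.
 have -> : 4 / (1 - q) * (y * (1 - q) / ((1 + y) * (1 + q * y))) = 4 * y / ((1 + y) * (1 + q * y)).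
  by field; nra.
 have qy : 0 < q * y by rewrite mulr_gt0.
 have q1' : q < 1 by rewrite -subr_gt0.
 rewrite ler_pdivlMr ?mulr_gt0 ?addr_gt0 //.
 case: (lerP 0 x) => x0.
  rewrite ger0_norm // -/y.
  have y1 : y <= 1 by rewrite /y -expR0 ler_expR mulNr oppr_le0 mulr_ge0 // ltW.
  have h : (1 + y) * (1 + q * y) <= 4 by nra.
  nra.
 rewrite ltr0_norm // mulrN (expRN (- c * x)) -/y.
 have y1 : 1 <= y by rewrite /y -expR0 ler_expR mulr_le0 // ?oppr_le0 ltW.
 rewrite mulrC ler_pdivrMr //; nra.
exists (4 / (1 - q)); first pos.
move=> N w; suff h : \sum_(k < N) expR (- c * `|k%:R - w|) <= 4 / (1 - q) * (s (N%:R - w) - s (- w)).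
 apply: le_trans h _; rewrite ler_piMr ?divr_ge0 ?(ltW q1) //.
 by rewrite lerBlDr; apply: le_trans (s1 _) _; rewrite lerDl ltW.
elim: N => [|N ih]; first by rewrite big_ord0 sub0r subrr mulr0.
rewrite big_ord_recr /=; apply: le_trans (lerD ih (key (N%:R - w))) _.
rewrite -mulrDr (_ : N%:R - w + 1 = N.+1%:R - w); last by rewrite -natr1; ring.
lra.
Qed.

(** Each coordinate in [J] runs over a convergent sum whose centre depends only on the coordinates
    off [J]; those run freely and give the power of K + 1. *)
Lemma sum_off (c : R) (J : {set 'I_n}) : 0 < c -> exists2 C : R, 0 < C &
 forall K (om : {ffun 'I_n -> 'I_K.+1} -> 'I_n -> R),
 (forall k k' : {ffun 'I_n -> 'I_K.+1}, (forall j, j \notin J -> k j = k' j) -> om k = om k') ->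
 \sum_(k : {ffun 'I_n -> 'I_K.+1}) \prod_(j in J) expR (- c * `|(k j)%:R - om k j|)
  <= C * K.+1%:R ^+ (n - #|J|).
Proof.
move=> c0; have [C C0 hC] := exp_dist_sum c0; exists (C ^+ #|J|); first pos.
move=> K om omJ.
pose r (k : {ffun 'I_n -> 'I_K.+1}) : {ffun 'I_n -> 'I_K.+1} := [ffun j => if j \in J then ord0 else k j].
have omr k : om k = om (r k) by apply: omJ => j nj; rewrite ffunE (negbTE nj).
have rr k : r (r k) = r k by apply/ffunP => j; rewrite !ffunE; case: (j \in J).
rewrite (partition_big r (fun b => r b == b)) /=; last by move=> k _; rewrite rr.
have inner b : \sum_(k | r k == b) \prod_(j in J) expR (- c * `|(k j)%:R - om k j|) <= C ^+ #|J|.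
 pose F (j : 'I_n) (t : 'I_K.+1) : R :=
  if j \in J then expR (- c * `|t%:R - om b j|) else (t == b j)%:R.
 have F0 j t : 0 <= F j t by rewrite /F; case: ifP => _; [exact: expR_ge0|exact: ler0n].
 apply: (@le_trans _ _ (\sum_(k : {ffun 'I_n -> 'I_K.+1}) \prod_j F j (k j))).
  rewrite [leRHS](bigID (fun k => r k == b)) /= -[leLHS]addr0; apply: lerD.
   apply: ler_sum => k /eqP kb; rewrite big_mkcond /=; apply: ler_prod => j _.
   rewrite (omr k) kb /F; case jJ : (j \in J); first by rewrite expR_ge0 lexx.
   have -> : b j = k j by rewrite -kb /r ffunE jJ.
   by rewrite eqxx ler01 /=.
  by apply: sumr_ge0 => k _; apply: prodr_ge0.
 rewrite -(bigA_distr_bigA F) /=.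
 rewrite (_ : C ^+ #|J| = \prod_(j : 'I_n) (if j \in J then C else 1)).
  apply: ler_prod => j _; rewrite sumr_ge0 //= /F; case: ifP => _; first exact: hC.
  by rewrite (bigD1 (b j)) //= eqxx big1 ?addr0 // => t /negbTE ->.
 by rewrite -big_mkcond prodr_const.
apply: (@le_trans _ _ (\sum_(b | r b == b) C ^+ #|J|)); first exact: ler_sum.
rewrite sumr_const -[leLHS]mulr_natr ler_wpM2l ?exprn_ge0 ?(ltW C0) //.
rewrite (_ : #|_|%:R = \sum_(b : {ffun 'I_n -> 'I_K.+1} | r b == b) 1); last by rewrite sumr_const.
pose H (j : 'I_n) (t : 'I_K.+1) : R := if j \in J then (t == ord0)%:R else 1.
have H0 j t : 0 <= H j t by rewrite /H; case: ifP => _; [exact: ler0n|exact: ler01].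
apply: (@le_trans _ _ (\sum_(k : {ffun 'I_n -> 'I_K.+1}) \prod_j H j (k j))).
 rewrite [leRHS](bigID (fun k => r k == k)) /= -[leLHS]addr0; apply: lerD.
  apply: ler_sum => k /eqP kb; rewrite big1 // => j _; rewrite /H; case: ifP => // jJ.
  by rewrite -kb ffunE jJ eqxx.
 by apply: sumr_ge0 => k _; apply: prodr_ge0.
rewrite -(bigA_distr_bigA H) /=.
rewrite (_ : (n - #|J|)%N = #|~: J|); last by rewrite -{1}(card_ord n) -(cardsC J) addKn.
rewrite (_ : K.+1%:R ^+ #|~: J| = \prod_(j : 'I_n) (if j \in ~: J then K.+1%:R else 1)).
 apply: ler_prod => j _; rewrite sumr_ge0 //= inE /H; case: (j \in J) => /=.
  by rewrite (bigD1 ord0) //= big1 ?addr0 // => t /negbTE ->.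
 by rewrite sumr_const card_ord.
by rewrite -big_mkcond prodr_const.
Qed.

Definition kW r (W : 'M[R]_(n, r)) (k : 'I_n -> nat) (s : 'I_r) : R := \sum_i (k i)%:R * W i s.

(** Choose r rows of W that form an invertible block: with the other k_i fixed, the values of the r
    forms determine these r coordinates up to a proportional error, and [sum_off] applies. *)
Lemma sum_linear r (W : 'M[R]_(n, r)) (c : R) : row_full W -> 0 < c -> exists2 C : R, 0 < C &
 forall K (tau : 'I_r -> R),
 \sum_(k : {ffun 'I_n -> 'I_K.+1}) expR (- c * \sum_s `|kW W (fun i => k i) s - tau s|)
  <= C * K.+1%:R ^+ (n - r).
Proof.
move=> fW c0; pose f0 := fullrankfun fW.
have f0i : injective f0 by exact: fullrankfun_inj.
pose B := rowsub f0 W.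
have uB : B \in unitmx by exact: fullrowsub_unit.
pose M := \sum_s \sum_t `|invmx B s t|.
have M0 : 0 <= M by apply: sumr_ge0 => s _; exact: sumr_ge0.
pose c' := c / (r%:R * M + 1).
have rM : 0 < r%:R * M + 1 by rewrite ltr_wpDl // mulr_ge0.
have c'0 : 0 < c' by rewrite divr_gt0.
pose J := [set f0 t | t : 'I_r].
have cJ : #|J| = r by rewrite card_imset // card_ord.
have [C C0 hC] := sum_off J c'0; exists C => // K tau.
pose off (k : {ffun 'I_n -> 'I_K.+1}) : 'rV[R]_r :=
 \row_s (tau s - \sum_(i | i \notin J) (k i)%:R * W i s).
(* The real values of the chosen coordinates at which the r forms equal [tau] exactly. *)
pose om (k : {ffun 'I_n -> 'I_K.+1}) (j : 'I_n) : R :=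
 \sum_(t | f0 t == j) (off k *m invmx B) 0 t.
have omE k t : om k (f0 t) = (off k *m invmx B) 0 t.
 by rewrite /om (big_pred1 t) // => t'; rewrite /= (inj_eq f0i).
have := hC K om; rewrite cJ => /(_ _) h; apply: le_trans (h _) => {h}; last first.
 move=> k k' kk; apply/funext => j; apply: eq_bigr => t _; congr ((_ *m _) _ _).
 apply/rowP => s; rewrite !mxE; congr (_ - _); apply: eq_bigr => i iJ; by rewrite kk.
apply: ler_sum => k _; rewrite -expR_sum ler_expR -mulr_sumr.
rewrite mulNr mulNr lerN2 big_imset /=; last by move=> ? ? _ _; exact: f0i.
set S := \sum_s `|kW W (fun i => k i) s - tau s|.
have dif t : (k (f0 t))%:R - om k (f0 t) = \sum_s (kW W (fun i => k i) s - tau s) * invmx B s t.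
 have e : \row_t (k (f0 t))%:R *m B = \row_s (kW W (fun i => k i) s - \sum_(i | i \notin J) (k i)%:R * W i s).
  apply/rowP => s; rewrite !mxE /kW [X in _ = X - _](bigID (mem J)) /= addrK.
  rewrite big_imset /=; last by move=> ? ? _ _; exact: f0i.
  by apply: eq_bigr => t' _; rewrite !mxE.
 have e2 : (k (f0 t))%:R = (\row_t (k (f0 t))%:R *m B *m invmx B) 0 t :> R.
  by rewrite mulmxK // mxE.
 rewrite omE e2 e !mxE -sumrB; apply: eq_bigr => s _; rewrite !mxE; ring.
have bd t : `|(k (f0 t))%:R - om k (f0 t)| <= S * M.
 rewrite dif; apply: le_trans (ler_norm_sum _ _ _) _; rewrite mulr_suml; apply: ler_sum => s _.
 rewrite normrM ler_wpM2l // /M (bigD1 s) //= (bigD1 t) //= -addrA lerDl addr_ge0 ?sumr_ge0 //.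
 by move=> s' _; pos.
have S0 : 0 <= S by apply: sumr_ge0.
apply: (@le_trans _ _ (c' * \sum_(t < r) (S * M))).
 by apply: ler_wpM2l; [exact: ltW|apply: ler_sum].
rewrite sumr_const card_ord -mulr_natr /c'.
have -> : c / (r%:R * M + 1) * (S * M * r%:R) = c * S * (r%:R * M / (r%:R * M + 1)).
 lra.
rewrite ler_piMr ?mulr_ge0 ?(ltW c0) // ler_pdivrMr // mul1r lerDl //.
Qed.

End Sums.

(** * Covering the unit box by logarithmic boxes *)

Section Boxes.
Variables (R : realType) (n : nat).
Local Notation V := 'rV[R]_n.
Implicit Types (x : V) (u : V -> R).

Lemma LC_sumF (I : finType) (P : pred I) K s (h : I -> V -> R) (a : I -> R) :
 (forall k, LC K s (h k)) -> LC K s (fun x => \sum_(k | P k) a k * h k x).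
Proof.
move=> lh; elim: (index_enum I) => [|k r ih].
 rewrite (_ : (fun x => _) = (fun=> 0)); last by apply/funext => x; rewrite big_nil.
 by split=> //; exists 0 => x y; rewrite subrr normr0 mul0r.
case Pk : (P k).
 rewrite (_ : (fun x => _) = (fun x => a k * h k x + 1 * \sum_(k <- r | P k) a k * h k x)).
  exact: LC_lin.
 by apply/funext => x; rewrite big_cons Pk mul1r.
rewrite (_ : (fun x => _) = (fun x => \sum_(k <- r | P k) a k * h k x)) //.
by apply/funext => x; rewrite big_cons Pk.
Qed.

Lemma int_Rn0 : int_Rn (fun _ : V => 0) = 0.
Proof. by rewrite int_RnE; rewrite Ifold0. Qed.

Lemma int_Rn_sumF (I : finType) (P : pred I) K (h : I -> V -> R) (a : I -> R) : 0 <= K ->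
 (forall k, LC K [::] (h k)) ->
 int_Rn (fun x => \sum_(k | P k) a k * h k x) = \sum_(k | P k) a k * int_Rn (h k).
Proof.
move=> K0 lh.
have H (r : seq I) : LC K [::] (fun x => \sum_(k <- r | P k) a k * h k x) /\
  int_Rn (fun x => \sum_(k <- r | P k) a k * h k x) = \sum_(k <- r | P k) a k * int_Rn (h k).
 elim: r => [|k r [ih1 ih2]].
  rewrite (_ : (fun x => _) = (fun=> 0)); last by apply/funext => x; rewrite big_nil.
  split; last by rewrite int_Rn0 big_nil.
  by split=> //; exists 0 => x y; rewrite subrr normr0 mul0r.
 case Pk : (P k).
  rewrite (_ : (fun x => _) = (fun x => a k * h k x + 1 * \sum_(k <- r | P k) a k * h k x)).
   by split; [exact: LC_lin|rewrite (int_Rn_lin K0) // ih2 big_cons Pk mul1r].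
  by apply/funext => x; rewrite big_cons Pk mul1r.
 rewrite (_ : (fun x => _) = (fun x => \sum_(k <- r | P k) a k * h k x)).
  by rewrite big_cons Pk.
 by apply/funext => x; rewrite big_cons Pk.
by have [] := H (index_enum I).
Qed.

(** Piecewise linear cutoffs are enough, since integrands only need to be Lipschitz. The scale is e
    rather than 2, so that sizes are exponentials of integers. *)
Definition trap (k : nat) (w : R) : R := Num.max 0 (Num.min 1 (2 - `|w| * expR k%:R)).

Lemma trap_ge0 k w : 0 <= trap k w. Proof. by rewrite /trap le_max lexx. Qed.
Lemma trap_le1 k w : trap k w <= 1.
Proof. by rewrite /trap ge_max ler01 ge_min lexx. Qed.
Lemma trap1 k w : `|w| <= expR (- k%:R) -> trap k w = 1.
Proof.
move=> h; rewrite /trap; have : `|w| * expR k%:R <= 1 by rewrite -ler_pdivlMr // mul1r -expRN.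
by move=> h2; rewrite min_l ?max_r //; lra.
Qed.
Lemma trap0 k w : 2 * expR (- k%:R) < `|w| -> trap k w = 0.
Proof.
rewrite expRN ltr_pdivrMr // => h.
by rewrite /trap max_l // ge_min; lra.
Qed.

Lemma clamp_lip (a b : R) : `|Num.max 0 (Num.min 1 a) - Num.max 0 (Num.min 1 b)| <= `|a - b|.
Proof.
have h : forall c e : R, c <= e -> Num.max 0 (Num.min 1 c) <= Num.max 0 (Num.min 1 e)
  /\ Num.max 0 (Num.min 1 e) - Num.max 0 (Num.min 1 c) <= e - c.
 move=> c e ce; rewrite /Num.max /Num.min.
 by do ![case: ifP]; move=> *; split; lra.
case: (leP a b) => ab.
 have [h1 h2] := h a b ab; rewrite distrC [X in _ <= X]distrC !ger0_norm ?subr_ge0 //.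
have [h1 h2] := h b a (ltW ab); by rewrite !ger0_norm ?subr_ge0 // ltW.
Qed.

Lemma trap_lip k w w' : `|trap k w - trap k w'| <= expR k%:R * `|w - w'|.
Proof.
apply: le_trans (clamp_lip _ _) _.
rewrite (_ : _ - _ = (`|w'| - `|w|) * expR k%:R); last by ring.
rewrite normrM (ger0_norm (expR_ge0 _)) mulrC ler_wpM2l // distrC.
exact: ler_dist_dist.
Qed.

Lemma trap_int k : int1 (trap k) <= 4 * expR (- k%:R).
Proof.
have K0 : 0 <= 2 * expR (- k%:R) :> R by rewrite mulr_ge0 //.
have c : ccs (2 * expR (- k%:R)) (trap k).
 split; last exact: trap0.
 by apply: (lip_continuous (L := expR k%:R)); exact: trap_lip.
have := int1_bound K0 c (C := 1); rewrite mul1r => h.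
apply: le_trans (ler_norm _) _; apply: le_trans (h _) _.
 by move=> w; rewrite ger0_norm ?trap_ge0 // trap_le1.
lra.
Qed.

(** The last level has no lower bound: it collects everything of size at most e^-K, zero
    included. *)
Lemma level_exists (K : nat) (w : R) : `|w| <= 1 -> exists k : 'I_K.+1,
 `|w| <= expR (- k%:R) /\ ((k < K)%N -> expR (- k%:R - 1) <= `|w|).
Proof.
move=> w1; elim: K => [|K [k [k1 k2]]].
 by exists ord0; rewrite oppr0 expR0.
have [kK|kK] := ltnP k K.
 by exists (widen_ord (leqnSn _) k); auto.
have ek : k = K :> nat by apply/eqP; rewrite eqn_leq kK -ltnS ltn_ord.
have [h|h] := leP `|w| (expR (- K.+1%:R)).
 by exists ord_max; rewrite /= ltnn.
exists (widen_ord (leqnSn _) k); split=> //= _; rewrite ek.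
by apply: ltW; move: h; rewrite -natr1 opprD.
Qed.

Lemma box_upper (K : nat) (F : {ffun 'I_n -> 'I_K.+1} -> R) u : LC 1 [::] u ->
 (forall k, 0 <= F k) ->
 (forall x (k : {ffun 'I_n -> 'I_K.+1}), (forall j, `|coord x j| <= expR (- (k j)%:R)) ->
  (forall j, (k j < K)%N -> expR (- (k j)%:R - 1) <= `|coord x j|) -> `|u x| <= F k) ->
 `|int_Rn u| <= \sum_k F k * \prod_j (4 * expR (- (k j)%:R)).
Proof.
move=> lu F0 uF.
pose h (k : {ffun 'I_n -> 'I_K.+1}) (x : V) := \prod_j trap (k j) (coord x j).
have b1 (k : {ffun 'I_n -> 'I_K.+1}) j w : `|trap (k j) w| <= 1 by rewrite ger0_norm ?trap_ge0 ?trap_le1.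
have bs (k : {ffun 'I_n -> 'I_K.+1}) j w : 2 < `|w| -> trap (k j) w = 0.
 move=> h2; apply: trap0; apply: le_lt_trans h2; rewrite ler_piMr // -[leRHS]expR0 ler_expR oppr_le0 ler0n.
have bL (k : {ffun 'I_n -> 'I_K.+1}) j w w' : `|trap (k j) w - trap (k j) w'| <= expR K%:R * `|w - w'|.
 apply: le_trans (trap_lip _ _ _) _; rewrite ler_wpM2r // ler_expR ler_nat -ltnS.
 exact: ltn_ord.
have lh k : LC 2 [::] (h k) := prod_LC (b1 k) (bL k) (bs k).
have hint k : int_Rn (h k) = \prod_j int1 (trap (k j)) := int_Rn_prod (bL k) (bs k).
apply: (@le_trans _ _ (int_Rn (fun x => \sum_k F k * h k x))).
 apply: (int_Rn_abs (K := 2)) => //; [by apply: LC_widen lu; rewrite ler1n|exact: LC_sumF|move=> x].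
 have hk0 k : 0 <= h k x by apply: prodr_ge0 => j _; exact: trap_ge0.
 have [/forallP x1|] := boolP [forall j, `|coord x j| <= 1]; last first.
  rewrite negb_forall => /existsP[j]; rewrite -ltNge => h1.
  by rewrite (LC_supp lu _ h1) // normr0 sumr_ge0 // => k _; pos.
 have /choice[k hk] := fun j => level_exists K (x1 j).
 pose k' : {ffun 'I_n -> 'I_K.+1} := [ffun j => k j].
 rewrite (bigD1 k') //= (le_trans (uF x k' _ _)) //.
 - by move=> j; rewrite ffunE; case: (hk j).
 - by move=> j; rewrite ffunE; case: (hk j).
 rewrite (_ : h k' x = 1); last by apply: big1 => j _; rewrite ffunE trap1 //; case: (hk j).
 by rewrite mulr1 lerDl sumr_ge0 // => i _; pos.
rewrite (@int_Rn_sumF _ predT 2 h F (ler0n _ 2) lh); apply: ler_sum => k _; rewrite ler_wpM2l // hint.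
apply: ler_prod => j _; rewrite trap_int andbT; apply: int1_ge0 => w; exact: trap_ge0.
Qed.

(** With y = w e^k this is 1 for |y - 3/4| <= 1/8 and 0 for |y - 3/4| >= 1/4; as e^-1 <= 1/2,
    different levels have disjoint supports. *)
Definition tent (k : nat) (w : R) : R :=
 Num.max 0 (Num.min 1 (2 - 8 * `|w * expR k%:R - 3 / 4|)).

Lemma tent_ge0 k w : 0 <= tent k w. Proof. by rewrite /tent le_max lexx. Qed.
Lemma tent_le1 k w : tent k w <= 1.
Proof. by rewrite /tent ge_max ler01 ge_min lexx. Qed.

Lemma expRm1 : expR (-1) <= 1 / 2 :> R.
Proof.
rewrite expRN ler_pdivlMr // mulrC ler_pdivrMr // mul1r.
by have := expR_ge1Dx (1 : R); lra.
Qed.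

Lemma tent_supp k w : tent k w != 0 -> expR (- k%:R - 1) <= w <= expR (- k%:R) /\ expR (- k%:R - 1) < w.
Proof.
rewrite /tent; have [h|h] := lerP (2 - 8 * `|w * expR k%:R - 3 / 4|) 0.
 by rewrite max_l ?eqxx // ge_min h orbT.
have h' : `|w * expR k%:R - 3 / 4| < 1 / 4 by lra.
move: h'; rewrite ltr_norml => /andP[h1 h2] _.
have h3 : w <= expR (- k%:R) by rewrite expRN -[leRHS]mul1r ler_pdivlMr //; lra.
suff h4 : expR (- k%:R - 1) < w by rewrite h3 h4 (ltW h4).
rewrite expRD expRN mulrC ltr_pdivrMr //; have := expRm1; lra.
Qed.

Lemma tent_inj k k' w : tent k w != 0 -> tent k' w != 0 -> k = k'.
Proof.
move=> /tent_supp[/andP[h1 h2] h3] /tent_supp[/andP[h4 h5] h6].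
apply/eqP; rewrite eqn_leq; apply/andP; split; rewrite leqNgt; apply/negP => kk.
 have : expR (- k%:R) <= expR (- k'%:R - 1) :> R.
  by rewrite ler_expR -opprD lerN2 natr1 ler_nat.
 lra.
have : expR (- k'%:R) <= expR (- k%:R - 1) :> R.
 by rewrite ler_expR -opprD lerN2 natr1 ler_nat.
lra.
Qed.

Lemma tent_lip k w w' : `|tent k w - tent k w'| <= 8 * expR k%:R * `|w - w'|.
Proof.
apply: le_trans (clamp_lip _ _) _.
rewrite (_ : _ - _ = 8 * (`|w' * expR k%:R - 3 / 4| - `|w * expR k%:R - 3 / 4|)); last by ring.
rewrite normrM (ger0_norm (ler0n _ 8)) -mulrA ler_wpM2l //; apply: le_trans (ler_dist_dist _ _) _.
rewrite (_ : _ - _ = expR k%:R * (w' - w)); last by ring.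
by rewrite normrM (ger0_norm (expR_ge0 _)) distrC.
Qed.

(** An interval of length e^-k / 8 around (3/4) e^-k lies where [tent] equals 1. *)
Lemma tent_int k : expR (- k%:R) / 8 <= int1 (tent k).
Proof.
have e0 : 0 < expR (- k%:R) :> R by exact: expR_gt0.
pose a : R := 11 / 16 * expR (- k%:R); pose b : R := 13 / 16 * expR (- k%:R).
have ab : a < b by rewrite /a /b; nra.
have tD w : w \in `[a, b]%classic -> tent k w = 1.
 rewrite inE /= in_itv /= => /andP[]; rewrite /a /b expRN ler_pdivrMr // ler_pdivlMr // => h1 h2.
 have h3 : `|w * expR k%:R - 3 / 4| <= 1 / 8 by rewrite ler_norml; apply/andP; split; lra.
 by rewrite /tent min_l ?max_r //; lra.
have c : ccs 1 (tent k).
 split.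
  by apply: (lip_continuous (L := 8 * expR k%:R)); exact: tent_lip.
 move=> s s1; apply/eqP/negP => /negP /tent_supp[/andP[h1 h2] _].
 have s0 : 0 <= s by apply: le_trans h1; exact: expR_ge0.
 move: s1; rewrite ger0_norm // ltNge (le_trans h2) // -[leRHS]expR0 ler_expR oppr_le0 ler0n.
have mub : @lebesgue_measure R `[a, b]%classic = (b - a)%:E.
 by rewrite lebesgue_measure_itv /= lte_fin ab -EFinB.
rewrite /int1 /Rintegral -lee_fin fineK; last exact: integrable_fin_num (ccs_integrable c).
have -> : ((expR (- k%:R) / 8)%:E = \int[@lebesgue_measure R]_(s in `[a, b]) (tent k s)%:E)%E.
 under eq_integral do rewrite tD //.
 by rewrite integral_cst //= mul1e mub /a /b; congr EFin; lra.
apply: ge0_subset_integral => //.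
- by have /integrableP[] := ccs_integrable c.
- by move=> w _; rewrite lee_fin tent_ge0.
Qed.

(** Disjoint supports keep the sum of the box functions at most 1 at every point, which is why [S]
    must be duplicate free. *)
Lemma box_lower (S : seq (mindex n)) u (c : R) : uniq S -> 0 <= c -> LC 1 [::] u ->
 (forall x, 0 <= u x) ->
 (forall x k, k \in S -> (forall j, expR (- (k j)%:R - 1) <= coord x j <= expR (- (k j)%:R)) -> c <= u x) ->
 c * \sum_(k <- S) \prod_j (expR (- (k j)%:R) / 8) <= int_Rn u.
Proof.
move=> uS c0 lu u0 uc.
pose h (k : mindex n) (x : V) := \prod_j tent (k j) (coord x j).
have hk0 k x : 0 <= h k x by apply: prodr_ge0 => j _; exact: tent_ge0.
have b1 (k : mindex n) j w : `|tent (k j) w| <= 1 by rewrite ger0_norm ?tent_ge0 ?tent_le1.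
have bs (k : mindex n) j w : 1 < `|w| -> tent (k j) w = 0.
 move=> s1; apply/eqP/negP => /negP /tent_supp[/andP[h1 h2] _].
 have s0 : 0 <= w by apply: le_trans h1; exact: expR_ge0.
 move: s1; rewrite ger0_norm // ltNge (le_trans h2) // -[leRHS]expR0 ler_expR oppr_le0 ler0n.
have bL (k : mindex n) j w w' : `|tent (k j) w - tent (k j) w'| <= 8 * expR (\max_i k i)%:R * `|w - w'|.
 apply: le_trans (tent_lip _ _ _) _; rewrite ler_wpM2r // ler_wpM2l // ler_expR ler_nat.
 exact: leq_bigmax.
have lh k : LC 1 [::] (h k) := prod_LC (b1 k) (bL k) (bs k).
have hint k : int_Rn (h k) = \prod_j int1 (tent (k j)) := int_Rn_prod (bL k) (bs k).
have LCs (r : seq (mindex n)) : LC 1 [::] (fun x => c * \sum_(k <- r) h k x) /\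
  int_Rn (fun x => c * \sum_(k <- r) h k x) = c * \sum_(k <- r) int_Rn (h k).
 elim: r => [|k r [ih1 ih2]].
  rewrite (_ : (fun x => _) = (fun=> 0)); last by apply/funext => x; rewrite big_nil mulr0.
  split; last by rewrite int_Rn0 big_nil mulr0.
  by split=> //; exists 0 => x y; rewrite subrr normr0 mul0r.
 rewrite (_ : (fun x => _) = (fun x => c * h k x + 1 * (c * \sum_(k <- r) h k x))).
  by split; [exact: LC_lin|rewrite (int_Rn_lin (K := 1)) // ih2 big_cons mul1r mulrDr].
 by apply/funext => x; rewrite big_cons mul1r mulrDr.
apply: (@le_trans _ _ (int_Rn (fun x => c * \sum_(k <- S) h k x))).
 have [_ ->] := LCs S; rewrite ler_wpM2l // ler_sum // => k _; rewrite hint.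
 by apply: ler_prod => j _; rewrite tent_int andbT //.
apply: (int_Rn_le (K := 1)) => //; first by case: (LCs S).
move=> x; have [/hasP[k kS hx]|] := boolP (has (fun k => h k x != 0) S); last first.
 rewrite -all_predC => /allP hS; rewrite big_seq big1 ?mulr0 ?u0 // => k kS.
 by have := hS k kS; rewrite /= negbK => /eqP.
have nz j : tent (k j) (coord x j) != 0.
 by apply: contraNneq hx => e; rewrite /h (bigD1 j) //= e mul0r.
rewrite (bigD1_seq k) //= big1 ?addr0.
 apply: (@le_trans _ _ c); last by apply: (uc x k) => // j; case: (tent_supp (nz j)).
 rewrite ler_piMr //; rewrite -[leRHS](expr1n R #|'I_n|) -prodr_const; apply: ler_prod => j _.
 by rewrite tent_ge0 tent_le1.
move=> k' kk; have [j kj] : exists j, k' j != k j.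
 apply/existsP; rewrite -negb_forall; apply: contra kk => /forallP e; apply/eqP/ffunP => j.
 exact/eqP/e.
rewrite /h (bigD1 j) //=; case: (eqVneq (tent (k' j) (coord x j)) 0) => [->|nz']; first lra.
by rewrite (tent_inj nz' (nz j)) eqxx in kj.
Qed.

End Boxes.

(** From x <= e^x at x = L / n, raised to the power n. *)
Lemma pow_le_exp (R : realType) (n : nat) (L : R) : 0 <= L -> L ^+ n <= n%:R ^+ n * expR L.
Proof.
case: n => [|n] L0; first by rewrite !expr0 mul1r -expR0 ler_expR.
have h : L / n.+1%:R <= expR (L / n.+1%:R).
 by apply: le_trans (expR_ge1Dx _); rewrite lerDr.
have -> : expR L = expR (L / n.+1%:R) ^+ n.+1.
 by rewrite -expRM_natl mulrC mulfVK.
rewrite -exprMn; apply: lerXn2r; rewrite ?nnegrE //.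
by rewrite mulrC -ler_pdivrMr.
Qed.

Lemma predn_sub2 (n k : nat) : (k + 1 < n)%N -> (n - k.+1 = (n - (k + 1 + 1)).+1)%N.
Proof. lia. Qed.

(** * From bounds on boxes to bounds on integrals *)

Section Dyadic.
Variables (R : realType) (n : nat).
Local Notation V := 'rV[R]_n.

Lemma sum_linear_seq r (Ws : seq 'M[R]_(n, r)) (c : R) : (forall W, W \in Ws -> row_full W) -> 0 < c ->
 exists2 C : R, 0 < C & forall K (tau : 'I_r -> R),
 \sum_(k : {ffun 'I_n -> 'I_K.+1}) \sum_(W <- Ws) expR (- c * \sum_s `|kW W (fun i => k i) s - tau s|)
  <= C * K.+1%:R ^+ (n - r).
Proof.
move=> + c0; elim: Ws => [_|W Ws ih hW].
 by exists 1 => // K tau; rewrite big1 // => k _; rewrite big_nil.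
have [W' W's|C C0 hC] := ih; first by apply: hW; rewrite inE W's orbT.
have [C' C'0 hC'] := sum_linear (hW W (mem_head _ _)) c0.
exists (C' + C); first exact: addr_gt0.
move=> K tau; under eq_bigr do rewrite big_cons.
by rewrite big_split mulrDl; apply: lerD; by [].
Qed.

(** On a box, value times volume is bounded by B D times the exponential sum, whose r independent
    forms leave n - r of the n free directions. The crude bound B e^(q L) is only used on boxes with
    an index at the last level, whose volume absorbs it. *)
Lemma dyadic_bound r (Ws : seq 'M[R]_(n, r)) (c q g : R) : (forall W, W \in Ws -> row_full W) ->
 0 < c -> 0 <= q -> 0 <= g -> exists2 C : R, 0 < C & forall (L B D : R) tau (u : V -> R),
 1 <= L -> 0 <= B -> expR (- g * L) <= D -> LC 1 [::] u -> (forall x, `|u x| <= B * expR (q * L)) ->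
 (forall (k : mindex n) x, (forall j, expR (- (k j)%:R - 1) <= `|coord x j|) ->
  (forall j, `|coord x j| <= expR (- (k j)%:R)) ->
  `|u x| * expR (- (\sum_j k j)%:R) <= B * D * \sum_(W <- Ws) expR (- c * \sum_s `|kW W k s - tau s|)) ->
 `|int_Rn u| <= C * B * D * L ^+ (n - r).
Proof.
move=> fW c0 q0 g0; have [C C0 hC] := sum_linear_seq fW c0.
(* K is about (q + g + 1) L; rounding and the step to K + 1 cost at most 2 <= 2 L, whence the 3. *)
pose a : R := q + g + 3; have a0 : 0 < a by rewrite /a; lra.
exists (4 ^+ n * (C * a ^+ (n - r) + a ^+ n * n%:R ^+ n)).
 pos.
move=> L B D tau u L1 B0 gD lu uq uk.
have L0 : 0 < L by apply: lt_le_trans L1.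
have D0 : 0 < D by apply: lt_le_trans gD; exact: expR_gt0.
pose z := (q + g + 1) * L; have z0 : 0 <= z by rewrite mulr_ge0 ?(ltW L0) //; lra.
pose K := (Num.truncn z).+1.
have /andP[zK1 zK2] := truncn_itv z0.
have Kz : z <= K%:R by rewrite ltW.
have Ka : K.+1%:R <= a * L by rewrite /K -2!natr1 /a; move: zK1; rewrite /z; nra.
pose S (k : {ffun 'I_n -> 'I_K.+1}) := \sum_(W <- Ws) expR (- c * \sum_s `|kW W (fun i => k i) s - tau s|).
have S0 k : 0 <= S k by apply: sumr_ge0 => W _; exact: expR_ge0.
pose F (k : {ffun 'I_n -> 'I_K.+1}) : R := if [forall j, (k j < K)%N] then B * D * S k * expR (\sum_j k j)%:R
 else B * expR (q * L).
have F0 k : 0 <= F k.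
 by rewrite /F; case: ifP => _; pos.
apply: le_trans (box_upper lu F0 _) _.
 move=> x k h1 h2; rewrite /F; case: ifP => [/forallP kK|_]; auto.
 rewrite -ler_pdivrMr // -expRN.
 pose k' : mindex n := [ffun j => k j : nat].
 have -> : (\sum_j k j)%N = (\sum_j k' j)%N by apply: eq_bigr => j _; rewrite ffunE.
 have -> : S k = \sum_(W <- Ws) expR (- c * \sum_s `|kW W k' s - tau s|).
  apply: eq_bigr => W _; congr (expR (_ * _)); apply: eq_bigr => s _; congr (`|_ - _|).
  by apply: eq_bigr => i _; rewrite ffunE.
 apply: uk => j; rewrite ffunE; auto.
have pr (k : {ffun 'I_n -> 'I_K.+1}) : \prod_j (4 * expR (- (k j)%:R)) = 4 ^+ n * expR (- (\sum_j k j)%:R) :> R.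
 rewrite big_split /= prodr_const card_ord; congr (_ * _).
 by rewrite natr_sum -sumrN expR_sum.
under eq_bigr do rewrite pr mulrCA.
rewrite -mulr_sumr -!mulrA ler_wpM2l //.
have termle (k : {ffun 'I_n -> 'I_K.+1}) : F k * expR (- (\sum_j k j)%:R) <= B * D * S k + B * expR (q * L - K%:R).
 rewrite /F; case: ifP => [_|/negbT].
  by rewrite -mulrA -expRD subrr expR0 mulr1 lerDl mulr_ge0.
 rewrite negb_forall => /existsP[j]; rewrite -leqNgt => jK.
 apply: (@le_trans _ _ (B * expR (q * L - K%:R))); last by rewrite lerDr ?mulr_ge0 // ltW.
 rewrite -mulrA -expRD ler_wpM2l // ler_expR lerD2l lerN2 ler_nat.
 by apply: leq_trans jK _; rewrite (bigD1 j) //= leq_addr.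
apply: (@le_trans _ _ (\sum_(k : {ffun 'I_n -> 'I_K.+1}) (B * D * S k + B * expR (q * L - K%:R)))); first exact: ler_sum.
rewrite big_split /= -mulr_sumr sumr_const card_ffun !card_ord.
have e1 : B * D * \sum_k S k <= B * D * (C * a ^+ (n - r) * L ^+ (n - r)).
 rewrite ler_wpM2l ?mulr_ge0 ?(ltW D0) // (le_trans (hC K tau)) // -mulrA -exprMn.
 by rewrite ler_wpM2l ?(ltW C0) // lerXn2r ?nnegrE // mulr_ge0 // ltW.
have e2 : (B * expR (q * L - K%:R)) *+ (K.+1 ^ n) <= B * D * (a ^+ n * n%:R ^+ n * L ^+ (n - r)).
 rewrite -mulr_natr natrX -!mulrA ler_wpM2l //.
 apply: (@le_trans _ _ (expR (- g * L) * (a ^+ n * n%:R ^+ n))); last first.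
  apply: ler_pM => //; rewrite ?mulr_ge0 ?exprn_ge0 ?(ltW a0) //.
  by rewrite !mulrA ler_peMr ?mulr_ge0 ?exprn_ge0 ?(ltW a0) // exprn_ege1.
 apply: (@le_trans _ _ (expR (- g * L) * expR (- L) * (a * L) ^+ n)).
  apply: ler_pM; auto.
   by rewrite -expRD ler_expR; move: Kz; rewrite /z; lra.
  by rewrite lerXn2r ?nnegrE // mulr_ge0 // ltW.
 rewrite -mulrA ler_wpM2l // exprMn mulrCA ler_wpM2l ?exprn_ge0 ?(ltW a0) //.
 by rewrite expRN mulrC ler_pdivrMr // pow_le_exp // ltW.
apply: le_trans (lerD e1 e2) _; apply: eqW; ring.
Qed.

(** For e >= 0 the factor e^(-a e) decays by itself; for e < 0 the weight, at most e^(M e), takes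
    over. Both rates are positive when 0 < a < M. *)
Lemma exp_tail (a c M e y : R) : c <= a -> c <= M - a -> 0 <= y -> y <= 1 -> y <= expR (M * e) ->
 expR (- a * e) * y <= expR (- c * `|e|).
Proof.
move=> ca cM y0 y1 yM; case: (lerP 0 e) => e0.
 rewrite ger0_norm //; apply: (@le_trans _ _ (expR (- a * e))).
  by rewrite ler_piMr.
 by rewrite ler_expR; nra.
rewrite ltr0_norm //; apply: (@le_trans _ _ (expR (- a * e) * expR (M * e))).
 by rewrite ler_wpM2l.
by rewrite -expRD ler_expR; nra.
Qed.

End Dyadic.

(** * Upper bounds for weighted integrals *)

Section Estimates.
Variables (R : realType) (n : nat) (f : 'rV[R]_n -> R).
Local Notation V := 'rV[R]_n.
Variables (A : seq (mindex n)) (G : seq (mindex n * nat)).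
Hypothesis NG : newton_gen f A G.

Local Notation P := (newton_poly f).
Local Notation d := (newton_dist f).
Local Notation tau := (principal_face f).

Definition mm (x : V) : R := \sum_(v <- A) `|monomial v x|.

Lemma mm_ge0 x : 0 <= mm x. Proof. by apply: sumr_ge0. Qed.

Lemma mm_ge v x : v \in A -> `|monomial v x| <= mm x.
Proof. by move=> vA; rewrite /mm (big_rem v) //= lerDl sumr_ge0. Qed.

Lemma mono_up (v k : mindex n) (x : V) : (forall j, `|coord x j| <= expR (- (k j)%:R)) ->
 `|monomial v x| <= expR (- (npair k v)%:R).
Proof.
move=> h; rewrite normr_prod natr_sum -sumrN expR_sum; apply: ler_prod => j _.
rewrite normr_ge0 normrX /= natrM mulrC -mulrN expRM_natl.
by rewrite lerXn2r ?nnegrE.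
Qed.

Lemma mono_lo (v k : mindex n) (x : V) : (forall j, expR (- (k j)%:R - 1) <= `|coord x j|) ->
 expR (- (npair k v)%:R - (\sum_j v j)%:R) <= `|monomial v x|.
Proof.
move=> h; rewrite normr_prod !natr_sum -!sumrN -big_split expR_sum /=; apply: ler_prod => j _.
rewrite expR_ge0 normrX /= natrM mulrC.
rewrite (_ : _ - _ = (v j)%:R * (- (k j)%:R - 1)); last lra.
by rewrite expRM_natl lerXn2r ?nnegrE.
Qed.

Lemma mono_le1 (v : mindex n) (x : V) : (forall j, `|coord x j| <= 1) -> `|monomial v x| <= 1.
Proof.
move=> h; rewrite normr_prod; apply: (@le_trans _ _ (\prod_(j < n) 1)); last by rewrite big1.
by apply: ler_prod => j _; rewrite normr_ge0 normrX exprn_ile1.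
Qed.

Lemma argminA (F : mindex n -> nat) : exists2 v, v \in A & forall w, w \in A -> (F v <= F w)%N.
Proof.
case: A (gen_nil NG) => // v0 A' _; elim: A' => [|v A' [w wA hw]].
 by exists v0; rewrite ?mem_head // => w; rewrite inE => /eqP ->.
have [h|h] := leqP (F w) (F v).
 exists w; first by move: wA; rewrite !inE => /orP[->//|->]; rewrite !orbT.
 by move=> w'; rewrite !inE => /or3P[/eqP ->|/eqP ->//|w'A]; apply: hw; rewrite inE ?eqxx ?w'A ?orbT.
exists v; first by rewrite !inE eqxx orbT.
move=> w'; rewrite !inE => /or3P[/eqP ->|/eqP ->//|w'A]; apply: ltnW; apply: leq_trans h _; apply: hw.
 exact: mem_head.
by rewrite inE w'A orbT.
Qed.

(** Bounds |v| for all v in [A], hence the loss in log |x^v| when each |x_j| is only known up to a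
    factor e. *)
Definition Vm : R := (\sum_(v <- A) \sum_j v j)%:R.
Definition wt (M : nat) (L : R) (x : V) : R := ((1 + expR L * mm x)^-1) ^+ M.

Lemma wt_ge0 M L x : 0 <= wt M L x.
Proof. by rewrite exprn_ge0 // invr_ge0 addr_ge0 // mulr_ge0 ?mm_ge0. Qed.

Lemma wt_le1 M L x : wt M L x <= 1.
Proof.
rewrite exprn_ile1 ?invr_ge0 ?addr_ge0 ?mulr_ge0 ?mm_ge0 //.
by rewrite invf_le1 ?ltr_pwDl ?lerDl ?mulr_ge0 ?mm_ge0.
Qed.

Lemma wt_box M L (k v : mindex n) x : v \in A -> (forall j, expR (- (k j)%:R - 1) <= `|coord x j|) ->
 wt M L x <= expR (M%:R * Vm) * expR (M%:R * ((npair k v)%:R - L)).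
Proof.
move=> vA h; rewrite -expRD -mulrDr expRM_natl /wt; apply: lerXn2r; rewrite ?nnegrE //.
 by rewrite invr_ge0 addr_ge0 // mulr_ge0 ?mm_ge0.
have vV : (\sum_j v j)%:R <= Vm.
 by rewrite ler_nat (big_rem v) //= leq_addr.
have m0 : expR (- (npair k v)%:R - Vm) <= mm x.
 apply: le_trans (mm_ge x vA); apply: le_trans (mono_lo v h).
 by rewrite ler_expR lerD2l lerN2.
have e0 : 0 < expR L * expR (- (npair k v)%:R - Vm) by rewrite mulr_gt0.
rewrite (_ : Vm + _ = - (L + (- (npair k v)%:R - Vm))); last by ring.
rewrite expRN expRD lef_pV2 ?posrE //; last first.
 by rewrite ltr_pwDl // mulr_ge0 ?mm_ge0.
by rewrite -[leLHS]add0r lerD // ler_wpM2l.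
Qed.

Lemma unit_box (u : V -> R) (F : V -> R) x : LC 1 [::] u -> 0 <= F x ->
 ((forall j, `|coord x j| <= 1) -> `|u x| <= F x) -> `|u x| <= F x.
Proof.
move=> lu F0 h; have [/forallP x1|] := boolP [forall j, `|coord x j| <= 1]; auto.
rewrite negb_forall => /existsP[j]; rewrite -ltNge => h1.
by rewrite (LC_supp lu _ h1) // normr0.
Qed.

(** The condition over [G] says that (b + (1, ..., 1)) / (k0 + g) lies in the polyhedron. The lowest
    level l = <k, v> of a box then satisfies (k0 + g) l <= |k| + <k, b>, which pays for t^k0 with
    t^-g to spare; the boxes with l near L produce the logarithms. *)
Lemma estimate_general (b : mindex n) (k0 M : nat) (g : R) : 0 < g -> k0%:R + g < M%:R ->
 (forall p, p \in G -> (k0%:R + g) * p.2%:R <= (\sum_i p.1 i + npair p.1 b)%:R) ->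
 exists2 C : R, 0 < C & forall (L B : R) (u : V -> R), 1 <= L -> 0 <= B -> LC 1 [::] u ->
 (forall x, `|u x| <= B * expR (k0%:R * L) * `|monomial b x| * wt M L x) ->
 `|int_Rn u| <= C * B * expR (- g * L) * L ^+ n.-1.
Proof.
move=> g0 gM bG; pose s := k0%:R + g; have s0 : 0 < s by rewrite /s ltr_wpDl.
(* Only the form <k, v> of the minimizing exponent is controlled, and that exponent depends on the
   box, so all are listed. One form out of n leaves L^(n-1). *)
pose col (v : mindex n) : 'M[R]_(n, 1) := \col_i (v i)%:R.
pose c := Num.min s (M%:R - s).
have c0 : 0 < c by rewrite lt_min s0 subr_gt0.
have fW W : W \in [seq col v | v <- A] -> row_full W.
 move=> /mapP[v vA ->]; rewrite /row_full eqn_leq rank_leq_col lt0n mxrank_eq0.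
 apply/negP => /eqP/matrixP e; have := gen_pos NG vA; rewrite big1 // => i _.
 by apply/eqP; have := e i 0; rewrite !mxE => /eqP; rewrite pnatr_eq0.
have [C C0 hC] := dyadic_bound fW c0 (ler0n _ k0) (ltW g0).
exists (C * expR (M%:R * Vm)); first pos.
move=> L B u L1 B0 lu uB; pose B' := B * expR (M%:R * Vm).
have B'0 : 0 <= B' by rewrite mulr_ge0.
have BB' : B <= B' by rewrite ler_peMr // -[leLHS]expR0 ler_expR mulr_ge0 // ler0n.
have Px0 : P (\row_i ((b i).+1%:R / s)).
 apply: (gen_ineq NG) => p pG; rewrite -(ler_pM2l s0); apply: le_trans (bG p pG) _.
 apply: eqW; rewrite /rpair mulr_sumr /npair -big_split /= natr_sum.
 apply: eq_bigr => i _; rewrite /coord mxE /nr -mulnS natrM; field; pos.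
rewrite (_ : C * expR (M%:R * Vm) * B = C * B'); last by rewrite /B'; ring.
rewrite -subn1; apply: (hC L B' (expR (- g * L)) (fun=> L) u L1 B'0 (lexx _) lu).
- move=> x; apply: (@unit_box _ (fun=> _)) => // [|x1]; first by rewrite mulr_ge0.
 apply: le_trans (uB x) _; rewrite -!mulrA; apply: ler_pM => //.
  by rewrite !mulr_ge0 ?wt_ge0.
 by rewrite ler_piMr // mulr_ile1 ?wt_ge0 ?wt_le1 ?mono_le1.
move=> k x h1 h2; have [v vA vmin] := argminA (npair k).
set l := npair k v in vmin *.
have kb : s * l%:R <= (\sum_j k j)%:R + (npair k b)%:R.
 have h : l%:R <= rpair (nr R k) (\row_i ((b i).+1%:R / s)).
  apply: (newton_valid (gen_dom NG)) Px0 => [i|w wA]; auto.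
  by rewrite rpair_nr ler_nat vmin.
 move: h; rewrite -(ler_pM2l s0) => h; apply: le_trans h _.
 apply: eqW; rewrite /rpair mulr_sumr -natrD /npair -big_split /= natr_sum.
 apply: eq_bigr => i _; rewrite /coord mxE /nr -mulnS natrM; field; pos.
have W1 : wt M L x * expR (- (M%:R * Vm)) <= 1.
 rewrite expRN ler_pdivrMr // mul1r; apply: le_trans (wt_le1 _ _ _) _.
 by rewrite -[leLHS]expR0 ler_expR mulr_ge0 // ler0n.
have W2 : wt M L x * expR (- (M%:R * Vm)) <= expR (M%:R * (l%:R - L)).
 by rewrite expRN ler_pdivrMr // mulrC; exact: wt_box.
have W0 : 0 <= wt M L x * expR (- (M%:R * Vm)) by rewrite mulr_ge0 ?wt_ge0.
have cs : c <= s by rewrite /c ge_min lexx.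
have cM : c <= M%:R - s by rewrite /c ge_min lexx orbT.
have key := exp_tail cs cM W0 W1 W2.
apply: (@le_trans _ _ (B' * expR (- g * L) * expR (- c * `|l%:R - L|))); last first.
 rewrite ler_wpM2l ?mulr_ge0 // big_map (big_rem v) //= big_ord1.
 have -> : kW (col v) k ord0 = l%:R.
  by rewrite /kW /l natr_sum; apply: eq_bigr => i _; rewrite mxE natrM.
 by rewrite lerDl sumr_ge0 // => w _; by [].
apply: (@le_trans _ _ (B' * expR (- g * L) * (expR (- s * (l%:R - L)) * (wt M L x * expR (- (M%:R * Vm)))))); last first.
 by rewrite ler_wpM2l ?mulr_ge0.
apply: (@le_trans _ _ (B * expR (k0%:R * L) * expR (- (npair k b)%:R) * wt M L x * expR (- (\sum_j k j)%:R))).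
 rewrite ler_wpM2r //; apply: le_trans (uB x) _; rewrite ler_wpM2r ?wt_ge0 //.
 by rewrite ler_wpM2l ?mulr_ge0 // mono_up.
rewrite [leLHS](_ : _ = B * wt M L x * expR (k0%:R * L - (npair k b)%:R - (\sum_j k j)%:R)); last first.
 by rewrite !expRD; ring.
rewrite /B' [leRHS](_ : _ = B * wt M L x * expR (M%:R * Vm - g * L - s * (l%:R - L) - M%:R * Vm)); last first.
 by rewrite !expRD -!mulNr; ring.
rewrite ler_wpM2l ?mulr_ge0 ?wt_ge0 // ler_expR; move: kb; rewrite /s; lra.
Qed.

Section Principal.
Variables (U : 'M[R]_(dim_set tau, n)) (a : mindex n) (l : nat) (e : R).
Hypothesis pdu : pdata U a l e.
Local Notation p := (d^-1).
Local Notation W := (col_mx U (const_mx 1 : 'rV_n))^T.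

Lemma dpos : 0 < d. Proof. exact: (dist_gt0 NG). Qed.

Lemma W_full : row_full W.
Proof. by rewrite /row_full mxrank_tr; exact: (pd_free pdu). Qed.

(* A distance from [k] to the normal cone of the principal face. *)
Definition gapk (k : mindex n) (lk : nat) : R := (\sum_j k j)%:R * d - lk%:R.

Lemma gapk_ge0 k lk : (forall w, w \in A -> (lk <= npair k w)%N) -> 0 <= gapk k lk.
Proof.
move=> h; rewrite subr_ge0; have := newton_valid (gen_dom NG) (c := nr R k) (l := lk%:R) _ _ (dist_mem NG).
rewrite rpair_diag -natr_sum; apply=> [i|w wA]; auto.
by rewrite rpair_nr ler_nat h.
Qed.

Lemma gapk_u k lk r : (forall w, w \in A -> (lk <= npair k w)%N) ->
 `|rpair (nr R k) (row r U)| <= gapk k lk / e.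
Proof.
move=> h; rewrite ler_pdivlMr ?(pd_egt0 pdu) // mulrC /gapk natr_sum.
by apply: (gap_u NG pdu) => [i|w wA]; [exact: ler0n|rewrite rpair_nr ler_nat h].
Qed.

Lemma kW_l (k : mindex n) r : kW W k (lshift 1 r) = rpair (nr R k) (row r U).
Proof. by apply: eq_bigr => i _; rewrite /coord !mxE /= (unsplitK (inl r)). Qed.

Lemma kW_r (k : mindex n) (r : 'I_1) : kW W k (rshift _ r) = (\sum_j k j)%:R.
Proof.
by rewrite /kW natr_sum; apply: eq_bigr => i _; rewrite !mxE /= (unsplitK (inr r)) mxE mulr1.
Qed.

(** On the boxes that matter, the face forms are near 0 and |k| is near L / d. *)
Definition tgt (L : R) : 'I_(dim_set tau + 1) -> R :=
 fun s => match fintype.split s with inl _ => 0 | inr _ => L / d end.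

Definition Q : R := (dim_set tau)%:R / e + p + 1.
Lemma Qpos : 0 < Q.
Proof.
rewrite /Q ltr_wpDl // addr_ge0 ?divr_ge0 ?invr_ge0 ?(ltW dpos) //.
exact/ltW/(pd_egt0 pdu).
Qed.

(** The slack controls the face forms through [gap_u], and |k| = (slack + level) / d. These dim + 1
    forms are independent, which leaves n - dim - 1 = m(f) - 1 powers of L. *)
Lemma forms_bound k lk L : (forall w, w \in A -> (lk <= npair k w)%N) ->
 \sum_s `|kW W k s - tgt L s| <= Q * (gapk k lk + `|lk%:R - L|).
Proof.
move=> h; rewrite big_split_ord /= big_ord1.
have g0 := gapk_ge0 h; have d0 := dpos; have p0 : 0 < p by rewrite invr_gt0.
have e0 := pd_egt0 pdu.
rewrite kW_r /tgt (unsplitK (inr ord0)).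
have h1 : \sum_(i < dim_set tau) `|kW W k (lshift 1 i) - tgt L (lshift 1 i)| <= (dim_set tau)%:R / e * gapk k lk.
 rewrite [leRHS](_ : _ = \sum_(i < dim_set tau) (gapk k lk / e)).
  by apply: ler_sum => i _; rewrite kW_l /tgt (unsplitK (inl i)) subr0 gapk_u.
 by rewrite sumr_const card_ord -mulr_natr; ring.
have h2 : `|(\sum_j k j)%:R - L / d| <= p * (gapk k lk + `|lk%:R - L|).
 rewrite (_ : _ - _ = p * (gapk k lk + (lk%:R - L))).
  rewrite normrM (gtr0_norm p0) ler_wpM2l ?(ltW p0) //.
  by apply: le_trans (ler_normD _ _) _; rewrite (ger0_norm g0).
 by rewrite /gapk; field; pos.
apply: le_trans (lerD h1 h2) _; rewrite /Q.
have z0 : 0 <= `|lk%:R - L| by [].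
have ez : 0 <= (dim_set tau)%:R / e by rewrite divr_ge0 // ltW.
by nra.
Qed.

(** Since |k| = (slack + level) / d, the volume e^-|k| splits into e^(-L/d), a decay in the slack,
    and a factor in level - L that [exp_tail] balances against the weight. *)
Lemma level_bound (M : nat) : p < M%:R -> exists2 c : R, 0 < c &
 forall k (lk : nat) L x v, v \in A -> npair k v = lk -> (forall w, w \in A -> (lk <= npair k w)%N) ->
 (forall j, expR (- (k j)%:R - 1) <= `|coord x j|) ->
 wt M L x * expR (- (\sum_j k j)%:R) <=
 expR (M%:R * Vm) * expR (- p * L) * expR (- c * (gapk k lk + `|lk%:R - L|)).
Proof.
move=> pM; have d0 := dpos; have p0 : 0 < p by rewrite invr_gt0.
exists (Num.min p (M%:R - p)); first by rewrite lt_min p0 subr_gt0.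
set c := Num.min _ _.
have cp : c <= p by rewrite ge_min lexx.
have cM : c <= M%:R - p by rewrite ge_min lexx orbT.
move=> k lk L x v vA kv h h1.
have W1 : wt M L x * expR (- (M%:R * Vm)) <= 1.
 rewrite expRN ler_pdivrMr // mul1r; apply: le_trans (wt_le1 _ _ _) _.
 by rewrite -[leLHS]expR0 ler_expR mulr_ge0 // ler0n.
have W2 : wt M L x * expR (- (M%:R * Vm)) <= expR (M%:R * (lk%:R - L)).
 by rewrite expRN ler_pdivrMr // mulrC -kv; exact: wt_box.
have W0 : 0 <= wt M L x * expR (- (M%:R * Vm)) by rewrite mulr_ge0 ?wt_ge0.
have key := exp_tail cp cM W0 W1 W2.
have g0 := gapk_ge0 h.
apply: (@le_trans _ _ (expR (M%:R * Vm) * expR (- p * L) * expR (- c * gapk k lk) * expR (- c * `|lk%:R - L|))); last first.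
 by rewrite -[leLHS]mulrA -[X in _ * X <= _]expRD -mulrDr.
apply: le_trans (ler_wpM2l _ key); last by [].
rewrite [leRHS](_ : _ = wt M L x * expR (M%:R * Vm - p * L - c * gapk k lk - p * (lk%:R - L) - M%:R * Vm)); last first.
 by rewrite !expRD -!mulNr; ring.
rewrite ler_wpM2l ?wt_ge0 // ler_expR.
have : (\sum_j k j)%:R = p * (gapk k lk + lk%:R) by rewrite /gapk subrK mulrC mulfK // lt0r_neq0.
by move=> ->; nra.
Qed.

Lemma estimate_principal (M : nat) : p < M%:R ->
 exists2 C : R, 0 < C & forall (L B : R) (u : V -> R), 1 <= L -> 0 <= B -> LC 1 [::] u ->
 (forall x, `|u x| <= B * wt M L x) ->
 `|int_Rn u| <= C * B * expR (- p * L) * L ^+ (mult_m f).-1.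
Proof.
move=> pM; have d0 := dpos; have p0 : 0 < p by rewrite invr_gt0.
have [c c0 hc] := level_bound pM; have Q0 := Qpos.
have cQ : 0 < c / Q by rewrite divr_gt0.
have fW W' : W' \in [:: W] -> row_full W' by rewrite inE => /eqP ->; exact: W_full.
have [C C0 hC] := dyadic_bound fW cQ (lexx 0) (ltW p0).
exists (C * expR (M%:R * Vm)); first pos.
move=> L B u L1 B0 lu uB; pose B' := B * expR (M%:R * Vm).
have B'0 : 0 <= B' by rewrite mulr_ge0.
have BB' : B <= B' by rewrite ler_peMr // -[leLHS]expR0 ler_expR mulr_ge0 // ler0n.
rewrite (_ : C * expR (M%:R * Vm) * B = C * B'); last by rewrite /B'; ring.
rewrite (_ : (mult_m f).-1 = (n - (dim_set tau + 1))%N); last by rewrite addn1 subnS.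
apply: (hC L B' (expR (- p * L)) (tgt L) u L1 B'0 (lexx _) lu).
 move=> x; apply: le_trans (uB x) _; rewrite mul0r expR0 mulr1.
 by apply: le_trans BB'; rewrite ler_piMr // wt_le1.
move=> k x h1 h2; have [v vA vmin] := argminA (npair k).
rewrite big_seq1 /B' -!mulrA.
apply: (@le_trans _ _ (B * (wt M L x * expR (- (\sum_j k j)%:R)))).
 by rewrite mulrA ler_wpM2r.
rewrite ler_wpM2l //; apply: le_trans (hc k _ L x v vA erefl vmin h1) _.
rewrite -mulrA ler_wpM2l // ler_wpM2l // ler_expR.
have := forms_bound L vmin.
rewrite !mulNr lerN2 mulrAC ler_pdivrMr // -mulrA => h; rewrite ler_wpM2l ?(ltW c0) //.
by rewrite mulrC.
Qed.

Lemma multE : (mult_m f).-1 = (n - (dim_set tau).+1)%N.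
Proof. by rewrite /mult_m subnS. Qed.

(** The factor min(1, t |x^v0|) suppresses boxes with <k, v0> well above L. If v0 lies in the span
    of the face directions and (1, ..., 1), then <k, v0> - L is of order L on the boxes that matter
    and a power of t is gained; otherwise <k, v0> is one more independent form and a logarithm is
    gained. *)
Lemma estimate_outside (M : nat) (v0 : mindex n) : p < M%:R -> v0 \in A -> (l < npair a v0)%N ->
 forall eps : R, 0 < eps -> exists2 L0 : R, 1 <= L0 &
 forall (L B : R) (u : V -> R), L0 <= L -> 0 <= B -> LC 1 [::] u ->
 (forall x, `|u x| <= B * Num.min 1 (expR L * `|monomial v0 x|) * wt M L x) ->
 `|int_Rn u| <= eps * B * expR (- p * L) * L ^+ (mult_m f).-1.
Proof.
move=> pM v0A lv0 eps eps0; have d0 := dpos; have p0 : 0 < p by rewrite invr_gt0.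
have [c c0 hc] := level_bound pM; have Q0 := Qpos.
have mn (z x : V) (L : R) : 0 <= Num.min 1 (expR L * `|monomial v0 x|).
 by [].
have mn1 (x : V) (L : R) : Num.min 1 (expR L * `|monomial v0 x|) <= 1 by rewrite ge_min lexx.
have mnk (k : mindex n) (x : V) (L : R) eta : 0 <= eta <= 1 -> (forall j, `|coord x j| <= expR (- (k j)%:R)) ->
  Num.min 1 (expR L * `|monomial v0 x|) <= expR (- eta * ((npair k v0)%:R - L)).
 move=> /andP[eta0 eta1] h2; have h3 : expR L * `|monomial v0 x| <= expR (L - (npair k v0)%:R).
  by rewrite expRD ler_wpM2l // mono_up.
 case: (lerP 0 ((npair k v0)%:R - L)) => z0.
  rewrite ge_min; apply/orP; right; apply: le_trans h3 _; rewrite ler_expR; nra.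
 by rewrite ge_min; apply/orP; left; rewrite -[leLHS]expR0 ler_expR; nra.
pose E := expR (M%:R * Vm); have E0 : 0 < E by exact: expR_gt0.
have E1 : 1 <= E by rewrite -[leLHS]expR0 ler_expR mulr_ge0 // ler0n.
have uE L B (u : V -> R) x : 0 <= B -> (forall x, `|u x| <= B * Num.min 1 (expR L * `|monomial v0 x|) * wt M L x) ->
  `|u x| <= B * E * expR (0 * L).
 move=> B0 uB; apply: le_trans (uB x) _; rewrite mul0r expR0 mulr1 -mulrA ler_wpM2l //.
 by apply: le_trans E1; rewrite mulr_ile1 ?wt_ge0 ?wt_le1 // mn.
have [vs|nvs] := boolP (mpoint R v0 <= col_mx U (const_mx 1 : 'rV_n))%MS.
 have [w hw] := submxP vs; pose w1 := lsubmx w; pose w2 := rsubmx w 0 0.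
 have vE k : (npair k v0)%:R = \sum_r w1 0 r * rpair (nr R k) (row r U) + w2 * (\sum_j k j)%:R.
  rewrite -rpair_nr hw -[w]hsubmxK mul_row_col [rsubmx w]mx11_scalar mul_scalar_mx rpairD rpairZ.
  congr (_ + _ * _); last first.
   by rewrite natr_sum; apply: eq_bigr => i _; rewrite /coord mxE mulr1.
  by rewrite mulmx_sum_row rpair_lin.
 (* Pairing with the normal [a] kills the face directions, and <a, v0> > l = d |a|. *)
 have w2d : d < w2.
  have := vE a; rewrite big1 ?add0r => [h|r _]; last by rewrite (normal_u NG pdu) mulr0.
  have a0 : 0 < (\sum_j a j)%:R :> R by rewrite ltr0n (normal_gt0 NG pdu).
  rewrite -(ltr_pM2r a0) -h mulrC natr_sum (normal_d NG pdu) ltr_nat //.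
 pose Qw := (\sum_r `|w1 0 r|) / e + (w2 - d) * p + 1.
 have e0 := pd_egt0 pdu.
 have Qw1 : 1 <= Qw.
  rewrite /Qw lerDr; apply: addr_ge0; first pos.
  nra.
 (* On the boxes that matter <k, v0> is near w2 L / d, which exceeds L by [del] L. *)
 pose del := (w2 - d) * p; have del0 : 0 < del by rewrite mulr_gt0 // subr_gt0.
 have low k lk L : (forall w, w \in A -> (lk <= npair k w)%N) ->
   del * L - Qw * (gapk k lk + `|lk%:R - L|) <= (npair k v0)%:R - L.
  move=> h; have g0 := gapk_ge0 h; rewrite vE.
  have s1 : - ((\sum_r `|w1 0 r|) / e * gapk k lk) <= \sum_r w1 0 r * rpair (nr R k) (row r U).
   rewrite lerNl; apply: le_trans (ler_norm _) _; rewrite normrN.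
   apply: le_trans (ler_norm_sum _ _ _) _; rewrite !mulr_suml; apply: ler_sum => r _.
   by rewrite normrM -mulrA ler_wpM2l // mulrC gapk_u.
  have s2 : (\sum_j k j)%:R = p * (gapk k lk + lk%:R) :> R.
   by rewrite /gapk subrK mulrC mulfK // lt0r_neq0.
  have s3 : L - `|lk%:R - L| <= lk%:R.
   by have := ler_norm (L - lk%:R); rewrite distrC; lra.
  have s4 : w2 * (\sum_j k j)%:R = del * (gapk k lk + lk%:R) + (gapk k lk + lk%:R).
   by rewrite s2 /del; field; pos.
  rewrite s4 /Qw -/del; set X := gapk k lk; set Y := `|_ - _|; set S := _ / e.
  rewrite -/X in g0 s1; rewrite -/Y in s3; rewrite -/S in s1.
  have Y0 : 0 <= Y by rewrite /Y normr_ge0.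
  have S0 : 0 <= S by rewrite divr_ge0 ?sumr_ge0 // ltW.
  nra.
 (* A fractional power of the extra factor is used, small enough for the error terms of [low] to
    consume at most half of the rate [c]. *)
 pose eta := Num.min 1 (c / (2 * Qw)).
 have eta0 : 0 < eta by rewrite lt_min ltr01 divr_gt0 // mulr_gt0 //; lra.
 have eta1 : eta <= 1 by rewrite ge_min lexx.
 have etac : eta * Qw <= c / 2.
  apply: (@le_trans _ _ (c / (2 * Qw) * Qw)); last by rewrite invfM mulrA mulfVK // gt_eqF //; lra.
  by rewrite ler_wpM2r ?ge_min ?lexx ?orbT //; lra.
 pose cq := c / 2 / Q; have cQ : 0 < cq by rewrite !divr_gt0.
 have fW W' : W' \in [:: W] -> row_full W' by rewrite inE => /eqP ->; exact: W_full.
 have ed0 : 0 < eta * del by rewrite mulr_gt0.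
 have [C C0 hC] := dyadic_bound fW cQ (lexx 0) (addr_ge0 (ltW p0) (ltW ed0)).
 exists (Num.max 1 (C * E / eps / (eta * del))); first by rewrite le_max lexx.
 move=> L B u; rewrite ge_max => /andP[L1 L2] B0 lu uB.
 have B'0 : 0 <= B * E by rewrite mulr_ge0 // ltW.
 have h := hC L (B * E) _ (tgt L) u L1 B'0 (lexx _) lu (fun x => uE L B u x B0 uB).
 have {}h : `|int_Rn u| <= C * (B * E) * expR (- (p + eta * del) * L) * L ^+ (mult_m f).-1.
  rewrite (_ : (mult_m f).-1 = (n - (dim_set tau + 1))%N); last by rewrite addn1 multE.
  apply: h => k x h1 h2; have [v vA vmin] := argminA (npair k).
  rewrite big_seq1.
  apply: (@le_trans _ _ (B * Num.min 1 (expR L * `|monomial v0 x|) * (wt M L x * expR (- (\sum_j k j)%:R)))).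
   by rewrite mulrA ler_wpM2r.
  rewrite -!mulrA ler_wpM2l //.
  apply: (@le_trans _ _ (expR (- eta * ((npair k v0)%:R - L)) * (E * expR (- p * L) *
    expR (- c * (gapk k (npair k v) + `|(npair k v)%:R - L|))))).
   apply: ler_pM; rewrite ?mn // ?mulr_ge0 ?wt_ge0 //.
    by apply: mnk => //; rewrite (ltW eta0).
   exact: (hc k _ L x v vA erefl vmin h1).
  rewrite [leLHS]mulrC -!mulrA ler_wpM2l ?(ltW E0) // -!expRD ler_expR.
  have h3 := low k _ L vmin; have h4 := forms_bound L vmin.
  have h5 : cq * \sum_s `|kW W k s - tgt L s| <= c / 2 * (gapk k (npair k v) + `|(npair k v)%:R - L|).
   apply: le_trans (ler_wpM2l (ltW cQ) h4) _.
   by rewrite mulrA /cq mulfVK ?lt0r_neq0.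
  have g0 := gapk_ge0 vmin.
  set X := gapk k _ + _ in h3 h5 *; have X0 : 0 <= X by rewrite addr_ge0.
  set T := \sum_s _ in h5 *; nra.
 apply: le_trans h _; rewrite ler_wpM2r ?exprn_ge0 //; first by lra.
 rewrite (_ : - (p + eta * del) * L = - p * L - eta * del * L); last by ring.
 rewrite expRD expRN; have X1 := expR_ge1Dx (eta * del * L).
 set X := expR (eta * del * L) in X1 *; have X0 : 0 < X by exact: expR_gt0.
 have ce : C * E / X <= eps.
  move: L2; rewrite ler_pdivrMr // ler_pdivrMr // ler_pdivrMr // => L2.
  apply: le_trans L2 _; rewrite mulrC ler_wpM2l ?(ltW eps0) //; lra.
 apply: (@le_trans _ _ (C * E / X * B * expR (- p * L))); first by apply: eqW; ring.
 by rewrite ler_wpM2r // ler_wpM2r.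
have fW W' : W' \in [:: (col_mx (col_mx U (const_mx 1 : 'rV_n)) (mpoint R v0))^T] -> row_full W'.
 rewrite inE => /eqP ->; rewrite /row_full mxrank_tr; apply: inj_row_free => w.
 rewrite -[w]hsubmxK mul_row_col [rsubmx w]mx11_scalar mul_scalar_mx.
 case: (eqVneq (rsubmx w 0 0) 0) => [->|w0].
  rewrite scale0r addr0 => /eqP; rewrite mulmx_free_eq0; last exact: (pd_free pdu).
  by move=> /eqP ->; rewrite raddf0 row_mx0.
 move=> /eqP; rewrite addrC addr_eq0 => /eqP h; case/negP: nvs.
 by rewrite -[mpoint R v0](scalerK w0) scalemx_sub // h -mulNmx submxMl.
pose tg L : 'I_(dim_set tau + 1 + 1) -> R := fun s => match fintype.split s with inl s' => tgt L s' | inr _ => L end.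
pose W' := (col_mx (col_mx U (const_mx 1 : 'rV_n)) (mpoint R v0))^T.
have forms2 k lk L : (forall w, w \in A -> (lk <= npair k w)%N) ->
  \sum_s `|kW W' k s - tg L s| <= Q * (gapk k lk + `|lk%:R - L|) + `|(npair k v0)%:R - L|.
 move=> h; rewrite big_split_ord /= big_ord1; apply: lerD.
  apply: le_trans (forms_bound L h); apply: eqW.
  apply: eq_bigr => s _; rewrite /tg (unsplitK (inl s)); congr (`|_ - _|).
  by apply: eq_bigr => i _; rewrite /W' !mxE (unsplitK (inl s)) !mxE.
 rewrite /tg (unsplitK (inr ord0)); apply: eqW; congr (`|_ - _|).
 rewrite /kW natr_sum; apply: eq_bigr => i _; rewrite /W' !mxE (unsplitK (inr ord0)) mxE natrM //.
(* With Y = |level - L| one has |<k, v0> - L| <= <k, v0> - L + 2 Y, so that 3 [c2] must fit into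
   [c]. *)
pose c2 := Num.min 1 (c / 3); have c20 : 0 < c2 by rewrite lt_min ltr01 divr_gt0.
pose c3 := c2 / (Q + 1); have c30 : 0 < c3 by rewrite divr_gt0 // addr_gt0.
have [C C0 hC] := dyadic_bound fW c30 (lexx 0) (ltW p0).
have n2 : (dim_set tau + 1 < n)%N.
 have /fW := mem_head W' [::]; rewrite /row_full => /eqP h.
 by have := rank_leq_row W'; rewrite h addn1.
exists (Num.max 1 (C * E / eps)); first by rewrite le_max lexx.
move=> L B u; rewrite ge_max => /andP[L1 L2] B0 lu uB.
have B'0 : 0 <= B * E by rewrite mulr_ge0 // ltW.
have h := hC L (B * E) _ (tg L) u L1 B'0 (lexx _) lu (fun x => uE L B u x B0 uB).
have {}h : `|int_Rn u| <= C * (B * E) * expR (- p * L) * L ^+ (n - (dim_set tau + 1 + 1)).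
 apply: h => k x h1 h2; have [v vA vmin] := argminA (npair k).
 rewrite big_seq1.
 apply: (@le_trans _ _ (B * Num.min 1 (expR L * `|monomial v0 x|) * (wt M L x * expR (- (\sum_j k j)%:R)))).
  by rewrite mulrA ler_wpM2r.
 rewrite -!mulrA ler_wpM2l //; have g0 := gapk_ge0 vmin.
 have h3 := hc k _ L x v vA erefl vmin h1; have h4 := forms2 k _ L vmin.
 have lv : (npair k v <= npair k v0)%N by exact: vmin.
 set X := gapk k _ in h3 h4 g0 *; set Y := `|(npair k v)%:R - L| in h3 h4 *.
 have Y0 : 0 <= Y by exact: normr_ge0.
 have c2c : 3 * c2 <= c by rewrite mulrC -ler_pdivlMr // /c2 ge_min lexx orbT.
 have c21 : c2 <= 1 by rewrite ge_min lexx.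
 have cE : c3 * \sum_s `|kW W' k s - tg L s| <= c2 * (X + Y + `|(npair k v0)%:R - L|).
  apply: le_trans (ler_wpM2l (ltW c30) h4) _.
  rewrite /c3 -[_ / _ * _]mulrA ler_wpM2l ?(ltW c20) // mulrC ler_pdivrMr; last pos.
  have Z0 : 0 <= `|(npair k v0)%:R - L| by exact: normr_ge0.
  nra.
 apply: (@le_trans _ _ (expR (- c2 * ((npair k v0)%:R - L + Y)) * expR (c2 * Y) * (E * expR (- p * L) * expR (- c * (X + Y))))).
  apply: ler_pM; rewrite ?mn // ?mulr_ge0 ?wt_ge0 //.
  rewrite -expRD (_ : - c2 * _ + _ = - c2 * ((npair k v0)%:R - L)); last by ring.
  by apply: mnk => //; rewrite (ltW c20).
 rewrite (mulrC _ (E * _ * _)) -!mulrA ler_wpM2l ?(ltW E0) // -!expRD ler_expR.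
 have Zb : `|(npair k v0)%:R - L| <= (npair k v0)%:R - L + 2 * Y.
  have : (npair k v)%:R - L <= (npair k v0)%:R - L by rewrite lerD2r ler_nat.
  have := ler_norm (L - (npair k v)%:R); rewrite distrC -/Y => y1 y2.
  by rewrite ler_norml; apply/andP; split; clear -y1 y2 Y0; lra.
 rewrite -/W'; set T := \sum_s _ in cE *.
 set N := `|_ - L| in cE Zb; nra.
apply: le_trans h _.
have -> : (mult_m f).-1 = (n - (dim_set tau + 1 + 1)).+1 by rewrite multE predn_sub2.
rewrite exprS [leRHS]mulrA; apply: ler_wpM2r; first by rewrite exprn_ge0 // (le_trans ler01).
rewrite (_ : C * (B * E) * _ = C * E * (B * expR (- p * L))); last by ring.
rewrite (_ : eps * B * _ * L = eps * L * (B * expR (- p * L))); last by ring.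
apply: ler_wpM2r; first pos.
by move: L2; rewrite ler_pdivrMr // => L2; rewrite (mulrC eps).
Qed.

End Principal.
End Estimates.

(** * Lower bound by counting boxes *)

Section Lower.
Variables (R : realType) (n : nat) (f : 'rV[R]_n -> R).
Local Notation V := 'rV[R]_n.
Variables (A : seq (mindex n)) (G : seq (mindex n * nat)).
Hypothesis NG : newton_gen f A G.

Local Notation d := (newton_dist f).
Local Notation tau := (principal_face f).
Variables (U : 'M[R]_(dim_set tau, n)) (a : mindex n) (l : nat) (e : R).
Hypothesis pdu : pdata U a l e.
Local Notation p := (d^-1).
Local Notation rk := (\rank (kermx (col_mx U (const_mx 1 : 'rV[R]_n))^T)).

(** The normal [a], scaled to level L and perturbed along [cmx], gives functionals of total size L /
    d with values at least L on [A]. Rounding them up yields about L^(m(f)-1) different boxes of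
    volume comparable to e^(-L/d), on which t m(x) is comparable to 1. *)
Lemma estimate_lower (del : R) : 0 < del -> exists c C2 : R, [/\ 0 < c, 0 < C2 & exists L0 : R,
 1 <= L0 /\ forall (L B : R) (u : V -> R), L0 <= L -> 0 <= B -> LC 1 [::] u -> (forall x, 0 <= u x) ->
 (forall x, (forall j, 0 < coord x j <= del) -> C2 * expR (- L) <= mm A x ->
   mm A x <= (size A)%:R * expR (- L) -> B <= u x) ->
 c * B * expR (- p * L) * L ^+ (mult_m f).-1 <= int_Rn u].
Proof.
move=> del0; have d0 := dpos NG; have p0 : 0 < p by rewrite invr_gt0.
have [eta eta0 heta] := normal_perturb NG pdu.
have nd := normal_d NG pdu.
have a0 : 0 < \sum_i nr R a i by rewrite -natr_sum ltr0n (normal_gt0 NG pdu).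
have l0 : 0 < l%:R :> R by rewrite -nd mulr_gt0.
(* Shifting every index by [K0] brings the boxes into the cube of size [del] and costs a constant
   factor of volume. *)
have [K0 hK0] : exists K0 : nat, expR (- K0%:R) <= del.
 exists (Num.truncn del^-1).+1; rewrite expRN -[leRHS]invrK lef_pV2 ?posrE ?expR_gt0 ?invr_gt0 //.
 have di : 0 <= del^-1 by rewrite invr_ge0 ltW.
 have /andP[_ h] := truncn_itv di; apply: le_trans (ltW h) _.
 by apply: le_trans (expR_ge1Dx _); rewrite lerDr.
pose pv := pinvmx (cmx U).
pose M0 := 1 + \sum_i \sum_r `|pv i r|.
have M00 : 0 < M0 by rewrite ltr_pwDl // sumr_ge0 // => i _; exact: sumr_ge0.
(* The spacing of the parameters: functionals with the same rounding differ by at most 1 in each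
   entry and [M0] dominates the pseudo-inverse of [cmx], so their parameters, being integers less
   than 1 apart, coincide. *)
pose D0 := 2 * M0; have D00 : 0 < D0 by rewrite mulr_gt0.
pose q := eta / (l%:R * D0); have q0 : 0 < q by rewrite divr_gt0 // mulr_gt0.
pose N1 : R := n%:R * (1 + K0%:R).
have N10 : 0 <= N1 by rewrite mulr_ge0 // addr_ge0.
exists (q ^+ (mult_m f).-1 * (8^-1 ^+ n * expR (- N1))), (expR (- (d * N1) - Vm R A)).
split; first by rewrite !mulr_gt0 ?exprn_gt0 // invr_gt0.
 exact: expR_gt0.
exists 1; split=> // L B u L1 B0 lu u0 uB.
have L0 : 0 < L by apply: lt_le_trans L1.
pose Qn := Num.truncn (q * L).
have qL0 : 0 <= q * L by rewrite mulr_ge0 // ltW.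
have /andP[Q1 Q2] := truncn_itv qL0.
pose s (g : {ffun 'I_rk -> 'I_Qn.+1}) r : R := l%:R * D0 * (g r)%:R / L.
have hs g r : `|s g r| <= eta.
 rewrite ger0_norm; last by rewrite divr_ge0 ?mulr_ge0 // ltW.
 rewrite /s ler_pdivrMr // (_ : eta * L = l%:R * D0 * (q * L)).
  apply: ler_wpM2l; first by rewrite mulr_ge0 // ltW.
  apply: (@le_trans _ _ Qn%:R) => //; by rewrite ler_nat -ltnS ltn_ord.
 by rewrite /q; field; rewrite !lt0r_neq0.
pose lam g i : R := L / l%:R * ((a i)%:R + \sum_r s g r * cmx U r i).
have lam0 g i : 0 <= lam g i.
 by rewrite mulr_ge0 ?divr_ge0 ?(ltW L0) ?(ltW l0) //; case: (heta (s g) (hs g)).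
have lamv g v : v \in A -> L <= rpair (lam g) (mpoint R v).
 move=> vA; have [_ /(_ v vA) h] := heta (s g) (hs g).
 rewrite (_ : rpair _ _ = L / l%:R * rpair (fun i => (a i)%:R + \sum_r s g r * cmx U r i) (mpoint R v)).
  by rewrite mulrAC ler_pdivlMr // ler_wpM2l // ltW.
 by rewrite mulr_sumr; apply: eq_bigr => i _; rewrite mulrA.
have lams g : \sum_i lam g i = L / d.
 rewrite -mulr_sumr big_split /= exchange_big /= [X in _ + X]big1 ?addr0.
  by rewrite -nd -/(\sum_i nr R a i); field; rewrite !lt0r_neq0.
 by move=> r _; rewrite -mulr_sumr cmx_sum mulr0.
pose k g : mindex n := [ffun i => ((Num.truncn (lam g i)).+1 + K0)%N].
have klo g i : lam g i + K0%:R <= (k g i)%:R.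
 by rewrite ffunE natrD lerD2r ltW //; case/andP: (truncn_itv (lam0 g i)).
have kup g i : (k g i)%:R <= lam g i + 1 + K0%:R.
 by rewrite ffunE natrD lerD2r -natr1 lerD2r; case/andP: (truncn_itv (lam0 g i)).
have kinj : injective k.
 move=> g g' kk; apply/ffunP => r; apply/val_inj.
 have bd i : `|lam g i - lam g' i| <= 1.
  have := klo g i; have := kup g i; have := klo g' i; have := kup g' i; rewrite kk => h1 h2 h3 h4.
  by rewrite ler_norml; apply/andP; split; clear -h1 h2 h3 h4; lra.
 have le i : lam g i - lam g' i = D0 * \sum_r ((g r)%:R - (g' r)%:R) * cmx U r i.
  rewrite /lam -mulrBr opprD addrACA subrr add0r -sumrB mulr_sumr mulr_sumr; apply: eq_bigr => r' _.
  by rewrite /s; field; rewrite !lt0r_neq0.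
 pose y : 'rV[R]_n := (\row_r ((g r)%:R - (g' r)%:R)) *m cmx U.
 have yb i : `|y 0 i| <= D0^-1.
  rewrite -(ler_pM2l D00) divff ?lt0r_neq0 // -{1}(gtr0_norm D00) -normrM.
  rewrite (_ : D0 * y 0 i = lam g i - lam g' i) // le; congr (_ * _).
  by rewrite mxE; apply: eq_bigr => r' _; rewrite mxE.
 have gr : (g r)%:R - (g' r)%:R = (y *m pv) 0 r.
  by rewrite /y -mulmxA mulmxVp ?cmx_free // mulmx1 mxE.
 have : `|(g r)%:R - (g' r)%:R| < 1 :> R.
  rewrite gr mxE; apply: le_lt_trans (ler_norm_sum _ _ _) _.
  apply: (@le_lt_trans _ _ (D0^-1 * \sum_i `|pv i r|)).
   by rewrite mulr_sumr; apply: ler_sum => i _; rewrite normrM ler_wpM2r.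
  rewrite mulrC ltr_pdivrMr // mul1r; apply: (@le_lt_trans _ _ M0); last by rewrite /D0; lra.
  rewrite /M0 -[leLHS]add0r lerD //; apply: ler_sum => i _.
  by rewrite [leRHS](bigD1 r) //= lerDl sumr_ge0.
 move=> h; apply/eqP; rewrite eqn_leq; apply/andP; split; rewrite leqNgt; apply/negP => hlt.
  by move: h; move: hlt; rewrite -(ler_nat R) -natr1 ltr_norml => h1 /andP[h2 h3]; clear -h1 h2 h3; lra.
 by move: h; move: hlt; rewrite -(ler_nat R) -natr1 ltr_norml => h1 /andP[h2 h3]; clear -h1 h2 h3; lra.
have ksum g : (\sum_i k g i)%:R <= L / d + N1 :> R.
 rewrite natr_sum -(lams g) (_ : N1 = \sum_(i < n) (1 + K0%:R)); last by rewrite sumr_const card_ord /N1 mulr_natl.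
 rewrite -big_split /=.
 by apply: ler_sum => i _; rewrite addrA.
pose S := [seq k g | g : {ffun 'I_rk -> 'I_Qn.+1}].
have uS : uniq S by rewrite map_inj_uniq ?enum_uniq.
have := box_lower uS B0 lu u0.
have hbox x kk : kk \in S -> (forall j, expR (- (kk j)%:R - 1) <= coord x j <= expR (- (kk j)%:R)) -> B <= u x.
 move=> /mapP[g _ ->] hx; have x0 j : 0 < coord x j by case/andP: (hx j) => h _; apply: lt_le_trans h; exact: expR_gt0.
 have nx j : `|coord x j| = coord x j by rewrite gtr0_norm.
 apply: uB => [j||].
 - rewrite x0 /=; case/andP: (hx j) => _ h; apply: le_trans h _; apply: le_trans hK0.
  by rewrite ler_expR lerN2 ler_nat ffunE leq_addl.
 - have [v vA vmin] := argminA NG (npair (k g)).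
  apply: le_trans (mm_ge x vA); apply: le_trans (mono_lo v (k := k g) _); last first.
   by move=> j; rewrite nx; case/andP: (hx j).
  have := gapk_ge0 NG vmin; rewrite /gapk subr_ge0 => h1.
  have h2 : (\sum_j k g j)%:R * d <= L + d * N1.
   apply: (@le_trans _ _ ((L / d + N1) * d)); first by rewrite ler_wpM2r ?ksum // ltW.
   by rewrite mulrDl mulfVK ?lt0r_neq0 // mulrC.
  have h3 : (\sum_j v j)%:R <= Vm R A by rewrite ler_nat (big_rem v) //= leq_addr.
  by rewrite -expRD ler_expR; lra.
 - rewrite /mm -sum1_size natr_sum mulr_suml big_seq [leRHS]big_seq; apply: ler_sum => v vA.
  apply: le_trans (mono_up v (k := k g) _) _.
   by move=> j; rewrite nx; case/andP: (hx j).
  rewrite mul1r ler_expR lerN2; apply: le_trans (lamv g v vA) _.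
  rewrite -rpair_nr; apply: ler_sum => i _; rewrite /coord mxE ler_wpM2r //.
  by apply: le_trans (klo g i); rewrite lerDl.
move=> /(_ hbox) h; apply: le_trans h.
set Z := 8^-1 ^+ n * expR (- N1) * expR (- p * L).
have Z0 : 0 <= Z by rewrite !mulr_ge0 ?exprn_ge0 ?invr_ge0 ?expR_ge0.
have term g : Z <= \prod_j (expR (- (k g j)%:R) / 8) :> R.
 rewrite big_split /= prodr_const card_ord /Z -mulrA [leRHS]mulrC ler_wpM2l ?exprn_ge0 ?invr_ge0 //.
 rewrite -expRD -expR_sum ler_expR sumrN -natr_sum; have := ksum g; rewrite (mulrC L); lra.
have reord (z0 z1 z2 z3 z4 z5 : R) : z0 * (z1 * z2) * z3 * z4 * z5 = z3 * (z1 * z2 * z4 * (z0 * z5)) by ring.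
have -> : q ^+ (mult_m f).-1 * (8^-1 ^+ n * expR (- N1)) * B * expR (- p * L) * L ^+ (mult_m f).-1 = B * (Z * (q * L) ^+ (mult_m f).-1).
 by rewrite (exprMn _ q L) reord.
rewrite ler_wpM2l // big_map.
apply: (@le_trans _ _ (\sum_(g <- enum {ffun 'I_rk -> 'I_Qn.+1}) Z)); last by apply: ler_sum => g _; exact: term.
rewrite big_enum /= sumr_const card_ffun !card_ord -[leRHS]mulr_natr natrX ler_wpM2l //.
rewrite (cmx_rank pdu) -multE; apply: lerXn2r; rewrite ?nnegrE //.
exact: ltW.
Qed.

End Lower.

(** * Euler fields *)

Section Euler.
Variables (R : realType) (n : nat).
Local Notation V := 'rV[R]_n.
Implicit Types (g h : V -> R) (i : 'I_n).

Definition eul i g : V -> R := fun x => coord x i * partial i g x.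

Lemma sm_eul i g : sm g -> sm (eul i g).
Proof. by move=> sg; apply: sm_mul; smooth. Qed.

Lemma eul_cst i c : eul i (fun=> c) = (fun=> 0).
Proof. by apply/funext => x; rewrite /eul pd_cst mulr0. Qed.

Lemma eul_add i g h : sm g -> sm h -> eul i (fun x => g x + h x) = (fun x => eul i g x + eul i h x).
Proof. by move=> sg sh; apply/funext => x; rewrite /eul pd_add // mulrDr. Qed.

Lemma eul_mul i g h : sm g -> sm h ->
 eul i (fun x => g x * h x) = (fun x => eul i g x * h x + g x * eul i h x).
Proof. by move=> sg sh; apply/funext => x; rewrite /eul pd_mul //; ring. Qed.

Lemma eul_inv i g : sm g -> (forall x, g x != 0) ->
 eul i (fun x => (g x)^-1) = (fun x => (- eul i g x) * ((g x)^-1 * (g x)^-1)).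
Proof. by move=> sg g0; apply/funext => x; rewrite /eul pd_inv // expr2; ring. Qed.

Lemma eul_monomial i a : eul i (@monomial R n a) = (fun x => (a i)%:R * monomial a x).
Proof. by apply/funext => x; rewrite /eul pd_monomial. Qed.

Lemma supB_eul K i g : supB K g -> supB K (eul i g).
Proof. by move=> sg j x Kx; rewrite /eul (supB_partial i sg Kx) mulr0. Qed.

Lemma supB_mul K g h : supB K g -> supB K (fun x => g x * h x).
Proof. by move=> sg j x Kx; rewrite (sg j x Kx) mul0r. Qed.

(** The transpose of x_i d_i is -(1 + x_i d_i), seen by integrating d_i (x_i g h). *)
Lemma int_Rn_eul K i g h : 0 <= K -> sm g -> sm h -> supB K g ->
 int_Rn (fun x => g x * eul i h x) = int_Rn (fun x => - (g x + eul i g x) * h x).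
Proof.
move=> K0 sg sh sK.
have s1 : sm (fun x => coord x i * g x * h x).
 smooth.
have k1 : supB K (fun x => coord x i * g x * h x).
 by move=> j x Kx; rewrite (sK j x Kx) mulr0 mul0r.
have := int_Rn_partial i K0 s1 k1.
rewrite (_ : partial i _ = (fun x => 1 * (g x * eul i h x) + (- 1) * (- (g x + eul i g x) * h x))).
 rewrite (int_Rn_lin K0) ?mul1r ?mulN1r => [/subr0_eq //||].
  apply: sm_LC; last by apply: supB_mul.
  by apply: sm_mul => //; exact: sm_eul.
 apply: sm_LC.
  by apply: sm_mul => //; apply: sm_opp; apply: sm_add => //; exact: sm_eul.
 by move=> j x Kx; rewrite (sK j x Kx) (supB_eul i sK Kx) addr0 oppr0 mul0r.
apply/funext => x; rewrite pd_mul //; last by apply: sm_mul => //; smooth.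
by rewrite pd_mul ?pd_coord ?eqxx //=; [rewrite /eul; ring|exact: sm_coord].
Qed.

Lemma int_Rn_add K g h : 0 <= K -> LC K [::] g -> LC K [::] h ->
 int_Rn (fun x => g x + h x) = int_Rn g + int_Rn h.
Proof.
move=> K0 lg lh; have := int_Rn_lin K0 1 1 lg lh; rewrite !mul1r => <-.
by congr int_Rn; apply/funext => x; lra.
Qed.

Lemma int_Rn_sum K (I : Type) (r : seq I) (G : I -> V -> R) : 0 <= K -> (forall k, LC K [::] (G k)) ->
 LC K [::] (fun x => \sum_(k <- r) G k x) /\
 int_Rn (fun x => \sum_(k <- r) G k x) = \sum_(k <- r) int_Rn (G k).
Proof.
move=> K0 lG; elim: r => [|k r [ih1 ih2]].
 under eq_fun do rewrite big_nil; rewrite big_nil; split; last exact: int_Rn0.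
 by split=> [|//]; exists 0 => x y; rewrite subrr normr0 mul0r.
under eq_fun do rewrite big_cons; rewrite big_cons; split; last by rewrite (int_Rn_add K0) // ih2.
have := LC_lin 1 1 (lG k) ih1; rewrite (_ : (fun x => _) = (fun x => G k x + \sum_(j <- r) G j x)) //.
by apply/funext => x; lra.
Qed.

End Euler.
#[export] Hint Resolve sm_eul : smooth.

(** * Symbol classes for the Euler fields *)

Section Symbols.
Variables (R : realType) (n : nat) (rho : R).
Local Notation V := 'rV[R]_n.
Implicit Types (u v w : R -> V -> R) (i : 'I_n).

Definition inbox (x : V) := forall i, `|coord x i| <= rho.
Local Notation dom u w := (exists2 C : R, 0 <= C & forall L x, 1 <= L -> inbox x -> `|u L x| <= C * w L x).

(** A symbol class: Euler derivatives up to order k obey the same kind of bound as u, uniformly for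
    L >= 1. Unlike plain derivatives, Euler fields do not spoil bounds by monomials. *)
Fixpoint sym k w u : Prop :=
 [/\ forall L, sm (u L),
   dom u w &
   if k is k'.+1 then forall i, sym k' w (fun L => eul i (u L)) else True].

Lemma sym_sm k w u L : sym k w u -> sm (u L). Proof. by case: k => [|k] []. Qed.

Lemma sym_bound k w u : sym k w u ->
 dom u w.
Proof. by case: k => [|k] []. Qed.

Lemma sym_eul k w u i : sym k.+1 w u -> sym k w (fun L => eul i (u L)).
Proof. by case=> _ _ h; exact: h. Qed.

Lemma sym_pred k w u : sym k.+1 w u -> sym k w u.
Proof.
elim: k u => [|k ih] u [h1 h2 h3]; first by split.
by split=> // i; apply: ih; exact: h3.
Qed.

Lemma sym_ext k w u u' : (forall L, u L = u' L) -> sym k w u -> sym k w u'.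
Proof. by move=> e; rewrite (_ : u = u') //; apply/funext. Qed.

Lemma sym_weight k w w' u : (exists2 C : R, 0 <= C & forall L x, 1 <= L -> inbox x -> w L x <= C * w' L x) ->
 sym k w u -> sym k w' u.
Proof.
move=> [C C0 hC]; have b u1 : (dom u1 w) ->
  dom u1 w'.
 move=> [C' C'0 h]; exists (C' * C); first exact: mulr_ge0.
 by move=> L x L1 bx; apply: le_trans (h L x L1 bx) _; rewrite -mulrA ler_wpM2l // hC.
elim: k u => [|k ih] u [h1 h2 h3]; split=> //; auto.
by move=> i; apply: ih; exact: h3.
Qed.

Lemma sym_add k w u v : sym k w u -> sym k w v -> sym k w (fun L x => u L x + v L x).
Proof.
elim: k u v => [|k ih] u v [h1 [C1 C10 h2] h3] [k1 [C2 C20 k2] k3]; split=> //;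
 try (smooth); try (exists (C1 + C2); first exact: addr_ge0;
 by move=> L x L1 bx; rewrite mulrDl; apply: le_trans (ler_normD _ _) _; apply: lerD; [exact: h2|exact: k2]).
move=> i; apply: (sym_ext (u := fun L x => eul i (u L) x + eul i (v L) x)); last by apply: ih; [exact: h3|exact: k3].
by move=> L; rewrite eul_add.
Qed.

Lemma sym_mul k w1 w2 u v : sym k w1 u -> sym k w2 v ->
 sym k (fun L x => w1 L x * w2 L x) (fun L x => u L x * v L x).
Proof.
have b u1 v1 : (dom u1 w1) ->
  (dom v1 w2) ->
  dom (fun L x => u1 L x * v1 L x) (fun L x => w1 L x * w2 L x).
 move=> [C1 C10 h1] [C2 C20 h2]; exists (C1 * C2); first exact: mulr_ge0.
 move=> L x L1 bx; rewrite normrM mulrACA; apply: ler_pM => //; auto.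
elim: k u v => [|k ih] u v hu hv; have [h1 h2 h3] := hu; have [k1 k2 k3] := hv.
 by split=> // [L|]; smooth.
split=> [L||i]; [exact: sm_mul|exact: b|].
apply: (sym_ext (u := fun L x => eul i (u L) x * v L x + u L x * eul i (v L) x)).
 by move=> L; rewrite eul_mul.
by apply: sym_add; apply: ih; [exact: h3|exact: sym_pred|exact: sym_pred|exact: k3].
Qed.

Lemma sym_scalar k (h : R -> R) : sym k (fun L _ => `|h L|) (fun L _ => h L).
Proof.
have b : forall h : R -> R, exists2 C : R, 0 <= C & forall L (x : V), 1 <= L -> inbox x -> `|h L| <= C * `|h L|.
 by move=> h'; exists 1 => // L x _ _; lra.
case: k => [|k]; split=> //; try (smooth).
move=> i; apply: (sym_ext (u := fun _ _ => 0)); first by move=> L; rewrite eul_cst.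
elim: k => [|k ih]; split=> //; try (smooth);
 try (by exists 1 => // L x _ _; rewrite normr0 mul1r).
by move=> j; apply: sym_ext ih => L; rewrite eul_cst.
Qed.

Lemma sym_cst k c : sym k (fun _ _ => 1) (fun _ _ => c).
Proof.
apply: sym_weight (sym_scalar k (fun=> c)); exists `|c| => // L x _ _; lra.
Qed.

Lemma sym_scale k w u c : sym k w u -> sym k w (fun L x => c * u L x).
Proof.
move=> hu; have := sym_mul (sym_cst k c) hu; apply: sym_weight.
by exists 1 => // L x _ _; by [].
Qed.

Lemma sym_opp k w u : sym k w u -> sym k w (fun L x => - u L x).
Proof.
by move=> /(sym_scale (-1)); apply: sym_ext => L; apply/funext => x; lra.
Qed.

Lemma sym_sum k w (I : Type) (r : seq I) (u : I -> R -> V -> R) : (forall L x, 0 <= w L x) ->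
 (forall j, sym k w (u j)) -> sym k w (fun L x => \sum_(j <- r) u j L x).
Proof.
move=> w0 hu; elim: r => [|j r ih].
 apply: (sym_ext (u := fun _ _ => 0)); first by move=> L; apply/funext => x; rewrite big_nil.
 by apply: sym_weight (sym_scalar k (fun=> 0)); exists 0 => // L x _ _; rewrite normr0 mul0r.
apply: (sym_ext (u := fun L x => u j L x + \sum_(j <- r) u j L x)); last exact: sym_add.
by move=> L; apply/funext => x; rewrite big_cons.
Qed.

Lemma sym_static k (g : V -> R) : sm g -> sym k (fun _ _ => 1) (fun=> g).
Proof.
have b : forall g : V -> R, sm g -> exists2 C : R, 0 <= C & forall (L : R) x, 1 <= L -> inbox x -> `|g x| <= C * 1.
 move=> h sh; have [B B0 hB] := bounded_box rho (sm_continuous sh).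
 by exists B => // L x _ bx; rewrite mulr1 hB.
by elim: k g => [|k ih] g sg; split=> //; smooth.
Qed.

Lemma sym_monomial k b : sym k (fun _ x => `|monomial b x|) (fun _ => @monomial R n b).
Proof.
elim: k => [|k ih]; split=> //; try (smooth);
 try (by exists 1 => // L x _ _; rewrite mul1r).
by move=> i; apply: sym_ext (sym_scale (b i)%:R ih) => L; rewrite eul_monomial.
Qed.

(** E (1/g) = -(E g) / g^2, where E g is of size w and w / g is bounded; the product rule carries
    the induction on k. *)
Lemma sym_inv k w g : (forall L x, 0 < g L x) -> (forall L x, 0 <= w L x) ->
 (exists2 C : R, 0 <= C & forall L x, 1 <= L -> inbox x -> w L x * (g L x)^-1 <= C) ->
 sym k w g -> sym k (fun L x => (g L x)^-1) (fun L x => (g L x)^-1).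
Proof.
move=> g0 w0 [C C0 wg]; have gn L x : g L x != 0 by rewrite gt_eqF.
have gi L x : 0 <= (g L x)^-1 by rewrite invr_ge0 ltW.
elim: k => [|k ih] hg; have [h1 h2 h3] := hg.
 split=> // [L|]; first exact: sm_inv.
 by exists 1 => // L x _ _; rewrite mul1r ger0_norm.
split=> [L||i]; first exact: sm_inv.
 by exists 1 => // L x _ _; rewrite mul1r ger0_norm.
apply: (sym_ext (u := fun L x => (- eul i (g L) x) * ((g L x)^-1 * (g L x)^-1))).
 by move=> L; rewrite eul_inv.
have hi := ih (sym_pred hg).
apply: sym_weight (sym_mul (sym_opp (h3 i)) (sym_mul hi hi)).
exists C => // L x L1 bx; rewrite mulrA ler_wpM2r //; exact: wg.
Qed.

End Symbols.

(** * Repeated integration by parts *)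

Section Parts.
Variables (R : realType) (n : nat) (rho : R) (A : seq (mindex n)) (f : 'rV[R]_n -> R).
Local Notation V := 'rV[R]_n.
Hypotheses (rho0 : 0 <= rho) (smf : sm f) (fsym : forall k, sym rho k (fun _ => @mm R n A) (fun=> f)).
Variable c : R.
Hypotheses (c0 : 0 < c) (ndg : forall x, inbox rho x -> c * @mm R n A x ^+ 2 <= \sum_i eul i f x ^+ 2).
(** [kap j.+1] is a bounded primitive of [kap j]; M primitives allow M integrations by parts. The
    trigonometric functions and the Laplace kernels are the two instances. *)
Variables (kap : nat -> R -> R) (M : nat) (B : R).
Hypotheses (kapS : forall j, csm (kap j)) (kapD : forall j (r : R), (j < M)%N -> is_derive r 1 (kap j.+1) (kap j r))
 (B0 : 0 <= B) (kapB : forall j r, (j <= M)%N -> `|kap j r| <= B).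
Local Notation m := (@mm R n A).
Local Notation S := (fun x : V => \sum_i eul i f x ^+ 2).
Local Notation g := (fun (L : R) (x : V) => 1 + expR L ^+ 2 * S x).

Let m0 x : 0 <= m x. Proof. exact: mm_ge0. Qed.
Let S0 x : 0 <= S x. Proof. by apply: sumr_ge0 => i _; by []. Qed.
Let g1 L x : 1 <= g L x. Proof. by rewrite lerDl mulr_ge0. Qed.
Let g0 L x : 0 < g L x. Proof. exact: lt_le_trans (g1 L x). Qed.
Let sF i : sm (eul i f). Proof. exact: sm_eul. Qed.
Let sS : sm S. Proof. by apply: sm_sum => i _; exact: sm_exp. Qed.

Let symF k i : sym rho k (fun _ => m) (fun=> eul i f).
Proof. exact: (sym_eul (u := fun=> f) i (fsym k.+1)). Qed.

(** 1 + t^2 S is bounded above by a multiple of 1 + t^2 m^2 and, by nondegeneracy, also below;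
    finally (1 + t m)^2 <= 2 (1 + t^2 m^2). *)
Lemma sym_ginv k : sym rho k (fun L x => (1 + expR L * m x)^-1 ^+ 2) (fun L x => (g L x)^-1).
Proof.
have hg : sym rho k (fun L x => 1 + expR L ^+ 2 * m x ^+ 2) g.
 have w1 : forall L x, 0 <= expR L ^+ 2 * m x ^+ 2 by move=> L x; rewrite mulr_ge0 ?sqr_ge0.
 apply: sym_add.
  by apply: sym_weight (sym_cst n rho k 1); exists 1 => // L x _ _; rewrite mul1r lerDl.
 have h := sym_mul (sym_scalar n rho k (fun L => expR L ^+ 2)) (sym_sum (index_enum 'I_n) (w := fun _ x => m x * m x) _
   (fun i => sym_mul (symF k i) (symF k i))).
 apply: (sym_ext (u := fun L x => expR L ^+ 2 * \sum_i eul i f x * eul i f x)).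
  by [].
 apply: sym_weight (h _) => [|L x]; last pos.
 exists 1 => // L x _ _; rewrite mul1r ger0_norm ?sqr_ge0 // -expr2 lerDr //.
have w0 L x : 0 <= 1 + expR L ^+ 2 * m x ^+ 2 by rewrite addr_ge0 ?mulr_ge0 ?sqr_ge0.
have hcmp : exists2 C : R, 0 <= C & forall L x, 1 <= L -> inbox rho x -> (1 + expR L ^+ 2 * m x ^+ 2) * (g L x)^-1 <= C.
 exists (1 + c^-1); first pos.
 move=> L x _ /ndg h; rewrite ler_pdivrMr // [leRHS]mulrDl mul1r; apply: lerD; auto.
 rewrite mulrDr mulr1; apply: ler_wpDl; first pos.
 rewrite [leRHS]mulrCA; apply: ler_wpM2l; auto.
 by rewrite mulrC ler_pdivlMr // mulrC.
apply: sym_weight (sym_inv g0 w0 hcmp hg).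
have [C C0 hC] := hcmp; exists (2 * C); first exact: mulr_ge0.
move=> L x L1 bx; have h1 := hC L x L1 bx.
have t0 : 0 <= expR L * m x by rewrite mulr_ge0 ?expR_ge0.
set y := expR L * m x in t0 *.
have yE : expR L ^+ 2 * m x ^+ 2 = y ^+ 2 by rewrite exprMn.
rewrite yE in h1; rewrite exprVn ler_pdivlMr; last by pos; lra.
apply: le_trans (ler_wpM2l (_ : 0 <= 2) h1) => //.
rewrite [leLHS]mulrC mulrA; apply: ler_wpM2r; first pos.
have := sqr_ge0 (1 - y); nra.
Qed.

(** Write 1 = 1/g + sum_i (t E_i f)(t E_i f / g) with g = 1 + t^2 S. The first term gains a factor
    (1 + t m)^-1 outright; in the others (t E_i f) kap_j(t f) = E_i (kap_(j+1)(t f)) is integrated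
    by parts with the same gain. The bound [b] is left abstract so that any estimate for weighted
    integrals can be plugged in. *)
Lemma parts k j (w u : R -> V -> R) : (j + k <= M)%N -> (forall L x, 0 <= w L x) -> sym rho k w u ->
 (forall L, supB rho (u L)) ->
 exists2 C : R, 0 <= C & forall L b, 1 <= L ->
  (forall (u' : V -> R) B', 0 <= B' -> sm u' -> supB rho u' ->
   (forall x, `|u' x| <= B' * (w L x * wt A k L x)) -> `|int_Rn u'| <= B' * b) ->
  `|int_Rn (fun x => u L x * kap j (expR L * f x))| <= C * b.
Proof.
have sk j' L : sm (fun x => kap j' (expR L * f x)).
 by apply: sm_comp => //; smooth.
have wt0' k' L x : 0 <= wt A k' L x by exact: wt_ge0.
elim: k j w u => [|k ih] j w u jk w0 su bu; last have jM : (j < M)%N by rewrite (leq_trans _ jk) // addnS ltnS leq_addr.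
 have [C C0 hC] := sym_bound su; exists (C * B); first exact: mulr_ge0.
 move=> L b L1; apply=> //.
 - pos.
 - by apply: sm_mul => //; exact: sym_sm su.
 - exact: supB_mul.
 move=> x; rewrite /wt expr0 mulr1 normrM.
 have [bx|->] := box_or_zero x (bu L).
  rewrite mulrAC; apply: ler_pM => //; [exact: hC|apply: kapB].
  by rewrite -(addn0 j).

 by rewrite normr0 mul0r !mulr_ge0.
pose w1 L x := w L x * (1 + expR L * m x)^-1.
have pos1 L x : 0 <= expR L * m x by rewrite mulr_ge0 ?expR_ge0.
have inv0 L x : 0 <= (1 + expR L * m x)^-1 by rewrite invr_ge0 addr_ge0.
have inv1 L x : (1 + expR L * m x)^-1 <= 1 by rewrite invf_le1 ?lerDl // ltr_pwDl.
have w10 L x : 0 <= w1 L x by rewrite mulr_ge0.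
have sgi L : sm (fun x => (g L x)^-1).
 apply: sm_inv => [|x]; last pos.
 smooth.
have su' L : sm (u L) by exact: sym_sm su.
pose u0 L x := u L x * (g L x)^-1.
pose v i (L : R) x := u L x * (expR L * (eul i f x * (g L x)^-1)).
have symu0 : sym rho k w1 u0.
 apply: sym_weight (sym_mul (sym_pred su) (sym_ginv k)); exists 1 => // L x _ _.
 by rewrite mul1r ler_wpM2l // expr2 ler_piMl.
have symv i : sym rho k.+1 w1 (v i).
 apply: sym_weight (sym_mul su (sym_mul (sym_scalar n rho k.+1 (fun L => expR L)) (sym_mul (symF k.+1 i) (sym_ginv k.+1)))).
 exists 1 => // L x _ _; rewrite mul1r ler_wpM2l // ger0_norm ?expR_ge0 // expr2 !mulrA ler_piMl //.
 by rewrite ler_pdivrMr ?mul1r ?lerDr // ltr_pwDl.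
have supv i L : supB rho (v i L) by exact: supB_mul.
have smv i L : sm (v i L) by exact: sym_sm (symv i).
pose u1 i (L : R) x := - (v i L x + eul i (v i L) x).
have symu1 i : sym rho k w1 (u1 i).
 by apply: sym_opp; apply: sym_add; [exact: sym_pred|exact: (sym_eul i (symv i))].
have supu1 i L : supB rho (u1 i L).
 by move=> j' x Kx; rewrite /u1 (supv i L j' x Kx) (supB_eul i (supv i L) Kx) addr0 oppr0.
have jk' : (j + k <= M)%N by apply: leq_trans jk; rewrite addnS.
have [C0' C00 h0] := ih j w1 u0 jk' w10 symu0 (fun L => supB_mul _ (bu L)).
have /choice[C1 hC1] i : exists C1 : R, 0 <= C1 /\ forall L b, 1 <= L ->
  (forall (u' : V -> R) B', 0 <= B' -> sm u' -> supB rho u' ->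
   (forall x, `|u' x| <= B' * (w1 L x * wt A k L x)) -> `|int_Rn u'| <= B' * b) ->
  `|int_Rn (fun x => u1 i L x * kap j.+1 (expR L * f x))| <= C1 * b.
 have [|C1 C10 h1] := ih j.+1 w1 (u1 i) _ w10 (symu1 i) (supu1 i); first by rewrite addSnnS.
 by exists C1.
exists (C0' + \sum_i C1 i); first by rewrite addr_ge0 // sumr_ge0 // => i _; case: (hC1 i).
move=> L b L1 hb.
have hb' : forall (u' : V -> R) B', 0 <= B' -> sm u' -> supB rho u' ->
   (forall x, `|u' x| <= B' * (w1 L x * wt A k L x)) -> `|int_Rn u'| <= B' * b.
 move=> u' B' B'0 s1 s2 h; apply: hb => // x; have := h x; by rewrite /w1 /wt exprS -!mulrA.
have s0 : sm (fun x => u0 L x * kap j (expR L * f x)) by apply: sm_mul => //; apply: sm_mul.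
have b0' : supB rho (fun x => u0 L x * kap j (expR L * f x)) by apply: supB_mul; apply: supB_mul.
have s1 i : sm (fun x => v i L x * eul i (fun x => kap j.+1 (expR L * f x)) x).
 smooth.
have b1 i : supB rho (fun x => v i L x * eul i (fun x => kap j.+1 (expR L * f x)) x) by exact: supB_mul.
have eulk i x : eul i (fun x => kap j.+1 (expR L * f x)) x = expR L * eul i f x * kap j (expR L * f x).
 rewrite /eul (pd_comp (p := kap j.+1) (g := fun x => expR L * f x) i (kapD _ jM)); last first.
  smooth.
 by rewrite pd_scale //; ring.
rewrite (_ : (fun x => _) = (fun x => u0 L x * kap j (expR L * f x) +
  \sum_i v i L x * eul i (fun x => kap j.+1 (expR L * f x)) x)); last first.
 apply/funext => x; under eq_bigr => i _.
  rewrite eulk /v (_ : _ * _ = u L x * (g L x)^-1 * kap j (expR L * f x) * expR L ^+ 2 * eul i f x ^+ 2); last by ring.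
  over.
 rewrite -mulr_sumr /u0; have := g0 L x; set Sx := \sum_i _ => /lt0r_neq0 gn.
 by field.
have [l1 l2] := int_Rn_sum (index_enum 'I_n) rho0 (fun i => sm_LC (s1 i) (b1 i)).
rewrite (int_Rn_add rho0 (sm_LC s0 b0')) // l2 mulrDl mulr_suml.
apply: le_trans (ler_normD _ _) _; apply: lerD; auto.
apply: le_trans (ler_norm_sum _ _ _) _; apply: ler_sum => i _.
by rewrite (int_Rn_eul i rho0) //; case: (hC1 i) => _; apply.
Qed.

End Parts.

(** * Integrals over the unit segment *)

Section Segment.
Variable R : realType.
Local Notation mu := (@lebesgue_measure R).
Implicit Types F G H : R -> R.

Definition seg F : R := \int[mu]_(s in `[0%R, 1%R]) F s.

Let seg_integrable F : continuous F -> mu.-integrable `[0%R, 1%R] (EFin \o F).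
Proof.
move=> cF; apply: continuous_compact_integrable; first exact: segment_compact.
exact: continuous_subspaceT.
Qed.

Lemma segZ F c : continuous F -> seg (fun s => c * F s) = c * seg F.
Proof. by move=> cF; rewrite /seg RintegralZl //; auto. Qed.

Lemma seg_lin F G H t : continuous F -> continuous G -> continuous H ->
 seg F - seg G - t * seg H = seg (fun s => F s - G s - t * H s).
Proof.
move=> cF cG cH.
have cZ c (K : R -> R) : continuous K -> continuous (fun s : R => c * K s).
 by move=> cK s; apply: cvgM; [exact: cvg_cst|exact: cK].
have cD (K K' : R -> R) : continuous K -> continuous K' -> continuous (fun s : R => K s + K' s).
 by move=> cK cK' s; apply: cvgD; [exact: cK|exact: cK'].
rewrite (_ : (fun s => _) = (fun s => (F s + -1 * G s) + (- t) * H s)); last by apply/funext => s; ring.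
rewrite /seg RintegralD //; try auto.
rewrite RintegralD //; try auto.
by rewrite !RintegralZl //; try exact: seg_integrable; ring.
Qed.

Lemma seg_bound F C : continuous F -> (forall s, 0 <= s <= 1 -> `|F s| <= C) -> `|seg F| <= C.
Proof.
move=> cF FC; apply: le_trans (le_normr_Rintegral _ (seg_integrable cF)) _ => //.
have iC : mu.-integrable `[0%R, 1%R] (EFin \o cst C) by apply: seg_integrable => ?; exact: cst_continuous.
have iF : mu.-integrable `[0%R, 1%R] (EFin \o (fun s => `|F s|)).
 by have := integrable_abse (seg_integrable cF).
have := @le_Rintegral _ _ _ mu `[0%R, 1%R]%classic (fun s => `|F s|) (cst C) _ iF iC.
rewrite Rintegral_cst //= lebesgue_measure_itv /= lte_fin ltr01 sube0 /= mulr1; apply=> //.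
Qed.

Lemma seg_FTC F F' : continuous F' -> (forall u : R, is_derive u 1 F (F' u)) -> seg F' = F 1 - F 0.
Proof.
move=> cF' dF; have cF : continuous F.
 by move=> u; apply: differentiable_continuous; apply/derivable1_diffP; auto.
rewrite /seg /Rintegral (@continuous_FTC2 _ F' F) //.
- exact: continuous_subspaceT.
- split.
 + by [].
 + by apply: cvg_at_right_filter; exact: cF.
 + by apply: cvg_at_left_filter; exact: cF.
- by move=> u _; rewrite derive1E; case: (dF u).
Qed.

End Segment.

(** * Hadamard quotients *)

Section Hadamard.
Variables (R : realType) (n : nat).
Local Notation V := 'rV[R]_n.
Implicit Types (g h : V -> R) (i j : 'I_n) (x y : V).

(** A family closed under partial derivatives proves all its members smooth at once, so that a
    parameter integral has to be differentiated only once, in general form. *)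
Lemma sm_family (F : (V -> R) -> Prop) g :
 (forall g, F g -> continuous g /\ forall i, exists dg, F dg /\ forall x, is_derive x (evec R i) g (dg x)) ->
 F g -> sm g.
Proof.
move=> HF Fg; apply: Sm => s.
have Fs : F (iter_partial s g).
 elim: s => [//|i s ih] /=; have [_ /(_ i)[dg [Fdg hd]]] := HF _ ih.
 by rewrite (_ : partial i _ = dg) //; apply/funext => x; exact: pd_val.
move=> x _; have [c hd] := HF _ Fs; split; first exact: c.
by move=> i; have [dg [_ /(_ x) h]] := hd i; case: h.
Qed.

Lemma sm_quad g i K : sm g -> exists2 C : R, 0 <= C & forall x t,
 (forall j, `|coord x j| <= K) -> `|t| <= 1 ->
 `|g (upd x i (coord x i + t)) - g x - t * partial i g x| <= C * t ^+ 2.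
Proof.
move=> sg; have [B B0 gB] := bounded_box (K + 1) (sm_continuous (sm_partial i (sm_partial i sg))).
exists B => // x t xK t1.
have [c cx h] := mvt2 i x t sg; apply: le_trans h _; rewrite ler_wpM2r //.
apply: gB => j; rewrite coord_upd; case: eqP => [_|_]; last first.
 by apply: le_trans (xK j) _; lra.
have := ler_normD (c - coord x i) (coord x i); rewrite subrK => h; apply: le_trans h _.
by rewrite addrC; apply: lerD => //; lra.
Qed.

(* The mean value points of [mvt] stay within distance [2 K] of the box, whence the factor 3. *)
Lemma box_lip g (dg : 'I_n -> V -> R) K B : 0 <= K -> 0 <= B -> (forall i x, is_derive x (evec R i) g (dg i x)) ->
 (forall i x, (forall j, `|coord x j| <= 3 * K) -> `|dg i x| <= B) ->
 forall x y, (forall j, `|coord x j| <= K) -> (forall j, `|coord y j| <= K) -> `|g x - g y| <= B * d1 x y.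
Proof.
move=> K0 B0 gd gB x y xK yK.
have K3 : K <= 3 * K by lra.
have dd z i (s : R) : is_derive s 1 (fun s => g (upd z i s)) (dg i (upd z i s)).
 have := gd i (upd z i s); move/is_derive_upd; rewrite coord_upd eqxx.
 by rewrite (_ : (fun s0 => _) = (fun s => g (upd z i s))) //; apply/funext => u; rewrite upd_upd.
have step z i u v : (forall j, `|coord z j| <= K) -> `|u| <= K -> `|v| <= K ->
  `|g (upd z i u) - g (upd z i v)| <= B * `|u - v|.
 move=> zK uK vK; have [c cb ->] := mvt (dd z i) v u.
 rewrite normrM ler_wpM2r //; apply: gB => j; rewrite coord_upd; case: eqP => _; last exact: le_trans (zK j) K3.
 have := ler_normD (c - v) v; rewrite subrK => h; apply: le_trans h _.
 have := ler_normB u v; lra.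
exact: (@coordwise_lip _ _ (fun u => `|u| <= K)).
Qed.

Lemma box_continuous g (dg : 'I_n -> V -> R) : (forall i x, is_derive x (evec R i) g (dg i x)) ->
 (forall K, 0 <= K -> exists2 B : R, 0 <= B & forall i x, (forall j, `|coord x j| <= K) -> `|dg i x| <= B) ->
 continuous g.
Proof.
move=> gd gB x; pose K := `|x| + 1; have K0 : 0 <= K by rewrite addr_ge0.
have [B B0 hB] := gB (3 * K) (mulr_ge0 (ler0n _ 3) K0).
have L := box_lip K0 B0 gd hB.
pose del e := Num.min 1 (e / (B * n%:R + 1)).
have del0 e : 0 < e -> 0 < del e.
 by move=> e0; rewrite lt_min ltr01 divr_gt0 // ltr_wpDl // mulr_ge0.
have FF : Filter (nbhs (x : V)) by exact: nbhs_filter.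
apply/(@cvgrPdist_le R R V (nbhs (x : V)) FF) => e e0.
apply/(@nbhs_ballP R V); exists (del e); first exact: del0.
move=> y; rewrite -ball_normE /= lt_min => /andP[/ltW xy /ltW xy2].
have xK j : `|coord x j| <= K by apply: le_trans (coord_norm _ _) _; rewrite lerDl.
have yK j : `|coord y j| <= K.
 apply: le_trans (coord_norm _ _) _; rewrite -[y](subKr x); apply: le_trans (ler_normB _ _) _.
 by rewrite lerD2l.
apply: le_trans (L x y xK yK) _; apply: (@le_trans _ _ (B * (n%:R * `|x - y|))).
 rewrite ler_wpM2l // /d1 mulr_natl -[X in _ *+ X](card_ord n) -sumr_const; apply: ler_sum => i _.
 by have := coord_norm (x - y) i; rewrite /coord !mxE.
move: xy2; rewrite ler_pdivlMr; last pos.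
by apply: le_trans; rewrite mulrA [leRHS]mulrC ler_wpM2r // lerDl.
Qed.

(** Differentiation in x_i brings out a factor s, so the powers s^k are needed for a family closed
    under derivatives. *)
Definition pint k i h : V -> R := fun x => seg (fun s => s ^+ k * h (upd x i (s * coord x i))).

Lemma pint_cont k i h x : continuous h -> continuous (fun s : R => s ^+ k * h (upd x i (s * coord x i))).
Proof.
move=> ch s; apply: cvgM; first exact: exprn_continuous.
apply: (@continuous_comp _ _ _ (fun s : R => s * coord x i) (fun r => h (upd x i r))).
 by apply: cvgM; [exact: cvg_id|exact: cvg_cst].
apply: (@continuous_comp _ _ _ (fun r : R => upd x i r) h); [exact: upd_continuous1|exact: ch].
Qed.

Lemma pint_box k i h K : continuous h -> exists2 B : R, 0 <= B &
 forall x, (forall j, `|coord x j| <= K) -> `|pint k i h x| <= B.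
Proof.
move=> ch; have [B B0 hB] := bounded_box K ch; exists B => // x xK.
apply: seg_bound; first exact: pint_cont.
move=> s /andP[s0 s1]; rewrite normrM -[leRHS]mul1r; apply: ler_pM => //.
 by rewrite ger0_norm ?exprn_ge0 // exprn_ile1.
apply: hB => j; rewrite coord_upd; case: eqP => [_|//]; apply: le_trans (xK i).
by rewrite normrM ler_piMl // ger0_norm.
Qed.

Lemma pint_derive k i j h x : sm h ->
 is_derive x (evec R j) (pint k i h) (pint (k + (j == i)) i (partial j h) x).
Proof.
move=> sh; apply/is_derive_upd.
have [C C0 hC] := sm_quad j `|x| sh.
apply: (quad_is_derive (C := C)); near=> t.
have t1 : `|t| <= 1.
 by [].
rewrite upd_id /pint seg_lin; try (by apply: pint_cont; apply: sm_continuous => //; exact: sm_partial).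
apply: seg_bound.
 move=> s; apply: cvgB; first apply: cvgB.
 - by apply: pint_cont; exact: sm_continuous.
 - by apply: pint_cont; exact: sm_continuous.
 - by apply: cvgM; [exact: cvg_cst|apply: pint_cont; apply: sm_continuous; exact: sm_partial].
move=> s /andP[s0 s1]; set y := upd x i (s * coord x i).
have yK l : `|coord y l| <= `|x|.
 rewrite coord_upd; case: eqP => _; last exact: coord_norm.
 by apply: le_trans (coord_norm x i); rewrite normrM ler_piMl // ger0_norm.
pose b := (j == i) : nat.
have -> : upd (upd x j (coord x j + t)) i (s * coord (upd x j (coord x j + t)) i) = upd y j (coord y j + s ^+ b * t).
 apply: coordP => l; rewrite !coord_upd /b; case: (eqVneq l i) => [->|li]; case: (eqVneq j i) => [ji|ji] //=.
 - by rewrite ji expr1 mulrDr.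
 - by rewrite ji (negbTE li).
 - by rewrite expr0 mul1r.
have sb : 0 <= s ^+ b by exact: exprn_ge0.
have sb1 : s ^+ b <= 1 by exact: exprn_ile1.
have bt : `|s ^+ b * t| <= 1 by rewrite normrM (ger0_norm sb) mulr_ile1.
have := hC y _ yK bt; rewrite -/y => hy.
rewrite exprD (_ : _ - _ - _ = s ^+ k * (h (upd y j (coord y j + s ^+ b * t)) - h y - s ^+ b * t * partial j h y)); last by ring.
rewrite normrM ger0_norm ?exprn_ge0 //; apply: (@le_trans _ _ (1 * (C * (s ^+ b * t) ^+ 2))).
 by apply: ler_pM => //; [exact: exprn_ge0|exact: exprn_ile1].
rewrite mul1r ler_wpM2l // exprMn ler_piMl //; exact: exprn_ile1.
Unshelve. all: by end_near. Qed.

Lemma sm_pint k i h : sm h -> sm (pint k i h).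
Proof.
move=> sh; apply: (@sm_family (fun g => exists k h, sm h /\ g = pint k i h)); last by exists k, h.
move=> _ [{}k [{}h [{}sh ->]]]; split.
 apply: (box_continuous (dg := fun j => pint (k + (j == i)) i (partial j h))).
  by move=> j x; exact: pint_derive.
 move=> K K0; have /choice[b hb] j : exists B : R, 0 <= B /\ forall x, (forall l, `|coord x l| <= K) ->
   `|pint (k + (j == i)) i (partial j h) x| <= B.
  by have [B ? ?] := pint_box (k + (j == i)) i K (sm_continuous (sm_partial j sh)); exists B.
 exists (\sum_j b j); first by apply: sumr_ge0 => j _; case: (hb j).
 move=> j x xK; have [_ /(_ x xK) hj] := hb j; apply: le_trans hj _.
 by rewrite (bigD1 j) //= lerDl sumr_ge0 // => l _; case: (hb l).
move=> j; exists (pint (k + (j == i)) i (partial j h)); split; last by move=> x; exact: pint_derive.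
by exists (k + (j == i))%N, (partial j h); smooth.
Qed.

Definition res i g : V -> R := fun x => g (upd x i 0).
(** The smooth quotient of g - g(x_i = 0) by x_i, in Hadamard's integral form. *)
Definition had i g : V -> R := pint 0 i (partial i g).

Lemma res_derive i j g x : sm g -> is_derive x (evec R j) (res i g)
 (if j == i then 0 else res i (partial j g) x).
Proof.
move=> sg; apply/is_derive_upd; case: eqP => [->|/eqP ji].
 rewrite (_ : (fun s => _) = (fun=> res i g x)); first exact: is_derive_cst.
 by apply/funext => s; rewrite /res upd_upd.
rewrite (_ : (fun s => _) = (fun s => g (upd (upd x i 0) j s))); last first.
 by apply/funext => s; rewrite /res updC.
have := sm_is_derive1 j (upd x i 0) (coord x j) sg.
by rewrite (_ : upd (upd x i 0) j (coord x j) = upd x i 0) // updC 1?eq_sym // upd_id.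
Qed.

Lemma sm_res i g : sm g -> sm (res i g).
Proof.
move=> sg; apply: (@sm_family (fun h => exists g, sm g /\ h = res i g)); last by exists g.
move=> _ [{}g [{}sg ->]]; split.
 apply: (box_continuous (dg := fun j x => if j == i then 0 else res i (partial j g) x)).
  by move=> j x; exact: res_derive.
 move=> K K0; have /choice[b hb] j : exists B : R, 0 <= B /\ forall x, (forall l, `|coord x l| <= K) ->
   `|partial j g x| <= B.
  by have [B ? ?] := bounded_box K (sm_continuous (sm_partial j sg)); exists B.
 exists (\sum_j b j); first by apply: sumr_ge0 => j _; case: (hb j).
 move=> j x xK; apply: (@le_trans _ _ (b j)); last first.
  by rewrite (bigD1 j) //= lerDl sumr_ge0 // => l _; case: (hb l).
 have [b0 hj] := hb j; case: ifP => _; first by rewrite normr0.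
 by apply: hj => l; rewrite coord_upd; case: ifP; rewrite ?normr0.
move=> j; case: (eqVneq j i) => [->|ji].
 exists (fun=> 0); split; first by exists (fun=> 0); smooth.
 by move=> x; have := res_derive i i x sg; rewrite eqxx.
exists (res i (partial j g)); split; first by exists (partial j g); smooth.
by move=> x; have := res_derive i j x sg; rewrite (negbTE ji).
Qed.

Lemma sm_had i g : sm g -> sm (had i g).
Proof. by move=> sg; apply: sm_pint; smooth. Qed.

Lemma sm_iter_had i k g : sm g -> sm (iter k (had i) g).
Proof. by move=> sg; elim: k => //= k; exact: sm_had. Qed.

Lemma sm_iter_partial i k g : sm g -> sm (iter k (partial i) g).
Proof. by move=> sg; elim: k => //= k; smooth. Qed.

Lemma hadE i g x : sm g -> g x = res i g x + coord x i * had i g x.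
Proof.
move=> sg; pose c := coord x i.
have cF : continuous (fun s : R => s ^+ 0 * partial i g (upd x i (s * c))).
 by apply: pint_cont; apply: sm_continuous; smooth.
have D (s : R) : is_derive s 1 (fun s => g (upd x i (s * c))) (c * (s ^+ 0 * partial i g (upd x i (s * c)))).
 have h1 : is_derive (s * c) 1 (fun r => g (upd x i r)) (partial i g (upd x i (s * c))).
  exact: sm_is_derive1.
 have h2 : is_derive s 1 (fun s : R => s * c) c.
  have := @is_deriveM _ _ (@id R) (cst c) s 1 1 0 (is_derive_id _ _) (is_derive_cst _ _ _).
  by move=> h; deriv h; rewrite mulr0 add0r mulr1.
 have := @is_derive1_comp _ (fun r => g (upd x i r)) (fun s : R => s * c) s _ _ h1 h2; rewrite /comp => h; apply: is_derive_eq h _.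
 lra.
rewrite /had /pint -segZ // (seg_FTC _ D); first by rewrite mul1r mul0r upd_id /res addrC subrK.
by move=> s; apply: cvgM; [exact: cvg_cst|exact: cF].
Qed.

Lemma iter_partial_pint i k m h : sm h ->
 iter m (partial i) (pint k i h) = pint (k + m) i (iter m (partial i) h).
Proof.
move=> sh; elim: m => [|m ih]; first by rewrite addn0.
rewrite !iterS ih; apply/funext => x; apply: pd_val.
have := pint_derive (k + m) i i x (sm_iter_partial i m sh).
by rewrite eqxx addn1 addnS.
Qed.

Lemma pint_res k i h x : (k.+1)%:R * res i (pint k i h) x = res i h x.
Proof.
rewrite /res /pint coord_upd eqxx.
rewrite (_ : (fun s => _) = (fun s => h (upd x i 0) * s ^+ k)); last first.
 by apply/funext => s; rewrite mulr0 upd_upd mulrC.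
have ck : continuous (fun s : R => s ^+ k) by exact: exprn_continuous.
have D (s : R) : is_derive s 1 (fun s : R => s ^+ k.+1) (k.+1%:R * s ^+ k).
 have := @is_deriveX R R (@id R) k.+1 s 1 1 (is_derive_id s 1); rewrite exprfctE => h'.
 by deriv h'; rewrite mulr1.
rewrite segZ // mulrCA -segZ // (seg_FTC _ D); first by rewrite expr1n expr0n subr0 mulr1.
by move=> s; apply: cvgM; [exact: cvg_cst|exact: ck].
Qed.

(** At x_i = 0 the integral over s contributes only 1/(m+1), so each quotient shifts the order of
    the Taylor coefficient by one; factorials on both sides avoid divisions. *)
Lemma res_iter_had i k m g x : sm g ->
 ((m + k)`!)%:R * res i (iter m (partial i) (iter k (had i) g)) x =
 (m`!)%:R * res i (iter (m + k) (partial i) g) x.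
Proof.
move=> sg; elim: k m => [|k ih] m; first by rewrite addn0.
have := ih m.+1; rewrite factS natrM addSnnS => h.
rewrite [iter k.+1 _ _]iterS {1}/had iter_partial_pint ?add0n; last by apply: sm_partial; exact: sm_iter_had.
have m0 : m.+1%:R != 0 :> R by rewrite pnatr_eq0.
apply: (mulfI m0); rewrite [LHS]mulrCA pint_res [RHS]mulrA -h; congr (_ * _).
by rewrite iterSr.
Qed.

End Hadamard.

Lemma small_eq0 (R : realType) (c K del : R) : 0 < del -> 0 <= K ->
 (forall s, 0 < s -> s <= del -> `|c| <= K * s) -> c = 0.
Proof.
move=> d0 K0 h; apply/eqP; case: (eqVneq c 0) => // /negP c0; exfalso.
have c1 : 0 < `|c| by rewrite normr_gt0; apply/negP.
pose s := Num.min del (`|c| / (2 * (K + 1))).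
have K1 : 0 < 2 * (K + 1) by rewrite mulr_gt0 // ltr_wpDl.
have s0 : 0 < s by rewrite lt_min d0 divr_gt0.
have := h s s0; rewrite ge_min lexx => /(_ isT) h1.
have : K * s <= `|c| / 2.
 apply: (@le_trans _ _ (K * (`|c| / (2 * (K + 1))))); first by rewrite ler_wpM2l // ge_min lexx orbT.
 rewrite mulrA ler_pdivrMr // [leRHS](_ : _ = `|c| * (K + 1)); last lra.
 lra.
lra.
Qed.

Lemma poly_small (R : realType) (p : {poly R}) N (Q del : R) : (size p <= N)%N -> 0 < del -> 0 <= Q ->
 (forall s, 0 < s -> s <= del -> `|p.[s]| <= Q * s ^+ N) -> p = 0.
Proof.
elim: N p del => [|N ih] p del sp d0 Q0 h; first by apply/eqP; rewrite -size_poly_leq0.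
pose q := drop_poly 1 p.
have pE s : p.[s] = p`_0 + q.[s] * s.
 rewrite -{1}(poly_take_drop 1 p) hornerD hornerM hornerXn expr1 /q; congr (_ + _).
 by rewrite (horner_coef_wide _ (size_take_poly 1 p)) big_ord1 coef_take_poly mulr1.
have [B B0 qB] : exists2 B : R, 0 <= B & forall s, 0 < s -> s <= 1 -> `|q.[s]| <= B.
 exists (\sum_(i < size q) `|q`_i|); first exact: sumr_ge0.
 move=> s s0 s1; rewrite horner_coef; apply: le_trans (ler_norm_sum _ _ _) _; apply: ler_sum => i _.
 by rewrite normrM ler_piMr // ger0_norm ?exprn_ge0 ?exprn_ile1 // ltW.
have p0 : p`_0 = 0.
 apply: (@small_eq0 _ _ (Q + B) (Num.min del 1)); rewrite ?lt_min ?d0 ?ltr01 ?addr_ge0 //.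
 move=> s s0; rewrite le_min => /andP[sd s1].
 rewrite -[p`_0](addrK (q.[s] * s)) -pE; apply: le_trans (ler_normB _ _) _; rewrite mulrDl; apply: lerD.
  apply: le_trans (h s s0 sd) _; rewrite ler_wpM2l // exprS ler_piMr ?(ltW s0) // exprn_ile1 // ltW //.
 by rewrite normrM (gtr0_norm s0) ler_wpM2r ?(ltW s0) // qB.
have q0 : q = 0.
 apply: (ih q del) => //; first by rewrite size_drop_poly leq_subLR.
 move=> s s0 sd; have := h s s0 sd; rewrite pE p0 add0r normrM (gtr0_norm s0) exprSr mulrA.
 by rewrite ler_pM2r.
by rewrite -(poly_take_drop 1 p) -/q q0 mul0r addr0; apply/polyP => i; rewrite coef_take_poly coef0; case: i => //=; by [].
Qed.

(** * Decomposition of f along its Newton polyhedron *)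

Section Decomposition.
Variables (R : realType) (n : nat).
Local Notation V := 'rV[R]_n.
Implicit Types (g h : V -> R) (i j : 'I_n) (x y : V).

(** Taylor expansion in x_i to order N: for k < N the coefficient, independent of x_i, and for k = N
    the remainder. *)
Definition hop N i k g := if (k < N)%N then res i (iter k (had i) g) else iter N (had i) g.

Lemma sm_hop N i k g : sm g -> sm (hop N i k g).
Proof. by move=> sg; rewrite /hop; case: ifP => _; [apply: sm_res|]; exact: sm_iter_had. Qed.

Lemma had_expand N i g x : sm g -> g x = \sum_(k < N.+1) coord x i ^+ k * hop N i k g x.
Proof.
move=> sg; have H m : (m <= N)%N -> g x = \sum_(k < m) coord x i ^+ k * res i (iter k (had i) g) x +
  coord x i ^+ m * iter m (had i) g x.
 elim: m => [_|m ih mN]; first by rewrite big_ord0 add0r mul1r.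
 rewrite (ih (ltnW mN)) big_ord_recr /= (hadE i x (sm_iter_had i m sg)) exprSr; ring.
rewrite big_ord_recr /= {1}(H N) // {2}/hop ltnn; congr (_ + _).
by apply: eq_bigr => k _; rewrite /hop ltn_ord.
Qed.

Section Fixed.
Variable N : nat.
Local Notation E := {ffun 'I_n -> 'I_N.+1}.
Implicit Types e : E.

Definition me e : mindex n := [ffun i => nat_of_ord (e i)].
Definition Op e (r : seq 'I_n) g := foldr (fun i => hop N i (e i)) g r.

Lemma sm_Op e r g : sm g -> sm (Op e r g).
Proof. by move=> sg; elim: r => //= i r; exact: sm_hop. Qed.

Lemma Op_eq e e' r g : (forall i, i \in r -> e i = e' i) -> Op e r g = Op e' r g.
Proof.
elim: r => //= i r ih h; rewrite (h i) ?mem_head // ih // => j jr.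
by apply: h; rewrite inE jr orbT.
Qed.

Lemma expand_seq r g x : uniq r -> sm g ->
 g x = \sum_(e : E | [forall i, (i \notin r) ==> (e i == ord0)])
   (\prod_(i <- r) coord x i ^+ e i) * Op e r g x.
Proof.
move=> + sg; elim: r => [_|i r ih /= /andP[ir ur]].
 rewrite (big_pred1 [ffun=> ord0]) ?big_nil ?mul1r // => e; apply/forallP/eqP => [h|-> i].
  by apply/ffunP => i; rewrite ffunE; apply/eqP; have := h i; by [].
 by rewrite ffunE.
pose z e : E := [ffun j => if j == i then ord0 else e j].
rewrite (partition_big z (fun e => [forall j, (j \notin r) ==> (e j == ord0)])) /=; last first.
 move=> e /forallP h; apply/forallP => j; rewrite ffunE; case: (eqVneq j i) => [_|ji]; first by rewrite implybT.
 by have := h j; rewrite negb_or ji.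
rewrite [LHS](ih ur); apply: eq_bigr => e /forallP he.
rewrite (had_expand N i x (sm_Op e r sg)) mulr_sumr.
pose w k : E := [ffun j => if j == i then k else e j].
rewrite (reindex_onto w (fun e' : E => e' i)); last first.
 move=> e' /andP[_ /eqP ez]; apply/ffunP => j; rewrite ffunE.
 by case: eqP => [->//|/eqP ji]; rewrite -ez ffunE (negbTE ji).
apply: eq_big => [k|k _].
 apply/esym/andP; split; last by rewrite ffunE eqxx.
 apply/andP; split.
  apply/forallP => j; rewrite ffunE inE negb_or; apply/implyP => /andP[/negbTE -> jr].
  by have := he j; rewrite jr.
 apply/eqP/ffunP => j; rewrite !ffunE; case: eqP => [->|//].
 by have := he i; rewrite ir => /eqP.
rewrite big_cons {1 3}/w ffunE eqxx (_ : Op (w k) r g = Op e r g); last first.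
 by apply: Op_eq => j jr; rewrite ffunE; case: eqP => // ji; rewrite -ji jr in ir.
rewrite (_ : \prod_(j <- r) coord x j ^+ w k j = \prod_(j <- r) coord x j ^+ e j); first lra.
rewrite [LHS]big_seq [RHS]big_seq; apply: eq_bigr => j jr; rewrite ffunE.
by case: eqP => // ji; rewrite -ji jr in ir.
Qed.

Definition indep i g := forall x s, g (upd x i s) = g x.

Lemma indep_partial i j g : i != j -> sm g -> indep i g -> indep i (partial j g).
Proof.
move=> ij sg h x s; apply: pd_val; apply/is_derive_upd.
rewrite coord_upd eq_sym (negbTE ij).
rewrite (_ : (fun s0 => _) = (fun s0 => g (upd x j s0))); last by apply/funext => t; rewrite updC.
by have := sm_is_derive1 j x (coord x j) sg; rewrite upd_id.
Qed.

Lemma indep_had i j g : i != j -> sm g -> indep i g -> indep i (had j g).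
Proof.
move=> ij sg h x s; rewrite /had /pint; congr seg; apply/funext => t; congr (_ * _).
by rewrite coord_upd eq_sym (negbTE ij) updC //; exact: indep_partial.
Qed.

Lemma indep_hop i j k g : i != j -> sm g -> indep i g -> indep i (hop N j k g).
Proof.
move=> ij sg h; have H m : indep i (iter m (had j) g).
 elim: m => [//|m ih]; rewrite iterS; apply: indep_had ih => //; exact: sm_iter_had.
rewrite /hop; case: ifP => _; auto.
by move=> x s; rewrite /res updC //; exact: H.
Qed.

Lemma Op_indep e r g i : sm g -> uniq r -> i \in r -> (e i < N)%N -> indep i (Op e r g).
Proof.
move=> sg; elim: r => //= j r ih /andP[jr ur]; rewrite inE => /predU1P[->|ir] eN.
 by move=> x s; rewrite /hop eN /res upd_upd.
by apply: indep_hop; [case: eqP => // ij; rewrite -ij ir in jr|exact: sm_Op|exact: ih].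
Qed.

Definition zr (r : seq 'I_n) x : V := \row_i (if i \in r then 0 else coord x i).

Lemma zr_iter_partial r i k h : i \notin r -> sm h ->
 iter k (partial i) (fun x => h (zr r x)) = (fun x => iter k (partial i) h (zr r x)).
Proof.
move=> ir sh; elim: k => [//|k ih]; rewrite iterS ih; apply/funext => x; apply: pd_val.
apply/is_derive_upd; have s2 := sm_iter_partial i k sh.
rewrite (_ : (fun s => _) = (fun s => iter k (partial i) h (upd (zr r x) i s))); last first.
 apply/funext => s; congr (iter _ _ _ _); apply: coordP => j; rewrite coord_upd /coord !mxE.
 by case: (eqVneq j i) => [->|ji]; rewrite ?(negbTE ir) ?coord_upd ?eqxx ?(negbTE ji).
have := sm_is_derive1 i (zr r x) (coord x i) s2.
rewrite (_ : upd (zr r x) i (coord x i) = zr r x) //.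
by apply: coordP => j; rewrite coord_upd; case: eqP => [->|//]; rewrite /coord mxE (negbTE ir).
Qed.

Lemma Op_taylor e r g x : uniq r -> sm g -> (forall i, i \in r -> (e i < N)%N) ->
 Op e r g x * \prod_(i <- r) ((e i)`!)%:R =
 foldr (fun i h => iter (e i) (partial i) h) g r (zr r x).
Proof.
move=> + sg; elim: r x => [|i r ih] x /=.
 rewrite big_nil mulr1 => _ _; congr g; by apply: coordP => i; rewrite /coord mxE.
move=> /andP[ir ur] h; have hr j : j \in r -> (e j < N)%N by move=> jr; apply: h; rewrite inE jr orbT.
have {}ih y := ih y ur hr; pose D := foldr (fun i h => iter (e i) (partial i) h) g r.
have sD : sm D by rewrite /D; elim: (r) => //= j r' ih'; exact: sm_iter_partial.
set c := \prod_(i <- r) _ in ih; rewrite big_cons -/c -/D /hop (h i (mem_head _ _)).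
have c0 : c != 0.
 by rewrite /c; elim: (r) => [|j r' ih']; rewrite ?big_nil ?oner_eq0 // big_cons mulf_neq0 // pnatr_eq0 -lt0n.
have := res_iter_had i (e i) 0 x (sm_Op e r sg); rewrite add0n fact0 mul1r /= => e1.
rewrite mulrA [X in X * c]mulrC e1.
have sz : sm (fun x => D (zr r x)).
 have := sm_Op e r sg; rewrite (_ : (fun x => D (zr r x)) = (fun x => c * Op e r g x)).
  exact: sm_scale.
 by apply/funext => y; rewrite /D -ih mulrC.
have iz k : iter k (partial i) (fun x => c^-1 * D (zr r x)) = (fun x => c^-1 * iter k (partial i) D (zr r x)).
 transitivity (fun x => c^-1 * iter k (partial i) (fun x => D (zr r x)) x); last by rewrite zr_iter_partial.
 elim: k => [//|k ihk]; rewrite !iterS ihk; apply/funext => y.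
 by rewrite pd_scale //; exact: sm_iter_partial.
rewrite (_ : Op e r g = (fun x => c^-1 * D (zr r x))); last first.
 by apply/funext => y; rewrite /D -ih mulrC mulfK.
rewrite iz /res mulrC mulrA divff // mul1r.
have -> //: zr (i :: r) x = zr r (upd x i 0).
 by apply: coordP => j; rewrite /coord !mxE inE; case: (eqVneq j i) => [->|ji] /=; rewrite ?coord_upd ?eqxx ?(negbTE ji); case: ifP.
Qed.

Lemma torus_dense rho g : 0 < rho -> continuous g ->
 (forall x, inbox rho x -> (forall i, coord x i != 0) -> g x = 0) -> forall x, inbox rho x -> g x = 0.
Proof.
move=> rho0 cg h x bx.
pose y (t : R) : V := \row_i (if coord x i == 0 then t else coord x i).
have yx : y 0 = x by apply: coordP => i; rewrite {1}/coord mxE; case: eqP.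
have cy : continuous (fun t => g (y t)).
 move=> t; apply: (@continuous_comp _ _ _ y g); last exact: cg.
 have FF : Filter (nbhs t) by exact: nbhs_filter.
 apply/(@cvgrPdist_le R V R (nbhs t) FF) => e e0.
 apply/(@nbhs_ballP R R); exists e => // t'; rewrite -ball_normE /= => tt'.
 rewrite /Num.Def.normr /= mx_normrE; apply: bigmax_le => [|[k i] _]; auto.
 by rewrite !mxE; case: ifP => _; rewrite ?subrr ?normr0; apply: ltW.
have : g (y t) @[t --> (0:R)^'+] --> g x.
 rewrite -yx; apply: cvg_at_right_filter; exact: cy.
move=> /(@cvg_lim _) <- //; apply: lim_near_cst => //; near=> t.
have t0 : 0 < t by near: t; exact: nbhs_right_gt.
have tr : t <= rho by near: t; exact: nbhs_right_le.
apply: h => i; rewrite /coord mxE; case: (eqVneq (coord x i) 0) => x0.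
- by rewrite gtr0_norm.
- exact: bx.
- by [].
- exact: x0.
Unshelve. all: by end_near. Qed.

Lemma monomial_upd e i x s : monomial (me e) (upd x i s) = s ^+ e i * \prod_(j | j != i) coord x j ^+ e j.
Proof.
rewrite /monomial (bigD1 i) //= coord_upd eqxx ffunE; congr (_ * _).
by apply: eq_bigr => j /negbTE ji; rewrite coord_upd ji ffunE.
Qed.

(** Coordinates are separated one at a time. In x_i the terms with e_i < N form a polynomial of
    degree below N, and those with e_i = N are O(x_i^N); hence both parts vanish and the powers can
    be read off. *)
Lemma normal_unique rho (h : E -> V -> R) (P : pred E) : 0 < rho -> (forall e, continuous (h e)) ->
 (forall e i, (e i < N)%N -> indep i (h e)) ->
 (forall x, inbox rho x -> \sum_(e | P e) monomial (me e) x * h e x = 0) ->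
 forall e, P e -> forall x, inbox rho x -> h e x = 0.
Proof.
move=> rho0 ch ih hP.
suff H r : uniq r -> forall e0 x, inbox rho x -> (forall i, coord x i != 0) ->
  \sum_(e | P e && [forall i in r, e i == e0 i]) monomial (me e) x * h e x = 0.
 move=> e Pe; apply: torus_dense => // x bx x0; have := H (enum 'I_n) (enum_uniq _) e x bx x0.
 rewrite (big_pred1 e); last first.
  move=> e'; apply/andP/eqP => [[_ /forallP h']|->]; last by split=> //; apply/forallP => i; rewrite eqxx implybT.
  by apply/ffunP => i; apply/eqP; have := h' i; rewrite mem_enum.
 move=> /eqP; rewrite mulf_eq0 => /orP[|/eqP //]; rewrite /monomial => /prodf_eq0[i _].
 by rewrite expf_eq0 (negbTE (x0 i)) andbF.
elim: r => [_ e0 x bx _|i r IH /= /andP[ir ur] e0 x bx x0].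
 rewrite -[RHS](hP x bx); apply: eq_bigl => e; rewrite andb_idr // => _.
 by apply/forallP => i; by [].
pose Pr e := P e && [forall i in r, e i == e0 i].
pose c e := \prod_(j | j != i) coord x j ^+ e j.
pose p : {poly R} := \sum_(e | Pr e && (e i < N)%N) (c e * h e x) *: 'X^(e i).
have eqr e : P e && [forall j in i :: r, e j == e0 j] = Pr e && (e i == e0 i).
 rewrite /Pr -andbA; congr (_ && _); apply/forallP/andP => [h1|[/forallP h1 /eqP h2] j].
  split; last by have := h1 i; rewrite mem_head.
  by apply/forallP => j; apply/implyP => jr; have := h1 j; rewrite inE jr orbT.
 by apply/implyP; rewrite inE => /predU1P[->|jr]; [rewrite h2|have := h1 j; rewrite jr].
have [B B0 hB] : exists2 B : R, 0 <= B & forall e y, inbox rho y -> `|h e y| <= B.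
 have /choice[b hb] e : exists B : R, 0 <= B /\ forall y, inbox rho y -> `|h e y| <= B.
  by have [B ? ?] := bounded_box rho (ch e); exists B.
 exists (\sum_e b e); first by apply: sumr_ge0 => e _; case: (hb e).
 move=> e y yK; have [_ /(_ y yK) hj] := hb e; apply: le_trans hj _.
 by rewrite (bigD1 e) //= lerDl sumr_ge0 // => l _; case: (hb l).
have sumE s : 0 < s -> s <= rho -> p.[s] + \sum_(e | Pr e && ~~ (e i < N)%N) s ^+ N * (c e * h e (upd x i s)) = 0.
 move=> s0 sr; have b1 : inbox rho (upd x i s).
  by move=> j; rewrite coord_upd; case: ifP => _; [rewrite gtr0_norm|exact: bx].
 have b2 j : coord (upd x i s) j != 0.
  by rewrite coord_upd; case: ifP => _; pos.
 have := IH ur e0 (upd x i s) b1 b2; rewrite (bigID (fun e => (e i < N)%N)) /= => h1.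
 rewrite -[RHS]h1; congr (_ + _).
  rewrite horner_sum; apply: eq_bigr => e /andP[_ eN]; rewrite hornerZ hornerXn monomial_upd.
  by rewrite (ih e i eN) -/(c e); ring.
 apply: eq_bigr => e /andP[_ eN]; rewrite monomial_upd -/(c e) (_ : nat_of_ord (e i) = N); first by ring.
 by apply/eqP; rewrite eqn_leq -ltnS ltn_ord /= leqNgt.
have p0 : p = 0.
 apply: (@poly_small _ p N (\sum_(e : E) `|c e| * B) rho) => //.
 - apply: (leq_trans (size_sum _ _ _)); apply/bigmax_leqP => e /andP[_ eN].
  by apply: leq_trans (size_scale_leq _ _) _; rewrite size_polyXn.
 - pos.
 move=> s s0 sr; have /eqP := sumE s s0 sr; rewrite addr_eq0 => /eqP ->; rewrite normrN -mulr_sumr normrM.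
 rewrite mulrC (gtr0_norm (exprn_gt0 _ s0)) ler_wpM2r ?exprn_ge0 ?(ltW s0) //.
 apply: le_trans (ler_norm_sum _ _ _) _; rewrite [leRHS](bigID (fun e => Pr e && ~~ (e i < N)%N)) /=.
 apply: ler_wpDr; first by pos; by [].
 apply: ler_sum => e _; rewrite normrM ler_wpM2l // hB // => j; rewrite coord_upd.
 by case: eqP => _; [rewrite gtr0_norm|exact: bx].
rewrite (eq_bigl _ _ eqr).
have xE e : monomial (me e) x = coord x i ^+ e i * c e by rewrite -{1}(upd_id x i) monomial_upd.
have [eN|eN] := boolP (e0 i < N)%N.
 have := congr1 (fun q : {poly R} => q`_(e0 i)) p0; rewrite coef0 coef_sumMXn => h1.
 rewrite (eq_bigr (fun e => coord x i ^+ e0 i * (c e * h e x))); last first.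
  by move=> e /andP[_ /eqP ee]; rewrite xE ee mulrA.
 rewrite -mulr_sumr; apply/eqP; rewrite mulf_eq0; apply/orP; right; apply/eqP.
 rewrite -[RHS]h1; apply: eq_bigl => e; case: (eqVneq (e i) (e0 i)) => [->|ne]; first by rewrite eN eqxx !andbT.
 by rewrite -val_eqE /= in ne; rewrite (negbTE ne) !andbF.
have := IH ur e0 x bx x0; rewrite (bigID (fun e => (e i < N)%N)) /= => h1.
rewrite -[RHS]h1 [X in _ = X + _](_ : _ = p.[coord x i]); last first.
 rewrite horner_sum; apply: eq_bigr => e _; rewrite hornerZ hornerXn xE; ring.
rewrite p0 horner0 add0r; apply: eq_bigl => e; congr (_ && _).
have eNN : nat_of_ord (e0 i) = N by apply/eqP; rewrite eqn_leq -ltnS ltn_ord /= leqNgt.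
by rewrite -val_eqE /= eNN -leqNgt eqn_leq -ltnS ltn_ord.
Qed.

Lemma tscale_monomial (a b : mindex n) t x : monomial b (tscale a t x) = t ^+ npair a b * monomial b x.
Proof.
rewrite /monomial /npair -prodrXr -big_split /=; apply: eq_bigr => i _.
by rewrite /coord mxE exprMn exprM.
Qed.

Lemma tscale_inbox rho (a : mindex n) t x : 0 <= t -> t <= 1 -> inbox rho x -> inbox rho (tscale a t x).
Proof.
move=> t0 t1 bx i; rewrite /coord mxE normrM; apply: le_trans (bx i); rewrite ler_piMl //.
by rewrite ger0_norm ?exprn_ge0 // exprn_ile1.
Qed.

(** Along t^a x, terms whose coefficient is independent of all scaled coordinates are pure powers of
    t. Every other term has a scaled coordinate with exponent N > l and is O(t^l), and so is g by
    the existence of the limit. Thus the powers below l cancel, and [normal_unique] removes their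
    terms one by one. *)
Lemma vanish rho (h : E -> V -> R) g (a : mindex n) (l : nat) : 0 < rho -> (l < N)%N ->
 (forall e, continuous (h e)) -> (forall e i, (e i < N)%N -> indep i (h e)) ->
 (forall x, inbox rho x -> g x = \sum_e monomial (me e) x * h e x) ->
 (forall x, inbox rho x -> exists L : R, (fun t => g (tscale a t x) / t ^+ l) @ 0^'+ --> L) ->
 forall e, (npair a (me e) < l)%N -> forall x, inbox rho x -> h e x = 0.
Proof.
move=> rho0 lN ch ih gE gL e el.
pose good e := [forall i, (0 < a i)%N ==> (e i < N)%N].
have bad e' : ~~ good e' -> (l <= npair a (me e'))%N.
 rewrite negb_forall => /existsP[i]; rewrite negb_imply -leqNgt => /andP[ai ei].
 rewrite /npair (bigD1 i) //= ffunE; apply: leq_trans (leq_addr _ _).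
 by apply: leq_trans (ltnW lN) _; apply: leq_trans ei _; rewrite leq_pmull.
have ge : good e by apply/negbNE/negP => /bad; rewrite leqNgt el.
have hg e' x t : good e' -> h e' (tscale a t x) = h e' x.
 move=> /forallP ge'.
 pose z (r : seq 'I_n) : V := \row_i (if i \in r then t ^+ a i * coord x i else coord x i).
 have H r : h e' (z r) = h e' x.
  elim: r => [|i r IH]; first by congr h; apply: coordP => i; rewrite /coord mxE.
  rewrite -IH; case: (posnP (a i)) => ai.
   congr h; apply: coordP => j; rewrite /coord !mxE inE.
   by case: (eqVneq j i) => [->|] //=; rewrite ai expr0 mul1r if_same.
  have := ge' i; rewrite ai /= => ei; rewrite -[RHS](ih e' i ei (z r) (t ^+ a i * coord x i)).
  congr h; apply: coordP => j; rewrite coord_upd /coord !mxE inE.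
  by case: (eqVneq j i) => [->|].
 rewrite -[RHS](H (enum 'I_n)); congr h; apply: coordP => i; by rewrite /coord !mxE mem_enum.
suff H (j : nat) : (j < l)%N -> forall x, inbox rho x -> \sum_(e' | good e' && (npair a (me e') == j)) monomial (me e') x * h e' x = 0.
 apply: (normal_unique (P := fun e' => good e' && (npair a (me e') == npair a (me e))) rho0 ch ih).
  exact: H.
 by rewrite ge eqxx.
move=> jl x bx.
pose p : {poly R} := \sum_(e' | good e' && (npair a (me e') < l)%N) (monomial (me e') x * h e' x) *: 'X^(npair a (me e')).
suff p0 : p = 0.
 have := congr1 (fun q : {poly R} => q`_j) p0; rewrite coef0 coef_sumMXn => h1.
 rewrite -[RHS]h1; apply: eq_bigl => e'; case: eqP => [->|_]; last lra.
 by rewrite jl !andbT.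
have [B B0 hB] : exists2 B : R, 0 <= B & forall e y, inbox rho y -> `|monomial (me e) x * h e y| <= B.
 have /choice[b hb] e' : exists B : R, 0 <= B /\ forall y, inbox rho y -> `|h e' y| <= B.
  by have [B ? ?] := bounded_box rho (ch e'); exists B.
 have q0 e' : 0 <= `|monomial (me e') x| * b e' by rewrite mulr_ge0 //; case: (hb e').
 exists (\sum_e `|monomial (me e) x| * b e); first exact: sumr_ge0.
 move=> e' y yK; have [_ /(_ y yK) hj] := hb e'; rewrite normrM; apply: (@le_trans _ _ (`|monomial (me e') x| * b e')).
  by rewrite ler_wpM2l.
 by rewrite (bigD1 e') //= lerDl sumr_ge0.
have [Lx hL] := gL x bx.
have [del d0 hd] : exists2 del : R, 0 < del & forall t, 0 < t -> t <= del -> `|g (tscale a t x)| <= (`|Lx| + 1) * t ^+ l.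
 move/cvgrPdist_le : hL => /(_ 1 ltr01); rewrite /at_right near_withinE /= => /nbhs_ballP[r r0 hr].
 exists (r / 2); first pos.
 move=> t t0 tr; have := hr t; rewrite -ball_normE /= sub0r normrN gtr0_norm // => h1.
 have /h1/(_ t0) h2 : t < r by apply: le_lt_trans tr _; rewrite ltr_pdivrMr // ltr_pMr // ltr1n.
 have tl : 0 < t ^+ l by rewrite exprn_gt0.
 rewrite -ler_pdivrMr // -(gtr0_norm tl) -normrV ?unitfE ?gt_eqF // -normrM.
 have := ler_normB Lx (Lx - g (tscale a t x) / t ^+ l); rewrite subKr => h3.
 lra.
apply: (@poly_small _ p l (`|Lx| + 1 + \sum_(e : E) B) (Num.min del 1)).
- apply: (leq_trans (size_sum _ _ _)); apply/bigmax_leqP => e' /andP[_ eN].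
 by apply: leq_trans (size_scale_leq _ _) _; rewrite size_polyXn.
- pos.
- pos.
move=> t t0; rewrite le_min => /andP[td t1].
have ts := tscale_inbox a (ltW t0) t1 bx.
have -> : p.[t] = g (tscale a t x) - \sum_(e' | ~~ (good e' && (npair a (me e') < l)%N)) t ^+ npair a (me e') * (monomial (me e') x * h e' (tscale a t x)).
 rewrite gE // (bigID (fun e' => good e' && (npair a (me e') < l)%N)) /= -[LHS]addr0 -addrA; congr (_ + _).
  rewrite horner_sum; apply: eq_bigr => e' /andP[ge' _]; rewrite hornerZ hornerXn tscale_monomial hg //; ring.
 by apply/esym/eqP; rewrite subr_eq0; apply/eqP; apply: eq_bigr => e' _; rewrite tscale_monomial mulrA.
apply: le_trans (ler_normB _ _) _; rewrite mulrDl; apply: lerD; auto.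
apply: le_trans (ler_norm_sum _ _ _) _; rewrite mulr_suml [leRHS](bigID (fun e' => ~~ (good e' && (npair a (me e') < l)%N))) /=.
apply: ler_wpDr; first by pos; by [].
apply: ler_sum => e' /nandP h1; rewrite normrM mulrC ler_pM // ?hB // ger0_norm ?exprn_ge0 ?(ltW t0) //.
apply: ler_wiXn2l => //; auto.
by case: h1 => [/bad //|]; rewrite -leqNgt.
Qed.

End Fixed.

(** Exponents with all entries below N carry genuine Taylor coefficients; the others belong to
    remainders. [dc_G] places every exponent of the decomposition in the polyhedron. *)
Record decomp (f : V -> R) (G : seq (mindex n * nat)) (N : nat) (rho : R) (Ps : seq (mindex n))
  (F : mindex n -> V -> R) : Prop := Decomp {
 dc_sm : forall al : mindex n, sm (F al);
 dc_eq : forall x, inbox rho x -> f x = \sum_(al <- Ps) monomial al x * F al x;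
 dc_uniq : uniq Ps;
 dc_G : forall (al : mindex n) p, al \in Ps -> p \in G -> (p.2 <= npair p.1 al)%N;
 dc_all : forall al : mindex n, (forall i, (al i < N)%N) -> (forall p, p \in G -> (p.2 <= npair p.1 al)%N) -> al \in Ps;
 dc_coef : forall al : mindex n, al \in Ps -> (forall i, (al i < N)%N) -> F al 0 = taylor_coef f al }.

(** The levels in [G] stay below [N], so [vanish] removes from the full Taylor expansion each term
    whose exponent violates one of the inequalities. *)
Lemma decomposition f (G : seq (mindex n * nat)) N rho : 0 < rho -> sm f ->
 (forall p, p \in G -> (p.2 < N)%N) ->
 (forall p, p \in G -> forall x, inbox rho x ->
   exists L : R, (fun t => f (tscale p.1 t x) / t ^+ p.2) @ 0^'+ --> L) ->
 exists Ps F, decomp f G N rho Ps F.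
Proof.
move=> rho0 sf GN GL; pose E := {ffun 'I_n -> 'I_N.+1}.
pose em (al : mindex n) : E := [ffun i => inord (al i)].
have emK : cancel (@me N) em by move=> e; apply/ffunP => i; rewrite !ffunE inord_val.
have meK (al : mindex n) : (forall i, (al i <= N)%N) -> me (em al) = al.
 by move=> h; apply/ffunP => i; rewrite !ffunE inordK // ltnS.
pose h (e : E) := Op e (enum 'I_n) f.
have sh e : sm (h e) by exact: sm_Op.
have indh (e : E) i : (e i < N)%N -> indep i (h e).
 by move=> eN; apply: Op_indep; rewrite ?enum_uniq ?mem_enum.
have fE x : f x = \sum_e monomial (me e) x * h e x.
 rewrite {1}(expand_seq N x (enum_uniq 'I_n) sf); apply: eq_big => [e|e _].
  by apply/forallP => i; rewrite mem_enum.
 by congr (_ * _); rewrite big_enum; apply: eq_bigr => i _; rewrite ffunE.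
pose adm (al : mindex n) := all (fun p : mindex n * nat => (p.2 <= npair p.1 al)%N) G.
exists [seq me e | e <- enum E & adm (me e)], (fun al => h (em al)); split.
- by [].
- move=> x bx; rewrite big_map big_filter big_enum_cond /= fE (bigID (fun e : E => adm (me e))) /=.
 rewrite [X in _ + X]big1 ?addr0; first by apply: eq_bigr => e _; rewrite emK.
 move=> e /allPn[p pG]; rewrite -ltnNge => ep.
 rewrite (@vanish N rho h f p.1 p.2 rho0 (GN p pG)) ?mulr0 //.
 + by move=> e'; exact: sm_continuous.
 + exact: GL.
- by rewrite (map_inj_uniq (can_inj emK)) filter_uniq ?enum_uniq.
- by move=> al p /mapP[e]; rewrite mem_filter => /andP[/allP h1 _] -> pG; exact: h1.
- move=> al alN hp; rewrite -(meK al) => [|i]; auto.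
 apply: map_f; rewrite mem_filter mem_enum andbT meK; auto.
 by apply/allP.
move=> al /mapP[e _ ->] eN; rewrite emK /taylor_coef /h.
have eN' i : i \in enum 'I_n -> (e i < N)%N by move=> _; have := eN i; rewrite ffunE.
have := Op_taylor 0 (enum_uniq 'I_n) sf eN'.
have -> : \prod_(i <- enum 'I_n) ((e i)`!)%:R = \prod_i ((me e i)`!)%:R :> R.
 by rewrite big_enum; apply: eq_bigr => i _; rewrite ffunE.
have -> : zr (enum 'I_n) (0 : V) = 0 by apply: coordP => i; rewrite /coord !mxE mem_enum.
have -> : foldr (fun i h => iter (e i) (partial i) h) f (enum 'I_n) = dpart (me e) f.
 by rewrite /dpart; elim: (enum 'I_n) => //= i r ->; rewrite ffunE.
move=> <-; rewrite mulfK //; apply/prodf_neq0 => i _; by [].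
Qed.

End Decomposition.

(** * Lower bounds through limits along an ultrafilter *)

Lemma ultra_bounded (R : realType) (T : Type) (U : set_system T) (b : T -> R) (B : R) :
 UltraFilter U -> U [set x | `|b x| <= B] -> exists p : R, b @ U --> p.
Proof.
move=> UU Ub; have UP : ProperFilter U by exact: ultra_proper.
have [p [_ cp]] : `[- B, B]%classic `&` cluster (b @ U) !=set0.
 apply: segment_compact; rewrite /fmap /=; apply: filterS Ub => x /=.
 by rewrite in_itv -ler_norml.
exists p => S nS; have [//|h] := in_ultra_setVsetC (b @^-1` S) UU.
have [q [/= h1 h2]] := cp (~` S) S h nS; by [].
Qed.

Section Continuity.
Variables (R : realType) (T : topologicalType).
Implicit Types g h : T -> R.

Lemma contD g h : continuous g -> continuous h -> continuous (fun x => g x + h x).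
Proof. by move=> cg ch x; apply: cvgD; [exact: cg|exact: ch]. Qed.

Lemma contM g h : continuous g -> continuous h -> continuous (fun x => g x * h x).
Proof. by move=> cg ch x; apply: cvgM; [exact: cg|exact: ch]. Qed.

Lemma cont_norm g : continuous g -> continuous (fun x => `|g x|).
Proof. by move=> cg x; apply: cvg_norm; exact: cg. Qed.

Lemma cont_cst (c : R) : continuous (fun _ : T => c).
Proof. by move=> x; exact: cvg_cst. Qed.

Lemma contN g : continuous g -> continuous (fun x => - g x).
Proof. by move=> cg x; apply: cvgN; exact: cg. Qed.

Lemma cont_sum (I : Type) (r : seq I) (g : I -> T -> R) : (forall i, continuous (g i)) ->
 continuous (fun x => \sum_(i <- r) g i x).
Proof.
move=> cg; elim: r => [|i r ih].
 by under eq_fun do rewrite big_nil; move=> x; exact: cvg_cst.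
by under eq_fun do rewrite big_cons; exact: contD.
Qed.

End Continuity.

Section FaceBound.
Variables (R : realType) (n : nat).
Local Notation V := 'rV[R]_n.
Variables (f : V -> R) (A : seq (mindex n)) (G : seq (mindex n * nat)).
Hypothesis NG : newton_gen f A G.
Variables (Ps : seq (mindex n)).
Hypotheses (PsG : forall al p, al \in Ps -> p \in G -> (p.2 <= npair p.1 al)%N)
 (APs : forall v, v \in A -> v \in Ps).
Local Notation m := (@mm R n A).

Definition torus (x : V) := forall i, coord x i != 0.
Definition lnc (x : V) : 'I_n -> R := fun i => - ln `|coord x i|.

Lemma monomial_neq0 al (x : V) : torus x -> monomial al x != 0.
Proof. by move=> x0; apply/prodf_neq0 => i _; rewrite expf_neq0. Qed.

Lemma mm_gt0 x : torus x -> 0 < m x.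
Proof.
move=> x0; case: A (gen_nil NG) => // v A' _; rewrite /mm big_cons ltr_pwDl ?normr_gt0 ?monomial_neq0 //.
pos.
Qed.

Lemma ln_monomial al (x : V) : torus x -> ln `|monomial al x| = - rpair (lnc x) (mpoint R al).
Proof.
move=> x0; have x1 i : 0 < `|coord x i| by rewrite normr_gt0.
rewrite rpair_mpoint -sumrN /monomial normr_prod.
suff -> (r : seq 'I_n) : ln (\prod_(i <- r) `|coord x i ^+ al i|) = \sum_(i <- r) ln `|coord x i| * (al i)%:R.
 by apply: eq_bigr => i _; rewrite mulNr opprK.
elim: r => [|i r ih]; first by rewrite !big_nil ln1.
rewrite !big_cons lnM ?ih ?posrE ?normrX ?exprn_gt0 //.
 by rewrite lnXn // mulr_natr.
elim: (r) => [|j r' ih']; first by rewrite big_nil.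
by rewrite big_cons mulr_gt0 ?normrX ?exprn_gt0.
Qed.

(** In logarithmic coordinates monomials are linear forms; on the unit box the functional with
    entries -log |x_i| is nonnegative, so its lower bound over [A] extends to the whole
    polyhedron. *)
Lemma mono_dom_torus al x : al \in Ps -> torus x -> inbox 1 x -> `|monomial al x| <= m x.
Proof.
move=> aP x0 bx; have [v vA hv] : exists2 v, v \in A & forall w, w \in A ->
  rpair (lnc x) (mpoint R v) <= rpair (lnc x) (mpoint R w).
 case: A (gen_nil NG) => // v0 A' _; elim: A' => [|v A' [w wA hw]].
  by exists v0; rewrite ?mem_head // => w; rewrite inE => /eqP ->.
 case: (lerP (rpair (lnc x) (mpoint R w)) (rpair (lnc x) (mpoint R v))) => h.
  exists w; first by move: wA; rewrite !inE => /orP[->//|->]; lra.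
  by move=> u; rewrite !inE => /or3P[/eqP ->|/eqP ->|uA] //; apply: hw; rewrite inE ?eqxx ?uA ?orbT.
 exists v; first by rewrite !inE eqxx orbT.
 move=> u; rewrite !inE => /or3P[/eqP ->|/eqP ->|uA] //; apply: le_trans (ltW h) _; apply: hw; rewrite inE ?eqxx ?uA ?orbT //.
apply: le_trans (mm_ge x vA).
rewrite -ler_ln ?posrE ?normr_gt0 ?monomial_neq0 // !ln_monomial // lerN2.
apply: (newton_valid (gen_dom NG)) => [i|//|].
 by rewrite oppr_ge0 ln_le0.
by apply: (gen_ineq NG) => p pG; rewrite rpair_nr ler_nat PsG.
Qed.

Lemma torus_dense_le rho (g : V -> R) : 0 < rho -> continuous g ->
 (forall x, inbox rho x -> torus x -> g x <= 0) -> forall x, inbox rho x -> g x <= 0.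
Proof.
move=> r0 cg h x bx; have := @torus_dense R n rho (fun x => g x + `|g x|) r0 _ _ x bx.
suff h1 : continuous (fun x : V => g x + `|g x|).
 move=> /(_ h1) h2; suff : g x + `|g x| = 0 by have := normr_ge0 (g x); lra.
 by apply: h2 => y by' y0; rewrite ler0_norm ?subrr // h.
by apply: contD => //; exact: cont_norm.
Qed.

Lemma mm_continuous : continuous m.
Proof.
by apply: cont_sum => v; apply: cont_norm; apply: sm_continuous; smooth.
Qed.

Lemma mono_dom al x : al \in Ps -> inbox 1 x -> `|monomial al x| <= m x.
Proof.
move=> aP bx; rewrite -subr_le0; apply: (@torus_dense_le 1 (fun x => `|monomial al x| - m x)) => //.
 apply: contD; last by apply: contN; exact: mm_continuous.
 by apply: cont_norm; apply: sm_continuous; smooth.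
by move=> y by' y0; rewrite subr_le0 mono_dom_torus.
Qed.

Section Ultra.
Variables (K : finType) (H : K -> mindex n -> V -> R) (U : set_system V).
Hypotheses (cH : forall k al, continuous (H k al)) (UU : UltraFilter U).
Local Notation phi := (fun x : V => \sum_k (\sum_(al <- Ps) monomial al x * H k al x) ^+ 2).
(** The ultrafilter concentrates on points that violate every lower bound and tend to 0; along it
    all quotients x^al / m(x) have limits, named [ylim]. *)
Hypothesis (Ubad : forall e : R, 0 < e -> U [set x | [/\ torus x, inbox e x & phi x < e * m x ^+ 2]]).
Local Notation w al := (fun x : V => monomial al x / m x).

Let UP : ProperFilter U. Proof. exact: ultra_proper. Qed.

Let Utorus : U [set x | torus x /\ inbox 1 x].
Proof. by apply: filterS (Ubad ltr01) => x []. Qed.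

Let w_lim al : al \in Ps -> exists y : R, w al @ U --> y.
Proof.
move=> aP; apply: (@ultra_bounded _ _ _ _ 1 UU); apply: filterS Utorus => x [x0 bx] /=.
rewrite normrM normfV (gtr0_norm (mm_gt0 x0)) ler_pdivrMr ?mm_gt0 // mul1r; exact: mono_dom.
Qed.

Definition ylim al : R := lim (w al @ U).
Let ylimP al : al \in Ps -> w al @ U --> ylim al.
Proof. by move=> aP; have [y h] := w_lim aP; rewrite /ylim (cvg_lim _ h). Qed.

Let U0 : U --> (0 : V).
Proof.
move=> S /nbhs_ballP[r r0 hr]; apply: filterS (Ubad (divr_gt0 r0 (ltr0n _ 2))) => x [_ bx _].
apply: hr; rewrite -ball_normE /= sub0r normrN; apply: (@le_lt_trans _ _ (r / 2)).
 rewrite /Num.Def.normr /= mx_normrE; apply: bigmax_le => [|[k i] _]; first by rewrite divr_ge0 // ltW.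
 by rewrite (ord1 k); exact: bx.
by rewrite ltr_pdivrMr // ltr_pMr // ltr1n.
Qed.

Let H_lim k al : H k al @ U --> H k al 0.
Proof. by apply: cvg_trans (cH (x := 0)); apply: cvg_app. Qed.

Lemma cvg_seqsum (I : eqType) (r : seq I) (h : I -> V -> R) (l : I -> R) : (forall i, i \in r -> h i @ U --> l i) ->
 (fun x => \sum_(i <- r) h i x) @ U --> \sum_(i <- r) l i.
Proof.
elim: r => [_|i r ih hr].
 under eq_fun do rewrite big_nil; rewrite big_nil; exact: cvg_cst.
under eq_fun do rewrite big_cons; rewrite big_cons; apply: cvgD; first exact/hr/mem_head.
by apply: ih => j jr; apply: hr; rewrite inE jr orbT.
Qed.

Lemma ultra_unique (b : V -> R) (y z : R) : b @ U --> y -> b @ U --> z -> y = z.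
Proof. by move=> h1 h2; rewrite -(cvg_lim _ h1) // -(cvg_lim _ h2). Qed.

(** After division by m(x)^2 the sum of squares is below every e > 0, while each H(x) tends to
    H(0). *)
Lemma ylim_sum k : \sum_(al <- Ps) ylim al * H k al 0 = 0.
Proof.
pose F k x := \sum_(al <- Ps) w al x * H k al x.
have FL k' : F k' @ U --> \sum_(al <- Ps) ylim al * H k' al 0.
 by apply: cvg_seqsum => al aP; apply: cvgM; auto.
have SL : (fun x => \sum_(k <- index_enum K) F k x ^+ 2) @ U --> \sum_(k <- index_enum K) (\sum_(al <- Ps) ylim al * H k al 0) ^+ 2.
 apply: cvg_seqsum => k' _; rewrite expr2; under eq_fun do rewrite expr2.
 by apply: cvgM; by [].
set Y := \sum_(k <- _) _ in SL.
have Y0 : Y <= 0.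
 apply/ler_addgt0Pl => e e0; rewrite addr0.
 apply: (ler_cvg_to SL (cvg_cst e)); apply: filterS (Ubad e0) => x [x0 _]; have m0 := mm_gt0 x0; rewrite -ltr_pdivrMr ?exprn_gt0 // => /ltW.
 rewrite mulr_suml /F /=; apply: le_trans; apply: eqW.
 apply: eq_bigr => k' _; rewrite -exprVn -exprMn mulr_suml; congr (_ ^+ 2); apply: eq_bigr => al _; ring.
have : (\sum_(al <- Ps) ylim al * H k al 0) ^+ 2 <= 0.
 apply: le_trans Y0; rewrite /Y (bigD1 k) //= lerDl sumr_ge0 // => j _; by [].
nra.
Qed.

Let T := [seq al <- Ps | ylim al != 0].
Let inT al : (al \in T) = (ylim al != 0) && (al \in Ps). Proof. by rewrite mem_filter. Qed.

Let T0 : exists al0, al0 \in T.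
Proof.
have SL : (fun x => \sum_(v <- A) `|w v x|) @ U --> \sum_(v <- A) `|ylim v|.
 by apply: cvg_seqsum => v vA; apply: cvg_norm; auto.
have S1 : (fun x => \sum_(v <- A) `|w v x|) @ U --> (1 : R).
 apply: cvg_near_cst; apply: filterS Utorus => x [x0 _]; have m0 := mm_gt0 x0.
 transitivity (\sum_(v <- A) `|monomial v x| / m x); last by rewrite -mulr_suml divff // gt_eqF.
 by apply: eq_bigr => v _; rewrite normrM normfV (gtr0_norm m0).
have e1 := ultra_unique SL S1.
have /hasP[v vA yv] : has (fun v => ylim v != 0) A.
 apply/negPn/negP => /hasPn h; move: e1; rewrite big_seq big1 => [|v vA].
  lra.
 by have := h v vA; rewrite negbK => /eqP ->; rewrite normr0.
by exists v; rewrite inT yv APs.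
Qed.

(** The exponents with nonzero limit are those of a face whose normal comes from duality: it
    vanishes on differences inside the set, and is positive on differences leaving it and on the
    coordinate vectors. Then the limits are realized, up to a common factor, by an actual point of
    the torus. *)
Lemma ultra_face : exists (a : mindex n) (l : nat) (z : V) (C : R),
 [/\ forall i, (0 < a i)%N, forall al, al \in Ps -> (l <= npair a al)%N & exists2 al, al \in Ps & npair a al = l] /\
 [/\ torus z, 0 < C, forall al, al \in Ps -> npair a al = l -> monomial al z = C * ylim al
  & forall al, al \in Ps -> npair a al != l -> ylim al = 0].
Proof.
have [al0 al0T] := T0; have [y0 a0P] : ylim al0 != 0 /\ al0 \in Ps by move: al0T; rewrite inT => /andP.
pose lam al x := rpair (lnc x) (mpoint R al) - rpair (lnc x) (mpoint R al0).
have lamE al x : torus x -> lam al x = ln `|w al0 x| - ln `|w al x|.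
 move=> x0; have m0 := mm_gt0 x0; have p b : 0 < `|monomial b x| by rewrite normr_gt0 monomial_neq0.
 have q b : ln `|w b x| = ln `|monomial b x| - ln (m x).
  by rewrite normrM normfV (gtr0_norm m0) ln_div ?posrE.
 by rewrite /lam !q !ln_monomial //; ring.
have lnlim al : al \in T -> (fun x => ln `|w al x|) @ U --> ln `|ylim al|.
 rewrite inT => /andP[ya aP]; apply: (@cvg_comp _ _ _ (fun x => `|w al x|) (@ln R) U (nbhs `|ylim al|)).
  by apply: cvg_norm; auto.
 by apply: continuous_ln; rewrite normr_gt0.
have lamL al : al \in T -> lam al @ U --> ln `|ylim al0| - ln `|ylim al|.
 move=> aT; have h : (fun x => ln `|w al0 x| - ln `|w al x|) @ U --> ln `|ylim al0| - ln `|ylim al|.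
  by apply: cvgB; auto.
 apply: cvg_trans h; apply: near_eq_cvg; apply: filterS Utorus => x [x0 _]; by rewrite lamE.
have bnd (b : V -> R) (y : R) : b @ U --> y -> U [set x | `|b x| <= `|y| + 1].
 move=> /cvgrPdist_le /(_ 1 ltr01); apply: filterS => x h.
 have := ler_normB y (y - b x); rewrite subKr => h1; apply: le_trans h1 _; lra.
have lamI al (B : R) : al \in Ps -> al \notin T -> U [set x | B <= lam al x].
 move=> aP aT; have ya : ylim al = 0 by move: aT; rewrite inT aP andbT negbK => /eqP.
 have := bnd _ _ (lnlim al0 al0T); set B1 := _ + 1 => h1.
 have := ylimP aP; rewrite ya => /cvgrPdist_le /(_ (expR (- (B + B1))) (expR_gt0 _)) h2.
 apply: filterS (filterI Utorus (filterI h1 h2)) => x [[x0 _] [h3 h4]].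
 have wp : 0 < `|w al x| by rewrite normr_gt0 mulf_neq0 ?invr_neq0 ?monomial_neq0 // gt_eqF // mm_gt0.
 move: h4; rewrite /= sub0r normrN -[leLHS]lnK ?posrE // ler_expR => h4.
 rewrite /= lamE //; have := ler_norm (- ln `|w al0 x|); rewrite normrN; move: h3 => /= h3; lra.
have lnI i (B : R) : U [set x | B <= lnc x i].
 apply: filterS (Ubad (expR_gt0 (- B))) => x [x0 bx _] /=.
 by rewrite /lnc lerNr -ler_expR lnK ?posrE ?normr_gt0 // bx.
pose df (al be : mindex n) : {ffun 'I_n -> int} := [ffun i => (al i)%:Z - (be i)%:Z].
pose ev (i : 'I_n) : {ffun 'I_n -> int} := [ffun j => (i == j)%:Z].
(* Along the ultrafilter the forms in [G1], present with both signs, stay bounded, while those in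
   [G2] tend to +oo. *)
pose G1 := [seq df al al0 | al <- T] ++ [seq df al0 al | al <- T].
pose G2 := [seq df al al0 | al <- [seq al <- Ps | al \notin T]] ++ [seq ev i | i <- enum 'I_n].
have [Hs [HG HC]] := @cone_inequalities R _ (G1 ++ G2).
(* The sum of all inequalities of the cone is positive on a generator as soon as one of them is. *)
pose az : {ffun 'I_n -> int} := [ffun i => \sum_(h <- Hs) h i].
have azE g : zz az g = \sum_(h <- Hs) zz h g.
 by rewrite /zz exchange_big /=; apply: eq_bigr => i _; rewrite ffunE mulr_suml.
have az_ge g : g \in G1 ++ G2 -> 0 <= zz az g.
 by move=> gG; rewrite azE big_seq; apply: sumr_ge0 => h hH; exact: HG.
pose zl (g : {ffun 'I_n -> int}) x := zp g (lnc x).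
have zl_df al be x : zl (df al be) x = rpair (lnc x) (mpoint R al) - rpair (lnc x) (mpoint R be).
 by rewrite !rpair_mpoint -sumrB; apply: eq_bigr => i _; rewrite ffunE intrB; ring.
have zl_ev i x : zl (ev i) x = lnc x i.
 rewrite /zl /zp (bigD1 i) //= ffunE eqxx mul1r big1 ?addr0 // => j ji.
 by rewrite ffunE eq_sym (negbTE ji) mul0r.
have big g (B : R) : g \in G2 -> U [set x | B <= zl g x].
 rewrite mem_cat => /orP[/mapP[al]|/mapP[i _ ->]]; last first.
  by apply: filterS (lnI i B) => x /=; rewrite zl_ev.
 by rewrite mem_filter => /andP[aT aP] ->; apply: filterS (lamI al B aP aT) => x /=; rewrite zl_df.
have low g : g \in G1 ++ G2 -> exists C : R, U [set x | - C <= zl g x].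
 rewrite mem_cat => /orP[|gG]; last by exists 0; auto.
 rewrite mem_cat => /orP[/mapP[al aT ->]|/mapP[al aT ->]].
  exists (`|ln `|ylim al0| - ln `|ylim al| | + 1); apply: filterS (bnd _ _ (lamL al aT)) => x /=.
  by rewrite zl_df -/(lam al x) ler_norml => /andP[].
 exists (`|ln `|ylim al0| - ln `|ylim al| | + 1); apply: filterS (bnd _ _ (lamL al aT)) => x /=.
 have -> : zl (df al0 al) x = - lam al x by rewrite zl_df /lam opprB.
 by rewrite lerN2; apply: le_trans; exact: ler_norm.
have cone_low Gs (y : 'I_n -> R) : (forall g, g \in Gs -> exists C : R, U [set x | - C <= zl g x]) ->
  incone Gs y -> exists C : R, U [set x | - C <= \sum_i lnc x i * y i].
 elim: Gs y => [|g Gs ih] y hG /=.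
  move=> y00; exists 0; apply: filterS Utorus => x _ /=; rewrite oppr0 big1 // => i _.
  by rewrite y00 mulr0.
 move=> [c c0 hc]; have [C1 h1] := hG g (mem_head _ _).
 have [|C2 h2] := ih _ _ hc; first by move=> g' gG; apply: hG; rewrite inE gG orbT.
 exists (C2 + c * C1); apply: filterS (filterI h1 h2) => x [/= k1 k2].
 have -> : \sum_i lnc x i * y i = \sum_i lnc x i * (y i - c * (g i)%:~R) + c * zl g x.
  by rewrite /zl /zp mulr_sumr -big_split /=; apply: eq_bigr => i _; ring.
 have := ler_wpM2l c0 k1; lra.
(* If [az] vanished on g, all inequalities would, so -g would lie in the cone and be bounded below
   along the ultrafilter, although g tends to +oo. *)
have strict g : g \in G2 -> 0 < zz az g.
 move=> gG; have gG' : g \in G1 ++ G2 by rewrite mem_cat gG orbT.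
 rewrite lt_neqAle az_ge // andbT eq_sym; apply/negP => /eqP; rewrite azE big_seq => /eqP.
 rewrite psumr_eq0; auto.
 move=> /allP z0; have hz h : h \in Hs -> zz h g = 0 by move=> hH; have := z0 h hH; rewrite hH => /eqP.
 have /HC /(cone_low _ _ low)[C hC] : forall h, h \in Hs -> 0 <= zp h (fun i => - (g i)%:~R : R).
  move=> h hH; rewrite (_ : zp h _ = - (zz h g)%:~R); first by rewrite hz ?oppr0.
  by rewrite /zz raddf_sum /= /zp -sumrN; apply: eq_bigr => i _; lra.
 have [x [/= h1 h2]] := @filter_ex _ _ UP _ (filterI hC (big g (C + 1) gG)).
 move: h1 h2; rewrite (_ : \sum_i _ = - zl g x); last by rewrite -sumrN; apply: eq_bigr => i _; lra.
 lra.
have a_ev i : zz az (ev i) = az i.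
 rewrite /zz (bigD1 i) //= [X in _ * X]ffunE eqxx mulr1 big1 ?addr0 // => j ji.
 by rewrite [X in _ * X]ffunE eq_sym (negbTE ji) mulr0.
have a_gt0 i : 0 < az i.
 by rewrite -a_ev strict // mem_cat map_f ?mem_enum ?orbT.
pose a : mindex n := [ffun i => `|az i|%N].
have aE i : (a i)%:Z = az i by rewrite ffunE gtz0_abs.
have npE al be : (npair a al)%:Z - (npair a be)%:Z = zz az (df al be).
 have e1 b : (npair a b)%:Z = \sum_i az i * (b i)%:Z.
  by rewrite /npair (big_morph Posz PoszD (erefl _)); apply: eq_bigr => i _; rewrite PoszM aE.
 by rewrite !e1 -sumrB; apply: eq_bigr => i _; rewrite [X in _ = _ * X]ffunE mulrBr.
have inl al : al \in T -> df al al0 \in G1 ++ G2.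
 by move=> aT; rewrite mem_cat; apply/orP; left; rewrite mem_cat; apply/orP; left; apply/mapP; exists al.
have inr al : al \in T -> df al0 al \in G1 ++ G2.
 by move=> aT; rewrite mem_cat; apply/orP; left; rewrite mem_cat; apply/orP; right; apply/mapP; exists al.
have T_eq al : al \in T -> npair a al = npair a al0.
 move=> aT; apply/eqP; rewrite -eqz_nat -subr_eq0 npE eq_le az_ge ?inl // andbT.
 by rewrite -oppr_ge0 -npE opprB npE az_ge ?inr.
have T_lt al : al \in Ps -> al \notin T -> (npair a al0 < npair a al)%N.
 move=> aP aT; rewrite -ltz_nat -subr_gt0 npE strict // mem_cat; apply/orP; left.
 by apply/mapP; exists al; rewrite // mem_filter aT.
have l_le al : al \in Ps -> (npair a al0 <= npair a al)%N.
 by move=> aP; have [/T_eq ->//|/(T_lt _ aP)/ltnW] := boolP (al \in T).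
have eqT al : al \in Ps -> (npair a al == npair a al0) = (al \in T).
 move=> aP; have [/T_eq ->|/(T_lt _ aP) h] := boolP (al \in T); first by rewrite eqxx.
 by rewrite gtn_eqF.
pose k := size T; pose tn (r : 'I_k) := nth al0 T r.
have tnT r : tn r \in T by rewrite mem_nth.
pose M : 'M[R]_(n, k) := \matrix_(i, r) ((tn r i)%:R - (al0 i)%:R).
pose t : 'rV[R]_k := \row_r (ln `|ylim al0| - ln `|ylim (tn r)|).
pose lx x : 'rV[R]_n := \row_i lnc x i.
have lxM x r : (lx x *m M) 0 r = lam (tn r) x.
 by rewrite mxE /lam !rpair_mpoint -sumrB; apply: eq_bigr => i _; rewrite !mxE; ring.
(* The logarithms tend to [t] inside the row space of [M]. That space is closed: the projection [Pm]
   fixes the approximants, hence the limit, so [t] is attained exactly by some [mu]. *)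
pose Pm := pinvmx M *m M.
have tP : t *m Pm = t.
 apply/rowP => r; have h1 : (fun x => (lx x *m M *m Pm) 0 r) @ U --> (t *m Pm) 0 r.
  rewrite mxE; under eq_fun do rewrite mxE.
  apply: cvg_seqsum => s _; apply: cvgM; last exact: cvg_cst.
  by under eq_fun do rewrite lxM; rewrite mxE; exact: lamL.
 have h2 : (fun x => (lx x *m M *m Pm) 0 r) @ U --> t 0 r.
  under eq_fun do rewrite mulmxA mulmxKpV ?submxMl // lxM.
  by rewrite mxE; exact: lamL.
 exact: ultra_unique h1 h2.
pose mu := t *m pinvmx M.
have muM r : \sum_i mu 0 i * ((tn r i)%:R - (al0 i)%:R) = ln `|ylim al0| - ln `|ylim (tn r)|.
 have := congr1 (fun X : 'rV_k => X 0 r) tP; rewrite /Pm mulmxA -/mu !mxE => <-.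
 by apply: eq_bigr => i _; rewrite [M i r]mxE.
(* Signs are taken from a point of the ultrafilter's sets, absolute values from [mu]. *)
have [x [x0 hx]] : exists x, torus x /\ forall al, al \in T -> Num.sg (w al x) = Num.sg (ylim al).
 have hs (S : seq (mindex n)) : (forall al, al \in S -> al \in T) ->
   U [set x | forall al, al \in S -> Num.sg (w al x) = Num.sg (ylim al)].
  elim: S => [_|al S ih hS]; first by apply: filterS Utorus => x _ al; by [].
  have aT := hS al (mem_head _ _); move: (aT); rewrite inT => /andP[ya aP].
  have e0 : 0 < `|ylim al| / 2 by rewrite divr_gt0 ?normr_gt0.
  have := ylimP aP => /cvgrPdist_le /(_ _ e0) h1.
  have h2 := ih (fun b bS => hS b (mem_behead (s := al :: S) bS)).
  apply: filterS (filterI h1 h2) => x [/= k1 k2] b; rewrite inE => /predU1P[->|]; auto.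
  case: (ltrgt0P (ylim al)) ya k1 => // yp _.
   rewrite ler_norml => /andP[k3 k4]; rewrite !gtr0_sg //; lra.
  rewrite ler_norml => /andP[k3 k4]; rewrite !ltr0_sg //; lra.
 have [x [[x0 _] h]] := @filter_ex _ _ UP _ (filterI Utorus (hs T (fun _ h => h))).
 by exists x.
pose z : V := \row_i (Num.sg (coord x i) * expR (- mu 0 i)).
have zE al : monomial al z = Num.sg (monomial al x) * expR (- \sum_i mu 0 i * (al i)%:R).
 rewrite /monomial (big_morph (@Num.sg R) (@sgrM R) (@sgr1 R)) -sumrN expR_sum -big_split /=; apply: eq_bigr => i _.
 by rewrite /coord mxE exprMn sgrX -mulNr mulrC expRM_natr mulrC.
pose C := expR (- \sum_i mu 0 i * (al0 i)%:R) / `|ylim al0|.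
exists a, (npair a al0), z, C; split.
 split=> //; last by exists al0.
 by move=> i; have := a_gt0 i; rewrite -aE ltz_nat.
split; last by move=> al aP; rewrite eqT // inT aP andbT negbK => /eqP.
- move=> i; rewrite /coord mxE mulf_neq0 //; first by rewrite sgr_eq0; exact: x0.
 pos.
- by rewrite divr_gt0 ?normr_gt0.
move=> al aP /eqP; rewrite eqT // => aT.
have yp : 0 < `|ylim al| by move: aT; rewrite inT => /andP[h _]; rewrite normr_gt0.
have yp0 : 0 < `|ylim al0| by rewrite normr_gt0.
have sgE : Num.sg (monomial al x) = Num.sg (ylim al).
 by rewrite -(hx al aT) sgrM sgrV (gtr0_sg (mm_gt0 x0)) mulr1.
rewrite zE sgE [ylim al in RHS]numEsg; have iT : (index al T < k)%N by rewrite index_mem.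
have := muM (Ordinal iT); rewrite /tn /= nth_index // => h.
have -> : - \sum_i mu 0 i * (al i)%:R = - \sum_i mu 0 i * (al0 i)%:R - ln `|ylim al0| + ln `|ylim al|.
 have -> : \sum_i mu 0 i * (al i)%:R = \sum_i mu 0 i * (al0 i)%:R + (ln `|ylim al0| - ln `|ylim al|).
  by rewrite -h -big_split /=; apply: eq_bigr => i _; ring.
 by ring.
by rewrite (expRD _ (ln `|ylim al|)) (expRD _ (- ln `|ylim al0|)) (expRN (ln `|ylim al0|)) !lnK ?posrE // /C; ring.
Qed.

End Ultra.

(** If no constant worked, the violating points would generate a filter at 0; an ultrafilter above
    it yields a face and a torus point where all leading sums vanish. [H] is left free because three
    instances occur: the Euler derivatives of f, f itself, and f together with the monomials off the
    principal face. *)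
Lemma face_bound (K : finType) (H : K -> mindex n -> V -> R) : (forall k al, continuous (H k al)) ->
 (forall (a : mindex n) (l : nat) (z : V), (forall i, (0 < a i)%N) ->
  (forall al, al \in Ps -> (l <= npair a al)%N) -> (exists2 al, al \in Ps & npair a al = l) -> torus z ->
  exists k, \sum_(al <- Ps | npair a al == l) H k al 0 * monomial al z != 0) ->
 exists2 c : R, 0 < c & forall x, inbox c x ->
  c * m x ^+ 2 <= \sum_k (\sum_(al <- Ps) monomial al x * H k al x) ^+ 2.
Proof.
move=> cH hyp; pose phi (x : V) := \sum_k (\sum_(al <- Ps) monomial al x * H k al x) ^+ 2.
suff [c c0 hc] : exists2 c : R, 0 < c & forall x, inbox c x -> torus x -> c * m x ^+ 2 <= phi x.
 exists c => // x bx; rewrite -subr_le0.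
 apply: (@torus_dense_le c (fun x => c * m x ^+ 2 - phi x)) => //; last by move=> y by' y0; rewrite subr_le0 hc.
 have cm := mm_continuous; have cc := @cont_cst R V c.
 apply: contD; first by apply: contM => //; under eq_fun do rewrite expr2; exact: contM.
 apply: contN; apply: cont_sum => k; under eq_fun do rewrite expr2.
 suff h : continuous (fun x => \sum_(al <- Ps) monomial al x * H k al x) by exact: contM.
 apply: cont_sum => al; apply: contM => //; apply: sm_continuous; smooth.
apply: contrapT => nex.
pose B (e : R) : set V := [set x | [/\ torus x, inbox e x & phi x < e * m x ^+ 2]].
have B0 e : 0 < e -> B e !=set0.
 move=> e0; apply: contrapT => nB; apply: nex; exists e => // x bx x0; rewrite leNgt; apply/negP => h.
 by apply: nB; exists x.
have FB : Filter (filter_from [set e : R | 0 < e] B).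
 apply: filter_from_filter; first by exists 1 => /=.
 move=> e1 e2 /= h1 h2; exists (Num.min e1 e2); first pos.
 move=> x [x0 bx px]; have b1 : Num.min e1 e2 <= e1 by rewrite ge_min lexx.
 have b2 : Num.min e1 e2 <= e2 by rewrite ge_min lexx orbT.
 split; split=> //.
 - by move=> i; apply: le_trans (bx i) b1.
 - nra.
 - by move=> i; apply: le_trans (bx i) b2.
 - nra.
have PB : ProperFilter (filter_from [set e : R | 0 < e] B) by apply: filter_from_proper.
have [U [UU FU]] := ultraFilterLemma PB.
have Ubad e : 0 < e -> U (B e) by move=> e0; apply: FU; exists e.
have [a [l [z [C [[a0 al hl] [z0 C0 zE yE]]]]]] := @ultra_face K H U UU Ubad.
have [k] := hyp a l z a0 al hl z0; case/negP; apply/eqP.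
have := ylim_sum cH UU Ubad k; rewrite (bigID (fun al => npair a al == l)) /= [X in _ + X]big_seq_cond.
rewrite [X in _ + X]big1 ?addr0 => [|be /andP[bP bl]]; last by rewrite yE // mul0r.
move=> s0; apply: (mulfI (invr_neq0 (lt0r_neq0 C0))); rewrite mulr0 -[RHS]s0 mulr_sumr.
rewrite big_seq_cond [RHS]big_seq_cond; apply: eq_bigr => be /andP[bP /eqP bl].
by rewrite (zE be bP bl); field; pos.
Qed.

End FaceBound.

(** * Weighted scalings *)

Section Scaling.
Variables (R : realType) (n : nat).
Local Notation V := 'rV[R]_n.
Implicit Types (x y : V) (a : mindex n).

Definition psupp a : seq 'I_n := [seq i <- enum 'I_n | (0 < a i)%N].
Lemma mem_psupp a i : (i \in psupp a) = (0 < a i)%N.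
Proof. by rewrite mem_filter mem_enum andbT. Qed.

Lemma sm_zr r (g : V -> R) : sm g -> sm (fun x => g (zr r x)).
Proof.
move=> sg; elim: r => [|i r ih].
 by rewrite (_ : (fun x => _) = g) //; apply/funext => x; congr g; apply: coordP => i; rewrite /coord mxE.
rewrite (_ : (fun x => _) = res i (fun x => g (zr r x))); first exact: sm_res.
apply/funext => x; congr g; apply: coordP => j; rewrite /coord !mxE inE.
by case: (eqVneq j i) => [->|ji]; rewrite ?coord_upd ?eqxx ?(negbTE ji); case: ifP.
Qed.

Lemma tscale_lip a x (h : V -> R) : sm h -> exists2 C : R, 0 <= C & forall t, 0 < t -> t <= 1 ->
 `|h (tscale a t x) - h (zr (psupp a) x)| <= C * t.
Proof.
move=> sh; pose K := `|x|.
have [B B0 hB] : exists2 B : R, 0 <= B & forall i y, (forall j, `|coord y j| <= 3 * K) -> `|partial i h y| <= B.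
 have /choice[b hb] j : exists B : R, 0 <= B /\ forall y, (forall l, `|coord y l| <= 3 * K) ->
   `|partial j h y| <= B.
  by have [B ? ?] := bounded_box (3 * K) (sm_continuous (sm_partial j sh)); exists B.
 exists (\sum_j b j); first by apply: sumr_ge0 => j _; case: (hb j).
 move=> j y yK; have [_ /(_ y yK) hj] := hb j; apply: le_trans hj _.
 by rewrite (bigD1 j) //= lerDl sumr_ge0 // => l _; case: (hb l).
have L := box_lip (normr_ge0 x) B0 (fun i y => sm_is_derive i y sh) hB.
exists (B * \sum_i `|coord x i|); first pos.
move=> t t0 t1; have xK j : `|coord x j| <= K by exact: coord_norm.
apply: le_trans (L _ _ _ _) _.
- exact: (tscale_inbox a (ltW t0) t1 xK).
- by move=> j; rewrite /coord mxE; case: ifP => _; rewrite ?normr0; by [].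
rewrite -mulrA ler_wpM2l // mulr_suml; apply: ler_sum => i _.
rewrite {1 2}/coord !mxE mem_psupp; case: (posnP (a i)) => [->|ai].
 by rewrite mul1r subrr normr0 mulr_ge0 // ltW.
rewrite subr0 normrM mulrC ler_wpM2l // ger0_norm ?exprn_ge0 ?(ltW t0) //.
by rewrite -[leRHS]expr1; apply: ler_wiXn2l => //; auto.
Qed.

(** Terms with <a, al> > l are O(t^(l+1)); in the others the coefficient at t^a x differs by O(t)
    from its value with the scaled coordinates set to 0. *)
Lemma scaling_limit a (l : nat) x (S : seq (mindex n)) (h : mindex n -> V -> R) : (forall al, sm (h al)) ->
 (forall al, al \in S -> (l <= npair a al)%N) -> exists2 C : R, 0 <= C & forall t, 0 < t -> t <= 1 ->
 `|\sum_(al <- S) monomial al (tscale a t x) * h al (tscale a t x) -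
  t ^+ l * \sum_(al <- S | npair a al == l) monomial al x * h al (zr (psupp a) x)| <= C * t ^+ l.+1.
Proof.
move=> sh; elim: S => [_|al S ih hS].
 by exists 0 => // t _ _; rewrite !big_nil mulr0 subrr normr0 mul0r.
have [|C C0 hC] := ih; first by move=> be bS; apply: hS; rewrite inE bS orbT.
have [D D0 hD] := tscale_lip a x (sh al).
pose c := `|monomial al x|; pose e := `|h al (zr (psupp a) x)|.
have c0 : 0 <= c by exact: normr_ge0.
have e0 : 0 <= e by exact: normr_ge0.
exists (C + c * (D + e)); first by pos; by [].
move=> t t0 t1; rewrite !big_cons; have := hS al (mem_head _ _); rewrite tscale_monomial => lal.
have tl : 0 <= t ^+ l by rewrite exprn_ge0 // ltW.
set X := \sum_(al <- S) _; set Y := \sum_(al <- S | _) _.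
have hXY : `|X - t ^+ l * Y| <= C * t ^+ l.+1 by exact: hC.
have h1 := hD t t0 t1; rewrite -/e in h1 *.
case: eqP => [->|/eqP ne].
 have -> : t ^+ l * monomial al x * h al (tscale a t x) + X - t ^+ l * (monomial al x * h al (zr (psupp a) x) + Y) =
   (X - t ^+ l * Y) + t ^+ l * monomial al x * (h al (tscale a t x) - h al (zr (psupp a) x)) by ring.
 apply: le_trans (ler_normD _ _) _; rewrite mulrDl; apply: lerD => //.
 rewrite !normrM (ger0_norm tl) -/c exprSr.
 apply: (@le_trans _ _ (t ^+ l * c * (D * t))); first by apply: ler_wpM2l => //; pos.
 rewrite [leLHS](_ : _ = c * D * (t ^+ l * t)); last lra.
 apply: ler_wpM2r; first pos.
 nra.
have lt : (l.+1 <= npair a al)%N by rewrite ltn_neqAle eq_sym ne.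
have -> : t ^+ npair a al * monomial al x * h al (tscale a t x) + X - t ^+ l * Y =
  (X - t ^+ l * Y) + t ^+ npair a al * (monomial al x * h al (tscale a t x)) by ring.
apply: le_trans (ler_normD _ _) _; rewrite mulrDl; apply: lerD => //.
rewrite !normrM -/c ger0_norm ?exprn_ge0 ?(ltW t0) //.
have h2 : `|h al (tscale a t x)| <= D + e.
 have := ler_normD (h al (tscale a t x) - h al (zr (psupp a) x)) (h al (zr (psupp a) x)).
 rewrite subrK -/e => h3; nra.
have h3 : t ^+ npair a al <= t ^+ l.+1 by apply: ler_wiXn2l => //; exact: ltW.
rewrite mulrC; apply: ler_pM => //; first pos.
 pos.
exact: ler_wpM2l.
Qed.

Lemma scaling_cvg (u : R -> R) (l : nat) (P C : R) : 0 <= C ->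
 (forall t, 0 < t -> t <= 1 -> `|u t - t ^+ l * P| <= C * t ^+ l.+1) -> (fun t => u t / t ^+ l) @ 0^'+ --> P.
Proof.
move=> C0 h; apply/cvgrPdist_le => e e0; near=> t.
have t0 : 0 < t by near: t; exact: nbhs_right_gt.
have t1 : t <= 1 by near: t; exact: nbhs_right_le.
have te : t <= e / (C + 1) by near: t; apply: nbhs_right_le; rewrite divr_gt0 // ltr_wpDl.
have tl : 0 < t ^+ l by rewrite exprn_gt0.
rewrite (_ : P - _ = - (u t - t ^+ l * P) / t ^+ l); last by field; pos.
rewrite normrM normrN normfV (gtr0_norm tl) ler_pdivrMr //.
apply: le_trans (h t t0 t1) _; rewrite exprS mulrA; apply: ler_wpM2r; auto.
move: te; rewrite ler_pdivlMr ?ltr_wpDl // => te; apply: le_trans te.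
by rewrite mulrC ler_wpM2l ?(ltW t0) // lerDl.
Unshelve. by end_near. Qed.

Lemma scaling_sign (u : R -> R) (l : nat) (P C : R) : 0 <= C -> P != 0 ->
 (forall t, 0 < t -> t <= 1 -> `|u t - t ^+ l * P| <= C * t ^+ l.+1) ->
 exists2 t0 : R, 0 < t0 & forall t, 0 < t -> t <= t0 -> 0 < u t * P.
Proof.
move=> C0 P0 h; have p0 : 0 < `|P| by rewrite normr_gt0.
exists (Num.min 1 (`|P| / (C + 1) / 2)).
 pos.
move=> t t0; rewrite le_min => /andP[t1 t2].
have tl : 0 < t ^+ l by rewrite exprn_gt0.
have h1 := h t t0 t1.
have h2 : C * t ^+ l.+1 <= t ^+ l * (`|P| / 2).
 rewrite exprSr mulrCA ler_wpM2l ?(ltW tl) //.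
 move: t2; rewrite ler_pdivlMr // ler_pdivlMr ?ltr_wpDl // => t2; rewrite ler_pdivlMr //.
 lra.
have h3 : `|u t - t ^+ l * P| <= t ^+ l * (`|P| / 2) by exact: le_trans h2.
have tp : 0 < t ^+ l * `|P| by rewrite mulr_gt0.
move: h3; rewrite ler_norml => /andP[k1 k2].
case: (ltrgt0P P) P0 p0 h1 h2 k1 k2 tp => // Ps _ p0 h1 h2 k1 k2 tp.
 nra.
nra.
Qed.

End Scaling.

(** * Face polynomials and nondegeneracy *)

Section Nondeg.
Variables (R : realType) (n : nat).
Local Notation V := 'rV[R]_n.
Variables (f : V -> R) (A : seq (mindex n)) (G : seq (mindex n * nat)).
Hypothesis NG : newton_gen f A G.
Variables (N : nat) (rho : R) (Ps : seq (mindex n)) (F : mindex n -> V -> R).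
Hypotheses (rho0 : 0 < rho) (rho1 : rho <= 1) (dc : decomp f G N rho Ps F) (NA : forall v i, v \in A -> (v i < N)%N).
Local Notation m := (@mm R n A).

Definition fF (x : V) : R := \sum_(al <- Ps) monomial al x * F al x.

Lemma A_Ps v : v \in A -> v \in Ps.
Proof. by move=> vA; apply: (dc_all dc) => [i|p pG]; [exact: NA|exact: (gen_G NG)]. Qed.

Lemma Ps_newton al : al \in Ps -> newton_poly f (mpoint R al).
Proof. by move=> aP; apply: (gen_ineq NG) => p; rewrite rpair_nr ler_nat; exact: (dc_G dc). Qed.

Lemma fFE x : inbox rho x -> f x = fF x. Proof. exact: (dc_eq dc). Qed.

Lemma sm_fF : sm fF.
Proof. by apply: sm_sum => al _; apply: sm_mul; [exact: sm_monomial|exact: (dc_sm dc)]. Qed.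

(** The factor of x^al in x_i d_i (x^al F). At 0 it equals al_i F(0), the coefficient in the Euler
    derivative of a face polynomial. *)
Definition Hd (i : 'I_n) (al : mindex n) (x : V) : R := (al i)%:R * F al x + eul i (F al) x.

Lemma eul_fF i x : eul i fF x = \sum_(al <- Ps) monomial al x * Hd i al x.
Proof.
rewrite /eul /fF pd_sum; last by move=> al _; apply: sm_mul; [exact: sm_monomial|exact: (dc_sm dc)].
rewrite mulr_sumr; apply: eq_bigr => al _; rewrite pd_mul; [|exact: sm_monomial|exact: (dc_sm dc)].
by rewrite mulrDr [X in _ + X]mulrCA pd_monomial /Hd /eul; ring.
Qed.

Lemma sym_fF k : sym rho k (fun _ => m) (fun=> fF).
Proof.
have m0 : forall (L : R) x, 0 <= m x by move=> L x; exact: mm_ge0.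
have -> : (fun=> fF) = (fun (L : R) x => \sum_(al <- [seq al <- Ps | al \in Ps]) monomial al x * F al x).
 by rewrite (_ : [seq al <- Ps | al \in Ps] = Ps) //; apply/all_filterP/allP.
suff H S : (forall al, al \in S -> al \in Ps) -> sym rho k (fun _ => m) (fun (L : R) x => \sum_(al <- S) monomial al x * F al x).
 by apply: H => al; rewrite mem_filter => /andP[].
elim: S => [_|al S ih hS].
 apply: (sym_ext (u := fun _ _ => 0)); first by move=> L; apply/funext => x; rewrite big_nil.
 by apply: sym_weight (sym_scalar n rho k (fun=> 0)); exists 0 => // L x _ _; rewrite normr0 mul0r.
apply: (sym_ext (u := fun (L : R) x => monomial al x * F al x + \sum_(be <- S) monomial be x * F be x)).
 by move=> L; apply/funext => x; rewrite big_cons.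
apply: sym_add; last by apply: ih => be bS; apply: hS; rewrite inE bS orbT.
apply: sym_weight (sym_mul (sym_monomial rho k al) (sym_static rho k (dc_sm dc al))).
exists 1 => // L x _ bx; rewrite mulr1 mul1r; apply: (mono_dom NG (fun al p => @dc_G _ _ _ _ _ _ _ _ dc al p)).
 by apply: hS; exact: mem_head.
by move=> i; exact: le_trans rho1.
Qed.

Section Face.
Variables (a : mindex n) (l : nat).
Hypotheses (a0 : forall i, (0 < a i)%N) (al_l : forall al, al \in Ps -> (l <= npair a al)%N)
 (l_al : exists2 al, al \in Ps & npair a al = l).
Definition gam : set V := newton_poly f `&` Hplane (natv a) l%:Z.

Lemma hplaneE x : Hplane (natv a) l%:Z x <-> rpair (nr R a) x = l%:R.
Proof. by []. Qed.

Lemma gam_face : is_face (newton_poly f) gam.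
Proof.
exists (natv a), l%:Z; split=> // x Px; rewrite /Hhalf /= ipair_natv.
apply: (newton_valid (gen_dom NG) _ _ Px) => [i|v vA]; auto.
by rewrite rpair_nr ler_nat al_l // A_Ps.
Qed.

(* The functional [K a - c] is nonnegative and bounded below on [A] by its value on [gam]. *)
Lemma gam_bound (c : mindex n) (L : nat) x : gam x -> (forall v, v \in A -> npair a v = l -> (npair c v <= L)%N) ->
 rpair (nr R c) x <= L%:R.
Proof.
move=> [Px /hplaneE xl] cL.
pose K := (\sum_i c i + \sum_(v <- A) npair c v)%N.
have K1 i : (c i <= K * a i)%N.
 apply: leq_trans (leq_pmulr _ (a0 i)); apply: leq_trans (leq_addr _ _).
 by rewrite (bigD1 i) //= leq_addr.
have K2 v : v \in A -> (npair c v <= K)%N.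
 move=> vA; apply: leq_trans (leq_addl _ _); by rewrite (big_rem v) //= leq_addr.
have := newton_valid (gen_dom NG) (c := fun i => (K * a i)%:R - (c i)%:R) (l := (K * l)%:R - L%:R) _ _ Px.
have split y : rpair (fun i => (K * a i)%:R - (c i)%:R) y = K%:R * rpair (nr R a) y - rpair (nr R c) y.
 by rewrite mulr_sumr -sumrB; apply: eq_bigr => i _; lra.
rewrite split xl => h; suff : (K * l)%:R - L%:R <= K%:R * l%:R - rpair (nr R c) x :> R by rewrite natrM; lra.
apply: h => [i|v vA]; first by rewrite subr_ge0 ler_nat.
rewrite split !rpair_nr -natrM; have [e|ne] := eqVneq (npair a v) l.
 by rewrite e lerB // ler_nat cL.
rewrite lerBlDr addrAC lerBrDr -!natrD ler_nat; apply: leq_trans (leq_addr _ _).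
apply: (@leq_trans (K * l.+1)); first by rewrite mulnS addnC leq_add2r K2.
by rewrite leq_mul2l; apply/orP; right; rewrite ltn_neqAle eq_sym ne; exact/al_l/A_Ps.
Qed.

Lemma gam_coord x i : gam x -> coord x i < N%:R.
Proof.
move=> gx; pose c : mindex n := [ffun j => (j == i : nat)].
have cE y : rpair (nr R c) y = coord y i.
 rewrite /rpair (bigD1 i) //= big1 => [|j ji]; last by rewrite /nr ffunE (negbTE ji) mul0r.
 by rewrite /nr ffunE eqxx mul1r addr0.
have N0 : (0 < N)%N by have [v vA] := exA NG; apply: leq_ltn_trans (NA i vA).
rewrite -cE; apply: (@le_lt_trans _ _ N.-1%:R); last by rewrite ltr_nat prednK.
apply: gam_bound => // v vA _; rewrite -(ler_nat R) -rpair_nr cE /coord mxE ler_nat -ltnS prednK //.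
exact: NA.
Qed.

(** All entries of [a] are positive, which bounds the coordinates on the face through
    [gam_bound]. *)
Lemma gam_compact : compact gam.
Proof.
apply: bounded_closed_compact.
 exists N%:R; split; auto.
 move=> M NM x gx /=; rewrite /Num.Def.normr /= mx_normrE; apply: bigmax_le => [|[k i] _].
  by apply: le_trans (ltW NM).
 rewrite /= (ord1 k) ger0_norm; first by apply/ltW/(lt_trans (gam_coord i gx)).
 have [Px _] := gx; pose c (j : 'I_n) : R := (j == i)%:R.
 have := newton_valid (gen_dom NG) (c := c) (l := 0) _ _ Px.
 have cE y : rpair c y = coord y i.
  rewrite /rpair (bigD1 i) //= big1 => [|j ji]; last by rewrite /c (negbTE ji) mul0r.
  by rewrite /c eqxx mul1r addr0.
 by rewrite cE; apply=> [j|v vA]; [exact: ler0n|rewrite cE /coord mxE].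
have cr (c : 'I_n -> R) : continuous (rpair c : V -> R).
 apply: cont_sum => i; apply: contM; first exact: cont_cst.
 exact: coord_continuous.
have -> : gam = (\bigcap_(p in [set p | p \in G]) (rpair (nr R p.1) @^-1` [set y | p.2%:R <= y])) `&`
  (rpair (nr R a) @^-1` [set y | y = l%:R]).
 apply/seteqP; split=> x [Px /hplaneE xl]; split=> //.
 - by move=> p pG; exact: (newton_G NG).
 - by apply: (gen_ineq NG) => p; exact: Px.
apply: closedI; first apply: closed_bigI => p _; apply: preimage_closed => //; by [].
Qed.

Lemma gam_mindex al : gam (mpoint R al) <-> (al \in Ps) && (npair a al == l).
Proof.
split=> [gx|/andP[aP /eqP e]]; last first.
 by split; [exact: Ps_newton|apply/hplaneE; rewrite rpair_nr e].
have [Px /hplaneE] := gx; rewrite rpair_nr => /eqP; rewrite eqr_nat => ->; rewrite andbT.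
apply: (dc_all dc) => [i|p pG].
 by have := gam_coord i gx; rewrite /coord mxE ltr_nat.
by have := newton_G NG pG Px; rewrite rpair_nr ler_nat.
Qed.

Lemma gam_coef al : al \in Ps -> npair a al = l -> F al 0 = taylor_coef f al.
Proof.
move=> aP e; apply: (dc_coef dc) => // i; have /(gam_coord i) : gam (mpoint R al).
 by apply/gam_mindex; rewrite aP e eqxx.
by rewrite /coord mxE ltr_nat.
Qed.

Definition fpoly (z : V) : R := \sum_(al <- Ps | npair a al == l) F al 0 * monomial al z.

Lemma face_polyE : face_poly f gam = fpoly.
Proof.
apply/funext => z; rewrite /face_poly /fpoly; pose s := [seq al <- Ps | npair a al == l].
have us : uniq s by rewrite filter_uniq // (dc_uniq dc).
transitivity (\sum_(al <- s) taylor_coef f al * monomial al z).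
 rewrite [RHS]fsbig_seq // (_ : [set al : mindex n | gam (mpoint R al)] = [set` s]) //.
 by apply/seteqP; split=> al /=; rewrite mem_filter andbC; apply gam_mindex.
rewrite big_filter big_seq_cond [RHS]big_seq_cond; apply: eq_bigr => al /andP[aP /eqP e].
by rewrite gam_coef.
Qed.

Lemma sm_fpoly : sm fpoly.
Proof. by apply: sm_sum => al _; smooth. Qed.

Lemma eul_fpoly i z : eul i fpoly z = \sum_(al <- Ps | npair a al == l) (al i)%:R * F al 0 * monomial al z.
Proof.
rewrite /eul pd_sum; last by move=> al _; smooth.
rewrite mulr_sumr; apply: eq_bigr => al _; rewrite pd_scale; last exact: sm_monomial.
by rewrite mulrCA pd_monomial; ring.
Qed.

Lemma tscale_torus (t : R) (z : V) : 0 < t -> torus z -> torus (tscale a t z).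
Proof.
move=> t0 z0 i; rewrite /coord mxE; apply: mulf_neq0; auto.
pos.
Qed.

Lemma tscale_small (z : V) (r : R) : 0 < r -> exists2 t0 : R, 0 < t0 & forall t, 0 < t -> t <= t0 -> inbox r (tscale a t z).
Proof.
move=> r0; exists (Num.min 1 (r / (`|z| + 1))); first pos.
move=> t t0; rewrite le_min => /andP[t1 t2] i; rewrite /coord mxE normrM.
apply: (@le_trans _ _ (t * `|z|)).
 apply: ler_pM => //; last exact: coord_norm.
 rewrite ger0_norm ?exprn_ge0 ?(ltW t0) // -[leRHS]expr1; apply: ler_wiXn2l => //; auto.
move: t2; rewrite ler_pdivlMr //; lra.
Qed.

Hypothesis ndg : forall gam, is_face (newton_poly f) gam -> gam !=set0 -> compact gam ->
  forall x, inbox rho x -> torus x -> exists i, partial i (face_poly f gam) x != 0.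

(** Nondegeneracy is given only near the origin; quasi-homogeneity carries a torus point into the
    box and the nonzero derivative back. *)
Lemma fpoly_nondeg z : torus z -> exists i, eul i fpoly z != 0.
Proof.
move=> z0; have [t0 t00 ht] := tscale_small z rho0.
have g0 : gam !=set0.
 by have [al aP e] := l_al; exists (mpoint R al); apply/gam_mindex; rewrite aP e eqxx.
have [i] := ndg gam_face g0 gam_compact (ht t0 t00 (lexx _)) (tscale_torus t00 z0).
rewrite face_polyE => pi; exists i; rewrite eul_fpoly.
have : eul i fpoly (tscale a t0 z) != 0 by rewrite mulf_neq0 //; exact: tscale_torus.
rewrite eul_fpoly; apply: contra_neq => e0.
transitivity (t0 ^+ l * \sum_(al <- Ps | npair a al == l) (al i)%:R * F al 0 * monomial al z); last by rewrite e0 mulr0.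
by rewrite mulr_sumr; apply: eq_bigr => al /eqP e; rewrite tscale_monomial e; ring.
Qed.

(** A zero on the torus is simple by nondegeneracy, so small steps in a suitable x_i produce both
    signs without leaving the orthant. *)
Lemma fpoly_signs z : torus z -> fpoly z = 0 -> exists zp zn, [/\
 forall i, 0 < coord zp i * coord z i, forall i, 0 < coord zn i * coord z i, 0 < fpoly zp & fpoly zn < 0].
Proof.
move=> z0 fz; have [i /[dup] ei] := fpoly_nondeg z0; rewrite {1}/eul mulf_eq0 negb_or => /andP[_ di].
have [C C0 hC] := sm_quad i `|z| sm_fpoly.
set d := partial i fpoly z in di hC *.
have zi : 0 < `|coord z i| by rewrite normr_gt0.
have d0 : 0 < `|d| by rewrite normr_gt0.
(* Small enough to keep the sign of x_i and to let the linear term dominate the quadratic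
   remainder. *)
pose s := Num.min 1 (Num.min (`|coord z i| / 2) (`|d| / (C + 1) / 2)).
have s0 : 0 < s by rewrite !lt_min ltr01 !divr_gt0 // ltr_wpDl.
have s1 : s <= 1 by rewrite ge_min lexx.
have s2 : s <= `|coord z i| / 2 by rewrite !ge_min lexx orbT.
have s3 : s <= `|d| / (C + 1) / 2 by rewrite !ge_min lexx !orbT.
have s4 : C * s <= `|d| / 2.
 move: s3; rewrite ler_pdivlMr // ler_pdivlMr ?ltr_wpDl // => s3; rewrite ler_pdivlMr //.
 lra.
have key e : `|e| = 1 -> (forall j, 0 < coord (upd z i (coord z i + e * s)) j * coord z j) /\
  `|fpoly (upd z i (coord z i + e * s)) - e * s * d| <= s * (`|d| / 2).
 move=> e1; have es : `|e * s| = s by rewrite normrM e1 mul1r gtr0_norm.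
 split=> [j|].
  rewrite coord_upd; case: eqP => [->|_]; last by rewrite -expr2 exprn_even_gt0 //=.
  have : `|e * s * coord z i| <= `|coord z i| / 2 * `|coord z i| by rewrite normrM es ler_wpM2r.
  rewrite ler_norml => /andP[h1 _]; rewrite mulrDl -expr2.
  have := real_normK (num_real (coord z i)); set q := `|coord z i| in zi h1 *.
  by move=> <-; nra.
 have := hC z (e * s) (fun j => coord_norm z j); rewrite es => /(_ s1); rewrite fz subr0 => h1.
 apply: le_trans h1 _; rewrite -(real_normK (num_real (e * s))) es mulrCA ler_wpM2l ?(ltW s0) //.
have sg1 : `|Num.sg d| = 1 by rewrite normr_sg di.
have [k1 k2] := key (Num.sg d) sg1; have [k3 k4] := key (- Num.sg d) (etrans (normrN _) sg1).
have sd : Num.sg d * s * d = s * `|d| by rewrite mulrAC -normrEsg mulrC.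
have sp : 0 < s * `|d| by rewrite mulr_gt0.
exists (upd z i (coord z i + Num.sg d * s)), (upd z i (coord z i - Num.sg d * s)); split.
- exact: k1.
- by move=> j; have := k3 j; rewrite mulNr.
- by move: k2; rewrite sd ler_norml => /andP[h1 h2]; lra.
- by move: k4; rewrite !mulNr sd ler_norml => /andP[h1 h2]; lra.
Qed.

Lemma fpoly_scaling z : exists2 C : R, 0 <= C & forall t, 0 < t -> t <= 1 ->
 `|fF (tscale a t z) - t ^+ l * fpoly z| <= C * t ^+ l.+1.
Proof.
have [C C0 hC] := scaling_limit z (dc_sm dc) al_l; exists C => // t t0 t1; have := hC t t0 t1.
rewrite (_ : zr (psupp a) z = 0); last by apply: coordP => i; rewrite /coord !mxE mem_psupp a0.
rewrite (_ : \sum_(al <- Ps | npair a al == l) _ = fpoly z) //.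
by apply: eq_bigr => al _; lra.
Qed.

(** A zero would give the face polynomial both signs, and f would inherit them at points scaled into
    the box. *)
Lemma fpoly_definite z : (forall x, inbox rho x -> 0 <= f x) \/ (forall x, inbox rho x -> f x <= 0) ->
 torus z -> fpoly z != 0.
Proof.
move=> sgn z0; apply/negP => /eqP fz; have [zp [zn [_ _ hp hn]]] := fpoly_signs z0 fz.
have [Cp Cp0 hCp] := fpoly_scaling zp; have [Cn Cn0 hCn] := fpoly_scaling zn.
have [tp tp0 htp] := scaling_sign Cp0 (lt0r_neq0 hp) hCp.
have [tn tn0 htn] := scaling_sign Cn0 (ltr0_neq0 hn) hCn.
have [rp rp0 hrp] := tscale_small zp rho0; have [rn rn0 hrn] := tscale_small zn rho0.
case: sgn => sgn.
 have t0 : 0 < Num.min tn rn by rewrite lt_min tn0.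
 have := htn _ t0; rewrite ge_min lexx => /(_ isT); rewrite nmulr_lgt0 //; apply/negP; rewrite -leNgt.
 by rewrite -fFE; [apply: sgn|]; apply: hrn => //; rewrite ge_min lexx orbT.
have t0 : 0 < Num.min tp rp by rewrite lt_min tp0.
have := htp _ t0; rewrite ge_min lexx => /(_ isT); rewrite pmulr_lgt0 //; apply/negP; rewrite -leNgt.
by rewrite -fFE; [apply: sgn|]; apply: hrp => //; rewrite ge_min lexx orbT.
Qed.

Section Tau.
Variables (at_ : mindex n) (lt_ : nat).
Hypotheses (lt_A : forall al, al \in Ps -> (lt_ <= npair at_ al)%N)
 (gA : forall v, v \in A -> npair a v = l -> npair at_ v = lt_).

Lemma face_in_tau al : al \in Ps -> npair a al = l -> npair at_ al = lt_.
Proof.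
move=> aP e; apply/eqP; rewrite eqn_leq lt_A // andbT -(ler_nat R) -rpair_nr.
by apply: gam_bound => [|v vA vl]; [apply/gam_mindex; rewrite aP e eqxx|rewrite gA].
Qed.

(** The principal face may be noncompact: coordinates not scaled by [at_] remain variables of the
    coefficients, and the scaled ones are set to 0 there. *)
Definition gtau (x : V) : R := \sum_(al <- Ps | npair at_ al == lt_) monomial al x * F al (zr (psupp at_) x).

Lemma gtau_scaling z : exists2 C : R, 0 <= C & forall t, 0 < t -> t <= 1 ->
 `|gtau (tscale a t z) - t ^+ l * fpoly z| <= C * t ^+ l.+1.
Proof.
pose S := [seq al <- Ps | npair at_ al == lt_].
have [|C C0 hC] := scaling_limit (a := a) (l := l) (S := S) z (fun al => sm_zr (psupp at_) (dc_sm dc al)).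
 by move=> al; rewrite mem_filter => /andP[_]; auto.
exists C => // t t0 t1; have := hC t t0 t1.
rewrite (_ : zr (psupp a) z = 0); last by apply: coordP => i; rewrite /coord !mxE mem_psupp a0.
rewrite (_ : zr (psupp at_) 0 = 0); last by apply: coordP => i; rewrite /zr /coord !mxE; case: ifP; by [].
rewrite (_ : \sum_(al <- S | npair a al == l) _ = fpoly z).
 by rewrite big_filter.
rewrite /S big_filter_cond /fpoly big_seq_cond [RHS]big_seq_cond; apply: eq_big => [al|al _]; last lra.
case aP : (al \in Ps) => //=; case: (eqVneq (npair a al) l) => [e|_]; last lra.
by rewrite (face_in_tau aP e) eqxx.
Qed.

(** For a compact face with generators on the principal face, a zero gives [gtau] opposite signs at
    two points of one orthant; on the segment between them, inside the torus, it would have to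
    vanish. *)
Lemma fpoly_tau z : (forall x, inbox rho x -> torus x -> gtau x != 0) -> torus z -> fpoly z != 0.
Proof.
move=> nz z0; apply/negP => /eqP fz; have [zp [zn [sp sn hp hn]]] := fpoly_signs z0 fz.
have [Cp Cp0 hCp] := gtau_scaling zp; have [Cn Cn0 hCn] := gtau_scaling zn.
have [tp tp0 htp] := scaling_sign Cp0 (lt0r_neq0 hp) hCp.
have [tn tn0 htn] := scaling_sign Cn0 (ltr0_neq0 hn) hCn.
have [rp rp0 hrp] := tscale_small zp rho0; have [rn rn0 hrn] := tscale_small zn rho0.
pose t := Num.min (Num.min tp tn) (Num.min rp rn).
have t0 : 0 < t by rewrite !lt_min tp0 tn0 rp0.
have b1 := hrp t t0; have b2 := hrn t t0.
have {}b1 : inbox rho (tscale a t zp) by apply: b1; rewrite !ge_min lexx !orbT.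
have {}b2 : inbox rho (tscale a t zn) by apply: b2; rewrite !ge_min lexx !orbT.
have g1 : 0 < gtau (tscale a t zp).
 by have := htp t t0; rewrite !ge_min lexx => /(_ isT); rewrite pmulr_lgt0.
have g2 : gtau (tscale a t zn) < 0.
 by have := htn t t0; rewrite !ge_min lexx orbT => /(_ isT); rewrite nmulr_lgt0.
pose y (s : R) : V := \row_i ((1 - s) * coord (tscale a t zn) i + s * coord (tscale a t zp) i).
have y0 : y 0 = tscale a t zn by apply: coordP => i; rewrite {1}/coord mxE subr0 mul1r mul0r addr0.
have y1 : y 1 = tscale a t zp by apply: coordP => i; rewrite {1}/coord mxE subrr mul0r mul1r add0r.
have yb s : 0 <= s <= 1 -> inbox rho (y s) /\ torus (y s).
 move=> /andP[s0 s1]; split=> i; rewrite {1}/coord mxE.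
  apply: le_trans (ler_normD _ _) _; rewrite !normrM (ger0_norm s0) ger0_norm ?subr_ge0 //.
  have h1 : (1 - s) * `|coord (tscale a t zn) i| <= (1 - s) * rho by apply: ler_wpM2l; rewrite ?subr_ge0 //; exact: b2.
  have h2 : s * `|coord (tscale a t zp) i| <= s * rho by apply: ler_wpM2l => //; exact: b1.
  nra.
 suff : 0 < ((1 - s) * coord (tscale a t zn) i + s * coord (tscale a t zp) i) * coord z i.
  by move=> h; apply/negP => /eqP e; move: h; rewrite e mul0r ltxx.
 rewrite /tscale /coord !mxE -!/(coord _ _).
 have ta : 0 < t ^+ a i by rewrite exprn_gt0.
 rewrite (_ : _ * coord z i = t ^+ a i * ((1 - s) * (coord zn i * coord z i) + s * (coord zp i * coord z i))); last by ring.
 rewrite mulr_gt0 //; have := sp i; have := sn i; set p1 := coord zn i * _; set p2 := coord zp i * _ => h1 h2; nra.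
have cg : continuous gtau.
 rewrite /gtau; under eq_fun do rewrite -big_filter.
 apply: cont_sum => al; apply: contM; apply: sm_continuous; first exact: sm_monomial.
 exact: sm_zr (dc_sm dc al).
have cy : continuous y.
 move=> s; apply/(@cvgrPdist_le R V R (nbhs s) (nbhs_filter s)) => e e0.
 pose M := `|tscale a t zn| + `|tscale a t zp| + 1.
 have M0 : 0 < M by rewrite ltr_wpDl //.
 apply/(@nbhs_ballP R R); exists (e / M); first by rewrite /= divr_gt0.
 move=> s'; rewrite -ball_normE /= ltr_pdivlMr // => /ltW ss.
 rewrite /Num.Def.normr /= mx_normrE; apply: bigmax_le => [|[k i] _]; auto.
 rewrite !mxE; apply: le_trans ss.
 set u := coord (tscale a t zn) i; set v := coord (tscale a t zp) i.
 rewrite (_ : _ - _ = (s - s') * (v - u)); last by ring.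
 rewrite normrM ler_wpM2l //; apply: le_trans (ler_normB _ _) _; rewrite addrC /M.
 by apply: ler_wpDr => //; apply: lerD; exact: coord_norm.
have [||s] := @IVT R (fun s => gtau (y s)) 0 1 0 ler01.
- apply: continuous_subspaceT => s; apply: (@continuous_comp _ _ _ y gtau); [exact: cy|exact: cg].
- by rewrite y0 y1 ge_min (ltW g2) le_max (ltW g1) orbT.
rewrite in_itv /= => /yb[bs ts]; apply/eqP; exact: nz.
Qed.

End Tau.

End Face.

Hypothesis ndg : forall gam, is_face (newton_poly f) gam -> gam !=set0 -> compact gam ->
  forall x, inbox rho x -> torus x -> exists i, partial i (face_poly f gam) x != 0.

Let PsG al p : al \in Ps -> p \in G -> (p.2 <= npair p.1 al)%N. Proof. exact: (dc_G dc). Qed.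
Let cF al : continuous (F al). Proof. exact/sm_continuous/(dc_sm dc). Qed.

Lemma gradient_bound : exists2 c : R, 0 < c & forall x, inbox c x ->
 c * m x ^+ 2 <= \sum_i eul i fF x ^+ 2.
Proof.
have [||c c0 hc] := face_bound NG PsG A_Ps (H := Hd).
- move=> i al; apply: sm_continuous; apply: sm_add; last by apply: sm_eul; exact: (dc_sm dc).
 by apply: sm_scale; exact: (dc_sm dc).
- move=> a l z a0 al_l l_al z0; have [i ei] := fpoly_nondeg a0 al_l l_al ndg z0; exists i.
 move: ei; rewrite eul_fpoly; apply: contra_neq => e0; rewrite -[RHS]e0; apply: eq_bigr => al _; congr (_ * _).
 by rewrite /Hd /eul /coord mxE mul0r addr0.
exists c => // x bx; apply: le_trans (hc x bx) _.
by apply: eqW; apply: eq_bigr => i _; rewrite eul_fF.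
Qed.

Lemma definite_bound : (forall x, inbox rho x -> 0 <= f x) \/ (forall x, inbox rho x -> f x <= 0) ->
 exists2 c : R, 0 < c & forall x, inbox c x -> c * m x ^+ 2 <= fF x ^+ 2.
Proof.
move=> sgn; have [||c c0 hc] := face_bound NG PsG A_Ps (H := fun _ : 'I_1 => F).
- by [].
- by move=> a l z a0 al_l l_al z0; exists ord0; exact: (fpoly_definite a0 al_l l_al ndg sgn z0).
by exists c => // x bx; apply: le_trans (hc x bx) _; rewrite big_ord1.
Qed.

Section TauBound.
Variables (at_ : mindex n) (lt_ : nat).
Hypotheses (lt_A : forall al, al \in Ps -> (lt_ <= npair at_ al)%N).

Definition Mout (x : V) : R := \sum_(v <- A | npair at_ v != lt_) monomial v x ^+ 2.

(** On a compact face with a generator off the principal face nothing is known of the zeros of the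
    face polynomial; the squared monomials of [Mout] supply the lower bound there. *)
Lemma tau_bound : (forall x, inbox rho x -> torus x -> gtau at_ lt_ x != 0) ->
 exists2 c : R, 0 < c & forall x, inbox c x -> c * m x ^+ 2 <= fF x ^+ 2 + Mout x.
Proof.
move=> nz; pose vA (j : 'I_(size A)) := nth [ffun=> 0%N] A j.
pose K := ('I_1 + 'I_(size A))%type.
(* Each extra component singles out one monomial off the principal face, so that [face_bound] covers
   both situations. *)
pose H (k : K) (al : mindex n) (x : V) : R := match k with inl _ => F al x
  | inr j => ((al == vA j) && (npair at_ al != lt_))%:R end.
have vAA j : vA j \in A by rewrite mem_nth.
have [||c c0 hc] := face_bound NG PsG A_Ps (H := H).
- by move=> [k|j] al; [exact: cF|exact: cont_cst].
- move=> a l z a0 al_l l_al z0.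
 have [/existsP[j /andP[/eqP jl jt]]|nex] := boolP [exists j, (npair a (vA j) == l) && (npair at_ (vA j) != lt_)].
  exists (inr j); rewrite big_mkcond (bigD1_seq (vA j)) ?(dc_uniq dc) ?A_Ps //= jl !eqxx jt mul1r.
  rewrite big1 ?addr0 => [|al /negbTE ->]; last by rewrite mul0r; case: ifP.
  exact: monomial_neq0.
 exists (inl ord0); apply: (fpoly_tau a0 al_l l_al ndg lt_A _ nz z0) => v vA' vl; apply/eqP/negPn/negP => vt.
 case/negP: nex; apply/existsP; have iv : (index v A < size A)%N by rewrite index_mem.
 by exists (Ordinal iv); rewrite /vA nth_index // vl eqxx vt.
exists c => // x bx; apply: le_trans (hc x bx) _.
rewrite big_sumType /= big_ord1 lerD // /Mout (big_nth [ffun=> 0%N]) big_mkord [leRHS]big_mkcond /=.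
apply: ler_sum => j _; rewrite /H /=.
have [vt|vt] := boolP (npair at_ (nth [ffun=> 0%N] A j) != lt_).
 rewrite (bigD1_seq (vA j)) ?(dc_uniq dc) ?A_Ps //= eqxx /vA vt mulr1 big1 ?addr0 // => al /negbTE ->.
 by rewrite mulr0.
rewrite big1 ?expr0n // => al _; case: eqP => [->|_]; last by rewrite mulr0.
by rewrite /vA (negbTE vt) mulr0.
Qed.

Lemma tau_nonvanishing x : (forall x, inbox rho x -> torus x ->
  lim ((fun t => f (tscale at_ t x) / t ^+ lt_) @ 0^'+) != 0) ->
 inbox rho x -> torus x -> gtau at_ lt_ x != 0.
Proof.
move=> nz bx x0; have [C C0 hC] := scaling_limit x (dc_sm dc) lt_A.
have := nz x bx x0; suff -> : lim ((fun t => f (tscale at_ t x) / t ^+ lt_) @ 0^'+) = gtau at_ lt_ x by [].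
apply/cvg_lim => //; apply: (scaling_cvg C0) => t t0 t1; rewrite fFE; first exact: hC.
by apply: tscale_inbox => //; exact: ltW.
Qed.

End TauBound.
End Nondeg.

(** * Smooth functions of one variable *)

Section Csm.
Variable R : realType.
Implicit Types p q : R -> R.

Lemma csm_family (F : (R -> R) -> Prop) p :
 (forall q, F q -> exists dq, F dq /\ forall x : R, is_derive x 1 q (dq x)) -> F p -> csm p.
Proof.
move=> HF Fp; split=> k; have Fk : F (derive1n k p).
 elim: k => [//|k ih]; have [dq [Fdq hd]] := HF _ ih.
 rewrite derive1nS (_ : derive1 _ = dq) //; apply/funext => x; rewrite derive1E.
 by have h := hd x; rewrite derive_val.
by move=> r; have [dq [_ hd]] := HF _ Fk; auto.
Qed.

Inductive calg : (R -> R) -> Prop :=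
| calg_csm p : csm p -> calg p
| calg_add p q : calg p -> calg q -> calg (fun x => p x + q x)
| calg_mul p q : calg p -> calg q -> calg (fun x => p x * q x)
| calg_inv p : calg p -> (forall x, p x != 0) -> calg (fun x => (p x)^-1).

Lemma calg_derive p : calg p -> exists dp, calg dp /\ forall x : R, is_derive x 1 p (dp x).
Proof.
elim=> {p} [p cp|p q _ [dp [cdp hp]] _ [dq [cdq hq]]|p q cp [dp [cdp hp]] cq [dq [cdq hq]]|p cp [dp [cdp hp]] p0].
- exists (derive1 p); split; first by apply: calg_csm; exact: csm_derive1.
 by move=> x; exact: csm_derivable.
- exists (fun x => dp x + dq x); split; first exact: calg_add.
 by move=> x; have := is_deriveD (hp x) (hq x).
- exists (fun x => p x * dq x + q x * dp x); split; first by apply: calg_add; exact: calg_mul.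
 by move=> x; have := is_deriveM (hp x) (hq x).
exists (fun x => ((p x)^-1 * (p x)^-1) * (-1 * dp x)); split.
 apply: calg_mul; first by apply: calg_mul; apply: calg_inv.
 apply: calg_mul => //; apply: calg_csm; apply: (@csm_family (fun q => exists c, q = (fun=> c))); last by exists (-1).
 by move=> _ [c ->]; exists (fun=> 0); split; [exists 0|move=> x; exact: is_derive_cst].
move=> x; have := is_deriveV (p0 x) (hp x) => h; apply: is_derive_eq h _.
by rewrite /GRing.scale /= -exprVn expr2; ring.
Qed.

Lemma calg_smooth p : calg p -> csm p.
Proof. by apply: csm_family => q /calg_derive. Qed.

Lemma csm_cst c : csm (fun _ : R => c).
Proof.
apply: (@csm_family (fun q => exists c, q = (fun=> c))); last by exists c.
by move=> _ [d ->]; exists (fun=> 0); split; [exists 0|move=> x; exact: is_derive_cst].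
Qed.

Lemma csm_id : csm (fun x : R => x).
Proof.
apply: (@csm_family (fun q => q = (fun x => x) \/ exists c, q = (fun=> c))); auto.
move=> _ [->|[c ->]].
 by exists (fun=> 1); split; [right; exists 1|move=> x; exact: is_derive_id].
by exists (fun=> 0); split; [right; exists 0|move=> x; exact: is_derive_cst].
Qed.

Lemma csm_add p q : csm p -> csm q -> csm (fun x => p x + q x).
Proof. by move=> cp cq; apply: calg_smooth; apply: calg_add; exact: calg_csm. Qed.
Lemma csm_mul p q : csm p -> csm q -> csm (fun x => p x * q x).
Proof. by move=> cp cq; apply: calg_smooth; apply: calg_mul; exact: calg_csm. Qed.
Lemma csm_inv p : csm p -> (forall x, p x != 0) -> csm (fun x => (p x)^-1).
Proof. by move=> cp p0; apply: calg_smooth; apply: calg_inv => //; exact: calg_csm. Qed.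

Definition trig (s : bool) : R -> R := if s then sin else cos.

Definition sgt (s : bool) : R := if s then 1 else -1.

Lemma trig_derive s (x : R) : is_derive x 1 (trig s) (sgt s * trig (~~ s) x).
Proof.
rewrite /sgt; case: s => /=; first by apply: is_derive_eq (is_derive_sin x) _; lra.
by apply: is_derive_eq (is_derive_cos x) _; lra.
Qed.

Lemma csm_trig s : csm (trig s).
Proof.
apply: (@csm_family (fun q => exists c s, q = (fun x => c * trig s x))); last first.
 by exists 1, s; apply/funext => x; lra.
move=> _ [c [s' ->]]; exists (fun x => c * sgt s' * trig (~~ s') x); split.
 by exists (c * sgt s'), (~~ s').
move=> x; have := is_deriveZ c (trig_derive s' x) => h; apply: is_derive_eq h _.
by rewrite /GRing.scale /= mulrA.
Qed.

Lemma trig_le1 s x : `|trig s x| <= 1.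
Proof.
have h := @cos2Dsin2 R x; rewrite -(@ler_pXn2r _ 2) ?nnegrE // expr1n real_normK ?num_real //.
by case: s => /=; by [].
Qed.

(** The functions p(1/x) e^(-1/x), extended by 0, are closed under differentiation, which makes the
    bump smooth at 0. *)
Definition flat (p : {poly R}) (x : R) : R := if 0 < x then p.[x^-1] * expR (- x^-1) else 0.

(** e^(-1/h) beats size p + 2 powers of 1/h; the two not spent on p remain as h^2, enough for a
    derivative at 0. *)
Lemma flat_quad (p : {poly R}) :
 exists2 C : R, 0 <= C & forall h : R, h <= 1 -> `|flat p h| <= C * h ^+ 2.
Proof.
pose S := \sum_(i < size p) `|p`_i|; pose k := (size p).+2.
have S0 : 0 <= S by apply: sumr_ge0 => i _; exact: normr_ge0.
exists (S * k%:R ^+ k) => [|h h1]; first pos.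
rewrite /flat; case: ltP => h0; last by rewrite normr0 mulr_ge0 // mulr_ge0 //.
have hn : h != 0 by rewrite gt_eqF.
have y1 : 1 <= h^-1 by rewrite invf_ge1.
have y0 : 0 <= h^-1 by apply: le_trans y1.
have P1 : `|p.[h^-1]| <= S * h^-1 ^+ size p.
 rewrite horner_coef (le_trans (ler_norm_sum _ _ _)) // mulr_suml; apply: ler_sum => i _.
 rewrite normrM normrX (ger0_norm y0); apply: ler_wpM2l => //.
 by apply: ler_weXn2l => //; exact: ltnW.
have e1 := pow_le_exp k y0.
rewrite normrM (ger0_norm (expR_ge0 _)) expRN.
rewrite ler_pdivrMr // (le_trans P1) //.
have -> : h^-1 ^+ size p = h^-1 ^+ k * h ^+ 2.
 by rewrite /k -addn2 exprD -mulrA -exprMn mulVf // expr1n mulr1.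
move: e1; set a := h^-1 ^+ k; set b := k%:R ^+ k; set c := expR _ => e1.
have -> : S * b * h ^+ 2 * c = S * ((b * c) * h ^+ 2) by ring.
by apply: ler_wpM2l => //; exact: ler_wpM2r.
Qed.

Lemma flat_derive (p : {poly R}) (x : R) : is_derive x 1 (flat p) (flat ('X^2 * (p - p^`())) x).
Proof.
case: (ltrgt0P x) => x0.
- have e0 : \forall y \near x, (fun x : R => p.[x^-1] * expR (- x^-1)) y = flat p y.
  near=> y; rewrite /flat ifT //; near: y; exact: lt_nbhsr.
 have xi : x != 0 by rewrite gt_eqF.
 have di : is_derive x 1 (fun y : R => y^-1) (- x ^- 2).
  by have := @is_deriveV R (@id R) x 1 1 xi (is_derive_id x 1) => h; deriv h; rewrite mulr1.
 have dp := @is_derive1_comp R (horner p) (fun y : R => y^-1) x _ _ (is_derive_poly p x^-1) di.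
 have dn : is_derive x 1 (fun y : R => - y^-1) (- - x ^- 2) by have := is_deriveN di.
 have de := @is_derive1_comp R expR (fun y : R => - y^-1) x _ _ (is_derive_expR (- x^-1)) dn.
 apply: near_eq_is_derive e0 _; have h := is_deriveM dp de; apply: is_derive_eq h _.
 rewrite /flat ifT // /GRing.scale /= hornerM hornerXn hornerD hornerN exprVn opprK.
 by ring.
- have e0 : \forall y \near x, (fun x : R => 0) y = flat p y.
  near=> y; rewrite /flat ltNge ifN //; apply/negPn; apply: ltW; near: y; exact: lt_nbhsl.
 apply: near_eq_is_derive e0 _; rewrite /flat ltNge (ltW x0) /=; exact: is_derive_cst.
- rewrite x0; have [C C0 hC] := flat_quad p.
 apply: (@quad_is_derive _ _ _ _ C); near=> h.
 rewrite /flat ltxx mulr0 !subr0 add0r; apply: hC; apply: ltW; near: h.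
 by apply: lt_nbhsl; auto.
Unshelve. all: end_near. Qed.

Definition bump : R -> R := flat 1.

Lemma csm_bump : csm bump.
Proof.
apply: (@csm_family (fun q => exists p : {poly R}, q = flat p)); last by exists 1.
move=> _ [p ->]; exists (flat ('X^2 * (p - p^`()))); split; first by eexists.
by move=> x; exact: flat_derive.
Qed.

Lemma bump_ge0 x : 0 <= bump x.
Proof. by rewrite /bump /flat; case: ifP => // _; rewrite hornerC mul1r. Qed.
Lemma bump_gt0 x : 0 < x -> 0 < bump x.
Proof. by rewrite /bump /flat => ->; rewrite hornerC mul1r. Qed.
Lemma bump_eq0 x : x <= 0 -> bump x = 0.
Proof. by rewrite /bump /flat leNgt => /negbTE ->. Qed.

End Csm.

(** * Plateau functions and cutoffs *)

Section Plateau.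
Variables (R : realType) (n : nat).
Local Notation V := 'rV[R]_n.
Implicit Types (x y : V) (g h : V -> R).

Definition smoothstep (s : R) : R := bump (2 - s) / (bump (2 - s) + bump (s - 1)).

Lemma smoothstep_den s : 0 < bump (2 - s) + bump (s - 1) :> R.
Proof.
case: (ltP s 2) => s2; first by rewrite ltr_wpDr ?bump_ge0 // bump_gt0 // subr_gt0.
by rewrite ltr_wpDl ?bump_ge0 // bump_gt0 //; lra.
Qed.

Lemma smoothstep_itv s : 0 <= smoothstep s <= 1.
Proof.
have D := smoothstep_den s; rewrite /smoothstep divr_ge0 ?bump_ge0 ?(ltW D) //=.
by rewrite ler_pdivrMr // mul1r lerDl bump_ge0.
Qed.

Lemma smoothstep1 s : s <= 1 -> smoothstep s = 1.
Proof.
move=> s1; have D := smoothstep_den s; move: D; rewrite /smoothstep (@bump_eq0 _ (s - 1)) ?addr0; last by lra.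
by move=> D; rewrite divff // gt_eqF.
Qed.

Lemma smoothstep0 s : 2 <= s -> smoothstep s = 0.
Proof. by move=> s2; rewrite /smoothstep bump_eq0 ?mul0r //; lra. Qed.

Definition plateau (r : R) x := \prod_(i <- enum 'I_n) (smoothstep (r^-1 * coord x i) * smoothstep (- r^-1 * coord x i)).

Lemma sm_smoothstep c i : sm (fun x => smoothstep (c * coord x i)).
Proof.
have s1 : sm (fun x => c * coord x i) by apply: sm_scale; exact: sm_coord.
have s2 : sm (fun x => bump (2 - c * coord x i)).
 by apply: (sm_comp (@csm_bump R)); smooth.
apply: sm_mul => //; apply: sm_inv.
 apply: sm_add => //; apply: (sm_comp (@csm_bump R)); smooth.
by move=> x; rewrite gt_eqF // smoothstep_den.
Qed.

Lemma sm_plateau r : sm (plateau r).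
Proof. by apply: sm_prod => i; apply: sm_mul; exact: sm_smoothstep. Qed.

Lemma plateau_itv r x : 0 <= plateau r x <= 1.
Proof.
have h i : 0 <= smoothstep (r^-1 * coord x i) * smoothstep (- r^-1 * coord x i) <= 1.
 have /andP[a b] := smoothstep_itv (r^-1 * coord x i).
 have /andP[c d] := smoothstep_itv (- r^-1 * coord x i).
 nra.
apply/andP; split; first by apply: prodr_ge0 => i _; case/andP: (h i).
by apply: prodr_ile1 => i _; exact: h.
Qed.

Lemma plateau1 r x : 0 < r -> inbox r x -> plateau r x = 1.
Proof.
move=> r0 xr; apply: big1 => i _; have := xr i; rewrite ler_norml => /andP[a b].
rewrite !smoothstep1 ?mulr1 // ?mulNr; last by rewrite ler_pdivrMl ?mulr1.
by rewrite -mulrN ler_pdivrMl // mulr1; lra.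
Qed.

Lemma supB_plateau r : 0 < r -> supB (2 * r) (plateau r).
Proof.
move=> r0 i x xi; rewrite /plateau (bigD1_seq i) ?mem_enum ?enum_uniq //=.
suff -> : smoothstep (r^-1 * coord x i) * smoothstep (- r^-1 * coord x i) = 0 by rewrite mul0r.
case: (ltP 0 (coord x i)) xi => c0.
 by rewrite (gtr0_norm c0) => xi; rewrite smoothstep0 ?mul0r // ler_pdivlMl // mulrC ltW.
rewrite (ler0_norm c0) => xi; rewrite [X in _ * X]smoothstep0 ?mulr0 //.
by rewrite mulNr -mulrN ler_pdivlMl // mulrC ltW.
Qed.

Lemma inbox_norm (r : R) x : 0 <= r -> inbox r x <-> `|x| <= r.
Proof.
move=> r0; split=> [h|+ i].
 rewrite /Num.Def.normr /= mx_normrE; apply/bigmax_leP; split => // -[k j] _ /=.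
 by rewrite (ord1 k); exact: h.
rewrite {1}/Num.Def.normr /= mx_normrE => /bigmax_leP[_ /(_ (ord0, i) isT)] //.
Qed.

Lemma open_norm_lt (r : R) : open [set x : V | `|x| < r].
Proof. by apply: (open_comp (f := fun x : V => `|x|) (D := [set u | u < r])); [move=> x _; exact: norm_continuous|exact: open_lt]. Qed.
Lemma open_norm_gt (r : R) : open [set x : V | r < `|x|].
Proof. by apply: (open_comp (f := fun x : V => `|x|) (D := [set u | r < u])); [move=> x _; exact: norm_continuous|exact: open_gt]. Qed.

(** The open sets |x| < 3 r and |x| > 2 r cover the space; the product is smooth on the first and 0
    on the second. *)
Lemma sm_cutoff U g h (r : R) : 0 < r -> (forall x, inbox (3 * r) x -> U x) -> smooth_on U g ->
 sm h -> supB (2 * r) h -> sm (fun x => g x * h x).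
Proof.
move=> r0 rU sg sh bh; apply: Sm.
have s1 : smooth_on [set x | `|x| < 3 * r] (fun x => g x * h x).
 apply: alg_smooth; first exact: open_norm_lt.
 apply: alg_mul; apply: alg_sm => s x /= xr; last by case: sh => sh; exact: sh.
 by apply: sg; apply: rU; apply/inbox_norm; lra.
have s2 : smooth_on [set x | 2 * r < `|x|] (fun x => g x * h x).
 apply: alg_smooth; first exact: open_norm_gt.
 apply: (alg_ext _ (alg_cst _ 0)) => x /= xr.
 case: (pselect (exists i, 2 * r < `|coord x i|)) => [[i /bh ->]|/forallNP h0]; first lra.
 have : `|x| <= 2 * r; last lra.
 by apply/inbox_norm => [|i]; [lra|rewrite leNgt; apply/negP; exact: h0].
move=> s x _; case: (ltP `|x| (3 * r)) => xr; auto.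
by apply: s2 => /=; lra.
Qed.

Lemma eq_on_dpart (O : set V) g h a : open O -> (forall x, O x -> g x = h x) ->
 forall x, O x -> dpart a g x = dpart a h x.
Proof.
move=> oO; rewrite /dpart; elim: (enum 'I_n) g h => //= i s ih g h gh.
have key k (u v : V -> R) : (forall x, O x -> u x = v x) ->
  forall x, O x -> iter k (partial i) u x = iter k (partial i) v x.
 move=> uv; elim: k => //= k ihk x Ox; rewrite /partial; apply: near_eq_derive.
 exact: near_open Ox _.
auto.
Qed.

Lemma eq_on_taylor (O : set V) g h : open O -> O 0 -> (forall x, O x -> g x = h x) ->
 taylor_coef g = taylor_coef h.
Proof. by move=> oO O0 gh; apply/funext => a; rewrite /taylor_coef (eq_on_dpart a oO gh O0). Qed.

End Plateau.

(** * Exponential polynomials and first order equations *)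

Section ExpPoly.
Variable R : realType.
Implicit Types (q : R * nat) (s : seq (R * nat * R)) (F G Y : R -> R).

(** In terms of t = e^L this is t^q1 (log t)^q2. [ep] sums such terms with repetitions allowed, and
    [co] collects the total coefficient of one of them. *)
Definition gm q (L : R) : R := expR (q.1 * L) * L ^+ q.2.
Definition ep s (L : R) : R := \sum_(t <- s) t.2 * gm t.1 L.
Definition co s q : R := \sum_(t <- s | t.1 == q) t.2.
Definition lexlt q q' := (q.1 < q'.1) || ((q.1 == q'.1) && (q.2 < q'.2)%N).
Definition lo F G := forall eps : R, 0 < eps -> exists L0 : R, forall L, L0 <= L -> `|F L| <= eps * G L.
Definition bo F G := exists C L0 : R, forall L, L0 <= L -> `|F L| <= C * G L.

Lemma gm_ge0 q L : 0 <= L -> 0 <= gm q L.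
Proof. by move=> L0; rewrite mulr_ge0 ?exprn_ge0. Qed.
Lemma gm_gt0 q L : 0 < L -> 0 < gm q L.
Proof. by move=> L0; rewrite mulr_gt0 ?exprn_gt0. Qed.

Lemma gm_derive q (L : R) :
 is_derive L 1 (gm q) (q.1 * gm q L + q.2%:R * gm (q.1, q.2.-1) L).
Proof.
have d1 : is_derive L 1 (fun L : R => q.1 * L) q.1.
 by have h := is_deriveZ q.1 (is_derive_id L 1); deriv h; rewrite mulr1.
have d2 := @is_derive1_comp R expR (fun L : R => q.1 * L) L _ _ (is_derive_expR (q.1 * L)) d1.
have d3 : is_derive L 1 (fun L : R => L ^+ q.2) (q.2%:R * L ^+ q.2.-1).
 rewrite (_ : (fun L : R => _) = id ^+ q.2); last by apply/funext => y; rewrite exprfctE.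
 by have h := is_deriveX q.2 (is_derive_id L 1); deriv h; rewrite mulr1.
have h := is_deriveM d2 d3; apply: is_derive_eq h _.
by rewrite /GRing.scale /gm /=; ring.
Qed.

Lemma ep_cat s s' L : ep (s ++ s') L = ep s L + ep s' L.
Proof. by rewrite /ep big_cat. Qed.
Lemma ep_nil L : ep [::] L = 0. Proof. by rewrite /ep big_nil. Qed.
Lemma ep_cons t s L : ep (t :: s) L = t.2 * gm t.1 L + ep s L.
Proof. by rewrite /ep big_cons. Qed.

Lemma ep_co s L : ep s L = \sum_(q <- undup (map fst s)) co s q * gm q L.
Proof.
rewrite /ep; under [RHS]eq_bigr do rewrite /co mulr_suml.
rewrite (exchange_big_dep xpredT) //= big_seq [RHS]big_seq.
apply: eq_bigr => t ts; rewrite -big_filter (_ : [seq _ <- _ | _] = [:: t.1]) ?big_seq1 //.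
rewrite (eq_filter (a2 := pred1 t.1)); last by move=> q /=; by [].
by rewrite filter_pred1_uniq ?undup_uniq // mem_undup map_f.
Qed.

Lemma co_notin s q : q \notin map fst s -> co s q = 0.
Proof.
move=> qs; rewrite /co big_seq_cond big_pred0 // => t; apply/negP => /andP[ts /eqP e].
by move/negP: qs; apply; rewrite -e map_f.
Qed.

Lemma co_cat s s' q : co (s ++ s') q = co s q + co s' q.
Proof. by rewrite /co big_cat. Qed.
Definition ep_neg s := [seq (t.1, - t.2) | t <- s].
Lemma ep_negE s L : ep (ep_neg s) L = - ep s L.
Proof. by rewrite /ep big_map -sumrN; apply: eq_bigr => t _ /=; lra. Qed.
Lemma co_neg s q : co (ep_neg s) q = - co s q.
Proof. by rewrite /co big_map -sumrN. Qed.

Lemma lo_add F G H : lo F H -> lo G H -> lo (fun L => F L + G L) H.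
Proof.
move=> hF hG e e0; have e2 : 0 < e / 2 by rewrite divr_gt0.
have [a ha] := hF _ e2; have [b hb] := hG _ e2.
exists (Num.max a b) => L; rewrite ge_max => /andP[aL bL].
apply: le_trans (ler_normD _ _) _; apply: le_trans (lerD (ha _ aL) (hb _ bL)) _.
lra.
Qed.

Lemma lo_scale c F G : lo F G -> lo (fun L => c * F L) G.
Proof.
move=> hF e e0; have c1 : 0 < `|c| + 1 by rewrite ltr_wpDl.
have [a ha] := hF _ (divr_gt0 e0 c1); exists a => L /ha h.
rewrite normrM; apply: (@le_trans _ _ ((`|c| + 1) * `|F L|)); first by apply: ler_wpM2r => //; lra.
by rewrite -ler_pdivlMl //; lra.
Qed.

Lemma lo_eq F F' G (L1 : R) : (forall L, L1 <= L -> F L = F' L) -> lo F G -> lo F' G.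
Proof.
move=> e hF eps e0; have [a ha] := hF _ e0; exists (Num.max a L1) => L.
by rewrite ge_max => /andP[aL bL]; rewrite -e //; exact: ha.
Qed.

Lemma lo_zero G : (forall L, 0 <= L -> 0 <= G L) -> lo (fun=> 0) G.
Proof. by move=> G0 e e0; exists 0 => L L0; rewrite normr0 mulr_ge0 // ?(ltW e0) //; exact: G0. Qed.

Lemma lo_sum (I : eqType) (r : seq I) (F : I -> R -> R) G : (forall L, 0 <= L -> 0 <= G L) ->
 (forall i, i \in r -> lo (F i) G) -> lo (fun L => \sum_(i <- r) F i L) G.
Proof.
move=> G0; elim: r => [|i r ih] h.
 by apply: (@lo_eq (fun=> 0) _ _ 0) => [L _|]; [rewrite big_nil|exact: lo_zero].
apply: (@lo_eq (fun L => F i L + \sum_(i <- r) F i L) _ _ 0) => [L _|]; first by rewrite big_cons.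
apply: lo_add; first by apply: h; rewrite mem_head.
by apply: ih => j jr; apply: h; rewrite inE jr orbT.
Qed.

Lemma gm_lo q q' : lexlt q q' -> lo (gm q) (gm q').
Proof.
case: q q' => [a k] [b k'] /orP[/= ab|/andP[/= /eqP -> kk]] e e0; last first.
 exists (Num.max 1 e^-1) => L; rewrite ge_max => /andP[L1 Le].
 have L0 : 0 < L by apply: lt_le_trans L1.
 rewrite ger0_norm ?gm_ge0 ?(ltW L0) // /gm /= mulrCA; apply: ler_wpM2l; auto.
 apply: (@le_trans _ _ (e * L ^+ k.+1)); last by apply: ler_wpM2l; [exact: ltW|exact: ler_weXn2l].
 rewrite exprS mulrA ler_peMl ?exprn_ge0 ?(ltW L0) //.
 by rewrite mulrC -ler_pdivrMr // div1r.
have d0 : 0 < b - a by rewrite subr_gt0.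
pose c : R := k.+1%:R ^+ k.+1 / (b - a) ^+ k.+1.
exists (Num.max 1 (c / e)) => L; rewrite ge_max => /andP[L1 Le].
have L0 : 0 < L by apply: lt_le_trans L1.
have Lk : 1 <= L ^+ k' by exact: exprn_ege1.
rewrite ger0_norm ?gm_ge0 ?(ltW L0) // /gm /=.
have -> : expR (b * L) = expR ((b - a) * L) * expR (a * L) by rewrite -expRD; congr expR; ring.
rewrite [leRHS](_ : _ = expR (a * L) * (e * (expR ((b - a) * L) * L ^+ k'))); last by ring.
apply: ler_wpM2l; auto.
have := pow_le_exp k.+1 (ltW (mulr_gt0 d0 L0)); rewrite exprMn -ler_pdivlMl ?exprn_gt0 // => h.
apply: (@le_trans _ _ (e * expR ((b - a) * L))); last first.
 by rewrite mulrA ler_peMr // mulr_ge0 // ltW.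
rewrite -(ler_pM2l L0) -exprS; apply: le_trans h _.
rewrite mulrCA mulrA [leLHS](_ : _ = c * expR ((b - a) * L)); auto.
by rewrite mulrA; apply: ler_wpM2r; [exact: expR_ge0|rewrite -ler_pdivrMr].
Qed.

Lemma lexlt_total q q' : [|| q == q', lexlt q q' | lexlt q' q].
Proof.
case: q q' => a k [b k']; rewrite /lexlt /= xpair_eqE; case: (ltgtP a b) => //= _.
by case: ltngtP.
Qed.

Lemma lexlt_trans : transitive lexlt.
Proof.
move=> [b k'] [a k] [c k'']; rewrite /lexlt /= => /orP[h|/andP[/eqP <- h]] /orP[h'|/andP[/eqP <- h']].
- lra.
- by rewrite h.
- by rewrite h'.
by rewrite eqxx (ltn_trans h h') orbT.
Qed.

Lemma lexmax (r : seq (R * nat)) : r != [::] ->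
 exists2 q, q \in r & forall q', q' \in r -> q' = q \/ lexlt q' q.
Proof.
elim: r => // q r ih _; case: (eqVneq r [::]) => [->|/ih[m mr hm]].
 by exists q; rewrite ?mem_head // => q'; rewrite inE => /eqP; left.
case/or3P: (lexlt_total q m) => [/eqP e|qm|mq].
- exists m; first by rewrite inE mr orbT.
 by move=> q'; rewrite inE => /orP[/eqP ->|/hm //]; left.
- exists m; first by rewrite inE mr orbT.
 by move=> q'; rewrite inE => /orP[/eqP ->|/hm //]; right.
exists q; first by rewrite mem_head.
move=> q'; rewrite inE => /orP[/eqP ->|/hm[->|h]]; [by left|by right|right].
exact: lexlt_trans mq.
Qed.

Lemma lo_gm_trans F q q' : q = q' \/ lexlt q q' -> lo F (gm q) -> lo F (gm q').
Proof.
move=> [->//|qq'] hF e e0; have [a ha] := hF _ e0; have [b hb] := gm_lo qq' ltr01.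
exists (Num.max a b) => L; rewrite ge_max => /andP[aL bL]; apply: le_trans (ha _ aL) _.
apply: ler_wpM2l; auto.
by apply: le_trans (ler_norm _) _; have := hb _ bL; lra.
Qed.

Lemma lo_bo F q q' : lexlt q q' -> bo F (gm q) -> lo F (gm q').
Proof.
move=> qq' [C [L0 hF]] e e0; have c1 : 0 < `|C| + 1 by rewrite ltr_wpDl.
have [b hb] := gm_lo qq' (divr_gt0 e0 c1).
exists (Num.max (Num.max L0 b) 0) => L; rewrite !ge_max => /andP[/andP[aL bL] L00].
apply: le_trans (hF _ aL) _; have g0 := gm_ge0 q L00.
apply: (@le_trans _ _ ((`|C| + 1) * gm q L)).
 by apply: ler_wpM2r => //; have := ler_norm C; lra.
rewrite -ler_pdivlMl //; have := hb _ bL; rewrite ger0_norm // => h; apply: le_trans h _.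
lra.
Qed.

Lemma lo_self q c : lo (fun L => c * gm q L) (gm q) -> c = 0.
Proof.
move=> h; apply/eqP; rewrite -normr_eq0; apply/eqP/le_anti; rewrite normr_ge0 andbT.
apply/ler_addgt0Pl => e e0; rewrite addr0; have [a ha] := h _ e0.
pose L := Num.max a 1; have L0 : 0 < L by rewrite lt_max ltr01 orbT.
have := ha L; rewrite le_max lexx => /(_ isT); rewrite normrM (gtr0_norm (gm_gt0 q L0)).
by rewrite ler_pM2r // gm_gt0.
Qed.

(** The lexicographically largest term with nonzero coefficient dominates all the others, so its
    order must lie below q0. *)
Lemma ep_lo_co s q0 q : lo (ep s) (gm q0) -> q0 = q \/ lexlt q0 q -> co s q = 0.
Proof.
move=> hs hq; apply/eqP/negPn/negP => cq.
pose r := [seq q <- undup (map fst s) | co s q != 0].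
have rq : q \in r.
 rewrite mem_filter cq mem_undup; case: (boolP (q \in map fst s)) => // /co_notin e.
 by rewrite e eqxx in cq.
have [|m mr hm] := @lexmax r; first by case: (r) rq.
have q0m : q0 = m \/ lexlt q0 m.
 case: hq (hm _ rq) => [<-|h] [<-|h']; [by left|by right|by right|right; exact: lexlt_trans h'].
have /lo_self : lo (fun L => co s m * gm m L) (gm m).
 apply: (@lo_eq (fun L => ep s L + (-1) * \sum_(q <- rem m r) co s q * gm q L) _ _ 0) => [L _|].
  rewrite ep_co (bigID (fun q => co s q != 0)) /= [X in _ + X + _]big1 => [|q' /negPn/eqP ->]; last lra.
  by rewrite -big_filter -/r (big_rem m) //= mulN1r addr0 addrK.
 apply: lo_add; first exact: lo_gm_trans hs.
 apply: lo_scale; apply: lo_sum => [L|q' q'r]; first exact: gm_ge0.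
 apply: lo_scale; apply: gm_lo; have ur : uniq r by rewrite filter_uniq ?undup_uniq.
 move: q'r; rewrite mem_rem_uniq // inE => /andP[/eqP ne /hm[]] //.
by move: mr; rewrite mem_filter => /andP[/eqP].
Qed.

Let scR (a b : R) : a *: (b : R^o) = a * b. Proof. by []. Qed.

(** At resonance a + r = 0 the power of L goes up by one; otherwise the solution is built by
    induction on the power of L. *)
Lemma gm_solve r q : exists2 s, (forall t, t \in s -> t.1.1 = q.1) &
 forall L : R, is_derive L 1 (ep s) (gm q L - r * ep s L).
Proof.
case: q => a k; case: (eqVneq (a + r) 0) => ar.
 exists [:: ((a, k.+1), k.+1%:R^-1)] => [t|L]; first by rewrite inE => /eqP ->.
 have h : is_derive L 1 (fun y => k.+1%:R^-1 * gm (a, k.+1) y) _ := is_deriveZ (k.+1%:R^-1) (gm_derive (a, k.+1) L).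
 rewrite (_ : ep _ = (fun y => k.+1%:R^-1 * gm (a, k.+1) y)); last first.
  by apply/funext => y; rewrite ep_cons ep_nil addr0.
 apply: is_derive_eq h _; rewrite scR /=.
 have -> : r = - a by lra.
 by rewrite mulrDr (mulrA _ k.+1%:R) mulVf //; ring.
elim: k => [|k [s hs ds]].
 exists [:: ((a, 0%N), (a + r)^-1)] => [t|L]; first by rewrite inE => /eqP ->.
 have h : is_derive L 1 (fun y => (a + r)^-1 * gm (a, 0%N) y) _ := is_deriveZ ((a + r)^-1) (gm_derive (a, 0%N) L).
 rewrite (_ : ep _ = (fun y => (a + r)^-1 * gm (a, 0%N) y)); last first.
  by apply/funext => y; rewrite ep_cons ep_nil addr0.
 apply: is_derive_eq h _; rewrite scR /= mul0r addr0.
 by field.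
pose c := (a + r)^-1.
exists (((a, k.+1), c) :: [seq (t.1, - (c * k.+1%:R) * t.2) | t <- s]) => [t|L].
 by rewrite inE => /orP[/eqP -> //|/mapP[u /hs us -> ]].
have h : is_derive L 1 (fun y => c * gm (a, k.+1) y + (- (c * k.+1%:R)) * ep s y) _
 := is_deriveD (is_deriveZ c (gm_derive (a, k.+1) L)) (is_deriveZ (- (c * k.+1%:R)) (ds L)).
have e L' : ep [seq (t.1, - (c * k.+1%:R) * t.2) | t <- s] L' = - (c * k.+1%:R) * ep s L'.
 by rewrite /ep big_map mulr_sumr; apply: eq_bigr => t _ /=; ring.
rewrite (_ : ep _ = (fun y => c * gm (a, k.+1) y + (- (c * k.+1%:R)) * ep s y)); last first.
 by apply/funext => y; rewrite ep_cons e.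
apply: is_derive_eq h _; rewrite !scR /=.
have cr : c * (a + r) = 1 by rewrite mulVf.
have -> : c * (a * gm (a, k.+1) L + k.+1%:R * gm (a, k) L) = c * (a + r) * gm (a, k.+1) L - c * r * gm (a, k.+1) L + c * k.+1%:R * gm (a, k) L by ring.
by rewrite cr; ring.
Qed.

Lemma ep_solve r s : exists2 s', (forall t, t \in s' -> exists2 u, u \in s & t.1.1 = u.1.1) &
 forall L : R, is_derive L 1 (ep s') (ep s L - r * ep s' L).
Proof.
elim: s => [|t s [s1 h1 d1]].
 exists [::] => // L; rewrite (_ : ep _ = cst 0); last by apply/funext => y; rewrite ep_nil.
 by rewrite mulr0 subr0; exact: is_derive_cst.
have [s2 h2 d2] := gm_solve r t.1.
exists ([seq (u.1, t.2 * u.2) | u <- s2] ++ s1) => [u|L].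
 rewrite mem_cat => /orP[/mapP[v /h2 vs ->]|/h1[v vs ->]]; first by exists t; rewrite ?mem_head.
 by exists v; rewrite // inE vs orbT.
have e L' : ep [seq (u.1, t.2 * u.2) | u <- s2] L' = t.2 * ep s2 L'.
 by rewrite /ep big_map mulr_sumr; apply: eq_bigr => u _ /=; lra.
have h : is_derive L 1 (fun y => t.2 * ep s2 y + ep s1 y) _ := is_deriveD (is_deriveZ t.2 (d2 L)) (d1 L).
rewrite [X in is_derive _ _ X](_ : _ = (fun y => t.2 * ep s2 y + ep s1 y)); last first.
 by apply/funext => y; rewrite ep_cat e.
apply: is_derive_eq h _; rewrite scR /= ep_cat ep_cons e; ring.
Qed.

Lemma nondecr F F' (a : R) : (forall u : R, is_derive u 1 F (F' u)) -> (forall u, a <= u -> 0 <= F' u) ->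
 forall x y, a <= x -> x <= y -> F x <= F y.
Proof.
move=> dF F0 x y ax xy.
have cF : continuous F by move=> u; apply/differentiable_continuous/derivable1_diffP; case: (dF u).
have [|c] := @MVT_segment _ F F' x y xy (fun u _ => dF u); first exact: continuous_subspaceT.
rewrite in_itv /= => /andP[xc cy] e; rewrite -subr_ge0 e mulr_ge0 ?subr_ge0 //.
by apply: F0; lra.
Qed.

(* (2/d) e^{-dL} L^m decreases at least at the rate e^{-dL} L^m as soon as L >= 2m/d. *)
Lemma gm_decay (d L : R) m : 0 < d -> 1 <= L -> 2 * m%:R <= d * L ->
 gm (- d, m) L <= - (2 / d * (- d * gm (- d, m) L + m%:R * gm (- d, m.-1) L)).
Proof.
move=> d0 l1 md; have L00 : 0 < L by apply: lt_le_trans l1.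
have g0 := gm_ge0 (- d, m.-1) (ltW L00).
have h : 2 * (m%:R * gm (- d, m.-1) L) <= d * gm (- d, m) L.
 case: (posnP m) => [->|m0]; first by rewrite mul0r mulr0 mulr_ge0 ?gm_ge0 ?ltW.
 have -> : gm (- d, m) L = L * gm (- d, m.-1) L.
  by case: (m) m0 => // k _; rewrite /gm /= exprS; ring.
 nra.
move: h; set u := gm (- d, m) L; set v := gm (- d, m.-1) L => h.
rewrite [leRHS](_ : _ = d^-1 * (2 * d * u - 2 * (m%:R * v))); last by ring.
by rewrite ler_pdivlMl //; lra.
Qed.

(** The function B satisfies B' <= -|Y'| for large L, so Y - B increases and Y + B decreases; the
    limit is the supremum of Y - B. *)
Lemma ode_limit Y Y' (d : R) m : 0 < d -> (forall u : R, is_derive u 1 Y (Y' u)) -> bo Y' (gm (- d, m)) ->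
 exists y : R, bo (fun L => Y L - y) (gm (- d, m)).
Proof.
move=> d0 dY [C [L0 hC]]; pose D : R := `|C|.
pose L1 := Num.max (Num.max L0 1) (2 * m%:R / d).
pose B (L : R) : R := 2 * D / d * gm (- d, m) L.
have dB (L : R) : is_derive L 1 B (2 * D / d * (- d * gm (- d, m) L + m%:R * gm (- d, m.-1) L)).
 by have h := is_deriveZ (2 * D / d) (gm_derive (- d, m) L); by [].
have L1p L : L1 <= L -> [/\ L0 <= L, 1 <= L & 2 * m%:R <= d * L].
 rewrite /L1 !ge_max => /andP[/andP[a b] c]; split=> //.
 by move: c; rewrite ler_pdivrMr // [L * d]mulrC.
have key L : L1 <= L -> D * gm (- d, m) L <= - (2 * D / d * (- d * gm (- d, m) L + m%:R * gm (- d, m.-1) L)).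
 move=> /L1p[_ l1 md]; have := gm_decay d0 l1 md; set u := gm _ _; set v := - d * _ + _ => h.
 rewrite [leRHS](_ : _ = D * - (2 / d * v)); last by ring.
 by apply: ler_wpM2l; first exact: normr_ge0.
have bd L : L1 <= L -> `|Y' L| <= D * gm (- d, m) L.
 move=> /L1p[a b _]; apply: le_trans (hC _ a) _; apply: ler_wpM2r; last exact: ler_norm.
 by apply: gm_ge0; lra.
have up x y : L1 <= x -> x <= y -> Y x - B x <= Y y - B y.
 apply: (@nondecr (fun L => Y L - B L) (fun L => Y' L - 2 * D / d * (- d * gm (- d, m) L + m%:R * gm (- d, m.-1) L)) L1 (fun u => is_deriveB (dY u) (dB u))).
 by move=> u Lu; have := key _ Lu; have := bd _ Lu; rewrite ler_norml => /andP[]; lra.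
have dn x y : L1 <= x -> x <= y -> Y y + B y <= Y x + B x.
 move=> Lx xy; rewrite -lerN2 !opprD.
 apply: (@nondecr (fun L => - Y L - B L) (fun L => - Y' L - 2 * D / d * (- d * gm (- d, m) L + m%:R * gm (- d, m.-1) L)) L1 (fun u => is_deriveB (is_deriveN (dY u)) (dB u))) => //.
 by move=> u Lu; have := key _ Lu; have := bd _ Lu; rewrite ler_norml => /andP[]; lra.
have B0 L : L1 <= L -> 0 <= B L.
 by move=> /L1p[_ b _]; rewrite /B mulr_ge0 ?gm_ge0 ?divr_ge0 ?mulr_ge0 ?normr_ge0 //; lra.
have cross x y : L1 <= x -> L1 <= y -> Y x - B x <= Y y + B y.
 move=> Lx Ly; case: (leP x y) => [xy|/ltW yx].
  by have := up _ _ Lx xy; have := B0 _ Ly; lra.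
 by have := dn _ _ Ly yx; have := B0 _ Lx; lra.
pose S := [set Y x - B x | x in [set x | L1 <= x]].
have hS : has_sup S.
 split; first by exists (Y L1 - B L1), L1 => //=.
 by exists (Y L1 + B L1) => _ [x Lx <-]; auto.
exists (sup S), (2 * D / d), L1 => L LL.
rewrite -/(B L) ler_norml; apply/andP; split; last first.
 rewrite lerBlDr addrC -lerBlDr; apply: ub_le_sup; first by case: hS.
 by exists L.
rewrite lerNl opprB lerBlDr addrC; apply: ge_sup; first by case: hS.
by move=> _ [x Lx <-]; auto.
Qed.

Definition expands (g : R) (m : nat) F := exists2 s, (forall t, t \in s -> - g < t.1.1) &
 bo (fun L => F L - ep s L) (gm (- g, m)).

Lemma bo_add F G q : bo F (gm q) -> bo G (gm q) -> bo (fun L => F L + G L) (gm q).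
Proof.
move=> [a [la ha]] [b [lb hb]]; exists (a + b), (Num.max la lb) => L.
rewrite ge_max => /andP[aL bL]; apply: le_trans (ler_normD _ _) _.
by rewrite mulrDl; apply: lerD; auto.
Qed.

Lemma bo_scale c F q : bo F (gm q) -> bo (fun L => c * F L) (gm q).
Proof.
move=> [a [la ha]]; exists (`|c| * a), la => L h.
by rewrite normrM -mulrA; apply: ler_wpM2l => //; exact: ha.
Qed.

Lemma bo_eq F F' q (L1 : R) : (forall L, L1 <= L -> F L = F' L) -> bo F (gm q) -> bo F' (gm q).
Proof.
move=> e [a [la ha]]; exists a, (Num.max la L1) => L.
by rewrite ge_max => /andP[aL bL]; rewrite -e //; exact: ha.
Qed.

(** After subtracting a particular solution and multiplying by e^(r L), the derivative is of order
    e^((r-g) L) L^m. As r < g there is a limit, and it is the coefficient of the new term e^(-r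
    L). *)
Lemma expands_ode g m r F G : (forall u : R, is_derive u 1 F (G u - r * F u)) -> r < g ->
 expands g m G -> expands g m F.
Proof.
move=> dF rg [s hs bs]; have [s' hs' ds'] := ep_solve r s.
pose Y L := expR (r * L) * (F L - ep s' L).
have dY (u : R) : is_derive u 1 Y (expR (r * u) * (G u - ep s u)).
 have d1 := gm_derive (r, 0%N) u.
 have h : is_derive u 1 (fun y => gm (r, 0%N) y * (F y - ep s' y)) _ := is_deriveM d1 (is_deriveB (dF u) (ds' u)).
 rewrite (_ : Y = (fun y => gm (r, 0%N) y * (F y - ep s' y))); last first.
  by apply/funext => y; rewrite /Y /gm /= mulr1.
 apply: is_derive_eq h _; rewrite !scR (_ : (F - ep s') u = F u - ep s' u) // /gm /= !mulr1 mul0r.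
 by ring.
have g0 : 0 < g - r by rewrite subr_gt0.
have bY : bo (fun u => expR (r * u) * (G u - ep s u)) (gm (- (g - r), m)).
 have [C [L0 hC]] := bs; exists C, L0 => L /hC h.
 rewrite normrM (ger0_norm (expR_ge0 _)) /gm /=.
 have -> : - (g - r) * L = r * L + - g * L by ring.
 rewrite expRD -mulrA mulrCA; apply: ler_wpM2l; first exact: expR_ge0.
 exact: h.
have [y by_] := ode_limit g0 dY bY.
exists (((- r, 0%N), y) :: s') => [t|].
 by rewrite inE => /orP[/eqP -> /=|/hs'[u /hs us ->] //]; lra.
have [C [L0 hC]] := by_; exists C, L0 => L /hC h.
rewrite ep_cons /gm /= mulr1.
have e : F L - (y * expR (- r * L) + ep s' L) = expR (- r * L) * (Y L - y).
 by rewrite /Y mulrBr mulrA -expRD mulNr addNr expR0; ring.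
rewrite e normrM (ger0_norm (expR_ge0 _)).
have -> : C * (expR (- g * L) * L ^+ m) = expR (- r * L) * (C * gm (- (g - r), m) L).
 have -> : - g * L = - r * L + - (g - r) * L by ring.
 by rewrite expRD /gm /=; ring.
by apply: ler_wpM2l; by [].
Qed.

End ExpPoly.

(** * Differentiation under the integral sign *)

Section Param.
Variables (R : realType) (n : nat).
Local Notation V := 'rV[R]_n.

Lemma quad_bound (F F' F'' : R -> R) (t C d : R) : (forall u : R, is_derive u 1 F (F' u)) ->
 (forall u : R, is_derive u 1 F' (F'' u)) -> (forall u, `|u - t| <= 1 -> `|F'' u| <= C) -> `|d| <= 1 ->
 `|F (t + d) - F t - d * F' t| <= C * d ^+ 2.
Proof.
move=> dF dF' hC d1; have [c ct e] := mvt dF t (t + d); have [c' ct' e'] := mvt dF' t c.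
move: ct; rewrite addrAC subrr add0r => ct.
rewrite e addrAC subrr add0r (_ : _ - _ = (F' c - F' t) * d); last lra.
rewrite e' -(real_normK (num_real d)) expr2 !normrM mulrA; apply: ler_wpM2r => //.
apply: ler_pM => //; apply: hC; lra.
Qed.

(** The second derivative [E2] only has to be bounded near each t; it supplies the quadratic
    remainder, uniform in x. *)
Lemma int_param K (E E1 E2 : R -> V -> R) : 0 <= K ->
 (forall u, sm (E u)) -> (forall u, supB K (E u)) -> (forall u, sm (E1 u)) -> (forall u, supB K (E1 u)) ->
 (forall (u : R) x, is_derive u 1 (fun u => E u x) (E1 u x)) ->
 (forall (u : R) x, is_derive u 1 (fun u => E1 u x) (E2 u x)) ->
 (forall t : R, exists C : R, forall u x, `|u - t| <= 1 -> `|E2 u x| <= C) ->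
 forall t : R, is_derive t 1 (fun u => int_Rn (E u)) (int_Rn (E1 t)).
Proof.
move=> K0 sE bE sE1 bE1 d1 d2 hC t; have [C hCt] := hC t.
apply: (@int_Rn_param _ _ K K0 E (E1 t) t C).
- by move=> u; exact: sm_LC.
- exact: sm_LC.
have h1 : \forall d \near (0 : R), `|d| <= 1 by apply: nbhs0_le; exact: ltr01.
apply: filterS h1 => d h1 x.
exact: (quad_bound (fun u => d1 u x) (fun u => d2 u x) (fun u => hCt u x) h1).
Qed.

Lemma sym_sub (r1 r2 : R) k w (u : R -> V -> R) : r1 <= r2 -> sym r2 k w u -> sym r1 k w u.
Proof.
move=> r12; have ib (x : V) : inbox r1 x -> inbox r2 x by move=> h i; exact: le_trans (h i) r12.
elim: k u => [|k ih] u [h1 [C C0 hC] h3]; split=> //; try (by exists C => // L x L1 /ib; exact: hC).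
by move=> i; exact: ih (h3 i).
Qed.

Definition madd (b c : mindex n) : mindex n := [ffun i => (b i + c i)%N].
Definition mdelta (i : 'I_n) : mindex n := [ffun j => (j == i : nat)].

Lemma monomial_madd b c (x : V) : monomial (madd b c) x = monomial b x * monomial c x.
Proof. by rewrite -big_split; apply: eq_bigr => i _; rewrite ffunE exprD. Qed.
Lemma monomial_mdelta i (x : V) : monomial (mdelta i) x = coord x i.
Proof.
rewrite /monomial (bigD1 i) //= ffunE eqxx expr1 big1 ?mulr1 // => j ji.
by rewrite ffunE (negbTE ji).
Qed.
Lemma npair_madd (a b c : mindex n) : npair a (madd b c) = (npair a b + npair a c)%N.
Proof. by rewrite -big_split; apply: eq_bigr => i _; rewrite ffunE mulnDr. Qed.
Lemma npair_mdelta (a : mindex n) i : npair a (mdelta i) = a i.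
Proof.
rewrite /npair (bigD1 i) //= ffunE eqxx muln1 big1 ?addn0 // => j ji.
by rewrite ffunE (negbTE ji) muln0.
Qed.

End Param.

(** * Sine, cosine and their iterated primitives *)

Section Oscillation.
Variable R : realType.

Definition osc (k j : nat) (s : bool) (u y : R) : R := expR (k%:R * u) * y ^+ j * trig s (expR u * y).

Lemma osc_derive k j s (u y : R) : is_derive u 1 (fun u => osc k j s u y)
 (k%:R * osc k j s u y + sgt R s * osc k.+1 j.+1 (~~ s) u y).
Proof.
have d1 : is_derive u 1 (fun L : R => k%:R * L) k%:R.
 by have h := is_deriveZ k%:R (is_derive_id u 1); deriv h; rewrite mulr1.
have d2 := @is_derive1_comp R expR (fun L : R => k%:R * L) u _ _ (is_derive_expR (k%:R * u)) d1.
have d3 : is_derive u 1 (fun u => expR u * y) (expR u * y).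
 have h : is_derive u 1 (fun u => y * expR u) _ := is_deriveZ y (is_derive_expR u).
 rewrite (_ : (fun u => expR u * y) = (fun u => y * expR u)); last by apply/funext => v; lra.
 by apply: is_derive_eq h _; rewrite mulrC.
have d4 := @is_derive1_comp R (trig s) (fun u : R => expR u * y) u _ _ (trig_derive s (expR u * y)) d3.
have d5 : is_derive u 1 (fun L : R => y ^+ j * expR (k%:R * L)) _ := is_deriveZ (y ^+ j) d2.
have h : is_derive u 1 (fun u => (y ^+ j * expR (k%:R * u)) * trig s (expR u * y)) _ := is_deriveM d5 d4.
rewrite (_ : (fun u => osc _ _ _ _ _) = (fun u => (y ^+ j * expR (k%:R * u)) * trig s (expR u * y))); last first.
 by apply/funext => v; rewrite /osc; ring.
deriv h; rewrite /osc -[k.+1%:R]natr1 mulrDl mul1r expRD exprS.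
by ring.
Qed.

Lemma osc_bound k j s (Y t u y : R) : `|y| <= Y -> `|u - t| <= 1 ->
 `|osc k j s u y| <= expR (k%:R * (`|t| + 1)) * Y ^+ j.
Proof.
move=> yY ut; rewrite /osc !normrM normrX (ger0_norm (expR_ge0 _)).
apply: (@le_trans _ _ (expR (k%:R * u) * `|y| ^+ j)).
 by rewrite ler_piMr ?trig_le1.
apply: ler_pM; rewrite //; last by apply: lerXn2r; rewrite ?nnegrE // (le_trans _ yY).
rewrite ler_expR; apply: ler_wpM2l => //; move: ut; rewrite ler_norml => /andP[_ h].
by have := ler_norm t; lra.
Qed.

(** One primitive of c times cos or sin, [true] standing for sin: cos gives sin, sin gives -cos. *)
Definition kapn (q : R * bool) : R * bool := (if q.2 then - q.1 else q.1, ~~ q.2).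
Definition kapt s (j : nat) (x : R) : R := (iter j kapn (1, s)).1 * trig (iter j kapn (1, s)).2 x.

Lemma kapt_derive s j (r : R) : is_derive r 1 (kapt s j.+1) (kapt s j r).
Proof.
rewrite /kapt iterS; case: (iter j kapn _) => c b /=.
have h : is_derive r 1 (fun x => (if b then - c else c) * trig (~~ b) x) _ :=
 is_deriveZ (if b then - c else c) (trig_derive (~~ b) r).
by apply: is_derive_eq h _; rewrite /GRing.scale; case: b => /=; ring.
Qed.

Lemma kapt_csm s j : csm (kapt s j).
Proof. by apply: csm_mul; [exact: csm_cst|exact: csm_trig]. Qed.

Lemma kapt_le1 s j r : `|kapt s j r| <= 1.
Proof.
rewrite /kapt normrM mulr_ile1 ?trig_le1 //.
elim: j => [|j]; first by rewrite normr1.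
by rewrite iterS; case: (iter j kapn _) => c []; rewrite ?normrN.
Qed.

End Oscillation.

Lemma ar0 p q S b b' : (p + q <= S + b -> b <= b' -> p + 0 + q <= S + b')%N. Proof. lia. Qed.
Lemma ar1 p q S b b' : (p + q <= S + b -> b < b' -> p + 1 + q <= S + b')%N. Proof. lia. Qed.
Lemma ar2 p k l S b c : (p + k * l <= S + b -> l <= c -> p + k.+1 * l <= S + (b + c))%N. Proof. lia. Qed.
Lemma ar3 p q S b : (p + q < S + b -> p + 1 + q <= S + b)%N. Proof. lia. Qed.
Lemma ar4 p k l S b c : (p + k * l <= S + b -> l < c -> p + 1 + k.+1 * l <= S + (b + c))%N. Proof. lia. Qed.

(** * Asymptotic expansions *)

Section Expansion.
Variables (R : realType) (n : nat).
Implicit Types (q : R * nat) (C : R -> nat -> R) (I J : R -> R).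

Lemma lexlt_neg (N : nat) (al : R) (k j : nat) : - N%:R < al -> lexlt (- N%:R, k) (al, j).
Proof. by rewrite /lexlt /= => ->. Qed.

Lemma powR_gm (t al : R) k : 1 < t -> powR t al * ln t ^+ k = gm (al, k) (ln t).
Proof. by move=> t1; rewrite /gm /powR gt_eqF // (lt_trans _ t1). Qed.

Lemma lo_sub F G (H : R -> R) : lo F H -> lo G H -> lo (fun L => F L - G L) H.
Proof.
move=> hF hG; apply: (@lo_eq _ (fun L => F L + (-1) * G L) _ _ 0) => [L _|]; first lra.
by apply: lo_add => //; exact: lo_scale.
Qed.

Definition elist C (r : seq R) : seq (R * nat * R) :=
 [seq (q, C q.1 q.2.+1) | q <- [seq (al, k) | al <- r, k <- iota 0 n]].

Lemma ep_elist C r L : ep (elist C r) L = \sum_(al <- r) \sum_(1 <= k < n.+1) C al k * gm (al, k.-1) L.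
Proof.
rewrite /ep /elist big_map big_allpairs; apply: eq_bigr => al _.
by rewrite -[1%N]add0n big_addn subn1 /= /index_iota subn0; apply: eq_bigr => k _; rewrite addn1.
Qed.

Lemma co_elist C r al k : uniq r -> al \in r -> (k < n)%N -> co (elist C r) (al, k) = C al k.+1.
Proof.
move=> ur ar kn; rewrite /co /elist big_mkcond big_map big_allpairs (bigD1_seq al) //=.
rewrite [X in _ + X]big1 ?addr0 => [|be ne]; last first.
 by apply: big1 => j _ /=; rewrite xpair_eqE (negbTE ne).
rewrite (bigD1_seq k) ?mem_iota ?iota_uniq //= eqxx big1 ?addr0 // => j jk.
by rewrite xpair_eqE (negbTE jk) andbF.
Qed.

Lemma co_elist0 C r al k : al \notin r \/ (n <= k)%N -> co (elist C r) (al, k) = 0.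
Proof.
move=> h; apply: co_notin; rewrite -map_comp (eq_map (g := id)) // map_id.
apply/negP => /allpairsP[[be j] /= [br]]; rewrite mem_iota /= add0n => jn [e1 e2]; case: h => [|]; first by rewrite e1 br.
by rewrite e2 leqNgt jn.
Qed.

Definition exp_approx I C (N : nat) (r : seq R) :=
 [/\ uniq r, (forall al, al \in r <-> exps n C N al) & lo (fun L => I (expR L) - ep (elist C r) L) (gm (- N%:R, 0%N))].

(** Finite sets of exponents become duplicate-free lists and t becomes e^L, so that coefficients can
    be compared by [ep_lo_co]. *)
Lemma has_expansionP I C : has_expansion n I C <-> forall N, exists r, exp_approx I C N r.
Proof.
split=> h N.
 have [/finite_seqP[r0 er] hI] := h N; pose r := undup r0.
 have er' : exps n C N = [set` r] by rewrite er; apply/seteqP; split=> x /=; rewrite mem_undup.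
 exists r; split=> [|al|e e0]; [exact: undup_uniq|by rewrite er'|].
 have [t0 [_ ht0]] := hI e e0.
 exists (Num.max 1 (t0 + 1)) => L; rewrite ge_max => /andP[L1 Lt].
 have tL : t0 < expR L by have := expR_ge1Dx L; lra.
 have e1 : 1 < expR L by have := expR_ge1Dx L; lra.
 have := ht0 _ tL; rewrite ep_elist er' -fsbig_seq ?undup_uniq //.
 have e' : powR (expR L) (- N%:R) = gm (- N%:R, 0%N) L.
  by rewrite -[LHS]mulr1 -(expr0 (ln (expR L))) powR_gm // expRK.
 rewrite e'; congr (`|_ - _| <= _); apply: eq_bigr => al _; apply: eq_bigr => k _.
 by rewrite powR_gm // expRK.
have [r [ur er hI]] := h N.
have er' : exps n C N = [set` r] by apply/seteqP; split=> x /=; rewrite er.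
split=> [|e e0]; first by rewrite er'; by [].
have [L0 hL] := hI e e0.
exists (Num.max 1 (expR L0)); split; auto.
move=> t; rewrite gt_max => /andP[t1 tL]; have t0 : 0 < t by lra.
have lL : L0 <= ln t by rewrite -(expRK L0) ler_ln ?posrE // ltW.
have := hL _ lL; rewrite lnK ?posrE // ep_elist er' -fsbig_seq //.
have -> : powR t (- N%:R) = gm (- N%:R, 0%N) (ln t).
 by rewrite -[LHS]mulr1 -(expr0 (ln t)) powR_gm.
by congr (`|_ - _| <= _); apply: eq_bigr => al _; apply: eq_bigr => k _; rewrite powR_gm.
Qed.

Lemma exps_coef C N r al k : (forall al, al \in r <-> exps n C N al) -> uniq r -> - N%:R <= al -> (k < n)%N ->
 co (elist C r) (al, k) = C al k.+1.
Proof.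
move=> er ur alN kn; case: (boolP (al \in r)) => ar; first exact: co_elist.
rewrite co_elist0; auto.
apply/esym/eqP/negPn/negP => ck; move/negP: ar; apply; apply/er; split=> //.
by exists k.+1.
Qed.

Lemma expansion_upper I C (p : R) m : has_expansion n I C -> bo (fun L => I (expR L)) (gm (- p, m)) ->
 forall al k, (k < n)%N -> C al k.+1 != 0 -> lexlt (- p, m) (al, k) = false.
Proof.
move=> /has_expansionP hC bI al k kn ck; apply/negP => pl.
pose N := (Num.truncn `|al|).+1.
have alN : - N%:R < al.
 by have := truncnS_gt `|al|; have := ler_norm (- al); rewrite normrN /N; lra.
have [r [ur er hI]] := hC N.
have : co (elist C r) (al, k) = 0.
 apply: (@ep_lo_co _ _ (al, k)); auto.
 apply: (@lo_eq _ (fun L => I (expR L) - (I (expR L) - ep (elist C r) L)) _ _ 0) => [L _|]; first by ring.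
 apply: lo_sub; first exact: lo_bo pl bI.
 by apply: lo_gm_trans hI; right; exact: lexlt_neg.
by rewrite (exps_coef er) ?(ltW alN) // => e; lra.
Qed.

Lemma expansion_lo I C (p : R) m : has_expansion n I C -> bo (fun L => I (expR L)) (gm (- p, m)) ->
 (m < n)%N -> C (- p) m.+1 = 0 -> lo (fun L => I (expR L)) (gm (- p, m)).
Proof.
move=> hC bI mn c0; have up := expansion_upper hC bI; move/has_expansionP: hC => hC.
pose N := (Num.truncn `|p|).+1.
have alN : - N%:R < - p.
 by rewrite ltrN2; have := truncnS_gt `|p|; have := ler_norm p; rewrite /N; lra.
have [r [ur er hI]] := hC N.
apply: (@lo_eq _ (fun L => (I (expR L) - ep (elist C r) L) + ep (elist C r) L) _ _ 0) => [L _|]; first by ring.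
apply: lo_add; first by apply: lo_gm_trans hI; right; exact: lexlt_neg.
apply: lo_sum => [L|t tr]; first exact: gm_ge0.
move: tr => /mapP[q /allpairsP[[al k] /= [ar]]]; rewrite mem_iota add0n /= => kn -> -> /=.
case: (eqVneq (C al k.+1) 0) => [->|ck].
 by apply: (@lo_eq _ (fun=> 0) _ _ 0) => [L _|]; [rewrite mul0r|apply: lo_zero => L; exact: gm_ge0].
apply: lo_scale; apply: gm_lo; case/or3P: (lexlt_total (al, k) (- p, m)) => // [/eqP[e1 e2]|h].
 by rewrite e1 e2 c0 eqxx in ck.
by rewrite (up _ _ kn ck) in h.
Qed.

(** Expansions of different precision agree where both apply, by uniqueness of coefficients; [C]
    reads each exponent from a precision beyond it. A negative exponent with n or more logarithms is
    excluded by the expansion whose precision is exactly that exponent, since its error has only n -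
    1 of them. *)
Lemma expansion_exists I (p : R) m : (0 < n)%N -> 0 < p -> bo (fun L => I (expR L)) (gm (- p, m)) ->
 (forall g, 0 < g -> expands g n.-1 (fun L => I (expR L))) -> exists C, has_expansion n I C.
Proof.
move=> n0 p0 bI hI; pose F L := I (expR L).
have /choice[S hS] (g : R) : exists s : seq (R * nat * R), 0 < g ->
  (forall t, t \in s -> - g < t.1.1) /\ bo (fun L => F L - ep s L) (gm (- g, n.-1)).
 case: (ltP 0 g) => g0; last by exists [::].
 by have [s h1 h2] := hI g g0; exists s.
have S1 g t : 0 < g -> t \in S g -> - g < t.1.1 by move=> /hS[h _]; exact: h.
have S2 g : 0 < g -> bo (fun L => F L - ep (S g) L) (gm (- g, n.-1)) by move=> /hS[].
have cmp s s' q : lo (fun L => F L - ep s L) (gm q) -> lo (fun L => F L - ep s' L) (gm q) -> co s q = co s' q.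
 move=> h h'; apply/eqP; rewrite -subr_eq0 -co_neg -co_cat; apply/eqP.
 apply: (@ep_lo_co _ _ q); auto.
 apply: (@lo_eq _ (fun L => (F L - ep s' L) - (F L - ep s L)) _ _ 0) => [L _|]; last exact: lo_sub.
 by rewrite ep_cat ep_negE; ring.
have Slo g q : 0 < g -> - g < q.1 -> lo (fun L => F L - ep (S g) L) (gm q).
 by move=> g0 gq; apply: lo_bo (S2 g g0); rewrite /lexlt /= gq.
have trim g q : 0 < g -> - g < q.1 -> (n <= q.2)%N -> co (S g) q = 0.
 move=> g0 gq nq; case: (ltP q.1 0) => q0; last first.
  rewrite (cmp (S g) [::] q (Slo g q g0 gq)); first by rewrite /co big_nil.
  apply: (@lo_eq _ F _ _ 0) => [L _|]; first by rewrite ep_nil subr0.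
  by apply: lo_bo bI; rewrite /lexlt /= (lt_le_trans _ q0) // oppr_lt0.
 have q1 : 0 < - q.1 by rewrite oppr_gt0.
 rewrite (cmp (S g) (S (- q.1)) q (Slo g q g0 gq)).
  apply: co_notin; apply/negP => /mapP[t /(S1 _ _ q1) + e]; by rewrite e opprK ltxx.
 apply: lo_bo (S2 _ q1); rewrite /lexlt /= opprK ltxx eqxx /=.
 by case: (n) n0 nq.
pose gam (al : R) := `|al| + 1.
have gam0 al : 0 < gam al by rewrite /gam ltr_wpDl.
have gamlt al : - gam al < al by rewrite /gam; have := ler_norm (- al); rewrite normrN; lra.
pose C al k := co (S (gam al)) (al, k.-1).
have CE (N : nat) al k : - N%:R <= al -> C al k.+1 = co (S N.+1%:R) (al, k).
 move=> alN; apply: cmp; apply: Slo => //=.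
 lra.
exists C; apply/has_expansionP => N; pose s := S N.+1%:R.
pose keys := [seq q <- undup (map fst s) | (- N%:R <= q.1) && (co s q != 0)].
pose r := undup (map fst keys).
have er al : al \in r <-> exps n C N al.
 rewrite mem_undup; split=> [/mapP[q]|[alN [k [/andP[k1 kn] ck]]]].
  rewrite mem_filter => /andP[/andP[qN cq] _] ->; split=> //.
  exists q.2.+1; split; last by rewrite (CE N) // -surjective_pairing.
  rewrite /= ltnNge; apply/negP => nq; move/negP: cq; apply; apply/eqP; apply: trim => //.
  lra.
 apply/mapP; exists (al, k.-1) => //; rewrite mem_filter mem_undup /= alN /=.
 have ck' : co s (al, k.-1) != 0 by rewrite -(CE N) // prednK.
 by rewrite ck' /=; apply: contraT => /co_notin e; lra.
exists r; split=> //; first exact: undup_uniq.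
have key L : ep (elist C r) L = \sum_(q <- keys) co s q * gm q L.
 rewrite /ep /elist big_map /=.
 pose ap := [seq (al, k) | al <- r, k <- iota 0 n].
 have uap : uniq ap.
  apply: allpairs_uniq; [exact: undup_uniq|exact: iota_uniq|].
  by move=> [? ?] [? ?] _ _ [-> ->].
 have uk : uniq keys by rewrite filter_uniq ?undup_uniq.
 have rN al : al \in r -> - N%:R <= al by move=> /er[].
 rewrite -/ap (eq_big_seq (fun q => co s q * gm q L)); last first.
  by move=> [al k] /allpairsP[[be j] /= [ar _ [-> ->]]]; rewrite (CE N) //; exact: rN.
 rewrite (bigID (fun q => q \in keys)) /= [X in _ + X]big_seq_cond [X in _ + X]big1 ?addr0; last first.
  move=> [al k] /andP[/allpairsP[[be j] /= [ar _ [-> ->]]] nk].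
  case: (eqVneq (co s (be, j)) 0) => [->|cs]; first lra.
  move/negP: nk; case; rewrite mem_filter cs (rN _ ar) /= mem_undup.
  by apply: contraT => /co_notin e; lra.
 rewrite -big_filter; apply: perm_big; apply: uniq_perm; [exact: filter_uniq|exact: uk|].
 move=> q; rewrite mem_filter; case: (boolP (q \in keys)) => //= qk.
 apply/allpairsP; exists q; split; last by rewrite -surjective_pairing.
  by rewrite mem_undup map_f.
 rewrite mem_iota add0n /= ltnNge; apply/negP => nq.
 move: qk; rewrite mem_filter => /andP[/andP[qN /negP cq] _]; apply: cq; apply/eqP; apply: trim => //.
 lra.
apply: (@lo_eq _ (fun L => (F L - ep s L) + \sum_(q <- [seq q <- undup (map fst s) | ~~ ((- N%:R <= q.1) && (co s q != 0))]) co s q * gm q L) _ _ 0).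
 move=> L _; rewrite key ep_co (bigID (fun q => (- N%:R <= q.1) && (co s q != 0))) /= !big_filter /F; ring.
apply: lo_add; first by apply: Slo => //=; lra.
apply: lo_sum => [L|q]; first exact: gm_ge0.
rewrite mem_filter negb_and => /andP[/orP[qN|/negPn/eqP ->] _].
 by apply: lo_scale; apply: gm_lo; rewrite /lexlt /= ltNge qN.
by apply: (@lo_eq _ (fun=> 0) _ _ 0) => [L _|]; [rewrite mul0r|apply: lo_zero => L; exact: gm_ge0].
Qed.

End Expansion.

(** * Truncated Laplace transforms *)

Section Laplace.
Variable R : realType.
Implicit Types (s X : R) (b : bool).

Lemma growth (F F' B B' : R -> R) (x y : R) : (forall u : R, is_derive u 1 F (F' u)) -> (forall u : R, is_derive u 1 B (B' u)) ->
 (forall u, x <= u <= y -> `|F' u| <= B' u) -> x <= y -> `|F y - F x| <= B y - B x.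
Proof.
move=> dF dB h xy.
have up (G G' : R -> R) : (forall u : R, is_derive u 1 G (G' u)) -> (forall u, x <= u <= y -> 0 <= G' u) -> G x <= G y.
 move=> dG G0.
 have cG : continuous G by move=> u; apply/differentiable_continuous/derivable1_diffP; case: (dG u).
 have [|c] := @MVT_segment _ G G' x y xy (fun u _ => dG u); first exact: continuous_subspaceT.
 rewrite in_itv => xc e; rewrite -subr_ge0 e mulr_ge0 ?subr_ge0; auto.
have h1 := up (fun u => B u - F u) (fun u => B' u - F' u) (fun u => is_deriveB (dB u) (dF u)).
have h2 := up (fun u => B u + F u) (fun u => B' u + F' u) (fun u => is_deriveD (dB u) (dF u)).
have h1' : B x - F x <= B y - F y.
 by apply: h1 => u /h; rewrite ler_norml => /andP[]; lra.
have h2' : B x + F x <= B y + F y.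
 by apply: h2 => u /h; rewrite ler_norml => /andP[]; lra.
by rewrite ler_norml; lra.
Qed.

Definition vv s : R := (1 + s ^+ 2)^-1.

Lemma vv_den s : 0 < 1 + s ^+ 2.
Proof. pos. Qed.
Lemma vv_gt0 s : 0 < vv s. Proof. by rewrite invr_gt0 vv_den. Qed.
Lemma vv_le1 s : vv s <= 1.
Proof. by rewrite invf_le1 ?vv_den // lerDl. Qed.
Lemma vvE s : vv s * (1 + s ^+ 2) = 1.
Proof. by rewrite mulVf // gt_eqF // vv_den. Qed.
Lemma vv_norm s : `|s| * vv s <= 1.
Proof.
rewrite ler_pdivrMr ?vv_den // mul1r -(real_normK (num_real s)).
nra.
Qed.

(** Division by 1 - i s in real and imaginary parts; [vv s] is 1 / (1 + s^2). *)
Definition lapm s (a : R * R) : R * R := (vv s * (a.1 - s * a.2), vv s * (a.2 + s * a.1)).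
Definition cmp (T : Type) b (a : T * T) := if b then a.2 else a.1.

(* [lap N X s] is the pair of real and imaginary parts of the integral of y^N e^(-y + iys) over
  0 <= y <= X, computed by integrating by parts, and [lapinf] is its limit as X tends to infinity. *)
Fixpoint lap (N : nat) X s : R * R := lapm s
 (if N is N'.+1 then (N'.+1%:R * (lap N' X s).1 - X ^+ N'.+1 * (expR (- X) * cos (X * s)),
            N'.+1%:R * (lap N' X s).2 - X ^+ N'.+1 * (expR (- X) * sin (X * s)))
  else (1 - expR (- X) * cos (X * s), 0 - expR (- X) * sin (X * s))).
Fixpoint lapinf (N : nat) s : R * R := lapm s
 (if N is N'.+1 then (N'.+1%:R * (lapinf N' s).1, N'.+1%:R * (lapinf N' s).2) else (1, 0)).

Definition lpt (N : nat) b X s : R := X ^+ N * (expR (- X) * trig b (X * s)).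
Definition dlpt (N : nat) b X s : R := (N%:R * X ^+ N.-1 - X ^+ N) * (expR (- X) * trig b (X * s)) +
 s * sgt R b * (X ^+ N * (expR (- X) * trig (~~ b) (X * s))).

Lemma lpt_derive N b X s : is_derive X 1 (fun X => lpt N b X s) (dlpt N b X s).
Proof.
have d3 : is_derive X 1 (fun L : R => L ^+ N) (N%:R * X ^+ N.-1).
 rewrite (_ : (fun L : R => _) = id ^+ N); last by apply/funext => y; rewrite exprfctE.
 by have h := is_deriveX N (is_derive_id X 1); deriv h; rewrite mulr1.
have d1 : is_derive X 1 (fun L : R => expR (- L)) (expR (- X) * (- 1)).
 exact: (@is_derive1_comp R expR (fun L : R => - L) X _ _ (is_derive_expR (- X)) (is_deriveN (is_derive_id X 1))).
have d2 : is_derive X 1 (fun L : R => L * s) s.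
 have h : is_derive X 1 (fun L : R => s * L) _ := is_deriveZ s (is_derive_id X 1).
 rewrite (_ : (fun L => L * s) = (fun L => s * L)); last by apply/funext => v; lra.
 by deriv h; rewrite mulr1.
have d4 := @is_derive1_comp R (trig b) (fun L : R => L * s) X _ _ (trig_derive b (X * s)) d2.
have h : is_derive X 1 (fun L => L ^+ N * (expR (- L) * trig b (L * s))) _ := is_deriveM d3 (is_deriveM d1 d4).
deriv h; rewrite /dlpt (_ : (_ * _) X = expR (- X) * trig b (X * s)) //.
by ring.
Qed.

Lemma lap_derive N s (X : R) : is_derive X 1 (fun X => (lap N X s).1) (lpt N false X s) /\
 is_derive X 1 (fun X => (lap N X s).2) (lpt N true X s).
Proof.
move: X; have key (a1 a2 d1 d2 : R -> R) (X : R) : (forall X : R, is_derive X 1 a1 (d1 X)) -> (forall X : R, is_derive X 1 a2 (d2 X)) ->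
  is_derive X 1 (fun X => vv s * (a1 X - s * a2 X)) (vv s * (d1 X - s * d2 X)) /\
  is_derive X 1 (fun X => vv s * (a2 X + s * a1 X)) (vv s * (d2 X + s * d1 X)).
 move=> h1 h2; split.
  have h : is_derive X 1 (fun X => vv s * (a1 X - s * a2 X)) _ :=
   is_deriveZ (vv s) (is_deriveB (h1 X) (is_deriveZ s (h2 X))).
  by [].
 have h : is_derive X 1 (fun X => vv s * (a2 X + s * a1 X)) _ :=
  is_deriveZ (vv s) (is_deriveD (h2 X) (is_deriveZ s (h1 X))).
 by [].
have fin (x e1 e2 : R) : vv s * (e1 + s * e2 - s * (e2 - s * e1)) = e1 /\ vv s * (e2 - s * e1 + s * (e1 + s * e2)) = e2.
 split; [rewrite -[RHS]mul1r|rewrite -[RHS]mul1r]; rewrite -(vvE s); ring.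
elim: N => [|N ih] X.
 have dl b' (Y : R) := lpt_derive 0 b' Y s.
 have dc (cst : R) b' (Y : R) : is_derive Y 1 (fun Y => cst - expR (- Y) * trig b' (Y * s)) (0 - dlpt 0 b' Y s).
  have h := is_deriveB (is_derive_cst cst Y 1) (dl b' Y).
  rewrite (_ : (fun Y => _) = (fun Y => cst - lpt 0 b' Y s)); last by apply/funext => u; rewrite /lpt mul1r.
  by [].
 have [k1 k2] := key _ _ _ _ X (dc 1 false) (dc 0 true); split; [apply: is_derive_eq k1 _|apply: is_derive_eq k2 _].
  rewrite -[RHS](fin 0 _ (lpt 0 true X s)).1 /dlpt /lpt /sgt; ring.
 rewrite -[RHS](fin 0 (lpt 0 false X s) _).2 /dlpt /lpt /sgt; ring.
have d1 (Y : R) : is_derive Y 1 (fun X => N.+1%:R * (lap N X s).1 - lpt N.+1 false X s) (N.+1%:R * lpt N false Y s - dlpt N.+1 false Y s).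
 have h : is_derive Y 1 (fun X => N.+1%:R * (lap N X s).1 - lpt N.+1 false X s) _ :=
  is_deriveB (is_deriveZ N.+1%:R (ih Y).1) (lpt_derive N.+1 false Y s).
 by [].
have d2 (Y : R) : is_derive Y 1 (fun X => N.+1%:R * (lap N X s).2 - lpt N.+1 true X s) (N.+1%:R * lpt N true Y s - dlpt N.+1 true Y s).
 have h : is_derive Y 1 (fun X => N.+1%:R * (lap N X s).2 - lpt N.+1 true X s) _ :=
  is_deriveB (is_deriveZ N.+1%:R (ih Y).2) (lpt_derive N.+1 true Y s).
 by [].
have [k1 k2] := key _ _ _ _ X d1 d2; split; [apply: is_derive_eq k1 _|apply: is_derive_eq k2 _].
 rewrite -[RHS](fin 0 _ (lpt N.+1 true X s)).1 /dlpt /lpt /sgt; ring.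
rewrite -[RHS](fin 0 (lpt N.+1 false X s) _).2 /dlpt /lpt /sgt; ring.
Qed.

Lemma cmp_lap_derive N b s X : is_derive X 1 (fun X => cmp b (lap N X s)) (lpt N b X s).
Proof. by case: b; have [] := lap_derive N s X. Qed.

Lemma lap0 N s : lap N 0 s = (0, 0).
Proof.
elim: N => [|N ih] /=; first by rewrite mul0r oppr0 expR0 cos0 sin0 /lapm /=; congr (_, _); ring.
by rewrite ih exprS /lapm /=; congr (_, _); ring.
Qed.

Lemma lapm_bound s (a : R * R) (B : R) : `|a.1| <= B -> `|a.2| <= B ->
 `|(lapm s a).1| <= 2 * B /\ `|(lapm s a).2| <= 2 * B.
Proof.
move=> h1 h2; have B0 : 0 <= B by apply: le_trans h1.
have v0 := vv_gt0 s; have v1 := vv_le1 s; have sv := vv_norm s.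
have key (x y : R) : `|x| <= B -> `|y| <= B -> vv s * (`|x| + `|s| * `|y|) <= 2 * B.
 move=> hx hy; rewrite mulrDr mulrA [vv s * `|s|]mulrC [2 * B]mulr_natl mulr2n; apply: lerD.
  nra.
 by rewrite -[leRHS]mul1r; apply: ler_pM => //; pos.
rewrite /lapm /= !normrM (gtr0_norm v0); split.
 apply: le_trans (key _ _ h1 h2); apply: ler_wpM2l; auto.
 by apply: le_trans (ler_normB _ _) _; rewrite normrM.
apply: le_trans (key _ _ h2 h1); apply: ler_wpM2l; auto.
by apply: le_trans (ler_normD _ _) _; rewrite normrM.
Qed.

Lemma lap_lim N : exists2 K : R, 0 <= K & forall X s, 1 <= X ->
 `|(lap N X s).1 - (lapinf N s).1| <= K * (X ^+ N * expR (- X)) /\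
 `|(lap N X s).2 - (lapinf N s).2| <= K * (X ^+ N * expR (- X)).
Proof.
have sub s (a b : R * R) : (lapm s a).1 - (lapm s b).1 = (lapm s (a.1 - b.1, a.2 - b.2)).1 /\
  (lapm s a).2 - (lapm s b).2 = (lapm s (a.1 - b.1, a.2 - b.2)).2.
 by rewrite /=; lra.
have E0 X : 0 <= expR (- X) by exact: expR_ge0.
elim: N => [|N [K K0 ih]].
 exists 2 => // X s X1; rewrite [lap _ _ _]/= [lapinf _ _]/=.
 rewrite !(sub _ _ _).1 !(sub _ _ _).2; apply: lapm_bound => /=; rewrite expr0 mul1r.
  by rewrite addrAC subrr add0r normrN normrM (ger0_norm (E0 _)) ler_piMr // (trig_le1 false).
 by rewrite subr0 sub0r normrN normrM (ger0_norm (E0 _)) ler_piMr // (trig_le1 true).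
exists (2 * (N.+1%:R * K + 1)) => [|X s X1]; first pos.
have [i1 i2] := ih X s X1; rewrite [lap _ _ _]/= [lapinf _ _]/=.
rewrite !(sub _ _ _).1 !(sub _ _ _).2 -mulrA.
have X0 : 0 <= X by lra.
have XN : X ^+ N * expR (- X) <= X ^+ N.+1 * expR (- X).
 by apply: ler_wpM2r => //; apply: ler_weXn2l.
have key (u w : R) b : `|u - w| <= K * (X ^+ N * expR (- X)) ->
  `|N.+1%:R * u - X ^+ N.+1 * (expR (- X) * trig b (X * s)) - N.+1%:R * w| <= (N.+1%:R * K + 1) * (X ^+ N.+1 * expR (- X)).
 move=> h; rewrite (_ : _ - _ = N.+1%:R * (u - w) - X ^+ N.+1 * (expR (- X) * trig b (X * s))); last lra.
 apply: le_trans (ler_normB _ _) _; rewrite mulrDl mul1r; apply: lerD.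
  rewrite normrM ger0_norm // -mulrA; apply: ler_wpM2l => //; apply: le_trans h _.
  by apply: ler_wpM2l.
 rewrite !normrM (ger0_norm (E0 _)) (ger0_norm (exprn_ge0 _ X0)); apply: ler_wpM2l; first exact: exprn_ge0.
 by rewrite ler_piMr // trig_le1.
by apply: lapm_bound; [exact: (key _ _ false)|exact: (key _ _ true)].
Qed.

End Laplace.

(** * Averaging the oscillatory integral *)

Section LaplaceInt.
Variables (R : realType) (n : nat).
Local Notation V := 'rV[R]_n.
Variables (K : R) (f phi : V -> R).
Hypotheses (K0 : 0 <= K) (sf : sm f) (sp : sm phi) (bp : supB K phi).

Lemma sm_vv (g : V -> R) : sm g -> sm (fun x => vv (g x)).
Proof.
move=> sg; apply: sm_inv; last by move=> x; pos.
smooth.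
Qed.

Lemma sm_lapm (g a1 a2 : V -> R) b : sm g -> sm a1 -> sm a2 -> sm (fun x => cmp b (lapm (g x) (a1 x, a2 x))).
Proof.
move=> sg s1 s2; have sv := sm_vv sg.
case: b; rewrite /cmp /=; smooth.
Qed.

Lemma sm_lap N X b (g : V -> R) : sm g -> sm (fun x => cmp b (lap N X (g x))).
Proof.
move=> sg; have st b' : sm (fun x => expR (- X) * trig b' (X * g x)).
 by apply: sm_scale; apply: (sm_comp (csm_trig R b')); smooth.
elim: N b => [|N ih] b.
 by apply: (@sm_lapm g (fun x => 1 - _) (fun x => 0 - _)) => //; apply: sm_sub; try exact: sm_cst; [exact: (st false)|exact: (st true)].
apply: (@sm_lapm g (fun x => _ - _) (fun x => _ - _)) => //; apply: sm_sub; apply: sm_scale.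
- exact: (ih false).
- exact: (st false).
- exact: (ih true).
exact: (st true).
Qed.

Lemma sm_lapinf N b (g : V -> R) : sm g -> sm (fun x => cmp b (lapinf N (g x))).
Proof.
move=> sg; elim: N b => [|N ih] b.
 by apply: (@sm_lapm g (fun x => 1) (fun x => 0)) => //; smooth.
by apply: (@sm_lapm g (fun x => _) (fun x => _)) => //; apply: sm_scale; [exact: (ih false)|exact: (ih true)].
Qed.

Lemma int_Rn_scale c (g : V -> R) : sm g -> supB K g -> int_Rn (fun x => c * g x) = c * int_Rn g.
Proof.
move=> sg bg; have := int_Rn_lin K0 c 0 (sm_LC sg bg) (sm_LC sg bg).
by rewrite mul0r addr0 => <-; congr int_Rn; apply/funext => x; lra.
Qed.

Lemma sm_phitrig b (u : R) : sm (fun x => phi x * trig b (u * f x)).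
Proof. by apply: sm_mul => //; apply: (sm_comp (csm_trig R b)); smooth. Qed.

Definition lapH N b (T X : R) := int_Rn (fun x => phi x * cmp b (lap N X (T * f x))).

Hint Resolve sm_vv sm_lapm sm_lap sm_lapinf sm_phitrig : smooth.

Lemma lapH_derive N b T (X : R) : is_derive X 1 (lapH N b T)
 (X ^+ N * expR (- X) * int_Rn (fun x => phi x * trig b ((X * T) * f x))).
Proof.
have sTf : sm (fun x => T * f x) by exact: sm_scale.
pose E1 X x := phi x * lpt N b X (T * f x); pose E2 X x := phi x * dlpt N b X (T * f x).
have sE1 u : sm (E1 u).
 by apply: sm_mul => //; do 2 apply: sm_scale; apply: (sm_comp (csm_trig R b)); smooth.
have d1 (u : R) x : is_derive u 1 (fun u => phi x * cmp b (lap N u (T * f x))) (E1 u x).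
 have h : is_derive u 1 (fun u => phi x * cmp b (lap N u (T * f x))) _ := is_deriveZ (phi x) (cmp_lap_derive N b (T * f x) u).
 by [].
have d2 (u : R) x : is_derive u 1 (fun u => E1 u x) (E2 u x).
 have h : is_derive u 1 (fun u => E1 u x) _ := is_deriveZ (phi x) (lpt_derive N b u (T * f x)).
 by [].
have hE2 : forall t : R, exists C : R, forall u x, `|u - t| <= 1 -> `|E2 u x| <= C; last first.
 have h := int_param K0 (fun u => sm_mul sp (sm_lap N u b sTf)) (fun u => supB_mul _ bp) sE1 (fun u => supB_mul _ bp) d1 d2 hE2 X.
 apply: is_derive_eq h _; rewrite -int_Rn_scale; [|exact: sm_phitrig|exact: supB_mul].
 by congr int_Rn; apply/funext => x; rewrite /E1 /lpt -[X * T * f x]mulrA; ring.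
move=> t; have [W W0 hW] := sm_bounded sp bp; have [Y Y0 hY] := bounded_box K (sm_continuous sTf).
pose U := `|t| + 1; pose B := expR U.
exists (W * ((N%:R * U ^+ N.-1 + U ^+ N) * B + Y * (U ^+ N * B))) => u x ut.
have U0 : 0 <= U by rewrite addr_ge0.
have B0 : 0 <= B by exact: expR_ge0.
have [xK|wx] := box_or_zero x bp; last first.
 rewrite /E2 wx mul0r normr0.
 pos.
have uU : `|u| <= U by have := ler_normD (u - t) t; rewrite subrK /U; lra.
have uk k : `|u ^+ k| <= U ^+ k by rewrite normrX; apply: lerXn2r; rewrite ?nnegrE.
have eb b' : `|expR (- u) * trig b' (u * (T * f x))| <= B.
 rewrite normrM (ger0_norm (expR_ge0 _)) -[leRHS]mulr1; apply: ler_pM; rewrite ?trig_le1 //.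
 by rewrite /B ler_expR; apply: le_trans (ler_norm _) _; rewrite normrN.
rewrite /E2 normrM; apply: ler_pM => //; apply: le_trans (ler_normD _ _) _; apply: lerD.
 rewrite normrM; apply: ler_pM => //; apply: le_trans (ler_normB _ _) _; apply: lerD => //.
 by rewrite normrM ger0_norm //; apply: ler_wpM2l.
rewrite normrM; apply: ler_pM => //.
 rewrite normrM (_ : `|sgt R b| = 1) ?mulr1; auto.
 by rewrite /sgt; case: (b); rewrite ?normrN normr1.
by rewrite normrM; apply: ler_pM.
Qed.

(** The kernel is the integral over y of y^N e^-y e^(i y s), cut at y = e^(L0-L) and y = 1. Below
    the first cut the trivial bound gives t^-(N+1), negligible as p < N + 1; between the cuts
    smallness at y t costs y^-p, integrable against y^N; beyond 1, e^-y absorbs all powers of y. *)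
Lemma laplace_lo N b (p : R) m : 0 < p -> p < N.+1%:R ->
 lo (fun L => int_Rn (fun x => phi x * trig b (expR L * f x))) (gm (- p, m)) ->
 lo (fun L => int_Rn (fun x => phi x * cmp b (lapinf N (expR L * f x)))) (gm (- p, m)).
Proof.
move=> p0 pN hJ eps e0; pose J L := int_Rn (fun x => phi x * trig b (expR L * f x)).
pose a := N.+1%:R - p; have a0 : 0 < a by rewrite subr_gt0.
(* N powers of y from the kernel, m from the logarithms, one from dy = y dY, and one to spare for
   convergence. *)
pose q := (N + m).+2; pose Kq : R := q%:R ^+ q; have Kq0 : 0 <= Kq by rewrite exprn_ge0.
pose D := a^-1 + Kq; have D0 : 0 <= D by rewrite addr_ge0 // invr_ge0 ltW.
have [W W0 hW] := sm_bounded sp bp.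
pose B0 := W * (2 * K) ^+ n.
have B00 : 0 <= B0 by rewrite mulr_ge0 // exprn_ge0 // mulr_ge0.
have Jb u : `|int_Rn (fun x => phi x * trig b (u * f x))| <= B0.
 apply: int_Rn_bound => //; first by apply: sm_LC; [exact: sm_phitrig|exact: supB_mul].
 by move=> x; rewrite normrM -[leRHS]mulr1; apply: ler_pM => //; exact: trig_le1.
pose e1 := eps / (2 * (D + 1)); have e10 : 0 < e1 by rewrite divr_gt0 // mulr_gt0 // ltr_wpDl.
have [L0' hL0'] := hJ _ e10; pose L0 := Num.max L0' 1.
have L01 : 1 <= L0 by rewrite le_max lexx orbT.
have hL0 L : L0 <= L -> `|J L| <= e1 * gm (- p, m) L.
 by move=> h; apply: hL0'; apply: le_trans h; rewrite le_max lexx.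
pose E := B0 * expR (N.+1%:R * L0) + 1; have E0 : 0 < E by rewrite ltr_wpDl // mulr_ge0.
have lx : lexlt (- N.+1%:R, 0%N) (- p, m) by rewrite /lexlt /= ltrN2 pN.
have e20 : 0 < eps / (2 * E) by rewrite divr_gt0 // mulr_gt0.
have [L1 hL1] := gm_lo lx e20.
exists (Num.max L0 L1) => L; rewrite ge_max => /andP[LL0 LL1].
have L1' : 1 <= L by apply: le_trans LL0.
have Lp : 0 <= L by lra.
set Om := gm (- p, m) L; have Om0 : 0 <= Om by exact: gm_ge0.
have eO : 0 <= e1 * Om := mulr_ge0 (ltW e10) Om0.
have eOa : 0 <= e1 * Om / a := divr_ge0 eO (ltW a0).
have eOK : 0 <= e1 * Om * Kq := mulr_ge0 eO Kq0.
pose T := expR L.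
have H0 : lapH N b T 0 = 0.
 rewrite /lapH (_ : (fun x => _) = (fun=> 0)); first by rewrite int_RnE Ifold0.
 by apply/funext => x; rewrite lap0; case: (b); rewrite mulr0.
pose X0 := expR (L0 - L).
have X00 : 0 < X0 by exact: expR_gt0.
have r1 : `|lapH N b T X0| <= E * gm (- N.+1%:R, 0%N) L.
 have dB (u : R) : is_derive u 1 (fun u => (B0 * X0 ^+ N) * u) (B0 * X0 ^+ N).
  by have h := is_deriveZ (B0 * X0 ^+ N) (is_derive_id u 1); deriv h; rewrite mulr1.
 have := growth (fun u => lapH_derive N b T u) dB _ (ltW X00); rewrite H0 subr0 mulr0 subr0.
 have bd u : 0 <= u <= X0 -> `|u ^+ N * expR (- u) * int_Rn (fun x => phi x * trig b (u * T * f x))| <= B0 * X0 ^+ N.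
  move=> /andP[u0 uX]; rewrite !normrM mulrC; apply: ler_pM => //.
  rewrite (ger0_norm (expR_ge0 _)) normrX (ger0_norm u0) -[leRHS]mulr1; apply: ler_pM; rewrite ?exprn_ge0 //.
   by apply: lerXn2r; rewrite ?nnegrE // ltW.
  by rewrite -expR0 ler_expR oppr_le0.
 move=> /(_ bd) h; apply: le_trans h _; rewrite -mulrA -exprSr /X0 -expRM_natl /gm /= expr0 mulr1.
 rewrite mulrBr expRD -mulNr mulrA; apply: ler_wpM2r; auto.
 by rewrite /E lerDl.
pose h Y := lapH N b T (expR Y).
have dh (Y : R) : is_derive Y 1 h (expR Y ^+ N * expR (- expR Y) * J (Y + L) * expR Y).
 have d := @is_derive1_comp R (lapH N b T) expR Y _ _ (lapH_derive N b T (expR Y)) (is_derive_expR Y).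
 by apply: is_derive_eq d _; rewrite /J expRD.
have r2 : `|h 0 - h (L0 - L)| <= e1 * Om / a.
 have dB (u : R) : is_derive u 1 (fun u => (e1 * Om / a) * gm (a, 0%N) u) (e1 * Om * expR (a * u)).
  have d := is_deriveZ (e1 * Om / a) (gm_derive (a, 0%N) u); apply: is_derive_eq d _.
  by rewrite /GRing.scale /gm /= mul0r addr0 mulr1; field; pos.
 have := growth dh dB.
 have LY : L0 - L <= 0 by lra.
 move=> /(_ (L0 - L) 0 _ LY) g; apply: le_trans (g _) _; last first.
  rewrite -mulrBr ler_piMr //.
  by rewrite /gm /= !mulr1 mulr0 expR0 lerBlDr lerDl.
 move=> u /andP[u1 u2]; have := hL0 (u + L); have hu : L0 <= u + L by lra.
 move=> /(_ hu) hj.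
 have g1 : gm (- p, m) (u + L) <= Om * expR (- p * u).
  rewrite /Om /gm /= mulrDr expRD [leRHS]mulrAC [_ * expR (- p * L)]mulrC -!mulrA.
  apply: ler_wpM2l; auto.
  apply: ler_wpM2l; auto.
  have uL : u + L <= L by lra.
  have uL0 : 0 <= u + L by lra.
  by apply: lerXn2r; by [].
 rewrite !normrM (ger0_norm (expR_ge0 (- expR u))) (ger0_norm (expR_ge0 u)) normrX (ger0_norm (expR_ge0 u)).
 have e1' : expR (- expR u) <= 1 by rewrite -expR0 ler_expR oppr_le0 expR_ge0.
 have -> : e1 * Om * expR (a * u) = expR u ^+ N * 1 * (e1 * (Om * expR (- p * u))) * expR u.
  rewrite /a -natr1 (_ : (N%:R + 1 - p) * u = N%:R * u + (- p * u) + u); last by ring.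
  by rewrite !expRD expRM_natl; ring.
 apply: ler_wpM2r; auto.
 apply: ler_pM; auto.
  by apply: ler_wpM2l => //; by [].
 by apply: le_trans hj _; apply: ler_wpM2l; auto.
have r3 Y : 0 <= Y -> `|h Y - h 0| <= e1 * Om * Kq.
 move=> Y0; have dB (u : R) : is_derive u 1 (fun u => - (e1 * Om * Kq) * gm (-1, 0%N) u) (e1 * Om * Kq * expR (- u)).
  have d := is_deriveZ (- (e1 * Om * Kq)) (gm_derive (-1, 0%N) u); apply: is_derive_eq d _.
  rewrite /GRing.scale /gm /= (_ : -1 * u = - u); last by ring.
  ring.
 have := growth dh dB; move=> /(_ 0 Y _ Y0) g; apply: le_trans (g _) _; last first.
  have := expR_ge0 (-1 * Y).
  rewrite /gm /= !mulr1 mulr0 expR0; nra.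
 move=> u /andP[u1 u2]; have := hL0 (u + L); have hu : L0 <= u + L by lra.
 move=> /(_ hu) hj.
 have g1 : gm (- p, m) (u + L) <= Om * expR u ^+ m.
  rewrite /Om /gm /= mulrDr expRD -[leRHS]mulrA [expR (- p * u) * _]mulrC -mulrA.
  apply: ler_wpM2l; auto.
  rewrite -exprMn -[leRHS]mul1r; apply: ler_pM; rewrite ?exprn_ge0 //; first by lra.
   by rewrite -expR0 ler_expR; nra.
  apply: lerXn2r; rewrite ?nnegrE; [lra|by rewrite mulr_ge0|].
  have := expR_ge1Dx u => eu; apply: (@le_trans _ _ (L * (1 + u))); first by nra.
  by apply: ler_wpM2l.
 rewrite !normrM (ger0_norm (expR_ge0 (- expR u))) (ger0_norm (expR_ge0 u)) normrX (ger0_norm (expR_ge0 u)).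
 apply: (@le_trans _ _ (expR u ^+ N * expR (- expR u) * (e1 * (Om * expR u ^+ m)) * expR u)).
  apply: ler_wpM2r; auto.
  apply: ler_wpM2l; first by [].
  by apply: le_trans hj _; apply: ler_wpM2l; auto.
 have -> : expR u ^+ N * expR (- expR u) * (e1 * (Om * expR u ^+ m)) * expR u =
   e1 * Om * (expR u ^+ q * expR (- expR u) * expR (- u)).
  have eu : expR u * expR (- u) = 1 by rewrite -expRD subrr expR0.
  rewrite /q !exprS exprD [RHS](_ : _ = (expR u ^+ N * expR (- expR u) * (e1 * (Om * expR u ^+ m)) * expR u) * (expR u * expR (- u))); last by ring.
  by rewrite eu mulr1.
 rewrite -[leRHS]mulrA; apply: ler_wpM2l => //.
 apply: ler_wpM2r; auto.
 by rewrite expRN ler_pdivrMr //; apply: pow_le_exp; by [].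
have hb Y : 0 <= Y -> `|h Y| <= eps * Om.
 move=> Y0; have -> : h Y = h (L0 - L) + (h 0 - h (L0 - L)) + (h Y - h 0) by ring.
 have t1 : E * gm (- N.+1%:R, 0%N) L <= eps / 2 * Om.
  have := hL1 L LL1; rewrite ger0_norm ?gm_ge0 // => t.
  apply: le_trans (ler_wpM2l (ltW E0) t) _; rewrite -/Om; apply: eqW.
  by field; pos.
 have t2 : e1 * Om / a + e1 * Om * Kq <= eps / 2 * Om.
  rewrite -mulrDr -/D /e1; apply: (@le_trans _ _ (eps / (2 * (D + 1)) * Om * (D + 1))).
   by apply: ler_wpM2l; [rewrite mulr_ge0 // ltW|lra].
  by apply: eqW; field; pos.
 have := ler_normD (h (L0 - L) + (h 0 - h (L0 - L))) (h Y - h 0).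
 have := ler_normD (h (L0 - L)) (h 0 - h (L0 - L)); have := r3 Y Y0.
 rewrite /h -/X0 in r1 r2 *; lra.
have [Kl Kl0 hKl] := lap_lim R N.
(* The bound [hb] concerns finite upper ends; the part beyond X = e^Y is made smaller than any
   [eta]. *)
apply/ler_addgt0Pl => eta eta0.
pose C := W * Kl * (2 * K) ^+ n * N.+1%:R ^+ N.+1 ; have C0 : 0 <= C by rewrite !mulr_ge0 // exprn_ge0 // mulr_ge0.
pose Y := C / eta; have Y0 : 0 <= Y by rewrite divr_ge0 // ltW.
pose X := expR Y; have X1 : 1 <= X by rewrite -expR0 ler_expR.
have XY : C / eta <= X by have := expR_ge1Dx Y; rewrite -/X /Y; lra.
have X0' : 0 < X by lra.
have sT : sm (fun x => T * f x) by exact: sm_scale.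
have s1 : sm (fun x => phi x * cmp b (lapinf N (T * f x))) by apply: sm_mul => //; exact: sm_lapinf.
have s2 : sm (fun x => phi x * cmp b (lap N X (T * f x))) by apply: sm_mul => //; exact: sm_lap.
have b1 g : supB K (fun x => phi x * g x) by exact: supB_mul.
have -> : int_Rn (fun x => phi x * cmp b (lapinf N (T * f x))) = h Y -
  int_Rn (fun x => phi x * cmp b (lap N X (T * f x)) + (-1) * (phi x * cmp b (lapinf N (T * f x)))).
 have := int_Rn_lin K0 1 (-1) (sm_LC s2 (b1 _)) (sm_LC s1 (b1 _)); rewrite mul1r mulN1r => e.
 rewrite (_ : (fun x => _ + -1 * _) = (fun x => 1 * (phi x * cmp b (lap N X (T * f x))) + (-1) * (phi x * cmp b (lapinf N (T * f x))))).
  by rewrite e /h /lapH -/X; ring.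
 by apply/funext => x; rewrite mul1r.
rewrite [leRHS]addrC; apply: le_trans (ler_normB _ _) _; apply: lerD; auto.
have := @int_Rn_bound _ _ K K0 (fun x => phi x * cmp b (lap N X (T * f x)) + (-1) * (phi x * cmp b (lapinf N (T * f x)))) (W * (Kl * (X ^+ N * expR (- X)))) => ib.
apply: le_trans (ib _ _) _.
- apply: sm_LC; first by apply: sm_add => //; smooth.
 by move=> i x xi; rewrite (bp xi) !mul0r mulr0 addr0.
- move=> x; rewrite mulN1r -mulrBr normrM; apply: ler_pM => //.
 by have [q1 q2] := hKl X (T * f x) X1; case: (b).
have xe : X ^+ N * expR (- X) <= N.+1%:R ^+ N.+1 / X.
 rewrite expRN ler_pdivrMr // mulrAC ler_pdivlMr // -exprSr; apply: pow_le_exp; lra.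
apply: (@le_trans _ _ (C / X)).
 rewrite (_ : C / X = W * (Kl * (N.+1%:R ^+ N.+1 / X)) * (2 * K) ^+ n); last by rewrite /C; ring.
 apply: ler_wpM2r; first pos.
 by do 2 apply: ler_wpM2l => //.
by rewrite ler_pdivrMr // mulrC -ler_pdivrMr.
Qed.

End LaplaceInt.

(** * Transfer of smallness through a first order equation *)

Section LoOde.
Variable R : realType.
Implicit Types (G : R -> R) (j p : R).

(** For j < p the equation is integrated from infinity, where the bound on G excludes the
    homogeneous solution e^(-j L); for j > p it is integrated from L0, and that solution is itself
    negligible. At j = p a factor L would be lost either way. *)
Lemma lo_ode G G1 j p m : (forall u : R, is_derive u 1 G (G1 u - j * G u)) -> j != p ->
 lo G1 (gm (- p, m)) -> bo G (gm (- p, m)) -> lo G (gm (- p, m)).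
Proof.
move=> dG jp hG1 bG; pose Y L := expR (j * L) * G L.
have dY (u : R) : is_derive u 1 Y (expR (j * u) * G1 u).
 have h : is_derive u 1 (fun y => gm (j, 0%N) y * G y) _ := is_deriveM (gm_derive (j, 0%N) u) (dG u).
 rewrite (_ : Y = (fun y => gm (j, 0%N) y * G y)); last by apply/funext => y; rewrite /Y /gm /= mulr1.
 by apply: is_derive_eq h _; rewrite /GRing.scale /gm /= !mulr1 mul0r; ring.
have GY L : G L = expR (- j * L) * Y L.
 by rewrite /Y mulrA -expRD mulNr addNr expR0 mul1r.
have gmj q k L : expR (j * L) * gm (q, k) L = gm (j + q, k) L.
 by rewrite /gm /= mulrDl expRD mulrA.
have gmj' q k L : expR (- j * L) * gm (q, k) L = gm (- j + q, k) L.
 by rewrite /gm /= mulrDl expRD mulrA.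
have Y1 e1 u : `|G1 u| <= e1 * gm (- p, m) u -> `|expR (j * u) * G1 u| <= e1 * gm (j - p, m) u.
 by move=> h; rewrite -gmj normrM (ger0_norm (expR_ge0 _)) mulrCA; apply: ler_wpM2l => //; by [].
move=> eps e0; case: (ltgtP j p) jp => // jp _.
 pose a := p - j; have a0 : 0 < a by rewrite subr_gt0.
 have ea : j - p = - a by rewrite /a opprB.
 pose e1 := eps * a / 4; have e10 : 0 < e1 by rewrite divr_gt0 // mulr_gt0.
 have [L0 hL0] := hG1 _ e10; have [C [L2 hC]] := bG.
 exists (Num.max (Num.max L0 1) (2 * m%:R / a)) => L; rewrite !ge_max => /andP[/andP[LL0 L1] Lm].
 have key L' : L <= L' -> `|Y L' - Y L| <= eps / 2 * gm (- a, m) L.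
  move=> LL; have dB (u : R) : is_derive u 1 (fun u => - (e1 * (2 / a)) * gm (- a, m) u)
    (- (e1 * (2 / a)) * (- a * gm (- a, m) u + m%:R * gm (- a, m.-1) u)).
   by have h := is_deriveZ (- (e1 * (2 / a))) (gm_derive (- a, m) u); by [].
  apply: le_trans (growth dY dB _ LL) _.
   move=> u /andP[Lu _]; have u1 : 1 <= u by lra.
   have um : 2 * m%:R <= a * u by rewrite [a * u]mulrC -ler_pdivrMr //; exact: le_trans Lu.
   have := Y1 e1 u (hL0 _ (le_trans LL0 Lu)); rewrite ea => h; apply: le_trans h _.
   have := gm_decay a0 u1 um; set X := gm (- a, m) u; set Z := - a * _ + _ => h.
   rewrite (_ : - (e1 * (2 / a)) * Z = e1 * - (2 / a * Z)); last by ring.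
   nra.
  have g0 : 0 <= gm (- a, m) L' by apply: gm_ge0; lra.
  have -> : e1 * (2 / a) = eps / 2 by rewrite /e1; field; rewrite gt_eqF.
  have e2 : 0 <= eps / 2 by lra.
  nra.
 have YL : `|Y L| <= eps * gm (- a, m) L.
  apply/ler_addgt0Pl => eta eta0.
  have lx : lexlt (- a, m) (0, 0%N) by rewrite /lexlt /= oppr_lt0 a0.
  have C1 : 0 < `|C| + 1 by rewrite ltr_wpDl.
  have [L3 hL3] := gm_lo lx (divr_gt0 eta0 C1).
  pose L' := Num.max (Num.max L L2) L3.
  have LL' : L <= L' by rewrite !le_max lexx.
  have L2' : L2 <= L' by rewrite !le_max lexx orbT.
  have L3' : L3 <= L' by rewrite !le_max lexx orbT.
  have L'0 : 0 <= L' by lra.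
  have g0 := gm_ge0 (- a, m) L'0; have gL : 0 <= gm (- a, m) L by apply: gm_ge0; lra.
  have h1 : `|Y L'| <= `|C| * gm (- a, m) L'.
   rewrite -ea -gmj /Y normrM (ger0_norm (expR_ge0 _)) mulrCA; apply: ler_wpM2l; auto.
   apply: le_trans (hC _ L2') _; apply: ler_wpM2r; [exact: gm_ge0|exact: ler_norm].
  have h2 : `|C| * gm (- a, m) L' <= eta.
   have := hL3 _ L3'; rewrite (ger0_norm g0) /gm /= mul0r expR0 !mulr1 -/(gm (- a, m) L') => h.
   apply: (@le_trans _ _ ((`|C| + 1) * gm (- a, m) L')); first by apply: ler_wpM2r => //; lra.
   by rewrite mulrC -ler_pdivlMr.
  have := key _ LL'; have := ler_normB (Y L') (Y L' - Y L).
  rewrite (_ : Y L' - (Y L' - Y L) = Y L); last by ring.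
  move=> h3 h4; nra.
 rewrite GY normrM (ger0_norm (expR_ge0 _)); have -> : - p = - j + - a by rewrite /a; ring.
 by rewrite -gmj' mulrCA; apply: ler_wpM2l => //; by [].
pose a := j - p; have a0 : 0 < a by rewrite subr_gt0.
pose e1 := eps * a / 2; have e10 : 0 < e1 by rewrite divr_gt0 // mulr_gt0.
have [L0' hL0'] := hG1 _ e10; pose L0 := Num.max L0' 1.
have L01 : 1 <= L0 by rewrite le_max lexx orbT.
have hL0 L : L0 <= L -> `|G1 L| <= e1 * gm (- p, m) L.
 by move=> h; apply: hL0'; apply: le_trans h; rewrite le_max lexx.
have lx : lexlt (- j, 0%N) (- p, m) by rewrite /lexlt /= ltrN2 jp.
have E0 : 0 < `|Y L0| + 1 by rewrite ltr_wpDl.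
have e20 : 0 < eps / (2 * (`|Y L0| + 1)) by rewrite divr_gt0 //.
have [L1 hL1] := gm_lo lx e20.
exists (Num.max L0 L1) => L; rewrite ge_max => /andP[LL0 LL1].
have L00 : 0 <= L by lra.
have key : `|Y L - Y L0| <= eps / 2 * gm (a, m) L.
 have dB (u : R) : is_derive u 1 (fun u => (eps / 2) * gm (a, m) u)
   ((eps / 2) * (a * gm (a, m) u + m%:R * gm (a, m.-1) u)).
  by have h := is_deriveZ (eps / 2) (gm_derive (a, m) u); by [].
 apply: le_trans (growth dY dB _ LL0) _.
  move=> u /andP[Lu _]; have u0 : 0 <= u by lra.
  apply: le_trans (Y1 e1 u (hL0 _ Lu)) _; rewrite -/a mulrDr /e1.
  rewrite (_ : eps * a / 2 * gm (a, m) u = eps / 2 * (a * gm (a, m) u)); last by ring.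
  have e2 : 0 <= eps / 2 by lra.
  by rewrite lerDl; apply: mulr_ge0 => //; apply: mulr_ge0 => //; exact: gm_ge0.
 have g0 : 0 <= gm (a, m) L0 by apply: gm_ge0; lra.
 nra.
have t1 : (`|Y L0| + 1) * gm (- j, 0%N) L <= eps / 2 * gm (- p, m) L.
 have := hL1 L LL1; rewrite ger0_norm ?gm_ge0 // => t.
 apply: le_trans (ler_wpM2l (ltW E0) t) _; apply: eqW.
 by field; by [].
rewrite GY (_ : Y L = Y L0 + (Y L - Y L0)); last by ring.
rewrite mulrDr; apply: le_trans (ler_normD _ _) _.
rewrite [X in _ <= X * _](splitr eps) mulrDl; apply: lerD.
 rewrite normrM (ger0_norm (expR_ge0 _)) mulrC; apply: le_trans t1.
 by rewrite /gm /= mulr1; apply: ler_wpM2r; [exact: expR_ge0|rewrite lerDl].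
rewrite normrM (ger0_norm (expR_ge0 _)); have -> : - p = - j + a by rewrite /a; ring.
by rewrite -gmj' mulrCA; apply: ler_wpM2l => //; by [].
Qed.

End LoOde.

(** * Algebra of the rational kernels *)

Section Kernels.
Variable R : realType.
Implicit Types (s : R) (b : bool) (P Q C S : {poly R}).

Definition ker (b : nat) P s : R := s ^+ b * P.[vv s].

Definition Dp P : {poly R} := 2%:R * 'X * ('X - 1) * P^`().
(** On kernels s^b P(1 / (1 + s^2)) the operator s d/ds acts as [Tp b]; hence [Tp t] stands for s
    d/ds + (t - b). *)
Definition Tp (t : nat) P : {poly R} := Dp P + t%:R * P.

Lemma vv_sqr s : s ^+ 2 * vv s = 1 - vv s.
Proof. by rewrite -[1 in RHS](vvE s); ring. Qed.

Lemma horner_nat (k : nat) P (x : R) : (k%:R * P).[x] = k%:R * P.[x].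
Proof. by rewrite mulr_natl hornerMn mulr_natl. Qed.

Lemma Dp_horner P (x : R) : (Dp P).[x] = 2 * x * (x - 1) * P^`().[x].
Proof. by rewrite /Dp -!mulrA horner_nat !hornerM hornerD hornerN hornerC hornerX. Qed.

Lemma Tp_horner t P (x : R) : (Tp t P).[x] = (Dp P).[x] + t%:R * P.[x].
Proof. by rewrite /Tp hornerD horner_nat. Qed.

Lemma vv_derive s : is_derive s 1 (@vv R) (- 2 * s * vv s ^+ 2).
Proof.
have d1 : is_derive s 1 (fun s : R => 1 + s ^+ 2) (2 * s).
 have h : is_derive s 1 (fun s : R => 1 + s * s) _ := is_deriveD (is_derive_cst (1 : R) s 1) (is_deriveM (is_derive_id s 1) (is_derive_id s 1)).
 rewrite (_ : (fun s => 1 + s ^+ 2) = (fun s => 1 + s * s)); auto.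
 by deriv h; ring.
have h := @is_deriveV R (fun s : R => 1 + s ^+ 2) s (2 * s) 1 (lt0r_neq0 (vv_den s)) d1; apply: is_derive_eq h _.
by rewrite /GRing.scale /= /vv exprVn; ring.
Qed.

Lemma pvv_derive P s : is_derive s 1 (fun s => P.[vv s]) (P^`().[vv s] * (- 2 * s * vv s ^+ 2)).
Proof. exact: (@is_derive1_comp R (horner P) (@vv R) s _ _ (is_derive_poly P (vv s)) (vv_derive s)). Qed.

Lemma ker_derive (b : nat) P (L y : R) :
 is_derive L 1 (fun L => ker b P (expR L * y)) (ker b (Tp b P) (expR L * y)).
Proof.
have d3 : is_derive L 1 (fun u => expR u * y) (expR L * y).
 have h : is_derive L 1 (fun u => y * expR u) _ := is_deriveZ y (is_derive_expR L).
 rewrite (_ : (fun u => expR u * y) = (fun u => y * expR u)); last by apply/funext => v; lra.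
 by deriv h; rewrite mulrC.
set s := expR L * y in d3 *.
have d4 : is_derive L 1 (fun u => (expR u * y) ^+ b) (b%:R * s ^+ b).
 have h := is_deriveX b d3.
 rewrite (_ : (fun u => _) = (fun u : R => expR u * y) ^+ b); last by apply/funext => u; rewrite exprfctE.
 deriv h; rewrite -/s; case: (b) => [|k]; first lra.
 by rewrite /= exprS; ring.
have d5 := @is_derive1_comp R (fun s => P.[vv s]) (fun u : R => expR u * y) L _ _ (pvv_derive P s) d3.
have h : is_derive L 1 (fun u => (expR u * y) ^+ b * P.[vv (expR u * y)]) _ := is_deriveM d4 d5.
deriv h; rewrite /ker Tp_horner Dp_horner -/s.
have e := vv_sqr s; set v := vv s in e *; set P' := P^`().[v].
rewrite [LHS](_ : _ = s ^+ b * (- 2 * v * (s ^+ 2 * v) * P' + b%:R * P.[v])); last by rewrite /P'; ring.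
by rewrite e; ring.
Qed.

Lemma Dp_add P Q : Dp (P + Q) = Dp P + Dp Q.
Proof. by rewrite /Dp derivD; ring. Qed.
Lemma Dp_opp P : Dp (- P) = - Dp P.
Proof. by rewrite /Dp derivN; ring. Qed.
Lemma Dp_mul P Q : Dp (P * Q) = P * Dp Q + Dp P * Q.
Proof. by rewrite /Dp derivM; ring. Qed.
Lemma Dp_nat (k : nat) P : Dp (k%:R * P) = k%:R * Dp P.
Proof. by rewrite /Dp [k%:R * P]mulr_natl derivMn -[_^`() *+ k]mulr_natl; ring. Qed.
Lemma Dp_X : Dp 'X = 2%:R * 'X * ('X - 1).
Proof. by rewrite /Dp derivX mulr1. Qed.
Lemma Dp_1 : Dp 1 = 0.
Proof. by rewrite /Dp -[1]polyC1 derivC mulr0. Qed.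

Lemma Tp_nat (k t : nat) P : Tp t (k%:R * P) = k%:R * Tp t P.
Proof. by rewrite /Tp Dp_nat; ring. Qed.
Lemma Tp_comm t t' P : Tp t (Tp t' P) = Tp t' (Tp t P).
Proof. by rewrite /Tp !Dp_add !Dp_nat; ring. Qed.

(** The operator of order 2 (k + 1) turns (1 + s^2)^-(k+1) into the next power up to a constant, so
    even operators need no equation to be undone. *)
Lemma Tp_Xn k : Tp k.+1.*2 ('X^(k.+1)) = k.+1.*2%:R * 'X^(k.+2).
Proof.
rewrite /Tp /Dp derivXn /= -mulr_natl -mul2n natrM [in RHS]exprS.
have -> : 'X^(k.+1) = 'X * 'X^k :> {poly R} by rewrite exprS.
by ring.
Qed.

Definition Tl (ts : seq nat) P := foldr Tp P ts.

Lemma Tl_comm t ts P : Tp t (Tl ts P) = Tl ts (Tp t P).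
Proof. by elim: ts => //= a ts ih; rewrite Tp_comm ih. Qed.
Lemma Tl_nat (k : nat) ts P : Tl ts (k%:R * P) = k%:R * Tl ts P.
Proof. by elim: ts => //= a ts ->; rewrite Tp_nat. Qed.

Lemma Tl_Xn ts k : exists Q, Tl ts ('X^(k.+1)) = 'X^(k.+1) * Q.
Proof.
elim: ts => [|t ts [Q e]] /=; first by exists 1; rewrite mulr1.
rewrite e; exists (2%:R * ('X - 1) * (k.+1%:R * Q + 'X * Q^`()) + t%:R * Q).
rewrite /Tp /Dp derivM derivXn /= -[X in X * Q]mulr_natl.
have -> : 'X^(k.+1) = 'X * 'X^k :> {poly R} by rewrite exprS.
by ring.
Qed.

Lemma ker_bound (b : nat) J Q : (b <= 1)%N -> exists2 B : R, 0 <= B & forall s, `|ker b ('X^(J.+1) * Q) s| <= B * vv s ^+ J.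
Proof.
move=> b1; exists (\sum_(i < size Q) `|Q`_i|); first pos.
move=> s; have v0 := vv_gt0 s; have v1 := vv_le1 s.
rewrite /ker hornerM hornerXn exprS !normrM (ger0_norm (exprn_ge0 _ (ltW v0))) (gtr0_norm v0).
have sv : `|s ^+ b| * vv s <= 1.
 by move: b1; case: (b) => [|[|//]] _; rewrite ?expr0 ?normr1 ?mul1r ?expr1 //; exact: vv_norm.
have qb : `|Q.[vv s]| <= \sum_(i < size Q) `|Q`_i|.
 rewrite horner_coef (le_trans (ler_norm_sum _ _ _)) //; apply: ler_sum => i _.
 rewrite normrM ler_piMr // normrX (gtr0_norm v0); apply: exprn_ile1 => //; exact: ltW.
rewrite (_ : _ * _ = (`|s ^+ b| * vv s) * `|Q.[vv s]| * vv s ^+ J); last by ring.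
apply: ler_wpM2r; first pos.
by rewrite -[leRHS]mul1r; apply: ler_pM => //; pos.
Qed.

(** The real part, and the imaginary part divided by s, of N! (1 - i s)^-(N+1), as polynomials in 1
    / (1 + s^2). *)
Fixpoint CS (N : nat) : {poly R} * {poly R} :=
 if N is N'.+1 then (N'.+1%:R * ('X * (CS N').1 - (1 - 'X) * (CS N').2), N'.+1%:R * ('X * ((CS N').2 + (CS N').1)))
 else ('X, 'X).

Lemma lapinfE N s : lapinf N s = ((CS N).1.[vv s], s * (CS N).2.[vv s]).
Proof.
have e := vv_sqr s; elim: N => [|N ih] /=.
 by rewrite /lapm /= hornerX; congr (_, _); ring.
rewrite ih /lapm /=; congr (_, _).
 rewrite horner_nat hornerD hornerN !hornerM hornerD hornerN hornerX hornerC.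
 rewrite [LHS](_ : _ = N.+1%:R * (vv s * (CS N).1.[vv s] - (s ^+ 2 * vv s) * (CS N).2.[vv s])); last by ring.
 by rewrite e.
by rewrite horner_nat hornerM hornerD hornerX; ring.
Qed.

Lemma cmp_lapinf b N s : cmp b (lapinf N s) = ker b (cmp b (CS N)) s.
Proof. by rewrite lapinfE /ker; case: b; rewrite /= ?expr1 ?expr0 ?mul1r. Qed.

(** For K_N = N! (1 - i s)^-(N+1) this is (s d/ds + N + 1) K_N = K_(N+1). *)
Lemma CS_Tp N : (CS N.+1).1 = Tp N.+1 (CS N).1 /\ (CS N.+1).2 = Tp N.+2 (CS N).2.
Proof.
elim: N => [|N [ih1 ih2]].
 by rewrite /= /Tp Dp_X; split; ring.
have h1 : Dp (CS N).1 = (CS N.+1).1 - N.+1%:R * (CS N).1 by rewrite ih1 /Tp addrK.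
have h2 : Dp (CS N).2 = (CS N.+1).2 - N.+2%:R * (CS N).2 by rewrite ih2 /Tp addrK.
have e1 : (CS N.+1).1 = N.+1%:R * ('X * (CS N).1 - (1 - 'X) * (CS N).2) by [].
have e2 : (CS N.+1).2 = N.+1%:R * ('X * ((CS N).2 + (CS N).1)) by [].
have f1 : (CS N.+2).1 = N.+2%:R * ('X * (CS N.+1).1 - (1 - 'X) * (CS N.+1).2) by [].
have f2 : (CS N.+2).2 = N.+2%:R * ('X * ((CS N.+1).2 + (CS N.+1).1)) by [].
have g1 : Dp (CS N.+1).1 = N.+1%:R * ('X * Dp (CS N).1 + Dp 'X * (CS N).1 - (1 - 'X) * Dp (CS N).2 + Dp 'X * (CS N).2).
 by rewrite e1 Dp_nat Dp_add Dp_opp !Dp_mul Dp_add Dp_opp Dp_1; ring.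
have g2 : Dp (CS N.+1).2 = N.+1%:R * ('X * (Dp (CS N).2 + Dp (CS N).1) + Dp 'X * ((CS N).2 + (CS N).1)).
 by rewrite e2 Dp_nat Dp_mul Dp_add; ring.
rewrite f1 f2 /Tp g1 g2 h1 h2 Dp_X e1 e2 -[N.+2%:R]natr1 -[N.+3%:R]natr1 -[N.+2%:R]natr1.
by split; ring.
Qed.

Fixpoint odds b (J : nat) : seq nat := if J is J'.+1 then J'.*2.+3 :: odds b J' else if b then [::] else [:: 1%N].

Lemma odds_odd b J t : t \in odds b J -> odd t /\ (b < t)%N.
Proof.
elim: J => [|J ih] /=; first by case: b; rewrite // inE => /eqP ->.
by rewrite inE => /orP[/eqP ->|/ih //]; rewrite /= odd_double; case: b {ih}.
Qed.

Definition lapN b J := if b then J.*2 else J.*2.+1.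

(** By [CS_Tp] the kernel arises from operators of consecutive orders. The even ones are absorbed
    into the power of 1 / (1 + s^2), and only odd orders t remain to be undone, each through an
    equation of rate t - b. *)
Lemma CS_odds b J : exists2 c : nat, (0 < c)%N & cmp b (CS (lapN b J)) = c%:R * Tl (odds b J) ('X^(J.+1)).
Proof.
elim: J => [|J [c c0 ih]].
 exists 1%N => //; case: b; rewrite [lapN _ _]/= /cmp; first by rewrite /= mul1r expr1.
 by rewrite (CS_Tp 0).1 /= mul1r expr1.
exists (c * J.+1.*2)%N; first by rewrite muln_gt0 c0.
have step : cmp b (CS (lapN b J.+1)) = Tp J.*2.+3 (Tp J.*2.+2 (cmp b (CS (lapN b J)))).
 by case: (b); rewrite /lapN /cmp doubleS; [rewrite (CS_Tp J.*2.+1).2 (CS_Tp J.*2).2|rewrite (CS_Tp J.*2.+2).1 (CS_Tp J.*2.+1).1].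
rewrite step ih !Tp_nat Tl_comm -[J.*2.+2]doubleS Tp_Xn Tl_nat Tp_nat /= natrM.
by rewrite mulrA.
Qed.

(** For K_N = N! (1 - i s)^-(N+1) this is K_N' = i K_(N+1), split into real and imaginary parts. *)
Lemma CS_deriv N : 2%:R * 'X^2 * (CS N).1^`() = (CS N.+1).2 /\ Tp 1 (CS N).2 = (CS N.+1).1.
Proof.
have [h1 h2] := CS_Tp N.
have e1 : (CS N.+1).1 = N.+1%:R * ('X * (CS N).1 - (1 - 'X) * (CS N).2) by [].
have e2 : (CS N.+1).2 = N.+1%:R * ('X * ((CS N).2 + (CS N).1)) by [].
split.
 have X1 : 'X - 1 != 0 :> {poly R} by rewrite -polyC1 polyXsubC_eq0.
 apply: (mulfI X1); rewrite [LHS](_ : _ = 'X * Dp (CS N).1); last by rewrite /Dp; ring.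
 have -> : Dp (CS N).1 = (CS N.+1).1 - N.+1%:R * (CS N).1 by rewrite h1 /Tp addrK.
 by rewrite e1 e2; ring.
have hd : Dp (CS N).2 = (CS N.+1).2 - N.+2%:R * (CS N).2 by rewrite h2 /Tp addrK.
by rewrite /Tp hd e2 e1 -[N.+2%:R]natr1; ring.
Qed.

Lemma lapinf_derive N b s : is_derive s 1 (fun s => cmp b (lapinf N s)) ((if b then 1 else -1) * cmp (~~ b) (lapinf N.+1 s)).
Proof.
have [h1 h2] := CS_deriv N; have e := vv_sqr s.
rewrite (_ : (fun s => _) = (fun s => ker b (cmp b (CS N)) s)); last by apply/funext => u; rewrite cmp_lapinf.
rewrite cmp_lapinf; case: b; rewrite /ker /cmp /=.
 have h : is_derive s 1 (fun s => s * (CS N).2.[vv s]) _ := is_deriveM (is_derive_id s 1) (pvv_derive (CS N).2 s).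
 rewrite (_ : (fun s => s ^+ 1 * _) = (fun s => s * (CS N).2.[vv s])); auto.
 apply: is_derive_eq h _; rewrite -[N.+1%:R * _]/((CS N.+1).1) -h2 Tp_horner Dp_horner /GRing.scale /= expr0 !mul1r mulr1.
 set v := vv s in e *; set P' := (CS N).2^`().[v].
 rewrite [LHS](_ : _ = - 2 * v * (s ^+ 2 * v) * P' + (CS N).2.[v]); last by rewrite /P'; ring.
 by rewrite e; ring.
have h := pvv_derive (CS N).1 s.
rewrite (_ : (fun s => s ^+ 0 * _) = (fun s => (CS N).1.[vv s])); last by apply/funext => u; lra.
by apply: is_derive_eq h _; rewrite -[N.+1%:R * _]/((CS N.+1).2) -h1 -[2%:R * _ * _]mulrA horner_nat hornerM hornerXn expr1; ring.
Qed.

Lemma csm_lapm (a1 a2 : R -> R) b : csm a1 -> csm a2 -> csm (fun s => cmp b (lapm s (a1 s, a2 s))).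
Proof.
move=> c1 c2; have ci := csm_id R; have cc c := @csm_cst R c.
have cv : csm (@vv R).
 apply: csm_inv => [|s]; last pos.
 exact: (csm_add (cc 1) (csm_mul ci ci)).
case: b; rewrite /cmp /=; apply: csm_mul => //.
 by apply: csm_add => //; exact: csm_mul.
rewrite (_ : (fun s => _) = (fun s => a1 s + -1 * (s * a2 s))); last by apply/funext => s; lra.
by apply: csm_add => //; apply: csm_mul => //; exact: csm_mul.
Qed.

Lemma csm_lapinf N b : csm (fun s => cmp b (lapinf N s)).
Proof.
have cc c := @csm_cst R c; elim: N b => [|N ih] b.
 exact: (@csm_lapm (fun=> 1) (fun=> 0)).
by apply: (@csm_lapm (fun s => _ * (lapinf N s).1) (fun s => _ * (lapinf N s).2)); apply: csm_mul => //; [exact: (ih false)|exact: (ih true)].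
Qed.

Lemma lapinf_bound N : exists2 B : R, 0 <= B & forall k s b, (k <= N)%N -> `|cmp b (lapinf k s)| <= B.
Proof.
have H k : exists2 B : R, 0 <= B & forall s b, `|cmp b (lapinf k s)| <= B.
 elim: k => [|k [B B0 ih]].
  exists 2 => // s b; have := @lapm_bound R s (1, 0) 1; rewrite /= normr1 normr0 lexx ler01 mulr1 => /(_ isT isT)[h1 h2].
  by case: b.
 exists (2 * (k.+1%:R * B)) => [|s b]; first pos.
 have := @lapm_bound R s (k.+1%:R * (lapinf k s).1, k.+1%:R * (lapinf k s).2) (k.+1%:R * B).
 rewrite /= !normrM !normr_nat => h.
 have [h1 h2] : `|(lapinf k.+1 s).1| <= 2 * (k.+1%:R * B) /\ `|(lapinf k.+1 s).2| <= 2 * (k.+1%:R * B).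
  by rewrite !normrM; apply: h; apply: ler_wpM2l => //; [exact: (ih s false)|exact: (ih s true)].
 by case: b.
elim: N => [|N [B B0 ih]].
 by have [B B0 h] := H 0%N; exists B => // k s b; rewrite leqn0 => /eqP ->.
have [B' B'0 h] := H N.+1; exists (B + B') => [|k s b]; first exact: addr_ge0.
rewrite leq_eqVlt => /orP[/eqP ->|kN]; first by apply: le_trans (h s b) _; lra.
by apply: le_trans (ih k s b kN) _; lra.
Qed.

(** Up to signs and exchange of the two parts, the primitives of K_N are K_(N-1), ..., K_0, so N of
    them stay bounded. *)
Definition kapl N b (j : nat) s : R := (iter j (@kapn R) (1, b)).1 * cmp (iter j (@kapn R) (1, b)).2 (lapinf (N - j) s).

Lemma kapl_derive N b j (r : R) : (j < N)%N -> is_derive r 1 (kapl N b j.+1) (kapl N b j r).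
Proof.
move=> jN; rewrite /kapl iterS -(subnSK jN); case: (iter j _ _) => c b' /=.
have h : is_derive r 1 (fun x => (if b' then - c else c) * cmp (~~ b') (lapinf (N - j.+1) x)) _ :=
 is_deriveZ (if b' then - c else c) (lapinf_derive (N - j.+1) (~~ b') r).
by deriv h; rewrite negbK; case: b' {h} => /=; ring.
Qed.

Lemma kapl_csm N b j : csm (kapl N b j).
Proof. by apply: csm_mul; [exact: csm_cst|exact: csm_lapinf]. Qed.

Lemma kapl_bound N b : exists2 B : R, 0 <= B & forall j r, (j <= N)%N -> `|kapl N b j r| <= B.
Proof.
have [B B0 h] := lapinf_bound N; exists B => // j r jN; rewrite /kapl normrM.
have -> : `|(iter j (@kapn R) (1, b)).1| = 1; last by rewrite mul1r; apply: h; exact: leq_subr.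
elim: j {jN} => [|j]; first by rewrite /= normr1.
by rewrite iterS; case: (iter j _ _) => c [] /=; rewrite ?normrN.
Qed.

End Kernels.

Notation osci s h phi := (fun L => int_Rn (fun x => trig s (expR L * h x) * phi x)).
Notation Om f := (gm (- (newton_dist f)^-1, (mult_m f).-1)).

(** * Expansion and leading term of the oscillatory integral *)

Section Oscillatory.
Variables (R : realType) (n : nat).
Local Notation V := 'rV[R]_n.
Variables (f : V -> R) (A : seq (mindex n)) (G : seq (mindex n * nat)).
Hypothesis NG : newton_gen f A G.
Variables (N : nat) (rho : R) (Ps : seq (mindex n)) (F : mindex n -> V -> R).
Hypotheses (rho1 : rho <= 1) (dc : decomp f G N rho Ps F).
Variables (rc c : R).
Local Notation ff := (fF Ps F).
Hypotheses (rc0 : 0 < rc) (rcr : rc <= rho) (c0 : 0 < c)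
 (grad : forall x, inbox rc x -> c * mm A x ^+ 2 <= \sum_i eul i ff x ^+ 2).

Let rc0' : 0 <= rc. Proof. exact: ltW. Qed.
Let rc1 : rc <= 1. Proof. exact: le_trans rho1. Qed.
Let sff : sm ff. Proof. exact: sm_fF dc. Qed.
Let fsym k : sym rc k (fun _ => mm A) (fun=> ff).
Proof. by apply: sym_sub rcr _; exact: (sym_fF NG rho1 dc). Qed.
Let sF al : sm (F al). Proof. exact: dc_sm dc al. Qed.

Section Tspan.
Implicit Types (b : mindex n) (k : nat) (s : bool) (h : V -> R) (x : V) (pi : mindex n * nat -> nat).

Definition tm k b s h (L : R) x : R := expR (k%:R * L) * monomial b x * h x * trig s (expR L * ff x).

Lemma sm_trigf s (L : R) : sm (fun x => trig s (expR L * ff x)).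
Proof. by apply: sm_comp; [exact: csm_trig|apply: sm_scale]. Qed.

Hint Resolve sff sF sm_trigf : smooth.

Lemma sm_tm k b s h L : sm h -> sm (tm k b s h L).
Proof.
move=> sh; apply: sm_mul; last exact: sm_trigf.
smooth.
Qed.

Lemma supB_tm k b s h L : supB rc h -> supB rc (tm k b s h L).
Proof. by move=> bh i x xi; rewrite /tm (bh i x xi) mulr0 mul0r. Qed.

Lemma LC1 h : sm h -> supB rc h -> LC 1 [::] h.
Proof. by move=> sh bh; apply: LC_widen rc1 _; exact: sm_LC. Qed.

(** [pi g] is a lower bound for the order of decay of t^k x^b dx along the weighted scaling attached
    to the half-space g = (a, l), in which x_i has weight a_i and t has weight -l. *)
Definition cond pi k b := forall g, g \in G -> (pi g + k * g.2 <= \sum_i g.1 i + npair g.1 b)%N.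

Inductive tspan pi : (R -> V -> R) -> Prop :=
| ts_zero : tspan pi (fun _ _ => 0)
| ts_cons r k b s h u : cond pi k b -> sm h -> supB rc h -> tspan pi u ->
  tspan pi (fun L x => r * tm k b s h L x + u L x).

Lemma tspan_sm pi u L : tspan pi u -> sm (u L).
Proof. by elim=> [|r k b s h v _ sh _ _ sv]; [exact: sm_cst|apply: sm_add => //; apply: sm_scale; exact: sm_tm]. Qed.

Lemma tspan_supB pi u L : tspan pi u -> supB rc (u L).
Proof.
elim=> [|r k b s h v _ _ bh _ bv] i x xi //.
by rewrite (supB_tm k b s L bh xi) (bv i x xi) mulr0 addr0.
Qed.

Lemma tspan_ext pi u v : (forall L x, u L x = v L x) -> tspan pi u -> tspan pi v.
Proof. by move=> uv; rewrite (_ : v = u) //; apply/funext => L; apply/funext => x; by []. Qed.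

Lemma tspan_add pi u v : tspan pi u -> tspan pi v -> tspan pi (fun L x => u L x + v L x).
Proof.
move=> + tv; elim=> [|r k b s h w cw sh bh _ ih].
 by apply: tspan_ext tv => L x; lra.
by apply: tspan_ext (ts_cons r s cw sh bh ih) => L x; lra.
Qed.

Lemma tspan_scale pi u r : tspan pi u -> tspan pi (fun L x => r * u L x).
Proof.
elim=> [|r' k b s h w cw sh bh _ ih].
 by apply: tspan_ext (ts_zero _) => L x; lra.
by apply: tspan_ext (ts_cons (r * r') s cw sh bh ih) => L x; lra.
Qed.

Lemma tspan_sum (I : eqType) (r : seq I) pi (u : I -> R -> V -> R) : (forall i, i \in r -> tspan pi (u i)) ->
 tspan pi (fun L x => \sum_(i <- r) u i L x).
Proof.
elim: r => [_|i r ih h]; first by apply: tspan_ext (ts_zero _) => L x; rewrite big_nil.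
apply: (@tspan_ext _ (fun L x => u i L x + \sum_(i <- r) u i L x)) => [L x|]; first by rewrite big_cons.
apply: tspan_add; first by apply: h; exact: mem_head.
by apply: ih => j jr; apply: h; rewrite inE jr orbT.
Qed.

Lemma tspan_tm pi r k b s h : cond pi k b \/ r = 0 -> sm h -> supB rc h -> tspan pi (fun L x => r * tm k b s h L x).
Proof.
move=> [cw|->] sh bh; last by apply: tspan_ext (ts_zero _) => L x; lra.
by apply: tspan_ext (ts_cons r s cw sh bh (ts_zero _)) => L x; lra.
Qed.

Definition dtm k b s h (L : R) x : R :=
 monomial b x * h x * (k%:R * osc k 0 s L (ff x) + sgt R s * osc k.+1 1 (~~ s) L (ff x)).

Lemma tm_derive k b s h (L : R) : sm h -> supB rc h ->
 is_derive L 1 (fun L => int_Rn (tm k b s h L)) (int_Rn (dtm k b s h L)).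
Proof.
move=> sh bh; pose w x := monomial b x * h x.
have sw : sm w by apply: sm_mul => //; exact: sm_monomial.
have bw : supB rc w by move=> i x xi; rewrite /w (bh i x xi) mulr0.
have e : tm k b s h = (fun L x => w x * osc k 0 s L (ff x)).
 by apply/funext => u; apply/funext => x; rewrite /tm /osc /w; ring.
have so k' j s' u : sm (fun x => osc k' j s' u (ff x)).
 apply: sm_mul; last exact: sm_trigf.
 smooth.
rewrite e.
pose E1 (u : R) x := w x * (k%:R * osc k 0 s u (ff x) + sgt R s * osc k.+1 1 (~~ s) u (ff x)).
pose E2 (u : R) x := w x * (k%:R * (k%:R * osc k 0 s u (ff x) + sgt R s * osc k.+1 1 (~~ s) u (ff x)) +
   sgt R s * (k.+1%:R * osc k.+1 1 (~~ s) u (ff x) + sgt R (~~ s) * osc k.+2 2 (~~ ~~ s) u (ff x))).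
have d1 (u : R) x : is_derive u 1 (fun u => w x * osc k 0 s u (ff x)) (E1 u x).
 have hz : is_derive u 1 (fun u => w x * osc k 0 s u (ff x)) _ := is_deriveZ (w x) (osc_derive k 0 s u (ff x)).
 by [].
have d2 (u : R) x : is_derive u 1 (fun u => E1 u x) (E2 u x).
 have hz : is_derive u 1 (fun u => E1 u x) _ := is_deriveZ (w x) (is_deriveD (is_deriveZ k%:R (osc_derive k 0 s u (ff x)))
  (is_deriveZ (sgt R s) (osc_derive k.+1 1 (~~ s) u (ff x)))).
 by [].
have sE1 u : sm (E1 u) by apply: sm_mul => //; apply: sm_add; apply: sm_scale.
have hE2 : forall t : R, exists C : R, forall u x, `|u - t| <= 1 -> `|E2 u x| <= C; last first.
 exact: (int_param rc0' (fun u => sm_mul sw (so k 0%N s u)) (fun u => supB_mul _ bw) sE1 (fun u => supB_mul _ bw) d1 d2 hE2).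
move=> t; have [W W0 hW] := sm_bounded sw bw; have [Y Y0 hY] := bounded_box rc (sm_continuous sff).
pose B j k' : R := expR (k'%:R * (`|t| + 1)) * Y ^+ j.
exists (W * (k%:R * (k%:R * B 0%N k + B 1%N k.+1) + (k.+1%:R * B 1%N k.+1 + B 2%N k.+2))) => u x ut.
have [xK|wx] := box_or_zero x bw; last first.
 rewrite /E2 wx mul0r normr0.
 by rewrite !(mulr_ge0, addr_ge0).
have ob k' j s' : `|osc k' j s' u (ff x)| <= B j k' by apply: osc_bound => //; exact: hY.
have sg1 s' : `|sgt R s'| = 1 by rewrite /sgt; case: s'; rewrite /= ?normrN normr1.
rewrite /E2 normrM; apply: ler_pM => //; apply: le_trans (ler_normD _ _) _; apply: lerD.
 rewrite normrM ger0_norm //; apply: ler_wpM2l => //; apply: le_trans (ler_normD _ _) _.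
 by apply: lerD; rewrite normrM ?sg1 ?mul1r // ger0_norm //; apply: ler_wpM2l.
rewrite normrM sg1 mul1r; apply: le_trans (ler_normD _ _) _.
by apply: lerD; rewrite normrM ?sg1 ?mul1r // ger0_norm //; apply: ler_wpM2l.
Qed.

(** Terms of the subtracted sum have order above l along (a, l): either <a, al> > l, or there is an
    extra factor x_i with a_i > 0; all others have coefficient 0. *)
Lemma euler_identity (a : mindex n) (l : nat) x : l%:R * ff x =
 \sum_i (a i)%:R * eul i ff x - \sum_(al <- Ps) monomial al x *
  (((npair a al)%:R - l%:R) * F al x + \sum_i (a i)%:R * (coord x i * partial i (F al) x)).
Proof.
have -> : \sum_i (a i)%:R * eul i ff x =
  \sum_(al <- Ps) monomial al x * ((npair a al)%:R * F al x + \sum_i (a i)%:R * (coord x i * partial i (F al) x)).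
 under eq_bigr => i _ do rewrite (eul_fF dc) mulr_sumr.
 rewrite exchange_big /=; apply: eq_bigr => al _; rewrite /npair natr_sum mulr_suml -big_split mulr_sumr /=.
 by apply: eq_bigr => i _; rewrite /Hd /eul; ring.
by rewrite -sumrB mulr_sumr; apply: eq_bigr => al _; ring.
Qed.

Definition inc pi (g0 : mindex n * nat) : mindex n * nat -> nat := fun g => (pi g + (g == g0))%N.

Lemma cond_inc pi (g0 : mindex n * nat) k b b' : cond pi k b -> (forall g, g \in G -> (npair g.1 b <= npair g.1 b')%N) ->
 (npair g0.1 b < npair g0.1 b')%N -> cond (inc pi g0) k b'.
Proof.
move=> cb bb b0 g gG; rewrite /inc; case: eqP => [e|_]; last exact: ar0 (cb g gG) (bb g gG).
by rewrite e; apply: ar1 b0; rewrite -e; auto.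
Qed.

Lemma cond_shift pi k b al : al \in Ps -> cond pi k b -> cond pi k.+1 (madd b al).
Proof.
by move=> aP cb g gG; rewrite npair_madd; exact: ar2 (cb g gG) (dc_G dc aP gG).
Qed.

(* (l d/dL + pi) gains one unit of decay in the direction (a, l): the Euler identity trades
  l e^L f for the Euler fields, which integrate by parts. *)
Lemma tm_key pi g0 k b s h : g0 \in G -> cond pi k b -> sm h -> supB rc h -> exists2 u,
 tspan (inc pi g0) u & forall L, g0.2%:R * int_Rn (dtm k b s h L) + (pi g0)%:R * int_Rn (tm k b s h L) = int_Rn (u L).
Proof.
case: g0 => a l gG cb sh bh; rewrite [(a, l).2]/=.
pose sg := sgt R s; pose q : R := (pi (a, l))%:R + l%:R * k%:R - (\sum_i a i)%:R - (npair a b)%:R.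
pose u1 L x := q * tm k b s h L x.
pose u2 L x := \sum_i - (a i)%:R * tm k (madd b (mdelta i)) s (partial i h) L x.
pose u3 L x := \sum_(al <- Ps) (- sg * ((npair a al)%:R - l%:R) * tm k.+1 (madd b al) (~~ s) (fun x => h x * F al x) L x
 + \sum_i - sg * (a i)%:R * tm k.+1 (madd (madd b al) (mdelta i)) (~~ s) (fun x => h x * partial i (F al) x) L x).
have bhm g : supB rc (fun x => h x * g x) by exact: supB_mul.
have t1 : tspan (inc pi (a, l)) u1.
 (* If the order along (a, l) is exactly [pi], the coefficient [q] is zero; if it is larger, the
    term already has the higher order. *)
 apply: tspan_tm => //; case: (leqP (\sum_i a i + npair a b) (pi (a, l) + k * l)) => hq.
  right; rewrite /q; have := cb _ gG => /= hq'.
  have /eqP e : (\sum_i a i + npair a b == pi (a, l) + k * l)%N by rewrite eqn_leq hq hq'.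
  have : (\sum_i a i + npair a b)%:R = (pi (a, l) + k * l)%:R :> R by rewrite e.
  lra.
 left => g ggG; rewrite /inc; case: eqP => [->|_]; first exact: ar3.
 by rewrite addn0; auto.
have t2 : tspan (inc pi (a, l)) u2.
 apply: tspan_sum => i _; apply: tspan_tm; [|exact: sm_partial|exact: supB_partial].
 case: (posnP (a i)) => ai; [by right; rewrite ai oppr0|left].
 apply: cond_inc cb _ _ => [g ggG|]; first by rewrite npair_madd leq_addr.
 by rewrite npair_madd npair_mdelta -[X in (X < _)%N]addn0 ltn_add2l.
have t3 : tspan (inc pi (a, l)) u3.
 apply: tspan_sum => al aP; have la := dc_G dc aP gG; have cs := cond_shift aP cb.
 apply: tspan_add.
  apply: tspan_tm => //; last smooth.
  case: (eqVneq (npair a al) l) => e; first by right; rewrite e subrr mulr0.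
  left => g ggG; rewrite npair_madd /inc; case: eqP => [->|_]; last by rewrite addn0; exact: ar2 (cb g ggG) (dc_G dc aP ggG).
  by apply: ar4 (cb _ gG) _; rewrite ltn_neqAle eq_sym e.
 apply: tspan_sum => i _; apply: tspan_tm => //; last by apply: sm_mul => //; smooth.
 case: (posnP (a i)) => ai; [by right; rewrite ai mulr0|left].
 apply: cond_inc cs _ _ => [g ggG|]; first by rewrite !npair_madd leq_addr.
 by rewrite [X in (_ < X)%N]npair_madd npair_mdelta -[X in (X < _)%N]addn0 ltn_add2l.
exists (fun L x => u1 L x + (u2 L x + u3 L x)); first by apply: tspan_add => //; exact: tspan_add.
move=> L; pose w x := tm k b s h L x.
have sw : sm w by exact: sm_tm.
have bw : supB rc w by exact: supB_tm.
pose D i := partial i (fun x => coord x i * w x).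
have scw i : sm (fun x => coord x i * w x) by apply: sm_mul => //; exact: sm_coord.
have bcw i : supB rc (fun x => coord x i * w x) by move=> j x xj; rewrite (bw j x xj) mulr0.
have sdt : sm (dtm k b s h L).
 apply: sm_mul; first by apply: sm_mul => //; smooth.
 by apply: sm_add; apply: sm_scale; apply: sm_mul; smooth.
have bdt : supB rc (dtm k b s h L) by move=> i x xi; rewrite /dtm (bh i x xi) mulr0 mul0r.
rewrite -(int_Rn_lin rc0' _ _ (sm_LC sdt bdt) (sm_LC sw bw)).
have -> : (fun x => l%:R * dtm k b s h L x + (pi (a, l))%:R * tm k b s h L x) =
 (fun x => (u1 L x + (u2 L x + u3 L x)) + \sum_i (a i)%:R * D i x).
 apply/funext => x.
 have eD i : D i x = w x + ((b i)%:R * w x + tm k (madd b (mdelta i)) s (partial i h) L x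
   + sg * (expR (k%:R * L) * monomial b x * h x * expR L * trig (~~ s) (expR L * ff x)) * eul i ff x).
  rewrite /D pd_mul //; last exact: sm_coord.
  rewrite pd_coord eqxx mulr1 addrC; congr (_ + _).
  have -> : w = (fun x => (expR (k%:R * L) * monomial b x * h x) * trig s (expR L * ff x)) by [].
  have s1 : sm (fun x => expR (k%:R * L) * monomial b x) by apply: sm_scale; exact: sm_monomial.
  rewrite pd_mul; [|exact: sm_mul|exact: sm_trigf].
  rewrite (pd_comp i (trig_derive s (expR L * ff x))); last exact: sm_scale.
  rewrite pd_scale // [partial i (fun x0 => _ * _ * h x0) x]pd_mul // pd_scale; last exact: sm_monomial.
  have e := @pd_monomial R n i b x.
  rewrite /tm monomial_madd monomial_mdelta -/sg /eul.
  set E := expR _; set m := monomial b x; set T := trig s _; set T' := trig _ _.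
  rewrite [LHS](_ : _ = E * T * h x * (coord x i * partial i (monomial b) x) + E * m * T * (coord x i * partial i h x)
   + E * m * h x * (sg * T' * (expR L * (coord x i * partial i ff x)))); last lra.
  by rewrite e -/m; ring.
 under eq_bigr => i _ do rewrite eD.
 have -> : dtm k b s h L x = k%:R * w x + sg * (expR (k%:R * L) * monomial b x * h x * expR L * trig (~~ s) (expR L * ff x)) * ff x.
  rewrite /dtm /osc /w /tm -[k.+1%:R]natr1 mulrDl mul1r expRD -/sg; lra.
 set W := sg * _.
 have -> : \sum_i (a i)%:R * (w x + ((b i)%:R * w x + tm k (madd b (mdelta i)) s (partial i h) L x + W * eul i ff x)) =
   (\sum_i a i)%:R * w x + (npair a b)%:R * w x - u2 L x + W * \sum_i (a i)%:R * eul i ff x.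
  rewrite /npair /u2 !natr_sum !mulr_suml mulr_sumr -sumrN -!big_split /=; apply: eq_bigr => i _.
  lra.
 have -> : u3 L x = - W * \sum_(al <- Ps) monomial al x *
  (((npair a al)%:R - l%:R) * F al x + \sum_i (a i)%:R * (coord x i * partial i (F al) x)).
  rewrite /u3 mulr_sumr; apply: eq_bigr => al _; rewrite [RHS]mulrA [RHS]mulrDr; congr (_ + _).
   rewrite /tm monomial_madd /W -[k.+1%:R]natr1 mulrDl mul1r expRD; lra.
  rewrite !mulr_sumr; apply: eq_bigr => i _.
  rewrite /tm !monomial_madd monomial_mdelta /W -[k.+1%:R]natr1 mulrDl mul1r expRD; lra.
 have e := euler_identity a l x; rewrite /u1 -/(w x) /q.
 nra.
have sD i : sm (D i) by apply: sm_partial.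
have bD i : supB rc (D i) by apply: supB_partial.
have su : sm (fun x => u1 L x + (u2 L x + u3 L x)).
 by apply: sm_add; [|apply: sm_add]; [exact: tspan_sm t1|exact: tspan_sm t2|exact: tspan_sm t3].
have bu : supB rc (fun x => u1 L x + (u2 L x + u3 L x)).
 by move=> i x xi; rewrite (tspan_supB L t1 xi) (tspan_supB L t2 xi) (tspan_supB L t3 xi) !addr0.
have lD i : LC rc [::] (fun x => (a i)%:R * D i x).
 by apply: sm_LC; [apply: sm_scale|move=> j x xj; rewrite (bD i j x xj) mulr0].
have lS : LC rc [::] (fun x => \sum_i (a i)%:R * D i x).
 apply: sm_LC; first by apply: sm_sum => i _; smooth.
 by move=> j x xj; apply: big1 => i _; rewrite (bD i j x xj) mulr0.
rewrite (int_Rn_add rc0' (sm_LC su bu) lS).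
rewrite (int_Rn_sum (index_enum _) rc0' lD).2 big1 ?addr0 // => i _.
have := int_Rn_lin rc0' (a i)%:R 0 (sm_LC (sD i) (bD i)) (sm_LC (sD i) (bD i)).
rewrite (_ : (fun x => _ + 0 * _) = (fun x => (a i)%:R * D i x)); last by apply/funext => x; lra.
by move=> ->; rewrite (int_Rn_partial i rc0' (scw i) (bcw i)) !mulr0 addr0.
Qed.

Lemma tspan_key pi g0 u : g0 \in G -> (0 < g0.2)%N -> tspan pi u -> exists2 u', tspan (inc pi g0) u' &
 forall L : R, is_derive L 1 (fun L => int_Rn (u L))
  (g0.2%:R^-1 * int_Rn (u' L) - (pi g0)%:R / g0.2%:R * int_Rn (u L)).
Proof.
move=> gG l0; have ln : g0.2%:R != 0 :> R by rewrite pnatr_eq0 -lt0n.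
elim=> [|r k b s h v cb sh bh tv [v' tv' dv]].
 exists (fun _ _ => 0); first exact: ts_zero.
 move=> L; have i0 : int_Rn (fun _ : V => 0) = 0 :> R by rewrite int_RnE Ifold0.
 by rewrite i0 !mulr0 subr0; exact: is_derive_cst.
have [w tw hw] := tm_key s gG cb sh bh.
exists (fun L x => r * w L x + v' L x); first by apply: tspan_add => //; exact: tspan_scale.
move=> L; have e (u1 u2 : V -> R) : sm u1 -> supB rc u1 -> sm u2 -> supB rc u2 ->
  int_Rn (fun x => r * u1 x + u2 x) = r * int_Rn u1 + int_Rn u2.
 move=> s1 b1 s2 b2; have := int_Rn_lin rc0' r 1 (sm_LC s1 b1) (sm_LC s2 b2).
 by rewrite mul1r => <-; congr int_Rn; apply/funext => x; lra.
have st L' := sm_tm k b s L' sh; have bt L' := supB_tm k b s L' bh.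
have -> : (fun L => int_Rn (fun x => r * tm k b s h L x + v L x)) = (fun L => r * int_Rn (tm k b s h L) + int_Rn (v L)).
 by apply/funext => L'; apply: e => //; [exact: tspan_sm tv|exact: tspan_supB tv].
have hd : is_derive L 1 (fun L => r * int_Rn (tm k b s h L) + int_Rn (v L)) _ :=
 is_deriveD (is_deriveZ r (tm_derive k b s L sh bh)) (dv L).
deriv hd; rewrite e; [|exact: tspan_sm tw|exact: tspan_supB tw|exact: tspan_sm tv'|exact: tspan_supB tv'].
rewrite e //; [|exact: tspan_sm tv|exact: tspan_supB tv].
have := hw L; set X := int_Rn (dtm _ _ _ _ _); set Y := int_Rn (tm _ _ _ _ _) => <-.
by field.
Qed.

(** Once pi >= g l for every half-space, each term meets the condition of [estimate_general], and
    integration by parts provides the weight required there. *)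
Lemma tspan_base pi u (g : R) : 0 < g -> (forall p, p \in G -> g * p.2%:R <= (pi p)%:R) -> tspan pi u ->
 bo (fun L => int_Rn (u L)) (gm (- g, n.-1)).
Proof.
move=> g0 hg; elim=> [|r k b s h v cb sh bh tv hv].
 exists 0, 0 => L _; by rewrite int_RnE Ifold0 normr0 mul0r.
have e L : int_Rn (fun x => r * tm k b s h L x + v L x) = r * int_Rn (tm k b s h L) + int_Rn (v L).
 have := int_Rn_lin rc0' r 1 (sm_LC (sm_tm k b s L sh) (supB_tm k b s L bh)) (sm_LC (tspan_sm L tv) (tspan_supB L tv)).
 by rewrite mul1r => <-; congr int_Rn; apply/funext => x; lra.
apply: (@bo_eq _ (fun L => r * int_Rn (tm k b s h L) + int_Rn (v L)) _ _ 0) => [L _|]; auto.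
apply: bo_add => //; apply: bo_scale.
pose M := (Num.truncn (k%:R + g)).+1.
have kM : k%:R + g < M%:R by rewrite /M truncnS_gt.
have [|C C0 hC] := @estimate_general R n f A G NG b k M g g0 kM.
 move=> p pG; rewrite mulrDl; apply: le_trans (lerD (lexx _) (hg _ pG)) _.
 by rewrite -natrM -natrD ler_nat addnC; auto.
pose w L x : R := `|expR (k%:R * L)| * `|monomial b x| * 1.
pose u1 L x : R := expR (k%:R * L) * monomial b x * h x.
have su1 : sym rc M w u1.
 apply: sym_mul; last exact: sym_static.
 apply: sym_mul; last exact: sym_monomial.
 exact: (sym_scalar n rc M (fun L => expR (k%:R * L))).
have [||C' C'0 hC'] := @parts R n rc A ff rc0' sff fsym c c0 grad (@kapt R s) M 1 (@kapt_csm R s) (fun j r _ => kapt_derive s j r) ler01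
  (fun j r _ => kapt_le1 s j r) M 0%N w u1 (leqnn _) _ su1.
- by move=> L x; rewrite !mulr_ge0.
- by move=> L i x xi; rewrite /u1 (bh i x xi) mulr0.
exists (C' * C), 1 => L L1.
have := hC' L (C * gm (- g, n.-1) L) L1; rewrite mulrA (_ : (fun x => u1 L x * _) = tm k b s h L); last first.
 by apply/funext => x; rewrite /kapt mul1r.
apply=> u' B' B'0 su' bu' hu'; rewrite /gm /= !mulrA [B' * C]mulrC; apply: hC => //; first exact: LC1.
by move=> x; apply: le_trans (hu' x) _; rewrite /w mulr1 (ger0_norm (expR_ge0 _)) !mulrA.
Qed.

(** While some half-space has pi < g l, an equation of rate pi / l < g raises that pi by one; the
    total deficit [def] decreases. *)
Lemma tspan_expands (g : R) : 0 < g -> forall pi u, tspan pi u -> expands g n.-1 (fun L => int_Rn (u L)).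
Proof.
move=> g0 pi; pose def pi := (\sum_(p <- G) ((Num.truncn (g * p.2%:R)).+1 - pi p))%N.
move: {2}(def pi).+1 (ltnSn (def pi)) => d; elim: d pi => // d ih pi dpi u tu.
case: (pselect (exists2 p, p \in G & (pi p)%:R < g * p.2%:R)) => [[p pG pp]|nb]; last first.
 exists [::] => //; have := @tspan_base pi u g g0 _ tu; rewrite /bo => h.
 have [p pG|C [L0 hC]] := h; first by rewrite leNgt; apply/negP => pp; apply: nb; exists p.
 by exists C, L0 => L /hC; rewrite ep_nil subr0.
have l0 : (0 < p.2)%N.
 by rewrite lt0n; apply/eqP => e; move: pp; rewrite e mulr0 ltNge ler0n.
have ln : 0 < p.2%:R :> R by rewrite ltr0n.
have [u' tu' du'] := tspan_key pG l0 tu.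
apply: (@expands_ode _ g n.-1 ((pi p)%:R / p.2%:R) _ (fun L => int_Rn (fun x => p.2%:R^-1 * u' L x))).
- move=> L; apply: is_derive_eq (du' L) _; congr (_ - _).
 have := int_Rn_lin rc0' p.2%:R^-1 0 (sm_LC (tspan_sm L tu') (tspan_supB L tu')) (sm_LC (tspan_sm L tu') (tspan_supB L tu')).
 by rewrite mul0r addr0 => <-; congr int_Rn; apply/funext => x; lra.
- by rewrite ltr_pdivrMr.
apply: (ih (inc pi p)); last exact: tspan_scale.
rewrite -ltnS; apply: leq_trans dpi; rewrite ltnS /def.
have pt : (pi p <= Num.truncn (g * p.2%:R))%N.
 by rewrite truncn_ge_nat ?(ltW pp) // mulr_ge0 ?ltW.
rewrite (big_rem p) //= [X in (_ < X)%N](big_rem p) //= -addSn; apply: leq_add.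
 by rewrite /inc eqxx addn1 subSS -subSn.
by apply: leq_sum => q _; apply: leq_sub2l; rewrite leq_addr.
Qed.

Lemma oscillatory_expands (g : R) s (phi : V -> R) : 0 < g -> sm phi -> supB rc phi ->
 expands g n.-1 (osci s ff phi).
Proof.
move=> g0 sp bp; have := @tspan_expands g g0 (fun=> 0%N) (fun L x => 1 * tm 0 [ffun=> 0%N] s phi L x) _.
rewrite (_ : (fun L => int_Rn _) = (osci s ff phi)).
 by apply; apply: tspan_tm => //; left => p; by [].
apply/funext => L; congr int_Rn; apply/funext => x.
rewrite /tm mul0r expR0 /monomial big1 => [|i _]; last by rewrite ffunE.
by ring.
Qed.

End Tspan.

Section Upper.
Variables (U : 'M[R]_(dim_set (principal_face f), n)) (a : mindex n) (l : nat) (e : R).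
Hypothesis pdu : pdata U a l e.

(** M > 1/d integrations by parts bring in the weight (1 + t m)^-M, and [estimate_principal]
    applies. *)
Lemma oscillatory_upper s (phi : V -> R) : sm phi -> supB rc phi ->
 bo (osci s ff phi) (Om f).
Proof.
move=> sp bp; pose M := (Num.truncn ((newton_dist f)^-1)).+1.
have kM : (newton_dist f)^-1 < M%:R by rewrite /M truncnS_gt.
have [C C0 hC] := estimate_principal NG pdu kM.
have [|C' C'0 hC'] := @parts R n rc A ff rc0' sff fsym c c0 grad (@kapt R s) M 1 (@kapt_csm R s) (fun j r _ => kapt_derive s j r) ler01
  (fun j r _ => kapt_le1 s j r) M 0%N (fun _ _ => 1) (fun=> phi) (leqnn _) (fun _ _ => ler01) (sym_static rc M sp).
 by move=> L.
exists (C' * C), 1 => L L1.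
have := hC' L (C * Om f L) L1; rewrite mulrA (_ : (fun x => phi x * _) = (fun x => trig s (expR L * ff x) * phi x)); last first.
 by apply/funext => x; rewrite /kapt mul1r mulrC.
apply=> u' B' B'0 su' bu' hu'; rewrite /gm /= !mulrA [B' * C]mulrC; apply: hC => //; first exact: LC1.
by move=> x; apply: le_trans (hu' x) _; lra.
Qed.
Local Notation p := ((newton_dist f)^-1).
Variables (phi : V -> R) (r1 : R).
Hypotheses (sp : sm phi) (bp : supB rc phi) (phi0 : forall x, 0 <= phi x) (r10 : 0 < r1)
 (phi1 : forall x, inbox r1 x -> phi x = 1).
(** Empty for hypotheses (a) and (b); for (c) it lists the generators off the principal face. *)
Variable O : seq (mindex n).
Hypothesis OA : forall v, v \in O -> v \in A /\ (l < npair a v)%N.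
Implicit Types (b : bool) (J k : nat) (L : R) (x : V) (ts : seq nat).

Definition Mo x : R := \sum_(v <- O) monomial (madd v v) x.
(** A damping factor for the places where f may be small compared with the monomials off the
    principal face; it is 1 when [O] is empty. *)
Definition qq L x : R := (1 + expR L ^+ 2 * Mo x)^-1.

Lemma mono2_ge0 v x : 0 <= monomial (madd v v) x :> R.
Proof. by rewrite monomial_madd -expr2. Qed.
Lemma mono2_norm v x : `|monomial (madd v v) x| = monomial (madd v v) x.
Proof. by rewrite ger0_norm // mono2_ge0. Qed.
Lemma Mo_ge0 x : 0 <= Mo x.
Proof. by apply: sumr_ge0 => v _; exact: mono2_ge0. Qed.
Lemma TMo_ge0 L x : 0 <= expR L ^+ 2 * Mo x.
Proof. by rewrite mulr_ge0 ?Mo_ge0. Qed.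
Lemma qden L x : 0 < 1 + expR L ^+ 2 * Mo x.
Proof. by have := TMo_ge0 L x; lra. Qed.
Lemma qq_gt0 L x : 0 < qq L x. Proof. by rewrite invr_gt0 qden. Qed.
Lemma qq_le1 L x : qq L x <= 1.
Proof. by rewrite invf_le1; have := TMo_ge0 L x; lra. Qed.
Lemma qqE L x : expR L ^+ 2 * Mo x * qq L x = 1 - qq L x.
Proof. by rewrite /qq; field; rewrite gt_eqF // qden. Qed.
Lemma sm_Mo : sm Mo.
Proof. by apply: sm_sum => v _; smooth. Qed.
Lemma sm_qq L : sm (qq L).
Proof.
apply: sm_inv => [|x]; last by rewrite gt_eqF // qden.
by apply: sm_add; [exact: sm_cst|apply: sm_scale; exact: sm_Mo].
Qed.

Lemma qq_derive L x : is_derive L 1 (fun L => qq L x) (- 2 * (expR L ^+ 2 * Mo x) * qq L x ^+ 2).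
Proof.
have d1 : is_derive L 1 (fun L => 1 + expR L ^+ 2 * Mo x) (2 * (expR L ^+ 2 * Mo x)).
 have h : is_derive L 1 (fun L => 1 + Mo x * (expR L * expR L)) _ :=
  is_deriveD (is_derive_cst (1 : R) L 1) (is_deriveZ (Mo x) (is_deriveM (is_derive_expR L) (is_derive_expR L))).
 rewrite (_ : (fun L => 1 + _) = (fun L => 1 + Mo x * (expR L * expR L))); last by apply/funext => u; lra.
 by deriv h; ring.
have h := @is_deriveV R (fun L => 1 + expR L ^+ 2 * Mo x) L _ 1 (lt0r_neq0 (qden L x)) d1; apply: is_derive_eq h _.
by rewrite /GRing.scale /= exprVn; ring.
Qed.

Lemma TMo_derive L x : is_derive L 1 (fun L => expR L ^+ 2 * Mo x) (2 * (expR L ^+ 2 * Mo x)).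
Proof.
have h : is_derive L 1 (fun L => Mo x * (expR L * expR L)) _ :=
  is_deriveZ (Mo x) (is_deriveM (is_derive_expR L) (is_derive_expR L)).
rewrite (_ : (fun L => _) = (fun L => Mo x * (expR L * expR L))); last by apply/funext => u; lra.
by deriv h; ring.
Qed.

Section Chain.
Variables (b : bool) (J : nat).

Definition kr ts s := ker b (Tl ts ('X^(J.+1) : {poly R})) s.

Lemma kr_bound ts : exists2 B : R, 0 <= B & forall s, `|kr ts s| <= B * vv s ^+ J.
Proof. by have [Q eQ] := Tl_Xn R ts J; rewrite /kr eQ; apply: ker_bound; case: b. Qed.

Lemma sm_poly (g : V -> R) (P : {poly R}) : sm g -> sm (fun x => P.[g x]).
Proof.
move=> sg; rewrite (_ : (fun x => _) = (fun x => \sum_(i <- enum 'I_(size P)) P`_i * g x ^+ i)).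
 by apply: sm_sum => i _; smooth.
by apply/funext => x; rewrite horner_coef big_enum.
Qed.

Lemma sm_kr ts L : sm (fun x => kr ts (expR L * ff x)).
Proof.
have s1 : sm (fun x => expR L * ff x) by exact: sm_scale.
by apply: sm_mul; [exact: sm_exp|apply: sm_poly; exact: sm_vv].
Qed.

Lemma kr_cons t ts s : kr (t :: ts) s = kr ((b : nat) :: ts) s + (t%:R - (b : nat)%:R) * kr ts s.
Proof. by rewrite /kr /ker !Tp_horner; ring. Qed.

(** The derivative of q^k in L is -2 k (t^2 Mo) q^(k+1), so this family is closed under d/dL up to
    linear combinations; members with i <= k stay bounded. *)
Definition tk (i k : nat) ts L x : R :=
 phi x * ((expR L ^+ 2 * Mo x) ^+ i * (qq L x ^+ k * kr ts (expR L * ff x))).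

Lemma sm_tk i k ts L : sm (tk i k ts L).
Proof.
apply: sm_mul => //; apply: sm_mul; first by apply: sm_exp; apply: sm_scale; exact: sm_Mo.
by apply: sm_mul; [apply: sm_exp; exact: sm_qq|exact: sm_kr].
Qed.

Lemma supB_tk i k ts L : supB rc (tk i k ts L). Proof. exact: supB_mul. Qed.

Lemma tk_derive i k ts (L : R) x : is_derive L 1 (fun L => tk i k ts L x)
 ((2 * i%:R) * tk i k ts L x - (2 * k%:R) * tk i.+1 k.+1 ts L x + tk i k ((b : nat) :: ts) L x).
Proof.
have dX (g : R -> R) (d : R) (j : nat) : is_derive L 1 g d -> is_derive L 1 (fun L => g L ^+ j) (j%:R * g L ^+ j.-1 * d).
 move=> dg; have h := is_deriveX j dg.
 rewrite (_ : (fun u => _) = g ^+ j); last by apply/funext => u; rewrite exprfctE.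
 by [].
have d1 := dX _ _ i (TMo_derive L x); have d2 := dX _ _ k (qq_derive L x).
have d3 : is_derive L 1 (fun L => kr ts (expR L * ff x)) (kr ((b : nat) :: ts) (expR L * ff x)).
 exact: ker_derive.
have h : is_derive L 1 (fun L => tk i k ts L x) _ := is_deriveZ (phi x) (is_deriveM d1 (is_deriveM d2 d3)).
deriv h; rewrite /tk.
set y := expR L ^+ 2 * Mo x; set q := qq L x; set K := kr ts _; set K' := kr (_ :: ts) _.
rewrite (_ : (_ * _) L = q ^+ k * K) // !exprS.
have e1 : i%:R * y ^+ i.-1 * y = i%:R * y ^+ i by case: (i) => [|i']; [rewrite !mul0r|rewrite /= exprS; ring].
have e2 : k%:R * q ^+ k.-1 * q = k%:R * q ^+ k by case: (k) => [|k']; [rewrite !mul0r|rewrite /= exprS; ring].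
rewrite [LHS](_ : _ = phi x * (y ^+ i * (q ^+ k * K') + y ^+ i * (K * (- 2 * y * q * (k%:R * q ^+ k.-1 * q)))
  + 2 * (i%:R * y ^+ i.-1 * y) * (q ^+ k * K))); last lra.
by rewrite e1 e2; ring.
Qed.

Lemma yq_le1 i k L x : (i <= k)%N -> `|(expR L ^+ 2 * Mo x) ^+ i * qq L x ^+ k| <= 1.
Proof.
move=> ik; have y0 := TMo_ge0 L x; have q0 := qq_gt0 L x; have q1 := qq_le1 L x; have e1 := qqE L x.
rewrite -(subnKC ik) exprD mulrA -exprMn normrM mulr_ile1 // normrX.
 by apply: exprn_ile1; rewrite // ger0_norm; lra.
by apply: exprn_ile1; rewrite // gtr0_norm.
Qed.

Lemma tk_bound i k ts : (i <= k)%N -> exists2 C : R, 0 <= C & forall L x, `|tk i k ts L x| <= C.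
Proof.
move=> ik; have [W W0 hW] := sm_bounded sp bp; have [B B0 hB] := kr_bound ts.
exists (W * B) => [|L x]; first exact: mulr_ge0.
rewrite /tk normrM; apply: ler_pM => //; rewrite mulrA normrM.
rewrite -[leRHS]mul1r; apply: ler_pM => //; first exact: yq_le1.
apply: le_trans (hB _) _; rewrite ler_piMr //; apply: exprn_ile1; [exact/ltW/vv_gt0|exact: vv_le1].
Qed.

Definition Gk ts L := int_Rn (tk 0 J ts L).

Lemma lin2 (u1 u2 : V -> R) (d1 d2 : R) : sm u1 -> supB rc u1 -> sm u2 -> supB rc u2 ->
 int_Rn (fun x => d1 * u1 x + d2 * u2 x) = d1 * int_Rn u1 + d2 * int_Rn u2.
Proof. by move=> s1 b1 s2 b2; rewrite (int_Rn_lin rc0' _ _ (sm_LC s1 b1) (sm_LC s2 b2)). Qed.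

(** d/dL acts on the kernel as [Tp b] = [Tp t] - (t - b); the additional integral comes from the
    damping factor. *)
Lemma Gk_derive t ts (L : R) : is_derive L 1 (Gk ts)
 ((Gk (t :: ts) L - 2 * J%:R * int_Rn (tk 1 J.+1 ts L)) - (t%:R - (b : nat)%:R) * Gk ts L).
Proof.
pose E1 L x := (- (2 * J%:R)) * tk 1 J.+1 ts L x + 1 * tk 0 J ((b : nat) :: ts) L x.
have d1 (u : R) x : is_derive u 1 (fun u => tk 0 J ts u x) (E1 u x).
 by apply: is_derive_eq (tk_derive 0 J ts u x) _; rewrite /E1; ring.
pose D i k ts' (u : R) x := (2 * i%:R) * tk i k ts' u x - (2 * k%:R) * tk i.+1 k.+1 ts' u x + tk i k ((b : nat) :: ts') u x.
pose E2 u x := (- (2 * J%:R)) * D 1%N J.+1 ts u x + 1 * D 0%N J ((b : nat) :: ts) u x.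
have d2 (u : R) x : is_derive u 1 (fun u => E1 u x) (E2 u x).
 have h : is_derive u 1 (fun u => E1 u x) _ := is_deriveD (is_deriveZ (- (2 * J%:R)) (tk_derive 1 J.+1 ts u x))
  (is_deriveZ 1 (tk_derive 0 J ((b : nat) :: ts) u x)).
 by [].
have sE1 u : sm (E1 u) by apply: sm_add; apply: sm_scale; exact: sm_tk.
have bE1 u : supB rc (E1 u) by move=> i x xi; rewrite /E1 /tk (bp xi) !mul0r !mulr0 addr0.
have hE2 : forall t : R, exists C : R, forall u x, `|u - t| <= 1 -> `|E2 u x| <= C.
 move=> t0.
 have Db i k ts' : (i <= k)%N -> exists2 C : R, 0 <= C & forall u x, `|D i k ts' u x| <= C.
  move=> ik; have [C1 C10 h1] := tk_bound ts' ik; have [C2 C20 h2] := @tk_bound i.+1 k.+1 ts' ik.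
  have [C3 C30 h3] := tk_bound ((b : nat) :: ts') ik.
  exists (2 * i%:R * C1 + 2 * k%:R * C2 + C3) => [|u x]; first pos.
  apply: le_trans (ler_normD _ _) _; apply: lerD => //; apply: le_trans (ler_normB _ _) _.
  have n0 (j : nat) : `|2 * j%:R| = 2 * j%:R :> R by rewrite ger0_norm.
  by apply: lerD; rewrite normrM n0; apply: ler_wpM2l; by [].
 have [C1 C10 h1] := Db 1%N J.+1 ts isT; have [C2 C20 h2] := Db 0%N J ((b : nat) :: ts) isT.
 exists (2 * J%:R * C1 + C2) => u x _; rewrite /E2 mul1r.
 apply: le_trans (ler_normD _ _) _; apply: lerD => //.
 by rewrite mulNr normrN normrM ger0_norm //; apply: ler_wpM2l; by [].
have h := int_param rc0' (fun u => sm_tk 0 J ts u) (fun u => supB_tk 0 J ts u) sE1 bE1 d1 d2 hE2 L.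
apply: is_derive_eq h _; rewrite /E1 lin2; try exact: sm_tk; try exact: supB_tk.
have -> : Gk (t :: ts) L = 1 * int_Rn (tk 0 J ((b : nat) :: ts) L) + (t%:R - (b : nat)%:R) * Gk ts L.
 rewrite -lin2; try exact: sm_tk; try exact: supB_tk.
 by congr int_Rn; apply/funext => x; rewrite /tk kr_cons; ring.
by ring.
Qed.

Hint Resolve sff sp sm_vv sm_lapinf sm_qq sm_poly sm_kr sm_tk : smooth.

Section Weighted.
Variable cb : R.
Hypotheses (cb0 : 0 < cb) (bnd : forall x, inbox rc x -> cb * mm A x ^+ 2 <= ff x ^+ 2 + Mo x) (pJ : p < J%:R).

(** (1 + t^2 Mo)(1 + (t f)^2) >= 1 + cb y^2 with y = t m, and 1 + y <= 2 (1 + 1/cb)(1 + cb y^2). *)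
Lemma weight_bound : exists2 B : R, 0 <= B & forall L x, inbox rc x ->
 qq L x ^+ J * vv (expR L * ff x) ^+ J <= B * wt A J L x.
Proof.
pose K := 2 * (1 + cb^-1); have ci : 0 < cb^-1 by rewrite invr_gt0.
have K0 : 0 < K by rewrite /K; lra.
exists (K ^+ J) => [|L x xr]; first pos.
rewrite /wt -!exprMn; apply: lerXn2r; rewrite ?nnegrE.
- by rewrite mulr_ge0 // ltW ?qq_gt0 ?vv_gt0.
- by rewrite mulr_ge0 ?invr_ge0 ?(ltW K0) // addr_ge0 // mulr_ge0 ?mm_ge0.
set s := expR L * ff x; set y := expR L * mm A x.
have y0 : 0 <= y by rewrite mulr_ge0 ?mm_ge0.
have d1 : 0 < 1 + y by lra.
rewrite ler_pdivlMr // /qq /vv -invfM mulrC.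
have dd : 0 < (1 + expR L ^+ 2 * Mo x) * (1 + s ^+ 2) by rewrite mulr_gt0 ?qden ?vv_den.
rewrite ler_pdivrMr //.
have h1 : 1 + cb * y ^+ 2 <= (1 + expR L ^+ 2 * Mo x) * (1 + s ^+ 2).
 have := bnd xr; have := TMo_ge0 L x; have s2 := sqr_ge0 s; have m0 := sqr_ge0 (expR L).
 move=> t0 bx; have : expR L ^+ 2 * (cb * mm A x ^+ 2) <= expR L ^+ 2 * (ff x ^+ 2 + Mo x) by apply: ler_wpM2l.
 have -> : cb * y ^+ 2 = expR L ^+ 2 * (cb * mm A x ^+ 2) by rewrite /y; ring.
 have -> : s ^+ 2 = expR L ^+ 2 * ff x ^+ 2 by rewrite /s; ring.
 have := mulr_ge0 t0 (mulr_ge0 m0 (sqr_ge0 (ff x))); lra.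
apply: (@le_trans _ _ (K * (1 + cb * y ^+ 2))); last nra; auto.
have e1 : K * (1 + cb * y ^+ 2) = 2 * (1 + cb * y ^+ 2 + cb^-1 + y ^+ 2) by rewrite /K; field; rewrite gt_eqF.
rewrite e1; have := sqr_ge0 (1 - y); have := sqr_ge0 y; have := mulr_ge0 (ltW cb0) (sqr_ge0 y).
lra.
Qed.

Lemma tk_weight ts : exists2 B : R, 0 <= B & forall L x, `|phi x * (qq L x ^+ J * kr ts (expR L * ff x))| <= B * wt A J L x.
Proof.
have [W W0 hW] := sm_bounded sp bp; have [B B0 hB] := kr_bound ts; have [B' B'0 hB'] := weight_bound.
exists (W * (B * B')) => [|L x]; first pos.
have wt0 : 0 <= wt A J L x by exact: wt_ge0.
have [xK|->] := box_or_zero x bp; last first.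
 rewrite mul0r normr0.
 pos.
rewrite normrM -[leRHS]mulrA; apply: ler_pM => //; rewrite normrM -mulrA.
have q0 : 0 <= qq L x ^+ J by rewrite exprn_ge0 // ltW ?qq_gt0.
rewrite (ger0_norm q0); apply: le_trans (ler_wpM2l q0 (hB _)) _.
by rewrite mulrCA; apply: ler_wpM2l => //; auto.
Qed.

Lemma Gk_bo ts : bo (Gk ts) (Om f).
Proof.
have [C C0 hC] := estimate_principal NG pdu pJ; have [B B0 hB] := tk_weight ts.
exists (C * B), 1 => L L1; rewrite /gm /= !mulrA; apply: hC => //.
 by apply: LC1; [exact: sm_tk|exact: supB_tk].
by move=> x; rewrite /tk mul1r; by [].
Qed.

Lemma min_bound v L x : v \in O -> expR L ^+ 2 * monomial (madd v v) x * qq L x <= Num.min 1 (expR L * `|monomial v x|).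
Proof.
move=> vO; set y := expR L * `|monomial v x|; have y0 : 0 <= y by rewrite mulr_ge0.
have ey : expR L ^+ 2 * monomial (madd v v) x = y ^+ 2.
 by rewrite exprMn real_normK ?num_real // monomial_madd.
have d0 : 0 < 1 + y ^+ 2 by rewrite ltr_wpDr.
have h : qq L x <= (1 + y ^+ 2)^-1.
 rewrite lef_pV2 ?posrE ?qden // lerD2l -ey; apply: ler_wpM2l; auto.
 by rewrite /Mo (big_rem v) //= lerDl; apply: sumr_ge0 => w _; exact: mono2_ge0.
rewrite ey; apply: le_trans (ler_wpM2l (sqr_ge0 y) h) _.
rewrite le_min !ler_pdivrMr // mul1r lerDr ler01 /=.
nra.
Qed.

(** Every term carries t^2 x^(2v) q <= min(1, t |x^v|) with v off the principal face, the situation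
    of [estimate_outside]. *)
Lemma err_lo ts : lo (fun L => int_Rn (tk 1 J.+1 ts L)) (Om f).
Proof.
pose u v L x := phi x * (expR L ^+ 2 * monomial (madd v v) x * (qq L x ^+ J.+1 * kr ts (expR L * ff x))).
have su v L : sm (u v L).
 apply: sm_mul => //; apply: sm_mul; first by apply: sm_scale; smooth.
 smooth.
have bu v L : supB rc (u v L) by exact: supB_mul.
apply: (@lo_eq _ (fun L => \sum_(v <- O) int_Rn (u v L)) _ _ 0) => [L _|].
 rewrite -(int_Rn_sum O rc0' (fun v => sm_LC (su v L) (bu v L))).2; congr int_Rn; apply/funext => x.
 by rewrite -mulr_sumr -mulr_suml -mulr_sumr.
apply: lo_sum => [L|v vO]; first exact: gm_ge0.
have [vA lv] := OA vO; have [B B0 hB] := tk_weight ts.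
move=> eps e0; have B1 : 0 < B + 1 by lra.
have [L0 L01 hL0] := estimate_outside NG pdu pJ vA lv (divr_gt0 e0 B1).
exists L0 => L LL; have L0' : 0 <= L by lra.
have := hL0 L (B + 1) (u v L) LL (ltW B1) (LC1 (su v L) (bu v L)).
rewrite divfK ?gt_eqF // -mulrA; apply => x.
rewrite /u (_ : phi x * _ = (expR L ^+ 2 * monomial (madd v v) x * qq L x) * (phi x * (qq L x ^+ J * kr ts (expR L * ff x)))); last by rewrite [qq L x ^+ J.+1]exprS; ring.
rewrite normrM [leRHS]mulrAC [leRHS]mulrC; apply: ler_pM => //; last first.
 apply: le_trans (hB L x) _; apply: ler_wpM2r; [exact: wt_ge0|lra].
rewrite ger0_norm; first exact: min_bound.
by rewrite !mulr_ge0 ?mono2_ge0 // ltW // qq_gt0.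
Qed.

Lemma chain_lo ts : (forall t, t \in ts -> t%:R - (b : nat)%:R != p) -> lo (Gk ts) (Om f) -> lo (Gk [::]) (Om f).
Proof.
elim: ts => // t ts ih ht hG; apply: ih => [t' t's|]; first by apply: ht; rewrite inE t's orbT.
apply: (lo_ode (Gk_derive t ts)); [by apply: ht; exact: mem_head| |exact: Gk_bo].
apply: (@lo_eq _ (fun L => Gk (t :: ts) L + (- (2 * J%:R)) * int_Rn (tk 1 J.+1 ts L)) _ _ 0) => [L _|]; first lra.
by apply: lo_add => //; apply: lo_scale; exact: err_lo.
Qed.

Lemma sym_qden k : sym rc k (fun L x => 1 + expR L ^+ 2 * Mo x) (fun L x => 1 + expR L ^+ 2 * Mo x).
Proof.
rewrite /Mo; elim: O => [|v O' ih].
 apply: (sym_ext (u := fun _ _ => 1)); first by move=> L; apply/funext => x; rewrite big_nil mulr0 addr0.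
 by apply: sym_weight (sym_cst n rc k 1); exists 1 => // L x _ _; rewrite big_nil mulr0 addr0 mulr1.
apply: (sym_ext (u := fun L x => (1 + expR L ^+ 2 * \sum_(v <- O') monomial (madd v v) x) + expR L ^+ 2 * monomial (madd v v) x)).
 by move=> L; apply/funext => x; rewrite big_cons; ring.
have m0 L x : 0 <= expR L ^+ 2 * \sum_(v <- O') monomial (madd v v) x.
 by rewrite mulr_ge0 //; apply: sumr_ge0 => w _; exact: mono2_ge0.
have m1 L x : 0 <= expR L ^+ 2 * monomial (madd v v) x by rewrite mulr_ge0 ?mono2_ge0.
apply: sym_add.
 by apply: sym_weight ih; exists 1 => // L x _ _; rewrite big_cons; have := m1 L x; lra.
apply: sym_weight (sym_mul (sym_scalar n rc k (fun L => expR L ^+ 2)) (sym_monomial rc k (madd v v))).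
exists 1 => // L x _ _; rewrite mul1r big_cons mono2_norm ger0_norm // mulrDr.
by have := m0 L x; lra.
Qed.

Lemma sym_qq k : sym rc k (fun L x => qq L x) (fun L x => qq L x).
Proof.
apply: (sym_inv (w := fun L x => 1 + expR L ^+ 2 * Mo x)).
- by move=> L x; exact: qden.
- by move=> L x; exact/ltW/qden.
- by exists 1 => // L x _ _; rewrite divff // gt_eqF // qden.
exact: sym_qden.
Qed.

Lemma sym_geo k (j : nat) : sym rc k (fun _ _ => 1) (fun L x => \sum_(i <- iota 0 j) qq L x ^+ i).
Proof.
apply: sym_sum => // i; elim: i => [|i ih].
 by apply: (sym_ext (u := fun _ _ => 1)); [move=> L; apply/funext => x; rewrite expr0|exact: sym_cst].
apply: (sym_ext (u := fun L x => qq L x * qq L x ^+ i)); first by move=> L; apply/funext => x; rewrite exprS.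
by apply: sym_weight (sym_mul (sym_qq k) ih); exists 1 => // L x _ _; rewrite mulr1 mul1r; exact: qq_le1.
Qed.

Lemma geo_sum L x : 1 - qq L x ^+ J = (\sum_(i <- iota 0 J) qq L x ^+ i) * (1 - qq L x).
Proof.
elim: J => [|j ih]; first by rewrite big_nil mul0r subrr.
by rewrite -addn1 iotaD big_cat big_seq1 mulrDl -ih addn1 exprS; ring.
Qed.

(** The Laplace kernel does not decay where f vanishes, so the cost of damping is estimated by J
    integrations by parts; 1 - q^J contains the factor t^2 Mo q, to which [min_bound] and
    [estimate_outside] apply. *)
Lemma top_lo M : (J <= M)%N -> lo (fun L => int_Rn (fun x => (phi x * (1 - qq L x ^+ J)) * cmp b (lapinf M (expR L * ff x)))) (Om f).
Proof.
move=> JM; pose w v L x : R := Num.min 1 (expR L * `|monomial v x|).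
pose u v L x := phi x * (\sum_(i <- iota 0 J) qq L x ^+ i) * (expR L ^+ 2 * monomial (madd v v) x * qq L x).
have w0 v L x : 0 <= w v L x by rewrite le_min ler01 mulr_ge0.
have bu v L : supB rc (u v L) by move=> i x xi; rewrite /u (bp xi) !mul0r.
have syu v k : v \in O -> sym rc k (w v) (u v).
 move=> vO; have h := sym_mul (sym_mul (sym_static rc k sp) (sym_geo k J))
  (sym_mul (sym_mul (sym_scalar n rc k (fun L => expR L ^+ 2)) (sym_monomial rc k (madd v v))) (sym_qq k)).
 apply: sym_weight h; exists 1 => // L x _ _; rewrite !mul1r mono2_norm (ger0_norm (sqr_ge0 _)).
 exact: min_bound.
have su v L : sm (u v L).
 apply: sm_mul; last by apply: sm_mul; smooth.
 by apply: sm_mul => //; apply: sm_sum => i _; smooth.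
have sk L : sm (fun x => cmp b (lapinf M (expR L * ff x))) by apply: sm_lapinf; exact: sm_scale.
apply: (@lo_eq _ (fun L => \sum_(v <- O) int_Rn (fun x => u v L x * cmp b (lapinf M (expR L * ff x)))) _ _ 0) => [L _|].
 have lc v : LC rc [::] (fun x => u v L x * cmp b (lapinf M (expR L * ff x))).
  by apply: sm_LC; [apply: sm_mul|apply: supB_mul].
 rewrite -(int_Rn_sum O rc0' lc).2.
 congr int_Rn; apply/funext => x; rewrite -mulr_suml; congr (_ * _).
 by rewrite geo_sum -qqE /Mo /u -mulr_sumr -mulr_suml -mulr_sumr !mulrA.
apply: lo_sum => [L|v vO]; first exact: gm_ge0.
have [B B0 hB] := kapl_bound R M b; have [vA lv] := OA vO.
have [|C C0 hC] := @parts R n rc A ff rc0' sff fsym c c0 grad (kapl M b) J B (@kapl_csm R M b)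
  (fun j r jJ => kapl_derive b r (leq_trans jJ JM)) B0 (fun j r jJ => hB j r (leq_trans jJ JM)) J 0%N (w v) (u v) (leqnn _) (w0 v) (syu v J vO).
 by [].
move=> eps e0; have C1 : 0 < C + 1 by lra.
have [L0 L01 hL0] := estimate_outside NG pdu pJ vA lv (divr_gt0 e0 C1).
exists L0 => L LL; have L1 : 1 <= L by lra.
have Om0 : 0 <= (Om f) L by apply: gm_ge0; lra.
have := hC L (eps / (C + 1) * (Om f) L) L1; rewrite (_ : (fun x => u v L x * _) = (fun x => u v L x * cmp b (lapinf M (expR L * ff x)))); last first.
 by apply/funext => x; rewrite /kapl /= mul1r subn0.
move=> h; apply: le_trans (h _) _ => [u' B' B'0 su' bu' hu'|].
 have := hL0 L B' u' LL B'0 (LC1 su' bu'); rewrite /gm /=.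
 set E := expR (- p * L); set P := L ^+ _; set e' := eps / _; move=> hh.
 have -> : B' * (e' * (E * P)) = e' * B' * E * P by ring.
 by apply: hh => x; rewrite -mulrA; exact: hu'.
rewrite mulrA; apply: ler_wpM2r => //; rewrite mulrCA ler_piMr ?(ltW e0) //.
by rewrite ler_pdivrMr // mul1r; lra.
Qed.

(** Smallness passes from the oscillatory integrals to the Laplace kernel, then to its damped
    version, and down the chain of odd operators to a pure power of 1 / (1 + (t f)^2), times t f if
    [b] holds. *)
Lemma base_lo : (forall b', lo (fun L => int_Rn (fun x => phi x * trig b' (expR L * ff x))) (Om f)) -> 0 < p ->
 (forall t, t \in odds b J -> t%:R - (b : nat)%:R != p) -> lo (Gk [::]) (Om f).
Proof.
move=> hJ p0 ht; apply: (chain_lo ht).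
have JM : (J <= lapN b J)%N by rewrite /lapN -addnn; case: (b); rewrite ?leqW // leq_addr.
have pM : p < (lapN b J).+1%:R by apply: lt_le_trans pJ _; rewrite ler_nat ltnW.
have h1 := laplace_lo rc0' sff sp bp p0 pM (hJ b).
have h2 := top_lo JM.
have [d d0 ed] := CS_odds R b J; have dn : d%:R != 0 :> R by rewrite pnatr_eq0 -lt0n.
apply: (@lo_eq _ (fun L => d%:R^-1 * (int_Rn (fun x => phi x * cmp b (lapinf (lapN b J) (expR L * ff x))) +
  (-1) * int_Rn (fun x => (phi x * (1 - qq L x ^+ J)) * cmp b (lapinf (lapN b J) (expR L * ff x))))) _ _ 0) => [L _|]; last first.
 by apply: lo_scale; apply: lo_add => //; exact: lo_scale.
have sk : sm (fun x => cmp b (lapinf (lapN b J) (expR L * ff x))) by apply: sm_lapinf; exact: sm_scale.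
have sq : sm (fun x => 1 - qq L x ^+ J) by apply: sm_sub; [exact: sm_cst|apply: sm_exp; exact: sm_qq].
rewrite -[X in _^-1 * (X + _)]mul1r -lin2.
- rewrite /Gk -[LHS]addr0 -[X in _ + X](mul0r (int_Rn (tk 0 J (odds b J) L))).
 have s1 : sm (fun x => 1 * (phi x * cmp b (lapinf (lapN b J) (expR L * ff x))) + (-1) * ((phi x * (1 - qq L x ^+ J)) * cmp b (lapinf (lapN b J) (expR L * ff x)))).
  smooth.
 rewrite -lin2 //; [|by move=> i x xi; rewrite (bp xi) !mul0r !mulr0 addr0|exact: sm_tk|exact: supB_tk].
 congr int_Rn; apply/funext => x; rewrite cmp_lapinf ed /tk /kr /ker horner_nat expr0 mul0r addr0.
 by field.
- smooth.
- exact: supB_mul.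
- smooth.
by move=> i x xi; rewrite (bp xi) !mul0r.
Qed.

End Weighted.

(** On the boxes of [estimate_lower] t m is comparable to 1, so t f and the damping are under
    control and the integrand, nonnegative everywhere, exceeds a constant. The odd kernel also needs
    |t f| bounded below, hence the bound of f^2 by m^2. *)
Lemma base_not_lo (sg : R) : (~~ b /\ sg = 1) \/ [/\ b, sg = 1 \/ sg = -1, forall x, inbox rc x -> 0 <= sg * ff x &
  exists2 cb : R, 0 < cb & forall x, inbox rc x -> cb * mm A x ^+ 2 <= ff x ^+ 2] -> ~ lo (Gk [::]) (Om f).
Proof.
move=> Hs hlo.
have sg1 : `|sg| = 1 by case: Hs => [[_ ->]|[_ [->|->] _ _]]; rewrite ?normrN normr1.
pose del := Num.min r1 rc; have del0 : 0 < del by rewrite lt_min r10 rc0.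
have [cl [C2 [cl0 C20 [L0 [L01 hL0]]]]] := estimate_lower NG pdu del0.
have [Cf Cf0 hCf] := sym_bound (fsym 0).
pose SA : R := (size A)%:R; pose Z := Cf * SA + 1; have Z1 : 1 <= Z by rewrite lerDr mulr_ge0.
pose Q := (1 + (size O)%:R * SA ^+ 2)^-1.
have Q0 : 0 < Q by rewrite invr_gt0 ltr_wpDr // mulr_ge0.
have [z z0 hz] : exists2 z : R, 0 < z & forall L x, 0 < expR L -> inbox rc x -> C2 * expR (- L) <= mm A x ->
   `|expR L * ff x| <= Z -> z <= sg * (expR L * ff x) ^+ b.
 case: Hs => [[/negbTE eb ->]|[eb _ sgn [cb cb0 hcb]]]; first by exists 1 => // L x _ _ _ _; rewrite eb expr0 mulr1.
 exists (cb * C2 ^+ 2 / Z) => [|L x E0 xr hm sZ].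
  by rewrite divr_gt0 ?mulr_gt0 //; lra.
 rewrite eb expr1; set s := expR L * ff x in sZ *.
 have s0 : 0 <= sg * s by rewrite /s mulrCA mulr_ge0 ?sgn.
 have es : sg * s = `|s| by rewrite -(ger0_norm s0) normrM sg1 mul1r.
 rewrite es ler_pdivrMr; last by lra.
 have y1 : C2 <= expR L * mm A x.
  by move: hm; rewrite expRN ler_pdivrMr // mulrC.
 have h2 : cb * C2 ^+ 2 <= s ^+ 2.
  have : C2 ^+ 2 <= (expR L * mm A x) ^+ 2 by apply: lerXn2r; rewrite ?nnegrE //; [exact: ltW|apply: le_trans y1; exact: ltW].
  move=> h; apply: le_trans (ler_wpM2l (ltW cb0) h) _.
  have -> : cb * (expR L * mm A x) ^+ 2 = expR L ^+ 2 * (cb * mm A x ^+ 2) by ring.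
  rewrite /s exprMn; apply: ler_wpM2l; auto.
 apply: le_trans h2 _; rewrite -(real_normK (num_real s)) expr2; apply: ler_wpM2l => //.
pose B := z * Q ^+ J * (1 + Z ^+ 2)^-1 ^+ J.+1.
have B0 : 0 < B.
 by rewrite !mulr_gt0 ?exprn_gt0 // invr_gt0 ltr_wpDr.
pose u L x := sg * tk 0 J [::] L x.
have uE L x : u L x = phi x * (qq L x ^+ J * (sg * (expR L * ff x) ^+ b * vv (expR L * ff x) ^+ J.+1)).
 by rewrite /u /tk /kr /ker /= hornerXn expr0 mul1r; ring.
have q0 L x : 0 <= qq L x ^+ J by rewrite exprn_ge0 // ltW // qq_gt0.
have v0 k s : 0 <= vv s ^+ k :> R by rewrite exprn_ge0 // ltW // vv_gt0.
have u0 L x : 0 <= u L x.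
 rewrite uE; have [xK|->] := box_or_zero x bp; last first.
  by rewrite mul0r.
 do 2 apply: mulr_ge0 => //; apply: mulr_ge0 => //.
 case: Hs => [[/negbTE eb ->]|[eb _ sgn _]]; first by rewrite eb expr0 mulr1.
 by rewrite eb expr1 mulrCA mulr_ge0 ?sgn.
have low L : L0 <= L -> cl * B * (Om f) L <= sg * Gk [::] L.
 move=> LL; have -> : sg * Gk [::] L = int_Rn (u L).
  rewrite -[LHS]addr0 -[X in _ + X](mul0r (Gk [::] L)) -lin2; try exact: sm_tk; try exact: supB_tk.
  by congr int_Rn; apply/funext => x; rewrite mul0r addr0.
 rewrite /gm /= mulrA; apply: hL0 => //; auto.
  apply: LC1; first by apply: sm_scale; exact: sm_tk.
  by move=> i x xi; rewrite /u (@supB_tk 0 J [::] L i x xi) mulr0.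
 move=> x xd m1 m2.
 have xr1 : inbox r1 x by move=> j; have /andP[x0 xj] := xd j; rewrite gtr0_norm //; apply: le_trans xj _; rewrite ge_min lexx.
 have xrc : inbox rc x by move=> j; have /andP[x0 xj] := xd j; rewrite gtr0_norm //; apply: le_trans xj _; rewrite ge_min lexx orbT.
 have L1 : 1 <= L by lra.
 have TM : expR L * mm A x <= SA.
  by move: m2; rewrite expRN ler_pdivlMr // mulrC.
 have TM0 : 0 <= expR L * mm A x by rewrite mulr_ge0 ?mm_ge0.
 have sZ : `|expR L * ff x| <= Z.
  rewrite normrM (ger0_norm (expR_ge0 _)); have := hCf L x L1 xrc => h.
  apply: le_trans (ler_wpM2l (expR_ge0 L) h) _; rewrite mulrCA; apply: (@le_trans _ _ (Cf * SA)); last by rewrite /Z lerDl.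
  by apply: ler_wpM2l.
 rewrite uE phi1 // mul1r /B -mulrA mulrCA.
 have hq : Q ^+ J <= qq L x ^+ J.
  apply: lerXn2r; rewrite ?nnegrE; [exact: ltW|exact/ltW/qq_gt0|].
  rewrite lef_pV2 ?posrE ?qden //; last pos.
  rewrite lerD2l; apply: (@le_trans _ _ ((size O)%:R * (expR L * mm A x) ^+ 2)); last first.
   by apply: ler_wpM2l => //; apply: lerXn2r; rewrite ?nnegrE.
  rewrite exprMn mulrCA; apply: ler_wpM2l; auto.
  have : \sum_(v <- O) monomial (madd v v) x <= \sum_(v <- O) mm A x ^+ 2.
   rewrite big_seq [leRHS]big_seq; apply: ler_sum => v vO; have [vA _] := OA vO.
   rewrite monomial_madd -expr2 -(real_normK (num_real _)); apply: lerXn2r; rewrite ?nnegrE ?mm_ge0 //.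
   exact: mm_ge.
  move=> hs; apply: le_trans hs _; by rewrite big_const_seq count_predT iter_addr_0 mulr_natl.
 have hv : (1 + Z ^+ 2)^-1 ^+ J.+1 <= vv (expR L * ff x) ^+ J.+1.
  apply: lerXn2r; rewrite ?nnegrE; [by rewrite invr_ge0 addr_ge0|exact/ltW/vv_gt0|].
  rewrite lef_pV2 ?posrE ?vv_den // lerD2l -(real_normK (num_real (expR L * ff x))).
  by apply: lerXn2r; rewrite ?nnegrE //; lra.
 have hzz := hz L x (expR_gt0 L) xrc m1 sZ.
 have Z0 : 0 <= (1 + Z ^+ 2)^-1 ^+ J.+1 by rewrite exprn_ge0 // invr_ge0 addr_ge0.
 apply: ler_pM => //; first pos.
  pos.
 by apply: ler_pM => //; exact: ltW.
have clB : 0 < cl * B / 2 by rewrite divr_gt0 // mulr_gt0.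
have [L1 hL1] := hlo _ clB.
pose L := Num.max L0 L1.
have LL0 : L0 <= L by rewrite le_max lexx.
have LL1 : L1 <= L by rewrite le_max lexx orbT.
have Lp : 0 < L by lra.
have := hL1 _ LL1; have := low _ LL0; have := gm_gt0 (- p, (mult_m f).-1) Lp.
have : sg * Gk [::] L <= `|Gk [::] L| by apply: le_trans (ler_norm _) _; rewrite normrM sg1 mul1r.
set X := (Om f) L; set Y := Gk _ _ => h1 X0 h2 h3.
have : cl * B * X <= cl * B / 2 * X by lra.
by rewrite ler_pM2r //; lra.
Qed.

End Chain.

(** For p < 1 the value N = 0 is allowed in [laplace_lo], and the real part of 1 / (1 - i s) is
    already a positive kernel. *)
Lemma not_all_lo_lt1 : p < 1 -> 0 < p -> O = [::] ->
 ~ (forall b, lo (osci b ff phi) (Om f)).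
Proof.
move=> p1 p0 O0 hJ.
have hJ' : lo (fun L => int_Rn (fun x => phi x * trig false (expR L * ff x))) (Om f).
 apply: (@lo_eq _ _ _ _ 0) (hJ false) => L _; by congr int_Rn; apply/funext => x; lra.
have h := @laplace_lo R n rc ff phi rc0' sff sp bp 0%N false p (mult_m f).-1 p0 p1 hJ'.
apply: (@base_not_lo false 0 1); auto.
apply: (@lo_eq _ _ _ _ 0) h => L _; congr int_Rn; apply/funext => x.
by rewrite cmp_lapinf /tk /kr /ker /= !expr0 !mul1r.
Qed.

Lemma not_all_lo b (cb sg : R) : 0 < p -> 0 < cb -> (forall x, inbox rc x -> cb * mm A x ^+ 2 <= ff x ^+ 2 + Mo x) ->
 (forall t : nat, odd t -> (b < t)%N -> t%:R - (b : nat)%:R != p) ->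
 (~~ b /\ sg = 1) \/ [/\ b, sg = 1 \/ sg = -1, forall x, inbox rc x -> 0 <= sg * ff x & O = [::]] ->
 ~ (forall b, lo (osci b ff phi) (Om f)).
Proof.
(* J > 1/d is what [estimate_principal] asks of the exponent of the weight. *)
move=> p0 cb0 bnd ht Hs hJ; pose J := (Num.truncn p).+1.
have pJ : p < J%:R by rewrite /J truncnS_gt.
have hJ' b' : lo (fun L => int_Rn (fun x => phi x * trig b' (expR L * ff x))) (Om f).
 apply: (@lo_eq _ _ _ _ 0) (hJ b') => L _; by congr int_Rn; apply/funext => x; lra.
apply: (@base_not_lo b J sg); last first.
 by apply: (base_lo cb0 bnd pJ hJ' p0) => t /odds_odd[]; exact: ht.
case: Hs => [|[hb hsg hs O0]]; [by left|right; split=> //].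
exists cb => // x /bnd; by rewrite /Mo O0 big_nil addr0.
Qed.

End Upper.
End Oscillatory.

(** * Assembly and localization *)

Section Global.
Variables (R : realType) (n : nat).
Local Notation V := 'rV[R]_n.

Lemma taylor_coef0 (f : V -> R) (v : mindex n) : (\sum_i v i = 0)%N -> taylor_coef f v = f 0.
Proof.
move=> v0; have vi i : v i = 0%N by apply/eqP; rewrite -leqn0 -v0 (bigD1 i) //= leq_addr.
rewrite /taylor_coef big1 => [|i _]; last by rewrite vi.
rewrite divr1 /dpart; suff -> : foldr (fun i h => iter (v i) (partial i) h) f (enum 'I_n) = f by [].
by elim: (enum 'I_n) => //= i s ->; rewrite vi.
Qed.

Lemma lexlt_false (x y : R) (j k : nat) : lexlt (x, j) (y, k) = false -> y < x \/ y = x /\ (k <= j)%N.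
Proof.
rewrite /lexlt /= => /negbT; rewrite negb_or -leNgt negb_and -leqNgt => /andP[yx h].
case: (ltgtP y x) yx => // [yx _|e _]; [by left|right; split=> //].
by move: h; rewrite e eqxx.
Qed.

(** Stated for functions smooth on the whole space, so that no open set has to be carried through
    the integrals; [s] distinguishes imaginary and real part. *)
Lemma oscillation_index (f : V -> R) (rho : R) : 0 < rho -> rho <= 1 -> sm f -> f 0 = 0 ->
 newton_poly f !=set0 ->
 (forall (a : 'I_n -> nat) (l : nat) gam, defines_face (newton_poly f) (natv a) l%:Z gam ->
   forall x, inbox rho x -> exists L : R, (fun t => f (tscale a t x) / t ^+ l) @ 0^'+ --> L) ->
 (forall gam, is_face (newton_poly f) gam -> gam !=set0 -> compact gam ->
  forall x, inbox rho x -> torus x -> exists i, partial i (face_poly f gam) x != 0) ->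
 (1 < newton_dist f
  \/ ((forall x, inbox rho x -> 0 <= f x) \/ (forall x, inbox rho x -> f x <= 0))
  \/ ((~ exists k : nat, (newton_dist f)^-1 = (k.*2.+1)%:R) /\
    (forall x, inbox rho x -> torus x -> forall (a : 'I_n -> nat) (l : nat),
      defines_face (newton_poly f) (natv a) l%:Z (principal_face f) ->
      lim ((fun t => f (tscale a t x) / t ^+ l) @ 0^'+) != 0))) ->
 exists2 rc : R, 0 < rc & [/\ rc <= rho, (0 < mult_m f <= n)%N,
  (forall s phi, sm phi -> supB rc phi ->
   (exists C, has_expansion n (fun t => int_Rn (fun x => trig s (t * f x) * phi x)) C) /\
   forall C al k, has_expansion n (fun t => int_Rn (fun x => trig s (t * f x) * phi x)) C ->
    (1 <= k <= n)%N -> C al k != 0 ->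
    al < - (newton_dist f)^-1 \/ al = - (newton_dist f)^-1 /\ (k <= mult_m f)%N) &
  forall phi (r1 : R) (C : bool -> R -> nat -> R), sm phi -> supB rc phi -> (forall x, 0 <= phi x) -> 0 < r1 ->
   (forall x, inbox r1 x -> phi x = 1) ->
   (forall s, has_expansion n (fun t => int_Rn (fun x => trig s (t * f x) * phi x)) (C s)) ->
   exists s, C s (- (newton_dist f)^-1) (mult_m f) != 0].
Proof.
move=> rho0 rho1 sf f0 ne Hlim nd cases.
have [A [uA AE AD]] := dickson (fun a => taylor_coef f a != 0).
have A0 : A != [::].
 have [x [k [q [w [hq [_ [w1 _]]]]]]] := ne.
 case: k q w hq w1 => [|k] q w hq w1; first by move/eqP: w1; rewrite big_ord0 eq_sym oner_eq0.
 by have [b [/AD[v vA _] _]] := hq ord0; apply: contraTneq vA => ->.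
have Apos v : v \in A -> (0 < \sum_i v i)%N.
 by move=> vA; rewrite lt0n; apply: contraTneq (AE _ vA) => /(taylor_coef0 f) ->; lra.
have [G [GA GS]] := newton_inequalities uA AE.
have NG := NewtonGen AE AD A0 Apos GA GS.
have n0 := n_gt0 NG.
have [U [a [l [e pdu]]]] := principal_data NG.
have dp := dpos NG; have p0 : 0 < (newton_dist f)^-1 by rewrite invr_gt0.
have GL p : p \in G -> forall x, inbox rho x -> exists L : R, (fun t => f (tscale p.1 t x) / t ^+ p.2) @ 0^'+ --> L.
 move=> pG; apply: (Hlim p.1 p.2 (newton_poly f `&` Hplane (natv p.1) p.2%:Z)); split=> // y /= Py.
 exact: (newton_G NG pG Py).
(* The order of the Taylor expansion exceeds all entries of [A] and all levels in [G]. *)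
pose N := ((\max_(v <- A) \max_i v i) + \max_(p <- G) p.2).+1.
have NGb p : p \in G -> (p.2 < N)%N.
 by move=> pG; rewrite ltnS; apply: leq_trans (leq_addl _ _); exact: (@leq_bigmax_seq _ _ xpredT (fun p : mindex n * nat => p.2)).
have NA v i : v \in A -> (v i < N)%N.
 move=> vA; rewrite ltnS; apply: leq_trans (leq_addr _ _).
 apply: leq_trans (@leq_bigmax_seq _ _ xpredT (fun v : mindex n => \max_i v i)%N _ vA isT).
 exact: (@leq_bigmax_cond _ xpredT (fun i => v i)).
have [Ps [F dc]] := decomposition rho0 sf NGb GL.
have [cg cg0 hg] := gradient_bound NG rho0 dc NA nd.
have la al : al \in Ps -> (l <= npair a al)%N.
 move=> aP; have [vp _] := pd_face pdu; have := vp _ (Ps_newton NG dc aP).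
 by rewrite /Hhalf /= ipair_natv rpair_nr -[_%:~R]/(l%:R : R) ler_nat.
(* What each hypothesis contributes: 1/d < 1 from (a), a lower bound by f alone from (b), a lower
   bound with the monomials off the principal face from (c). *)
have [cb cb0 hcb] : exists2 cb : R, 0 < cb &
  (newton_dist f)^-1 < 1 \/ (exists2 sg : R, sg = 1 \/ sg = -1 & (forall x, inbox rho x -> 0 <= sg * f x) /\
    forall x, inbox cb x -> cb * mm A x ^+ 2 <= fF Ps F x ^+ 2) \/
  ((~ exists k : nat, (newton_dist f)^-1 = (k.*2.+1)%:R) /\
   forall x, inbox cb x -> cb * mm A x ^+ 2 <= fF Ps F x ^+ 2 + Mout A a l x).
 case: cases => [d1|[sgn|[podd nz]]].
 - by exists 1 => //; left; rewrite invf_lt1.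
 - have [cb cb0 hcb] := definite_bound NG rho0 dc NA nd sgn.
  exists cb => //; right; left; case: sgn => sgn; [exists 1|exists (-1)]; try (auto).
   by split=> // x /sgn; lra.
  by split=> // x /sgn; lra.
 have nz' x : inbox rho x -> torus x -> gtau Ps F a l x != 0.
  apply: (tau_nonvanishing dc la) => y yr yt; apply: nz => //; exact: pd_face pdu.
 have [cb cb0 hcb] := tau_bound NG rho0 dc NA nd la nz'.
 by exists cb => //; auto.
pose rc := Num.min rho (Num.min cg cb).
have rc0 : 0 < rc by rewrite !lt_min rho0 cg0 cb0.
have rcr : rc <= rho by rewrite ge_min lexx.
have rcg x : inbox rc x -> inbox cg x.
 by move=> h i; apply: le_trans (h i) _; rewrite !ge_min lexx orbT.
have rcb x : inbox rc x -> inbox cb x.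
 by move=> h i; apply: le_trans (h i) _; rewrite !ge_min lexx !orbT.
have rrho x : inbox rc x -> inbox rho x by move=> h i; exact: le_trans (h i) rcr.
have grad x : inbox rc x -> cg * mm A x ^+ 2 <= \sum_i eul i (fF Ps F) x ^+ 2 by move=> /rcg; exact: hg.
have JE s phi L : supB rc phi -> int_Rn (fun x => trig s (expR L * f x) * phi x) =
  int_Rn (fun x => trig s (expR L * fF Ps F x) * phi x).
 move=> bp; congr int_Rn; apply/funext => x.
 have [xK|->] := box_or_zero x bp; first by rewrite (fFE dc) //; exact: rrho.
 lra.
have mn : (0 < mult_m f <= n)%N.
 by rewrite /mult_m subn_gt0 (dim_lt pdu) leq_subr.
have /andP[m0 mn'] := mn.
have up s phi : sm phi -> supB rc phi -> bo (osci s f phi)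
  (Om f).
 move=> sp bp; apply: (@bo_eq _ (osci s (fF Ps F) phi) _ _ 0) => [L _|]; first by rewrite JE.
 exact: (oscillatory_upper NG rho1 dc rc0 rcr cg0 grad pdu).
exists rc => //; split=> //.
 move=> s phi sp bp; split.
  apply: (expansion_exists n0 p0 (up s phi sp bp)) => g g0.
  rewrite (_ : (fun L => _) = (osci s (fF Ps F) phi)).
   exact: (oscillatory_expands NG rho1 dc rc0 rcr cg0 grad).
  by apply/funext => L; rewrite JE.
 move=> C al k hC /andP[k1 kn] ck; rewrite -(prednK k1) in ck kn *.
 have := expansion_upper hC (up s phi sp bp) kn ck => /lexlt_false[|[-> h]]; [by left|right; split=> //].
 by rewrite -(prednK m0) ltnS.
move=> phi r1 C sp bp phi0 r10 phi1 hC; apply/not_existsP => h.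
(* A zero coefficient at (-1/d, m) makes both integrals small against the leading term. *)
have hlo s : lo (osci s (fF Ps F) phi) (Om f).
 have c0 : C s (- (newton_dist f)^-1) (mult_m f).-1.+1 = 0 by rewrite prednK //; apply/eqP/negPn/negP; exact: h.
 have mn1 : ((mult_m f).-1 < n)%N by rewrite prednK.
 apply: (@lo_eq _ (osci s f phi) _ _ 0) => [L _|]; first auto.
 exact: (expansion_lo (hC s) (up s phi sp bp) mn1 c0).
have noO v : v \in [::] -> v \in A /\ (l < npair a v)%N by [].
have nal := @not_all_lo R n f A G NG N rho Ps F rho1 dc rc cg rc0 rcr cg0 grad U a l e pdu phi r1 sp bp phi0 r10 phi1.
case: hcb => [p1|[[sg sg1 [sgn hcb]]|[podd hcb]]].
- exact: (@not_all_lo_lt1 R n f A G NG N rho Ps F rho1 dc rc rc0 rcr U a l e pdu phi r1 sp bp phi0 r10 phi1 [::] noO p1 p0 erefl hlo).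
- have bnd x : inbox rc x -> cb * mm A x ^+ 2 <= fF Ps F x ^+ 2 + Mo [::] x.
  by move=> /rcb/hcb; rewrite /Mo big_nil addr0.
 have sgn' x : inbox rc x -> 0 <= sg * fF Ps F x by move=> xr; rewrite -(fFE dc) ?sgn //; exact: rrho.
 (* With a sign of f both parities are available: the odd kernel, whose rates are even, if 1/d is
    odd, and the even kernel otherwise. *)
 case: (pselect (exists k : nat, (newton_dist f)^-1 = (k.*2.+1)%:R)) => [[k pk]|np].
  apply: (nal [::] noO true cb sg p0 cb0 bnd _ _ hlo).
   move=> [//|t] ot _; rewrite -natr1 addrK pk eqr_nat; apply: contraTneq ot => ->.
   by rewrite /= odd_double.
  by right.
 apply: (nal [::] noO false cb 1 p0 cb0 bnd _ _ hlo); auto.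
 move=> t ot _; rewrite subr0; apply/eqP => e1; apply: np; exists t./2; rewrite -e1; congr (_%:R).
 by rewrite -[LHS]odd_double_half ot.
pose O := [seq v <- A | npair a v != l].
have OA v : v \in O -> v \in A /\ (l < npair a v)%N.
 rewrite mem_filter => /andP[ne' vA]; split=> //.
 by rewrite ltn_neqAle eq_sym ne' la //; exact: (A_Ps NG dc NA).
have bnd x : inbox rc x -> cb * mm A x ^+ 2 <= fF Ps F x ^+ 2 + Mo O x.
 move=> /rcb/hcb; rewrite /Mo /Mout /O big_filter; under [in X in _ -> X]eq_bigr do rewrite monomial_madd -expr2.
 by [].
apply: (nal O OA false cb 1 p0 cb0 bnd _ _ hlo); auto.
move=> t ot _; rewrite subr0; apply/eqP => e1; apply: podd; exists t./2; rewrite -e1; congr (_%:R).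
by rewrite -[LHS]odd_double_half ot.
Qed.

Lemma supp_supB (phi : V -> R) (r : R) : (forall x, supp phi x -> inbox r x) -> supB r phi.
Proof.
move=> h i x xr; apply/eqP/negPn/negP => px.
have : inbox r x by apply: h; apply: subset_closure.
by move=> /(_ i); lra.
Qed.

Lemma inbox_compact r : compact [set x : V | inbox r x].
Proof.
rewrite (_ : [set x : V | _] = [set x : V | forall i, `[- r, r]%classic (x ord0 i)]).
 by apply: (@rV_compact _ _ (fun=> `[- r, r]%classic)) => i; exact: segment_compact.
by apply/seteqP; split=> x /= h i; have := h i; rewrite /= in_itv /= -ler_norml.
Qed.

Lemma supB_supp (phi : V -> R) (r : R) : supB r phi -> compact (supp phi) /\ forall x, supp phi x -> inbox r x.
Proof.
move=> bp; have cl : closed [set x : V | inbox r x].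
 apply: compact_closed; [exact: norm_hausdorff|exact: inbox_compact].
have sub : supp phi `<=` [set x : V | inbox r x].
 rewrite [X in _ `<=` X](iffLR (closure_id _) cl); apply: closure_subset => x /= px i.
 by rewrite leNgt; apply/negP => /bp e; lra.
split=> //; apply: subclosed_compact (inbox_compact (r := r)) sub; exact: closed_closure.
Qed.

Lemma nbhs0_inbox (W : set V) : nbhs (0 : V) W -> exists2 r : R, 0 < r & forall x, inbox r x -> W x.
Proof.
move=> /(@nbhs_ballP R V)[r /= r0 hr]; exists (r / 2); first pos.
move=> x xr; apply: hr; rewrite -ball_normE /ball_ /= sub0r normrN.
have : `|x| <= r / 2 by apply/inbox_norm => //; lra.
lra.
Qed.

End Global.

Theorem theorem3p7 (R : realType) (n : nat) (U : set 'rV[R]_n) (f : 'rV[R]_n -> R) :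
  open_set U -> U 0 ->
  smooth_on U f ->
  f 0 = 0 ->
  (forall i : 'I_n, partial i f 0 = 0) ->
  newton_poly f !=set0 ->
  in_Ehat U f ->
  newton_nondegenerate U f ->
  (1 < newton_dist f
   \/ ((forall x, U x -> 0 <= f x) \/ (forall x, U x -> f x <= 0))
   \/ ((~ exists k : nat, (newton_dist f)^-1 = (k.*2.+1)%:R) /\
       (forall x, torus_part U x ->
          forall (a : 'I_n -> nat) (l : nat),
            defines_face (newton_poly f) (natv a) l%:Z (principal_face f) ->
            lim ((fun t => f (tscale a t x) / t ^+ l) @ 0^'+) != 0))) ->
  is_osc_index f (- (newton_dist f)^-1) (mult_m f).
Proof.
move=> oU U0 sU f0 _ ne [_ Eh] nd cases.
have [r0 r00 hr0] := nbhs0_inbox (open_nbhs_nbhs (conj oU U0)).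
(* The factor 3 leaves room in U for a plateau that is 1 on the r-box and vanishes off the
   2r-box. *)
have [r [r_gt0 r1 box3]] : exists r : R, [/\ 0 < r, r <= 1 & forall x, inbox (3 * r) x -> U x].
 exists (Num.min r0 1 / 3); split; first pos.
  by rewrite ler_pdivrMr //; apply: (@le_trans _ _ 1); [rewrite ge_min lexx orbT|lra].
 move=> x h; apply: hr0 => i; apply: le_trans (h i) _.
 by rewrite mulrC divfK ?gt_eqF // ge_min lexx.
have box x : inbox r x -> U x by move=> h; apply: box3 => i; apply: le_trans (h i) _; lra.
have [g sg gf] : exists2 g, sm g & forall x, inbox r x -> f x = g x.
 exists (fun x => f x * plateau r x); last by move=> x xr; rewrite plateau1 // mulr1.
 exact: (sm_cutoff r_gt0 box3 sU (sm_plateau n r) (supB_plateau r_gt0)).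
have tc : taylor_coef f = taylor_coef g.
 apply: (@eq_on_taylor _ _ [set x | `|x| < r]); [exact: open_norm_lt|by rewrite /= normr0|].
 by move=> x /= /ltW/inbox_norm h; auto.
have H := @oscillation_index R n g r r_gt0 r1 sg.
have np : newton_poly f = newton_poly g by rewrite /newton_poly tc.
have nD : newton_dist f = newton_dist g by rewrite /newton_dist np.
have pf : principal_face f = principal_face g by rewrite /principal_face np nD.
have mu : mult_m f = mult_m g by rewrite /mult_m pf.
have fp : face_poly f = face_poly g by rewrite /face_poly tc.
rewrite -nD -mu -pf -np -fp in H; clear tc np nD pf mu fp.
have near_eq (a : 'I_n -> nat) (l : nat) x : inbox r x ->
  {near 0^'+, (fun t => f (tscale a t x) / t ^+ l) =1 (fun t => g (tscale a t x) / t ^+ l)}.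
 move=> xr; near=> t; rewrite gf // => i.
 have t0 : 0 <= t by near: t; exact: nbhs_right_ge.
 have t1 : t <= 1 by near: t; apply: nbhs_right_le; exact: ltr01.
 rewrite /coord mxE normrM; apply: le_trans (xr i); rewrite ler_piMl // normrX ger0_norm //; exact: exprn_ile1.
have cvgE (a : 'I_n -> nat) (l : nat) gam x : defines_face (newton_poly f) (natv a) l%:Z gam -> inbox r x ->
  exists2 L : R, (fun t => f (tscale a t x) / t ^+ l) @ 0^'+ --> L & (fun t => g (tscale a t x) / t ^+ l) @ 0^'+ --> L.
 move=> dg xr; have fg : is_face (newton_poly f) gam by exists (natv a), l%:Z.
 have [L hL] := Eh gam fg x (box _ xr) a l dg; exists L => //.
 by apply: cvg_trans hL; apply: near_eq_cvg; auto.
have [|||||rc rc0 [rcr mn ex nz]] := H _ _ _ _ _.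
- by rewrite -gf // => i; rewrite /coord mxE normr0 ltW.
- by [].
- move=> a l gam dg x xr.
 by have [L _ hL] := cvgE a l gam x dg xr; exists L.
- move=> gam fg gn gc x xr xt; apply: nd => //; split=> //; exact: box.
- case: cases => [|[[h|h]|[h1 h2]]]; auto.
 + by right; left; left=> x xr; rewrite -gf //; exact/h/box.
 + by right; left; right=> x xr; rewrite -gf //; exact/h/box.
 right; right; split=> // x xr xt a l dg.
 have tx : torus_part U x by split=> //; exact: box.
 have [L h3 h4] := cvgE a l _ x dg xr; have := h2 x tx a l dg.
 by rewrite (cvg_lim _ h3) // (cvg_lim _ h4).
have JE s phi : supB rc phi -> (fun t => int_Rn (fun x => trig s (t * f x) * phi x)) =
  (fun t => int_Rn (fun x => trig s (t * g x) * phi x)).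
 move=> bp; apply/funext => t; congr int_Rn; apply/funext => x.
 have [xK|->] := box_or_zero x bp.
  by rewrite gf // => i; exact: le_trans (xK i) rcr.
 lra.
split.
 split=> // W W0.
 have [w w0 hw] := nbhs0_inbox W0; pose r2 := Num.min w rc / 2.
 have mw : 0 < Num.min w rc by rewrite lt_min w0 rc0.
 have r20 : 0 < r2 by rewrite divr_gt0.
 have e2 : 2 * r2 = Num.min w rc by rewrite mulrC divfK.
 have bphi := supB_plateau (n := n) r20; have sphi := sm_plateau n r2.
 have bphi' : supB rc (@plateau R n r2).
  by move=> i x xr; apply: (bphi i); apply: le_lt_trans xr; rewrite e2 ge_min lexx orbT.
 exists (plateau r2); split; first by case: sphi.
 have [cs ss] := supB_supp bphi; split=> //; split.
  by move=> x /ss h; apply: hw => i; apply: le_trans (h i) _; rewrite e2 ge_min lexx.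
 have [[Cre hre] _] := ex false _ sphi bphi'; have [[Cim him] _] := ex true _ sphi bphi'.
 exists Cre, Cim; rewrite /osc_re /osc_im.
 have Jr := JE false _ bphi'; have Ji := JE true _ bphi'; rewrite /= in Jr Ji.
 rewrite Jr Ji; split=> //; split=> //.
 have [s hs] := nz (plateau r2) r2 (fun s => if s then Cim else Cre) sphi bphi'
  (fun x => proj1 (andP (plateau_itv r2 x))) r20 (fun x xr => plateau1 r20 xr)
  (fun s => if s as s' return has_expansion n (fun t => int_Rn (fun x => trig s' (t * g x) * plateau r2 x)) (if s' then Cim else Cre) then him else hre).
 by case: s hs => hs; auto.
move=> al k [kn hS].
have W0 : nbhs (0 : 'rV[R]_n) [set x | `|x| < rc].
 by apply: open_nbhs_nbhs; split; [exact: open_norm_lt|rewrite /= normr0].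
have [phi [sphi [_ [sW [Cre [Cim [hre [him hC]]]]]]]] := hS _ W0.
have bphi : supB rc phi.
 by apply: supp_supB => x /sW /= /ltW/inbox_norm; auto.
have sp : sm phi by constructor.
move: hre him; rewrite /osc_re /osc_im.
have Jr := JE false _ bphi; have Ji := JE true _ bphi; rewrite /= in Jr Ji.
rewrite Jr Ji => hre him; case: hC => hC.
 by have [_ /(_ Cre al k hre kn hC)] := ex false _ sp bphi.
by have [_ /(_ Cim al k him kn hC)] := ex true _ sp bphi.
Unshelve. all: end_near.
Qed.
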